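(* Suppose that the following two conditions hold. (1) There exist a constant $\kappa>0$ and a nondecreasing, continuously differentiable function $\zeta:[0,\infty)\to[1,\infty)$ with $\int_0^\infty \frac{dr}{r\zeta(r)+1}=\infty$ such that for all $x\in\mathbb R^d$ $$2\langle x,b(x)\rangle+|\sigma(x)|^2+\int_U|c(x,u)|^2\,\nu(du)\le \kappa\,[\,|x|^2\zeta(|x|^2)+1\,].$$ (2) There exist $\delta_0>0$ and a nondecreasing concave function $\rho:[0,\infty)\to[0,\infty)$ with $\rho(r)>0$ for $r>0$ and $\int_{0+}\frac{dr}{\rho(r)}=\infty$ such that for every $R>0$ there is a constant $\kappa_R>0$ such that for all $x,z\in\mathbb R^d$ with $|x|\vee|z|\le R$ and $|x-z|\le\delta_0$, $$2\langle z-x,b(z)-b(x)\rangle+|\sigma(z)-\sigma(x)|^2\le\kappa_R|z-x|\rho(|z-x|),$$ $$\int_U|c(z,u)-c(x,u)|\,\nu(du)\le\kappa_R\,\rho(|z-x|);$$ in addition, $\int_U|c(0,u)|\,\nu(du)<\infty$. Then pathwise uniqueness holds for the stochastic differential equation $$dX(t)=b(X(t))\,dt+\sigma(X(t))\,dW(t)+\int_U c(X(t-),u)\,\widetilde N(dt,du).$$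
   Context: Let $d\ge2$, $(U,\mathfrak U)$ a measurable space, $\nu$ a $\sigma$-finite measure on $U$. The functions $b:\mathbb R^d\to\mathbb R^d$, $\sigma:\mathbb R^d\to\mathbb R^{d\times d}$, $c:\mathbb R^d\times U\to\mathbb R^d$ are Borel measurable; $b$, $\sigma$ and $c(\cdot,u)$ (for each $u\in U$) are continuous, and $x\mapsto\int_U|c(x,u)|^2\nu(du)$ is continuous. For a matrix or vector $A$, $|A|=\sqrt{\mathrm{tr}(AA^T)}$. On a filtered probability space $(\Omega,\mathcal F,\{\mathcal F_t\},\mathbb P)$ satisfying the usual hypotheses, $W$ is a standard $d$-dimensional $\{\mathcal F_t\}$-Brownian motion, $N$ is the Poisson random measure on $[0,\infty)\times U$ with intensity $dt\,\nu(du)$ associated with an $\{\mathcal F_t\}$-Poisson point process $p$ on $U$ independent of $W$, and $\widetilde N$ is its compensated measure. A (weak) solution up to an explosion time is an $\mathbb R^d$-valued càdlàg $\{\mathcal F_t\}$-adapted process $X$ with $X(0)$ $\mathcal F_0$-measurable such that, with $\tau_n=\inf\{t\ge0:|X(t)|>n\}$, the integral form of the equation holds at time $t\wedge\tau_n$ for all $n\in\mathbb N$ and $t\ge0$ a.s. Pathwise uniqueness holds if any two solutions $X_1,X_2$ (on the same filtered probability space with the same $W$, $N$) with $\mathbb P\{X_1(0)=X_2(0)\}=1$ satisfy $\mathbb P\{X_1(t)=X_2(t)\text{ for all }t\ge0\}=1$. *)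

(* Defs.v *)
(* Time is indexed by R and only t >= 0 is ever constrained;
   vectors of R^d are columns 'cV[R]_d. *)
From mathcomp Require Export all_boot all_order all_algebra.
From mathcomp Require Export all_classical all_reals all_analysis measurable_realfun.

Set Implicit Arguments.
Unset Strict Implicit.
Unset Printing Implicit Defensive.

Export Order.TTheory GRing.Theory Num.Theory.
Export numFieldNormedType.Exports.

Global Open Scope classical_set_scope.
Global Open Scope ring_scope.

Definition dotv (R : realType) (d : nat) (x y : 'cV[R]_d) : R :=
  \sum_(i < d) x i ord0 * y i ord0.

(* The norm |A| of the text. The library norm `|A| on matrices is the sup norm,
   which induces the same topology. *)
Definition hsnorm (R : realType) (m n : nat) (A : 'M[R]_(m, n)) : R :=
  Num.sqrt (\tr (A *m A^T)).

Definition borel (T : ptopologicalType) := g_sigma_algebraType (@open T).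

(* C^1 on [0, oo): the difference quotient at r is taken along s >= 0, so the
   derivative at 0 is the right one. *)
Definition C1_halfline (R : realType) (f : R -> R) : Prop :=
  exists f' : R -> R,
    {within `[0, +oo[, continuous f'} /\
    forall r, 0 <= r ->
      (f s - f r) / (s - r) @[s --> within [set s | 0 <= s] r^'] --> f' r.

Definition cadlag (R : realType) (T : topologicalType) (x : R -> T) : Prop :=
  (forall t, 0 <= t -> x s @[s --> t^'+] --> x t) /\
  (forall t, 0 < t -> exists l : T, x s @[s --> t^'-] --> l).

(* Sub-sigma-algebras of Omega are sets of sets. *)
Definition measurable_wrt (O : Type) (dT : measure_display)
    (T : measurableType dT) (G : set (set O)) (f : O -> T) : Prop :=
  forall B : set T, measurable B -> G (f @^-1` B).

Definition indep_sigma (dO : measure_display) (O : measurableType dO)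
    (R : realType) (P : probability O R) (G H : set (set O)) : Prop :=
  forall A B, G A -> H B -> P (A `&` B) = (P A * P B)%E.

Record usual_hypotheses (dO : measure_display) (O : measurableType dO)
    (R : realType) (P : probability O R) (F : R -> set (set O)) : Prop := {
  uh_sigma : forall t, 0 <= t -> sigma_algebra [set: O] (F t);
  uh_sub : forall t, 0 <= t -> F t `<=` measurable;
  uh_mono : forall s t, 0 <= s -> s <= t -> F s `<=` F t;
  uh_right_cont : forall t, 0 <= t -> \bigcap_(s in [set s | t < s]) F s = F t;
  uh_complete : forall A, P.-negligible A -> F 0 A }.

Definition adapted (O : Type) (R : realType) (F : R -> set (set O))
    (M : R -> O -> R) : Prop :=
  forall t, 0 <= t -> measurable_wrt (F t) (M t).

Definition vadapted (O : Type) (R : realType) (d : nat)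
    (F : R -> set (set O)) (X : R -> O -> 'cV[R]_d) : Prop :=
  forall i : 'I_d, adapted F (fun t w => X t w i ord0).

(* Taking A = setT in the last clause gives the law N(0, (t - s) I_d) of
   W t - W s; general A gives its independence from F s. The second parameter
   of normal_prob is the standard deviation. *)
Record brownian_motion (dO : measure_display) (O : measurableType dO)
    (R : realType) (P : probability O R) (F : R -> set (set O)) (d : nat)
    (W : R -> O -> 'cV[R]_d) : Prop := {
  bm_start : {ae P, forall w, W 0 w = 0};
  bm_cont : {ae P, forall w, {within `[0, +oo[, continuous (W ^~ w)}};
  bm_adapted : vadapted F W;
  bm_incr : forall s t, 0 <= s -> s < t ->
    forall (A : set O) (B : 'I_d -> set R), F s A ->
    (forall i, measurable (B i)) ->
    P (A `&` [set w | forall i, B i (W t w i ord0 - W s w i ord0)]) =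
    (P A * \prod_(i < d) normal_prob 0 (Num.sqrt (t - s)) (B i))%E }.

Definition sigma_of_bm (O : Type) (R : realType) (d : nat)
    (W : R -> O -> 'cV[R]_d) : set (set O) :=
  <<s [set A | exists t i (C : set R),
        [/\ 0 <= t, measurable C & A = (fun w => W t w i ord0) @^-1` C]] >>.

(* A point process on U is a random point function p : p w s = Some u means
   that s is in the domain D_p and p(s) = u; only s > 0 matters. The value of
   its counting measure N on B is #{s in D_p, (s, p(s)) in B}. *)
Definition Nmeas (O : Type) (R : realType) (U : Type)
    (p : O -> R -> option U) (w : O) (B : set (R * U)) : \bar R :=
  counting [set s | 0 < s /\ exists2 u, p w s = Some u & B (s, u)].

Definition intensity (R : realType) (dU : measure_display)
    (U : measurableType dU) (nu : {sigma_finite_measure set U -> \bar R})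
    (B : set (measurableTypeR R * U)) : \bar R :=
  (lebesgue_measure \x nu)%E (B `&` (`[0, +oo[ `*` setT)).

Definition sigma_of_N_after (O : Type) (R : realType) (dU : measure_display)
    (U : measurableType dU) (p : O -> R -> option U) (s : R) : set (set O) :=
  <<s [set A | exists (B : set (measurableTypeR R * U)) (C : set (\bar R)),
        [/\ measurable B, B `<=` `]s, +oo[ `*` setT, measurable C &
            A = (fun w => Nmeas p w B) @^-1` C]] >>.

(* {F_t}-Poisson point process with characteristic measure nu. Laws use
   poisson_prob (whose second argument is a dummy) rather than poisson_pmf,
   since poisson_pmf 0 k = 1 for every k. *)
Record poisson_point_process (dO : measure_display) (O : measurableType dO)
    (R : realType) (P : probability O R) (F : R -> set (set O))
    (dU : measure_display) (U : measurableType dU)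
    (nu : {sigma_finite_measure set U -> \bar R})
    (p : O -> R -> option U) : Prop := {
  pp_countable : forall w, countable [set s | 0 < s /\ p w s <> None];
  pp_measurable : forall B : set (measurableTypeR R * U), measurable B ->
    measurable_fun [set: O] (fun w => Nmeas p w B);
  pp_law : forall B : set (measurableTypeR R * U), measurable B ->
    (intensity nu B < +oo)%E -> forall k : nat,
    P [set w | Nmeas p w B = k%:R%:E] =
    poisson_prob (fine (intensity nu B)) 0%N [set k];
  pp_law_infty : forall B : set (measurableTypeR R * U), measurable B ->
    intensity nu B = +oo%E -> {ae P, forall w, Nmeas p w B = +oo%E};
  pp_indep : forall (k : nat) (B : 'I_k -> set (measurableTypeR R * U)),
    (forall i, measurable (B i)) -> trivIset setT B ->
    forall C : 'I_k -> set (\bar R), (forall i, measurable (C i)) ->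
    P [set w | forall i, C i (Nmeas p w (B i))] =
    (\prod_(i < k) P [set w | C i (Nmeas p w (B i))])%E;
  pp_adapted : forall t, 0 <= t -> forall A : set U, measurable A ->
    measurable_wrt (F t) (fun w => Nmeas p w (`]0, t] `*` A));
  pp_future : forall s, 0 <= s -> indep_sigma P (F s) (sigma_of_N_after p s) }.

(* Simple predictable integrands
     sum_i xi_i 1_(lo_i, hi_i](t)   and   sum_i xi_i 1_(lo_i, hi_i](t) 1_A_i(u),
   xi_i bounded and F_(lo_i)-measurable, nu(A_i) < oo. *)
Record simple_process (O : Type) (R : realType) (F : R -> set (set O)) := {
  sp_size : nat;
  sp_lo : 'I_sp_size -> R;
  sp_hi : 'I_sp_size -> R;
  sp_xi : 'I_sp_size -> O -> R;
  sp_ord : forall i, 0 <= sp_lo i <= sp_hi i;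
  sp_meas : forall i, measurable_wrt (F (sp_lo i)) (sp_xi i);
  sp_bounded : exists M : R, forall i w, `|sp_xi i w| <= M }.

Definition sp_eval (O : Type) (R : realType) (F : R -> set (set O))
    (H : simple_process F) (t : R) (w : O) : R :=
  \sum_(i < sp_size H) sp_xi i w * \1_(`]sp_lo i, sp_hi i]) t.

Definition sp_integral (O : Type) (R : realType) (F : R -> set (set O))
    (H : simple_process F) (B : R -> O -> R) (t : R) (w : O) : R :=
  \sum_(i < sp_size H) sp_xi i w *
    (B (Num.min (sp_hi i) t) w - B (Num.min (sp_lo i) t) w).

Record simple_field (O : Type) (R : realType) (F : R -> set (set O))
    (dU : measure_display) (U : measurableType dU)
    (nu : {sigma_finite_measure set U -> \bar R}) := {
  sf_proc : simple_process F;
  sf_set : 'I_(sp_size sf_proc) -> set U;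
  sf_set_meas : forall i, measurable (sf_set i);
  sf_set_fin : forall i, (nu (sf_set i) < +oo)%E }.

Definition sf_eval (O : Type) (R : realType) (F : R -> set (set O))
    (dU : measure_display) (U : measurableType dU)
    (nu : {sigma_finite_measure set U -> \bar R}) (H : simple_field F nu)
    (t : R) (u : U) (w : O) : R :=
  \sum_(i < sp_size (sf_proc H))
    sp_xi i w * \1_(`]sp_lo i, sp_hi i]) t * \1_(sf_set i) u.

(* Integral over (0, t] against the compensated measure N - dt nu(du). *)
Definition sf_integral (O : Type) (R : realType) (F : R -> set (set O))
    (dU : measure_display) (U : measurableType dU)
    (nu : {sigma_finite_measure set U -> \bar R}) (H : simple_field F nu)
    (p : O -> R -> option U) (t : R) (w : O) : R :=
  \sum_(i < sp_size (sf_proc H))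
    let lo := Num.min (sp_lo i) t in
    let hi := Num.min (sp_hi i) t in
    sp_xi i w * (fine (Nmeas p w (`]lo, hi] `*` sf_set i))
                 - (hi - lo) * fine (nu (sf_set i))).

(* Stochastic integrals as L^2 limits of the integrals of simple integrands:
   the process I is a version of (int_0^t h dB)_t, resp. of
   (int_0^t int_U f(s,u) Ntilde(ds,du))_t. *)
Definition is_ito_integral (dO : measure_display) (O : measurableType dO)
    (R : realType) (P : probability O R) (F : R -> set (set O))
    (B : R -> O -> R) (h : R -> O -> R) (I : R -> O -> R) : Prop :=
  [/\ adapted F I,
      forall w, {within `[0, +oo[, continuous (I ^~ w)} &
      exists H : nat -> simple_process F, forall T, 0 <= T ->
        (\int[P]_w \int[lebesgue_measure]_(t in `]0%R, T])
           ((sp_eval (H k) t w - h t w) ^+ 2)%:E)%E @[k --> \oo] --> 0%E /\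
        (\int[P]_w ((sp_integral (H k) B T w - I T w) ^+ 2)%:E)%E
           @[k --> \oo] --> 0%E].

Definition is_poisson_integral (dO : measure_display) (O : measurableType dO)
    (R : realType) (P : probability O R) (F : R -> set (set O))
    (dU : measure_display) (U : measurableType dU)
    (nu : {sigma_finite_measure set U -> \bar R}) (p : O -> R -> option U)
    (f : R -> U -> O -> R) (I : R -> O -> R) : Prop :=
  [/\ adapted F I,
      forall w, cadlag (I ^~ w) &
      exists H : nat -> simple_field F nu, forall T, 0 <= T ->
        (\int[P]_w \int[lebesgue_measure]_(t in `]0%R, T]) \int[nu]_u
           ((sf_eval (H k) t u w - f t u w) ^+ 2)%:E)%E @[k --> \oo] --> 0%E /\
        (\int[P]_w ((sf_integral (H k) p T w - I T w) ^+ 2)%:E)%E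
           @[k --> \oo] --> 0%E].

Definition exit_time (O : Type) (R : realType) (d : nat)
    (X : R -> O -> 'cV[R]_d) (n : nat) (w : O) : \bar R :=
  ereal_inf [set t%:E | t in [set t : R | 0 <= t /\ n%:R < hsnorm (X t w)]].

Definition stopped_time (O : Type) (R : realType) (tau : O -> \bar R)
    (t : R) (w : O) : R :=
  fine (Order.min t%:E (tau w)).

(* Stochastic interval [0, tau]. *)
Definition upto (O : Type) (R : realType) (tau : O -> \bar R)
    (t : R) (w : O) : R :=
  if (t%:E <= tau w)%E then 1 else 0.

Definition left_lim (O : Type) (R : realType) (d : nat)
    (X : R -> O -> 'cV[R]_d) (t : R) (w : O) : 'cV[R]_d :=
  lim (X s w @[s --> t^'-]).

(* The stochastic integrals over (0, t /\ tau_n] are the integrals over (0, t]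
   of the integrands cut off by 1_[0, tau_n]; these lie in L^2 because
   |X(s-)| <= n for 0 < s <= tau_n. *)
Record solution (dO : measure_display) (O : measurableType dO)
    (R : realType) (P : probability O R) (F : R -> set (set O)) (d : nat)
    (dU : measure_display) (U : measurableType dU)
    (nu : {sigma_finite_measure set U -> \bar R})
    (b : 'cV[R]_d -> 'cV[R]_d) (sigma : 'cV[R]_d -> 'M[R]_d)
    (c : 'cV[R]_d -> U -> 'cV[R]_d)
    (W : R -> O -> 'cV[R]_d) (p : O -> R -> option U)
    (X : R -> O -> 'cV[R]_d) : Prop := {
  sol_cadlag : forall w, cadlag (X ^~ w);
  sol_adapted : vadapted F X;
  sol_eq : forall n : nat,
    let tau := exit_time X n in
    exists (M : 'I_d -> 'I_d -> R -> O -> R) (L : 'I_d -> R -> O -> R),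
    [/\ forall i j, is_ito_integral P F (fun t w => W t w j ord0)
          (fun s w => upto tau s w * sigma (X s w) i j) (M i j),
        forall i, is_poisson_integral P F nu p
          (fun s u w => upto tau s w * c (left_lim X s w) u i ord0) (L i) &
        {ae P, forall w, forall t, 0 <= t -> forall i,
           X (stopped_time tau t w) w i ord0 =
             X 0 w i ord0
             + (\int[lebesgue_measure]_(s in `[0%R, stopped_time tau t w])
                  b (X s w) i ord0)
             + \sum_(j < d) M i j t w
             + L i t w}] }.

Definition pathwise_uniqueness (R : realType) (d : nat)
    (dU : measure_display) (U : measurableType dU)
    (nu : {sigma_finite_measure set U -> \bar R})
    (b : 'cV[R]_d -> 'cV[R]_d) (sigma : 'cV[R]_d -> 'M[R]_d)
    (c : 'cV[R]_d -> U -> 'cV[R]_d) : Prop :=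
  forall (dO : measure_display) (O : measurableType dO) (P : probability O R)
    (F : R -> set (set O)) (W : R -> O -> 'cV[R]_d) (p : O -> R -> option U),
  usual_hypotheses P F ->
  brownian_motion P F W ->
  poisson_point_process P F nu p ->
  indep_sigma P (sigma_of_bm W) (sigma_of_N_after p 0) ->
  forall X1 X2 : R -> O -> 'cV[R]_d,
  solution P F nu b sigma c W p X1 ->
  solution P F nu b sigma c W p X2 ->
  {ae P, forall w, X1 0 w = X2 0 w} ->
  {ae P, forall w, forall t, 0 <= t -> X1 t w = X2 t w}.

Record standing_assumptions (R : realType) (d : nat)
    (dU : measure_display) (U : measurableType dU)
    (nu : {sigma_finite_measure set U -> \bar R})
    (b : 'cV[R]_d -> 'cV[R]_d) (sigma : 'cV[R]_d -> 'M[R]_d)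
    (c : 'cV[R]_d -> U -> 'cV[R]_d) : Prop := {
  sa_b_meas : measurable_fun [set: borel 'cV[R]_d] (b : _ -> borel 'cV[R]_d);
  sa_sigma_meas :
    measurable_fun [set: borel 'cV[R]_d] (sigma : _ -> borel 'M[R]_d);
  sa_c_meas : measurable_fun [set: borel 'cV[R]_d * U]
    (fun q => (c q.1 q.2 : borel 'cV[R]_d));
  sa_b_cont : continuous b;
  sa_sigma_cont : continuous sigma;
  sa_c_cont : forall u, continuous (c ^~ u);
  sa_c2_fin : forall x, (\int[nu]_u (hsnorm (c x u) ^+ 2)%:E < +oo)%E;
  sa_c2_cont : continuous (fun x => \int[nu]_u (hsnorm (c x u) ^+ 2)) }.

(* Main.v *)
(** The two solutions are compared up to the first time one of them leaves the ball of
radius n or they separate by more than delta0; until then their difference is D = A + M + L,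
with A the integrated drift gap, M a Brownian and L a compensated Poisson integral.

Ito's formula is not needed. The function f(x) = sqrt(|x|^2 + e^2) lies below its tangent plane
plus a quadratic term, which controls the increments of A and M, and it is 1-Lipschitz, which
controls those of L. Summing over a uniform grid and using only E[psi dM] = 0, the isometry for
M and E|dL| <= 2 E (int int |c1 - c2| dnu ds), then refining the grid and letting e -> 0, one
finds a function V that dominates E|D| before the exit and satisfies
V(t) <= V(s) + C (t - s) rho(V(t)); the Osgood condition forces V = 0.
The same estimate, stopped at the first grid point after the exit, shows that D vanishes at the
exit time. Hence by right continuity the solutions cannot exit by separating. *)
From HB Require Import structures.
Require Import Defs.
From mathcomp Require Import ring lra.

Set Implicit Arguments.
Unset Strict Implicit.
Unset Printing Implicit Defensive.

(** * Real-valued integration and independence *)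

(** The stochastic integrals are given only as L^2 limits of integrals of simple integrands. Each
    estimate is therefore proved for finite sums over time intervals, tested against variables known
    at the left end of an interval, and then passed to the limit.

    The modulus condition bounds only the sum of the drift product and |sigma(z) - sigma(x)|^2, and
    the first may be very negative. The coefficient 1/2 of the second-order term thus has to be
    sharp in the limit, which forces the parameters [eta] and [th] tending to 0. Division by f then
    cancels the factor |z - x| of the modulus and leaves rho.

    For the jumps the modulus is an L^1(nu) bound, so they are measured by total variation and not
    by the isometry; this is where the 1-Lipschitz bound on f enters.

    Concavity of rho is used through the linear majorant rho(r) <= rho(m)(1 + r/m) with m = V(t), in
    place of Jensen's inequality.

    A jump may occur exactly at the exit, so agreement before it says nothing about the exit time
    itself. D contains that jump, and right continuity with Fatou's lemma carries the estimate
    there. *)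

Section integrable_real.
Context {d : measure_display} {T : measurableType d} {R : realType}.
Variable mu : {measure set T -> \bar R}.
Implicit Types (f g : T -> R) (D : set T).

Definition L1 D f := mu.-integrable D (EFin \o f).

Lemma L1_meas D f : L1 D f -> measurable_fun D f.
Proof. by move=> /measurable_int/measurable_EFinP. Qed.

Lemma L1_dom D f g : measurable D -> measurable_fun D f ->
  (forall x, D x -> `|f x| <= g x) -> L1 D g -> L1 D f.
Proof.
move=> mD mf fg ig; apply: (le_integrable mD _ _ ig) => //.
- exact/measurable_EFinP.
- by move=> x Dx /=; rewrite lee_fin (le_trans (fg _ Dx))// ler_norm.
Qed.

Lemma L1D D f g : measurable D -> L1 D f -> L1 D g -> L1 D (fun x => f x + g x).
Proof. by move=> mD fi gi; exact: (integrableD mD fi gi). Qed.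

Lemma L1B D f g : measurable D -> L1 D f -> L1 D g -> L1 D (fun x => f x - g x).
Proof. by move=> mD fi gi; exact: (integrableB mD fi gi). Qed.

Lemma L1Z D f k : measurable D -> L1 D f -> L1 D (fun x => k * f x).
Proof.
move=> mD fi; have := integrableZl mD k fi.
by apply: eq_integrable => // x _; rewrite /= EFinM.
Qed.

Lemma L1N D f : measurable D -> L1 D f -> L1 D (fun x => - f x).
Proof.
by move=> mD fi; have := L1Z (-1) mD fi; apply: eq_integrable => // x _ /=; rewrite mulN1r.
Qed.

Lemma L1_norm D f : measurable D -> L1 D f -> L1 D (fun x => `|f x|).
Proof. by move=> mD fi; exact: integrable_norm. Qed.

Lemma L1_sum D (I : Type) (s : seq I) (F : I -> T -> R) : measurable D ->
  (forall i, L1 D (F i)) -> L1 D (fun x => \sum_(i <- s) F i x).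
Proof.
move=> mD iF; elim: s => [|i s IH].
  by apply: (eq_integrable mD (cst 0%E)); [move=> x _; rewrite /= big_nil|exact: integrable0].
apply: (eq_integrable mD (EFin \o (fun x => F i x + \sum_(i <- s) F i x))).
  by move=> x _ /=; rewrite big_cons.
exact: L1D.
Qed.

Lemma L1Mb D f g (M : R) : measurable D -> measurable_fun D f ->
  (forall x, D x -> `|f x| <= M) -> L1 D g -> L1 D (fun x => f x * g x).
Proof.
move=> mD mf fM ig; apply: (@L1_dom _ _ (fun x => M * `|g x|)) => //.
- exact: measurable_funM mf (L1_meas ig).
- by move=> x Dx; rewrite normrM ler_wpM2r// fM.
- exact/L1Z/L1_norm.
Qed.

Lemma RintegralDr D f g : measurable D -> L1 D f -> L1 D g ->
  \int[mu]_(x in D) (f x + g x) = \int[mu]_(x in D) f x + \int[mu]_(x in D) g x.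
Proof. by move=> mD fi gi; exact: RintegralD. Qed.

Lemma RintegralBr D f g : measurable D -> L1 D f -> L1 D g ->
  \int[mu]_(x in D) (f x - g x) = \int[mu]_(x in D) f x - \int[mu]_(x in D) g x.
Proof. by move=> mD fi gi; exact: RintegralB. Qed.

Lemma Rintegral_sumr D (I : Type) (s : seq I) (F : I -> T -> R) : measurable D ->
  (forall i, L1 D (F i)) ->
  \int[mu]_(x in D) (\sum_(i <- s) F i x) = \sum_(i <- s) \int[mu]_(x in D) F i x.
Proof.
move=> mD iF; elim: s => [|i s IH].
  under eq_Rintegral do rewrite big_nil.
  by rewrite big_nil /Rintegral integral0.
under eq_Rintegral do rewrite big_cons.
by rewrite RintegralDr// ?big_cons ?IH//; exact: L1_sum.
Qed.

Lemma RintegralE D f : measurable D -> L1 D f ->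
  ((\int[mu]_(x in D) f x)%:E = \int[mu]_(x in D) (f x)%:E)%E.
Proof. by move=> mD fi; rewrite /Rintegral fineK//; exact: integrable_fin_num. Qed.

Lemma ler_Rint D f g : measurable D -> L1 D f -> L1 D g ->
  (forall x, D x -> f x <= g x) ->
  \int[mu]_(x in D) f x <= \int[mu]_(x in D) g x.
Proof. by move=> mD fi gi fg; exact: le_Rintegral. Qed.

Lemma ae_eq_Rint D f g : measurable D -> measurable_fun D f -> measurable_fun D g ->
  {ae mu, forall x, D x -> f x = g x} ->
  \int[mu]_(x in D) f x = \int[mu]_(x in D) g x.
Proof.
move=> mD mf mg fg; rewrite /Rintegral; congr fine.
apply: ae_eq_integral => //; try exact/measurable_EFinP.
by apply: filterS fg => x /[apply] /= ->.
Qed.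

Lemma ae_L1 D f g : measurable D -> measurable_fun D g ->
  {ae mu, forall x, D x -> f x = g x} -> L1 D f -> L1 D g.
Proof.
move=> mD mg fg /integrableP[mf fi]; apply/integrableP; split.
  exact/measurable_EFinP.
apply: le_lt_trans fi; rewrite le_eqVlt; apply/orP; left; apply/eqP.
apply: ae_eq_integral => //.
- by apply: measurableT_comp => //; exact/measurable_EFinP.
- exact/measurableT_comp.
- by apply: filterS fg => x /[apply] /= ->.
Qed.

Lemma ae_ler_Rint D f g : measurable D -> L1 D f -> L1 D g ->
  {ae mu, forall x, D x -> f x <= g x} ->
  \int[mu]_(x in D) f x <= \int[mu]_(x in D) g x.
Proof.
move=> mD fi gi fg; rewrite -lee_fin !RintegralE//.
rewrite -sube_ge0 -?RintegralE// -EFinB -RintegralBr//.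
have mB : measurable_fun D (fun x => f x - g x).
  exact: measurable_funB (L1_meas fi) (L1_meas gi).
rewrite (@ae_eq_Rint _ _ (fun x => `|g x - f x|))//.
- by rewrite lee_fin Rintegral_ge0.
- exact: measurable_funB (L1_meas gi) (L1_meas fi).
- apply: measurableT_comp => //.
  exact: measurable_funB (L1_meas gi) (L1_meas fi).
- by apply: filterS fg => x /[apply] ?; rewrite ger0_norm ?subr_ge0.
Qed.

Lemma le_norm_Rint D f g : measurable D -> L1 D f -> L1 D g ->
  (forall x, D x -> `|f x| <= g x) ->
  `|\int[mu]_(x in D) f x| <= \int[mu]_(x in D) g x.
Proof.
move=> mD fi gi fg; apply: le_trans (le_normr_Rintegral mD fi) _.
by apply: ler_Rint => //; exact: L1_norm.
Qed.

Definition L2 D f := measurable_fun D f /\ L1 D (fun x => f x ^+ 2).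

Lemma L2M D f g : measurable D -> L2 D f -> L2 D g -> L1 D (fun x => f x * g x).
Proof.
move=> mD [mf fi] [mg gi].
apply: (@L1_dom _ _ (fun x => f x ^+ 2 + g x ^+ 2)) => //.
- exact: measurable_funM.
- move=> x _; rewrite ler_norml; apply/andP; split.
  + have := sqr_ge0 (f x + g x); have := sqr_ge0 (f x); have := sqr_ge0 (g x); nra.
  + have := sqr_ge0 (f x - g x); have := sqr_ge0 (f x); have := sqr_ge0 (g x); nra.
- exact: L1D.
Qed.

Lemma L2D D f g : measurable D -> L2 D f -> L2 D g -> L2 D (fun x => f x + g x).
Proof.
move=> mD fi gi; have := L2M mD fi gi; move: fi gi => [mf fi] [mg gi] fgi; split.
  exact: measurable_funD.
apply: (eq_integrable mD (EFin \o (fun x => f x ^+ 2 + g x ^+ 2 + 2 * (f x * g x)))).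
  by move=> x _ /=; congr (_%:E); ring.
by apply: L1D => //; [exact: L1D|exact: L1Z].
Qed.

Lemma L2Mb D f g (M : R) : measurable D -> measurable_fun D f ->
  (forall x, D x -> `|f x| <= M) -> L2 D g -> L2 D (fun x => f x * g x).
Proof.
move=> mD mf fM [mg gi]; split; first exact: measurable_funM.
apply: (eq_integrable mD (EFin \o (fun x => f x ^+ 2 * g x ^+ 2))).
  by move=> x _ /=; rewrite exprMn.
apply: (@L1Mb _ _ _ (M ^+ 2)) => //.
- exact: measurable_funX.
- move=> x Dx; rewrite normrX; have := fM _ Dx.
  by move=> h; rewrite lerXn2r// nnegrE (le_trans _ h).
Qed.

Lemma L2Z D f k : measurable D -> L2 D f -> L2 D (fun x => k * f x).
Proof. by move=> mD fi; apply: (@L2Mb _ (cst k) _ `|k|). Qed.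

Lemma L2B D f g : measurable D -> L2 D f -> L2 D g -> L2 D (fun x => f x - g x).
Proof.
move=> mD fi gi; have -> : (fun x => f x - g x) = (fun x => f x + (-1) * g x).
  by apply/funext => x; ring.
exact/L2D/L2Z.
Qed.

Lemma L2_sum D (I : Type) (s : seq I) (F : I -> T -> R) : measurable D ->
  (forall i, L2 D (F i)) -> L2 D (fun x => \sum_(i <- s) F i x).
Proof.
move=> mD iF; elim: s => [|i s IH].
  have -> : (fun x => \sum_(i <- [::]) F i x) = cst 0.
    by apply/funext => x; rewrite big_nil.
  split => //; apply: (eq_integrable mD (cst 0%E)); last exact: integrable0.
  by move=> x _ /=; rewrite expr0n.
have -> : (fun x => \sum_(j <- i :: s) F j x) = (fun x => F i x + \sum_(j <- s) F j x).
  by apply/funext => x; rewrite big_cons.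
exact: L2D.
Qed.

Lemma ae_L2 D f g : measurable D -> measurable_fun D g ->
  {ae mu, forall x, D x -> f x = g x} -> L2 D f -> L2 D g.
Proof.
move=> mD mg fg [mf fi]; split => //.
apply: ae_L1 fi => //; first exact: measurable_funX.
by apply: filterS fg => x /[apply] ->.
Qed.

End integrable_real.

Section integrable_finite.
Context {d : measure_display} {T : measurableType d} {R : realType}.
Variable mu : {measure set T -> \bar R}.
Implicit Types (f g : T -> R) (D : set T).

Lemma L1_bnd D f (M : R) : measurable D -> (mu D < +oo)%E -> measurable_fun D f ->
  (forall x, D x -> `|f x| <= M) -> L1 mu D f.
Proof.
move=> mD muD mf fM; apply: measurable_bounded_integrable => //.
exists M; split; [exact: num_real|move=> x Mx y Dy /=].
exact: le_trans (fM _ Dy) (ltW Mx).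
Qed.

Lemma L2_L1 D f : measurable D -> (mu D < +oo)%E -> L2 mu D f -> L1 mu D f.
Proof.
move=> mD muD fi.
apply: (eq_integrable mD (EFin \o (fun x => f x * 1))).
  by move=> x _ /=; rewrite mulr1.
apply: L2M => //; split => //; apply: (@L1_bnd _ _ 1) => //.
by move=> x _; rewrite expr1n normr1.
Qed.

Lemma L2_bnd D f (M : R) : measurable D -> (mu D < +oo)%E -> measurable_fun D f ->
  (forall x, D x -> `|f x| <= M) -> L2 mu D f.
Proof.
move=> mD muD mf fM; split => //; apply: (@L1_bnd _ _ (M ^+ 2)) => //.
  exact: measurable_funX.
move=> x Dx; rewrite normrX; have := fM _ Dx.
by move=> h; rewrite lerXn2r// nnegrE (le_trans _ h).
Qed.

End integrable_finite.

Section product.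
Context d1 d2 (T1 : measurableType d1) (T2 : measurableType d2) (R : realType).
Variables (m1 : {sigma_finite_measure set T1 -> \bar R})
          (m2 : {sigma_finite_measure set T2 -> \bar R}).

(** Tonelli applied to the absolute values gives integrability, then Fubini gives the
    factorization. *)
Lemma Rint_prod (f : T1 -> R) (g : T2 -> R) : L1 m1 setT f -> L1 m2 setT g ->
  L1 (m1 \x m2)%E setT (fun z => f z.1 * g z.2) /\
  \int[(m1 \x m2)%E]_z (f z.1 * g z.2) = (\int[m1]_x f x) * (\int[m2]_y g y).
Proof.
move=> f1 g1; have mf := L1_meas f1; have mg := L1_meas g1.
have mfg : measurable_fun setT (fun z : T1 * T2 => f z.1 * g z.2).
  by apply: measurable_funM; exact: measurableT_comp.
have mfge : measurable_fun setT (EFin \o (fun z : T1 * T2 => f z.1 * g z.2)).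
  exact/measurable_EFinP.
have fgi : (m1 \x m2)%E.-integrable setT (EFin \o (fun z : T1 * T2 => f z.1 * g z.2)).
  apply/integrable12ltyP => //.
  have mnf : measurable_fun setT (fun x => `|f x|%:E) by apply/measurable_EFinP/measurableT_comp.
  have mng : measurable_fun setT (fun x => `|g x|%:E) by apply/measurable_EFinP/measurableT_comp.
  have -> : (\int[m1]_x \int[m2]_y `|(EFin \o (fun z : T1 * T2 => f z.1 * g z.2)%R) (x, y)| =
     (\int[m1]_x `|f x|%:E) * (\int[m2]_y `|g y|%:E))%E.
    transitivity (\int[m1]_x (`|f x|%:E * \int[m2]_y `|g y|%:E))%E.
      apply: eq_integral => x _; rewrite -ge0_integralZl//.
      by apply: eq_integral => y _; rewrite /= normrM EFinM.
    by rewrite ge0_integralZr// integral_ge0.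
  move/integrableP : f1 => [_ f1]; move/integrableP : g1 => [_ g1].
  by rewrite lte_mul_pinfty//; [exact: integral_ge0|rewrite ge0_fin_numE//; exact: integral_ge0].
split => //; rewrite {1}/Rintegral -(integral12_prod_meas1 fgi).
rewrite /fubini_F /= -RintegralZr//; congr fine; apply: eq_integral => x _.
by rewrite EFinM RintegralE// -integralZl.
Qed.

End product.

Section independence.
Context {dO : measure_display} {O : measurableType dO} {R : realType}.
Variable P : probability O R.

(** The joint law of (X, Y) agrees with the product of the two laws on rectangles, hence everywhere
    by uniqueness of the product measure; what remains is Fubini for f(x) g(y) and a change of
    variables. *)
Lemma indep_Rint d1 d2 (T1 : measurableType d1) (T2 : measurableType d2)
    (X : O -> T1) (Y : O -> T2) (f : T1 -> R) (g : T2 -> R) :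
  measurable_fun setT X -> measurable_fun setT Y ->
  (forall A B, measurable A -> measurable B ->
     P (X @^-1` A `&` Y @^-1` B) = (P (X @^-1` A) * P (Y @^-1` B))%E) ->
  measurable_fun setT f -> measurable_fun setT g ->
  L1 P setT (f \o X) -> L1 P setT (g \o Y) ->
  L1 P setT (fun w => f (X w) * g (Y w)) /\
  \int[P]_w (f (X w) * g (Y w)) = (\int[P]_w f (X w)) * (\int[P]_w g (Y w)).
Proof.
move=> mX mY XY mf mg fi gi.
pose X' : {mfun O >-> T1} := HB.pack X (isMeasurableFun.Build _ _ _ _ _ mX).
pose Y' : {mfun O >-> T2} := HB.pack Y (isMeasurableFun.Build _ _ _ _ _ mY).
have mXY : measurable_fun setT (fun w => (X w, Y w)) by exact: measurable_fun_pair.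
pose XY' : {mfun O >-> (T1 * T2)%type} := HB.pack (fun w => (X w, Y w))
  (isMeasurableFun.Build _ _ _ _ _ mXY).
pose m1 := distribution P X'; pose m2 := distribution P Y'.
pose m := distribution P XY'.
have mE C : measurable C -> (m1 \x m2)%E C = m C.
  apply: product_measure_unique => A B mA mB.
  by rewrite -XY.
have mfg : measurable_fun setT (fun z : T1 * T2 => f z.1 * g z.2).
  by apply: measurable_funM; exact: measurableT_comp.
have mfge : measurable_fun setT (EFin \o (fun z : T1 * T2 => f z.1 * g z.2)).
  exact/measurable_EFinP.
have mfe : measurable_fun setT (EFin \o f) by exact/measurable_EFinP.
have mge : measurable_fun setT (EFin \o g) by exact/measurable_EFinP.
have f1 : m1.-integrable setT (EFin \o f).
  apply/integrableP; split => //.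
  move/integrableP : fi => [_]; apply: le_lt_trans.
  by rewrite (ge0_integral_distribution X')//; exact: measurableT_comp.
have g1 : m2.-integrable setT (EFin \o g).
  apply/integrableP; split => //.
  move/integrableP : gi => [_]; apply: le_lt_trans.
  by rewrite (ge0_integral_distribution Y')//; exact: measurableT_comp.
have ef : \int[m1]_x f x = \int[P]_w f (X w).
  by rewrite /Rintegral; congr fine; rewrite (integral_distribution (X := X')).
have eg : \int[m2]_x g x = \int[P]_w g (Y w).
  by rewrite /Rintegral; congr fine; rewrite (integral_distribution (X := Y')).
have [fgi fgE] := Rint_prod f1 g1.
have fgm : m.-integrable setT (EFin \o (fun z : T1 * T2 => f z.1 * g z.2)).
  move/integrableP : fgi => [_ fgi]; apply/integrableP; split => //.
  rewrite (eq_measure_integral (m1 \x m2)%E)// => A mA _.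
  exact/esym/mE.
have iXY : L1 P setT (fun w => f (X w) * g (Y w)).
  move/integrableP : fgm => [_ fgm]; apply/integrableP; split.
    exact: (measurableT_comp mfge mXY).
  by move: fgm; rewrite ge0_integral_distribution//; apply: measurableT_comp.
split => //.
have -> : \int[P]_w (f (X w) * g (Y w)) = \int[m]_z (f z.1 * g z.2).
  rewrite /Rintegral; congr fine.
  by rewrite (integral_distribution (X := XY') (f := EFin \o (fun z : T1 * T2 => f z.1 * g z.2))).
have -> : \int[m]_z (f z.1 * g z.2) = \int[(m1 \x m2)%E]_z (f z.1 * g z.2).
  rewrite /Rintegral; congr fine; apply: eq_measure_integral => A mA _.
  exact/esym/mE.
by rewrite -ef -eg fgE.
Qed.

End independence.

(** * Moments of the normal and Poisson laws *)

Section density.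
Local Open Scope ereal_scope.
Context {d : measure_display} {T : measurableType d} {R : realType}.
Variables (mu nu : {measure set T -> \bar R}) (p : T -> R).
Hypothesis mp : measurable_fun setT p.
Hypothesis p0 : forall x, (0 <= p x)%R.
Hypothesis nuE : forall B, measurable B -> nu B = \int[mu]_(x in B) (p x)%:E.
Import HBNNSimple.

Let nnsfun_density (g : {nnsfun T >-> R}) :
  \int[nu]_x (g x)%:E = \int[mu]_x (g x * p x)%:E.
Proof.
rewrite integralT_nnsfun sintegralE.
transitivity (\sum_(k \in range g) \int[mu]_x (k * (\1_(g @^-1` [set k]) x * p x))%:E).
  apply: eq_fsbigr => k; rewrite inE => -[t _ <-].
  have mk : measurable (g @^-1` [set g t]) by [].
  rewrite nuE//; under [RHS]eq_integral do rewrite EFinM.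
  rewrite ge0_integralZl//; last 3 first.
  - by apply/measurable_EFinP/measurable_funM => //; exact: measurable_indic.
  - by move=> x _; rewrite lee_fin mulr_ge0.
  - by rewrite lee_fin.
  congr (_ * _); rewrite integral_mkcond; apply: eq_integral => x _.
  by rewrite patchE indicE; case: ifPn => _; rewrite ?mul1r ?mul0r.
rewrite -ge0_integral_fsum//.
- apply: eq_integral => x _; rewrite fsumEFin//; congr (_%:E).
  rewrite [in RHS](fimfunE g x) mulr_fsuml//; apply: eq_fsbigr => k _; exact: mulrA.
- move=> k; apply/measurable_EFinP/measurable_funM => //.
  by apply/measurable_funM => //; exact: measurable_indic.
- move=> k x _.
  have := nnfun_muleindic_ge0 g k x; rewrite lee_fin => h.
  by rewrite lee_fin mulrA mulr_ge0.
Qed.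

(** For simple functions this is the hypothesis applied to level sets; monotone convergence, used
    once under each measure, extends it. *)
Lemma ge0_integral_density (f : T -> R) : measurable_fun setT f ->
  (forall x, (0 <= f x)%R) -> \int[nu]_x (f x)%:E = \int[mu]_x (f x * p x)%:E.
Proof.
move=> mf f0; have mfe : measurable_fun setT (EFin \o f) by exact/measurable_EFinP.
pose g := nnsfun_approx measurableT mfe.
have gf x : EFin \o g^~ x @ \oo --> (f x)%:E.
  by apply: (@cvg_nnsfun_approx _ _ _ _ measurableT (EFin \o f)) => // *; rewrite lee_fin.
have ndg x : {homo (g^~ x) : m n / (m <= n)%N >-> (m <= n)%R}.
  by move=> m n mn; exact/lefP/nd_nnsfun_approx.
have h1 : (fun n => \int[nu]_x (g n x)%:E) @ \oo --> \int[nu]_x (f x)%:E.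
  have := @cvg_monotone_convergence _ _ _ nu _ measurableT (fun n => EFin \o g n).
  rewrite (_ : (fun x => limn _) = EFin \o f); last first.
    by apply/funext => x; apply/cvg_lim => //; exact: gf.
  apply.
  - by move=> n; exact/measurable_EFinP.
  - by move=> n x _; rewrite lee_fin.
  - by move=> x _ m n mn; rewrite lee_fin ndg.
have h2 : (fun n => \int[mu]_x (g n x * p x)%:E) @ \oo --> \int[mu]_x (f x * p x)%:E.
  have := @cvg_monotone_convergence _ _ _ mu _ measurableT
    (fun n => EFin \o (fun x => g n x * p x)%R).
  rewrite (_ : (fun x => limn _) = EFin \o (fun x => f x * p x)%R); last first.
    apply/funext => x; apply/cvg_lim => //=.
    apply/fine_cvgP; split; first exact: nearW.
    by apply: cvgMr_tmp; have /fine_cvgP[_] := gf x.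
  apply.
  - by move=> n; apply/measurable_EFinP/measurable_funM.
  - by move=> n x _; rewrite lee_fin mulr_ge0.
  - by move=> x _ m n mn; rewrite lee_fin ler_wpM2r ?ndg.
rewrite -(cvg_lim _ h1)// -(cvg_lim _ h2)//; congr (lim (_ @ \oo)).
by apply/funext => n; exact: nnsfun_density.
Qed.

End density.

Section normal_moments.
Context {R : realType}.
Local Notation mu := (@lebesgue_measure R).
Variable s : R.
Hypothesis s0 : 0 < s.
Local Notation N := (normal_prob 0 s).
Local Notation e := (normal_fun 0 s).

Let normal_funE x : e x = expR (- x ^+ 2 / (s ^+ 2 *+ 2)).
Proof. by rewrite /normal_fun subr0. Qed.

Let is_derive_e (x : R) : is_derive x 1 e (- (x / s ^+ 2) * e x).
Proof.
have -> : e = expR \o (fun x => - (s ^+ 2 *+ 2)^-1 * x ^+ 2).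
  by apply/funext => y /=; rewrite normal_funE; congr expR; rewrite mulrC mulNr mulrN.
apply: is_derive_eq.
rewrite [(_ \o _) x]/comp; move: (expR _) => E.
have s1 : s != 0 by rewrite gt_eqF.
transitivity (E * (- (s ^+ 2 *+ 2)^-1 * (x * 1 + x * 1))); first by [].
rewrite -mulr_natl; by field.
Qed.

(** This is the boundary term of the integration by parts below; exp y >= 1 + y bounds it by 2 s^2 /
    n. *)
Lemma cvg_mul_normal_fun : (fun n : nat => n%:R * e n%:R) @ \oo --> (0 : R).
Proof.
have s1 : s != 0 by rewrite gt_eqF.
apply: (@squeeze_cvgr _ _ _ _ (cst 0) (fun n : nat => (s ^+ 2 *+ 2) / n%:R)).
- near=> n.
  have n0 : (0 : R) < n%:R by rewrite ltr0n; near: n; exists 1%N.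
  rewrite mulr_ge0 ?normal_fun_ge0//= normal_funE mulNr expRN.
  rewrite ler_pdivlMr// mulrAC ler_pdivrMr ?expR_gt0//.
  have k0 : (0 : R) < s ^+ 2 *+ 2 by rewrite pmulrn_lgt0// exprn_gt0.
  rewrite -expr2 -ler_pdivrMl//.
  apply: le_trans (expR_ge1Dx _).
  by rewrite mulrC lerDr.
- exact: cvg_cst.
- rewrite -(mulr0 (s ^+ 2 *+ 2)); apply: cvgMl_tmp.
  by apply/gtr0_cvgV0; [near=> n; rewrite ltr0n; near: n; exists 1%N|exact: cvgr_idn].
Unshelve. all: by end_near. Qed.

Let is_derive_mulx (E : R -> R) (x E' c : R) : is_derive x 1 E E' ->
  is_derive x 1 (fun y => c * (y * E y)) (c * (x * E' + E x)).
Proof.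
move=> dE; apply: is_derive_eq.
by rewrite -[X in _ = _ * (_ + X)]mulr1.
Qed.

Let mul_normal_funE (n : nat) : (0 < n)%N ->
  (\int[mu]_(x in `[0%R, n%:R]) (x ^+ 2 * e x)%:E =
   (s ^+ 2)%:E * (\int[mu]_(x in `[0%R, n%:R]) (e x)%:E) -
   (s ^+ 2 * (n%:R * e n%:R))%:E)%E.
Proof.
move=> n0; have s1 : s != 0 by rewrite gt_eqF.
have ce : continuous e.
  by move=> x; apply: differentiable_continuous; apply/derivable1_diffP; case: (is_derive_e x).
have c2 : continuous (fun x : R => x ^+ 2 * e x : R).
  by move=> x; apply: cvgM; [exact: exprn_continuous|exact: ce].
(* Integration by parts: since e' = -(x / s^2) e, the derivative of F is x^2 e - s^2 e. *)
pose F (x : R) := - s ^+ 2 * (x * e x).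
have dF (x : R) : is_derive x 1 F (x ^+ 2 * e x - s ^+ 2 * e x).
  rewrite [X in is_derive _ _ _ X](_ : _ = - s ^+ 2 * (x * (- (x / s ^+ 2) * e x) + e x)).
    exact: is_derive_mulx.
  by move: (e x) => E; field.
have cF : continuous F.
  by move=> x; apply: differentiable_continuous; apply/derivable1_diffP; case: (dF x).
have i1 : mu.-integrable `[0%R, n%:R] (EFin \o (fun x => x ^+ 2 * e x)).
  by apply: continuous_compact_integrable;
    [exact: segment_compact|exact: continuous_subspaceT].
have i2 : mu.-integrable `[0%R, n%:R] (EFin \o e).
  by apply: continuous_compact_integrable;
    [exact: segment_compact|exact: continuous_subspaceT].
have := @continuous_FTC2 R (fun x => x ^+ 2 * e x - s ^+ 2 * e x) F 0 n%:R.
rewrite ltr0n => /(_ n0).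
have -> : (\int[mu]_(x in `[0%R, n%:R]) (x ^+ 2 * e x - s ^+ 2 * e x)%:E =
  (\int[mu]_(x in `[0%R, n%:R]) (x ^+ 2 * e x) -
  s ^+ 2 * \int[mu]_(x in `[0%R, n%:R]) e x)%:E)%E.
  by rewrite -RintegralZl// -RintegralBr ?RintegralE//;
     [apply: L1B => //; exact: L1Z|exact: L1Z].
rewrite -!RintegralE// -EFinM -EFinB => H; congr (_%:E).
have {}H : \int[mu]_(x in `[0, n%:R]) (x ^+ 2 * e x) -
    s ^+ 2 * \int[mu]_(x in `[0, n%:R]) e x = F n%:R - F 0.
  apply: EFin_inj; rewrite H ?EFinB//.
  - apply: continuous_subspaceT => x; apply: cvgB; first exact: c2.
    by apply: cvgMl_tmp; exact: ce.
  - split.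
    + by move=> x _; case: (dF x).
    + exact/cvg_at_right_filter/cF.
    + exact/cvg_at_left_filter/cF.
  - by move=> x _; rewrite derive1E; case: (dF x).
by move: H; rewrite /F; lra.
Qed.

Let bigcup_segment : \bigcup_(n : nat) `[0%R, n%:R]%classic = `[0%R, +oo[%classic :> set R.
Proof.
apply/seteqP; split => x /=.
  by move=> [n _] /=; rewrite !in_itv/= andbT => /andP[].
rewrite in_itv/= andbT => x0; exists (Num.bound x) => //=.
by rewrite in_itv/= x0/= ltW// archi_boundP.
Qed.

Let cvg_integral_segment (f : R -> R) : measurable_fun setT f -> (forall x, 0 <= f x) ->
  (\int[mu]_(x in `[0%R, n%:R]) (f x)%:E)%E @[n --> \oo] -->
  (\int[mu]_(x in `[0%R, +oo[) (f x)%:E)%E.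
Proof.
move=> mf f0; rewrite -bigcup_segment; apply: ge0_nondecreasing_set_cvg_integral.
- by apply/nondecreasing_seqP => n; rewrite subsetEset; apply: subset_itvl;
    rewrite bnd_simp ler_nat.
- by move=> n.
- by move=> n; apply/measurable_EFinP/measurable_funTS.
- by move=> n x _; rewrite lee_fin.
Qed.

Let integral_sqr_half : (\int[mu]_(x in `[0%R, +oo[) (x ^+ 2 * e x)%:E =
  (s ^+ 2)%:E * \int[mu]_(x in `[0%R, +oo[) (e x)%:E)%E.
Proof.
have me : measurable_fun setT e by exact: measurable_normal_fun.
have m2 : measurable_fun setT (fun x : R => x ^+ 2 * e x).
  by apply: measurable_funM => //; exact: measurable_funX.
have c1 := cvg_integral_segment m2
  (fun x => mulr_ge0 (sqr_ge0 x) (normal_fun_ge0 0 s x)).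
have c2 := cvg_integral_segment me (normal_fun_ge0 0 s).
apply: (cvg_unique _ c1) => //.
have -> : ((s ^+ 2)%:E * \int[mu]_(x in `[0%R, +oo[) (e x)%:E =
  (s ^+ 2)%:E * \int[mu]_(x in `[0%R, +oo[) (e x)%:E - (s ^+ 2 * 0)%:E)%E.
  by rewrite mulr0 sube0.
apply: (@cvg_trans _ ((fun n => (s ^+ 2)%:E * \int[mu]_(x in `[0%R, n%:R]) (e x)%:E -
   (s ^+ 2 * (n%:R * e n%:R))%:E)%E @ \oo)).
  apply: near_eq_cvg; near=> n.
  by rewrite mul_normal_funE//; near: n; exists 1%N.
apply: cvgeB.
- by rewrite fin_num_adde_defl.
- by apply: cvgeZl.
- apply: cvg_EFin; first exact: nearW.
  by apply: cvgMl_tmp; exact: cvg_mul_normal_fun.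
Unshelve. all: by end_near. Qed.

(** Both integrands are even, so it suffices to compare on the half line, where integration by parts
    gives the factor s^2; the total mass 1 of the density then fixes the value. *)
Lemma integral_sqr_normal : (\int[N]_x (x ^+ 2)%:E = (s ^+ 2)%:E)%E.
Proof.
have s1 : s != 0 by rewrite gt_eqF.
have pE : normal_pdf 0 s = (fun x => normal_peak s * e x) by rewrite normal_pdfE.
have pk : 0 < normal_peak s by exact: normal_peak_gt0.
have ce : continuous e.
  by move=> x; apply: differentiable_continuous; apply/derivable1_diffP; case: (is_derive_e x).
have me : measurable_fun setT e by exact: measurable_normal_fun.
have m2 : measurable_fun setT (fun x : R => x ^+ 2) by exact: measurable_funX.
rewrite (ge0_integral_density (mu := mu) (measurable_normal_pdf 0 s)
  (normal_pdf_ge0 0 s) _ m2 (@sqr_ge0 _))//.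
have := integral_normal_pdf 0 s; rewrite pE.
have eN x : e (- x) = e x by rewrite !normal_funE sqrrN.
have I1 : (\int[mu]_x (normal_peak s * e x)%:E =
  (normal_peak s)%:E * (2%:E * \int[mu]_(x in `[0%R, +oo[) (e x)%:E))%E.
  under eq_integral do rewrite EFinM.
  rewrite ge0_integralZl//; last 3 first.
  - exact/measurable_EFinP.
  - by move=> x _; rewrite lee_fin normal_fun_ge0.
  - by rewrite lee_fin ltW.
  by rewrite ge0_symfun_integralT ?set_itvcy//; [exact: normal_fun_ge0|move=> x /=; rewrite eN].
have I2 : (\int[mu]_x (x ^+ 2 * (normal_peak s * e x))%:E =
  (normal_peak s)%:E * (2%:E * \int[mu]_(x in `[0%R, +oo[) (x ^+ 2 * e x)%:E))%E.
  under eq_integral do rewrite mulrCA EFinM.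
  rewrite ge0_integralZl//; last 3 first.
  - by apply/measurable_EFinP/measurable_funM => //; exact: measurable_funX.
  - by move=> x _; rewrite lee_fin mulr_ge0 ?normal_fun_ge0 ?sqr_ge0.
  - by rewrite lee_fin ltW.
  rewrite ge0_symfun_integralT ?set_itvcy//.
  - by move=> x; rewrite mulr_ge0 ?normal_fun_ge0 ?sqr_ge0.
  - by move=> x; apply: cvgM; [exact: exprn_continuous|exact: ce].
  - by move=> x /=; rewrite eN sqrrN.
rewrite I1 I2 integral_sqr_half => H.
by rewrite (muleCA 2%:E) (muleCA (normal_peak s)%:E) H mule1.
Qed.

Lemma L2_normal : L2 N setT (@id R).
Proof.
split; first exact: measurable_id.
apply/integrableP; split.
  by apply/measurable_EFinP; exact: measurable_funX.
under eq_integral do rewrite /= ger0_norm ?sqr_ge0//.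
by rewrite integral_sqr_normal ltry.
Qed.

(** The law is invariant under negation, so the mean equals its own opposite. *)
Lemma Rintegral_normal : \int[N]_x x = 0.
Proof.
have s1 : s != 0 by rewrite gt_eqF.
have i1 : L1 N setT (@id R).
  by apply: L2_L1 => //; [rewrite -ge0_fin_numE// fin_num_measure|exact: L2_normal].
have mN : measurable_fun setT (-%R : measurableTypeR R -> measurableTypeR R).
  exact: measurable_funN.
have NE (A : set (measurableTypeR R)) : measurable A -> N A = pushforward N (-%R : _ -> measurableTypeR R) A.
  move=> mA; rewrite /pushforward /normal_prob.
  have pN (x : R) : normal_pdf 0 s (- x) = normal_pdf 0 s x.
    by rewrite normal_pdfE// !normal_funE sqrrN.
  have mpN : measurable_fun setT (fun y : R => (normal_pdf 0 s y)%:E).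
    by apply/measurable_EFinP; exact: measurable_normal_pdf.
  transitivity (\int[pushforward mu (-%R : measurableTypeR R -> measurableTypeR R)]_(x in A)
     (normal_pdf 0 s x)%:E)%E.
    by apply: eq_measure_integral => B mB _; exact/esym/lebesgue_measureN.
  rewrite (ge0_integral_pushforward mN)//.
  - by apply: eq_integral => x _ /=; rewrite pN.
  - exact: measurable_funTS.
  - by move=> y _; rewrite lee_fin normal_pdf_ge0.
have i2 : (N : {measure set (measurableTypeR R) -> \bar R}).-integrable
    (-%R @^-1` (setT : set (measurableTypeR R)))
    ((EFin \o (@id R)) \o (-%R : measurableTypeR R -> measurableTypeR R)).
  by rewrite preimage_setT; exact: (L1N measurableT i1).
suff : \int[N]_x x = - \int[N]_x x by lra.
rewrite -[in RHS]mulN1r -RintegralZl// /Rintegral; congr fine.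
transitivity (\int[pushforward N (-%R : measurableTypeR R -> measurableTypeR R)]_x (x%:E))%E.
  by apply: eq_measure_integral => B mB _; exact: NE.
have mi : measurable_fun setT (EFin \o (@id R)) by exact/measurable_EFinP.
rewrite (integral_pushforward mN mi i2 measurableT).
rewrite preimage_setT; apply: eq_integral => x _ /=.
by rewrite mulN1r.
Qed.

End normal_moments.

Section poisson_moments.
Context {R : realType}.
Variable l : R.
Hypothesis l0 : 0 <= l.
Local Notation pp k := (poisson_prob l 0%N [set k]).
Local Open Scope ereal_scope.

Let poisson_prob_set1 k : pp k = if (0 < l)%R then (poisson_pmf l k)%:E else (k == 0%N)%:R%:E.
Proof.
rewrite /poisson_prob; case: ifPn => // l1.
  by rewrite esum_set1// lee_fin poisson_pmf_ge0.
by rewrite diracE; case: k => [|k]; [rewrite mem_set|rewrite memNset].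
Qed.

Lemma sum_poisson_prob : \sum_(k <oo) pp k = 1.
Proof.
rewrite -(@probability_setT _ _ _ (poisson_prob l 0%N)).
rewrite (_ : [set: nat] = \bigcup_k [set k]); last first.
  by apply/seteqP; split => // k _; exists k.
rewrite measure_bigcup//.
- by under [RHS]eq_eseriesl do rewrite in_setT.
- by move=> i j _ _ [k [/= -> ->]].
Qed.

(** The shift k p_k = l p_(k-1) reduces it to the total mass; at rate 0 the law is the Dirac mass at
    0 and both sides vanish. *)
Lemma sum_poisson_prob_mean : \sum_(k <oo) k%:R%:E * pp k = l%:E.
Proof.
rewrite nneseries_recl//; last by move=> k _; rewrite mule_ge0.
rewrite mul0e add0e -nneseries_addn; last by move=> k; rewrite mule_ge0.
rewrite -[RHS]mule1 -sum_poisson_prob -nneseriesZl//.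
apply: eq_eseriesr => k _; rewrite addn1 !poisson_prob_set1.
have [l1|] := ltP 0%R l; last first.
  move=> l1; have -> : l = 0%R by apply/eqP; rewrite eq_le l1 l0.
  by rewrite mul0e mule0.
rewrite -!EFinM /poisson_pmf l1 exprS factS natrM; congr (_%:E).
have k1 : (k.+1%:R : R) != 0%R by rewrite pnatr_eq0.
have k2 : (k`!%:R : R) != 0%R by rewrite pnatr_eq0 -lt0n fact_gt0.
move: k1 k2; move: (k.+1%:R : R)%R (k`!%:R : R)%R (expR _) (l ^+ k)%R => a b c e a0 b0.
by field; rewrite a0 b0.
Qed.

(** The factorial moment, rather than the second moment, is compatible with the index shift: (k+1) k
    p_(k+1) = l k p_k, so the mean just computed finishes it. *)
Lemma sum_poisson_prob_factorial2 :
  \sum_(k <oo) (k%:R * k.-1%:R)%:E * pp k = (l ^+ 2)%:E.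
Proof.
have h0 k : 0 <= (k%:R * k.-1%:R)%:E * pp k by rewrite mule_ge0// lee_fin mulr_ge0.
rewrite nneseries_recl//.
rewrite mul0r mul0e add0e -nneseries_addn//.
rewrite expr2 EFinM -[X in _ = _ * X]sum_poisson_prob_mean -nneseriesZl//; last first.
  by move=> i _; rewrite mule_ge0.
apply: eq_eseriesr => k _; rewrite addn1 !poisson_prob_set1.
have [l1|] := ltP 0%R l; last first.
  move=> l1; have -> : l = 0%R by apply/eqP; rewrite eq_le l1 l0.
  by rewrite mul0e mule0.
rewrite -!EFinM /poisson_pmf l1 exprS factS natrM; congr (_%:E).
have k1 : (k.+1%:R : R) != 0%R by rewrite pnatr_eq0.
have k2 : (k`!%:R : R) != 0%R by rewrite pnatr_eq0 -lt0n fact_gt0.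
move: k1 k2; move: (k.+1%:R : R)%R (k%:R : R)%R (k`!%:R : R)%R (expR _) (l ^+ k)%R => a f b c e a0 b0.
by field; rewrite a0 b0.
Qed.

End poisson_moments.

Section poisson_variable.
Context {dO : measure_display} {O : measurableType dO} {R : realType}.
Variables (P : probability O R) (N : O -> \bar R) (l : R).
Hypothesis l0 : 0 <= l.
Hypothesis mN : measurable_fun setT N.
Hypothesis NE : forall k : nat, P [set w | N w = k%:R%:E] = poisson_prob l 0%N [set k].

Let A (k : nat) := [set w | N w = k%:R%:E].

Let mA k : measurable (A k).
Proof.
by have := mN measurableT (emeasurable_set1 k%:R%:E); rewrite setTI.
Qed.

Let tA : trivIset setT A.
Proof.
by move=> i j _ _ [w [/=]]; rewrite /A /= => -> /eqP; rewrite eqe eqr_nat => /eqP.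
Qed.

Let PA : P (\bigcup_k A k) = 1%E.
Proof.
rewrite measure_bigcup//.
transitivity (\sum_(k <oo) poisson_prob l 0%N [set k])%E; last exact: sum_poisson_prob.
by under eq_eseriesl do rewrite in_setT; apply: eq_eseriesr => k _; exact: NE.
Qed.

Let PAC : P (~` \bigcup_k A k) = 0%E.
Proof. by rewrite probability_setC ?PA ?subee//; exact: bigcup_measurable. Qed.

(** The atoms at the natural numbers already carry mass 1, so every other value, +oo included, is
    negligible. *)
Lemma poisson_ae_nat : {ae P, forall w, exists k : nat, N w = k%:R%:E}.
Proof.
exists (~` \bigcup_k A k); split => //.
- by apply: measurableC; exact: bigcup_measurable.
- by move=> w /= h [k _ Ak]; apply: h; exists k.
Qed.

Let ge0_integral_poisson (g : \bar R -> R) : measurable_fun setT g -> (forall x, 0 <= g x) ->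
  (\int[P]_w (g (N w))%:E = \sum_(k <oo) (g k%:R%:E)%:E * poisson_prob l 0%N [set k])%E.
Proof.
move=> mg g0.
have mgN : measurable_fun setT (fun w => (g (N w))%:E).
  by apply/measurable_EFinP; exact: measurableT_comp.
have mU : measurable (\bigcup_k A k) by exact: bigcup_measurable.
have mUC : measurable (~` \bigcup_k A k) by exact: measurableC.
have dU : [disjoint (\bigcup_k A k) & (~` \bigcup_k A k)] by exact/disj_setPCl.
have g0' w : (0 <= (g (N w))%:E)%E by rewrite lee_fin.
rewrite -(setUv (\bigcup_k A k)) (ge0_integral_setU _ mU mUC)//=; last by rewrite setUv.
rewrite (null_set_integral mUC (measurable_funTS mgN) PAC).
rewrite adde0 ge0_integral_bigcup//; last exact: measurable_funTS.
apply: eq_eseriesr => k _; rewrite -NE -[X in (_ * P X)%E]/(A k) -integral_cst//.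
by apply: eq_integral => w; rewrite inE /A /= => ->.
Qed.

(** The absolute values in [g1] and [g2] make the integrands nonnegative at every extended real, as
    the series formula demands; almost surely they are just N and N (N - 1). *)
Let g1 (x : \bar R) : R := `|fine x|.
Let g2 (x : \bar R) : R := `|fine x * (fine x - 1)|.

Let mg1 : measurable_fun setT g1.
Proof. by apply: measurableT_comp => //; exact: fine_measurable. Qed.

Let mg2 : measurable_fun setT g2.
Proof.
apply: measurableT_comp => //; apply: measurable_funM; first exact: fine_measurable.
by apply: measurable_funB => //; exact: fine_measurable.
Qed.

Let mfN : measurable_fun setT (fun w => fine (N w)).
Proof. by apply: measurableT_comp => //; exact: fine_measurable. Qed.

Let int_g1 : (\int[P]_w (g1 (N w))%:E = l%:E)%E.
Proof.
rewrite (ge0_integral_poisson mg1) ?/g1// -(sum_poisson_prob_mean l0).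
by apply: eq_eseriesr => k _; rewrite /g1 /= ger0_norm.
Qed.

Let int_g2 : (\int[P]_w (g2 (N w))%:E = (l ^+ 2)%:E)%E.
Proof.
rewrite (ge0_integral_poisson mg2) ?/g2// -(sum_poisson_prob_factorial2 l0).
apply: eq_eseriesr => -[|k] _; rewrite /g2 /= ?mul0r ?normr0// ger0_norm.
  by rewrite -natr1 addrK.
by rewrite -natr1 addrK mulr_ge0// -natr1 addr_ge0.
Qed.

Let L1_g1 : L1 P setT (fun w => g1 (N w)).
Proof.
apply/integrableP; split; first by apply/measurable_EFinP; exact: measurableT_comp.
under eq_integral do rewrite /= normr_id.
by rewrite int_g1 ltry.
Qed.

Let L1_g2 : L1 P setT (fun w => g2 (N w)).
Proof.
apply/integrableP; split; first by apply/measurable_EFinP; exact: measurableT_comp.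
under eq_integral do rewrite /= normr_id.
by rewrite int_g2 ltry.
Qed.

Let ae_g1 : {ae P, forall w, [set: O] w -> g1 (N w) = fine (N w)}.
Proof.
by apply: filterS poisson_ae_nat => w [k ->] _; rewrite /g1 /= ger0_norm.
Qed.

Let ae_g2 : {ae P, forall w, [set: O] w -> g2 (N w) + g1 (N w) = fine (N w) ^+ 2}.
Proof.
apply: filterS poisson_ae_nat => w [[|k] ->] _; rewrite /g1 /g2 /=.
  by rewrite mul0r normr0 addr0 expr0n.
have k0 : (0 : R) <= k.+1%:R * (k.+1%:R - 1) by rewrite mulr_ge0// subr_ge0 ler1n.
by rewrite (ger0_norm k0) ger0_norm//; move: (k.+1%:R : R) => a; ring.
Qed.

Lemma poisson_count_L2 : L2 P setT (fun w => fine (N w)).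
Proof.
split => //; apply: ae_L1 ae_g2 _ => //; first exact: measurable_funX.
exact: L1D.
Qed.

Lemma poisson_mean : \int[P]_w fine (N w) = l.
Proof.
rewrite -(ae_eq_Rint _ _ _ ae_g1)//; first by rewrite /Rintegral int_g1.
exact: measurableT_comp.
Qed.

Lemma poisson_second_moment : \int[P]_w (fine (N w) ^+ 2) = l ^+ 2 + l.
Proof.
rewrite -(ae_eq_Rint _ _ _ ae_g2)//.
- by rewrite RintegralDr// /Rintegral int_g1 int_g2.
- by apply: measurable_funD; exact: measurableT_comp.
- exact: measurable_funX.
Qed.

End poisson_variable.

(** * Martingale increments and their brackets *)

Section measurable_wrt.
Context {dO : measure_display} {O : measurableType dO} {R : realType}.
Variable G : set (set O).
Hypothesis sG : sigma_algebra [set: O] G.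
Local Notation GT := (g_sigma_algebraType G).

(** A sigma-algebra generates itself, so measurability with respect to G is ordinary measurability
    on another measurable type, and the closure properties carry over. *)
Lemma measurable_wrtP dT (T : measurableType dT) (f : O -> T) :
  measurable_wrt G f <-> measurable_fun [set: GT] (f : GT -> T).
Proof.
have GE : <<s G >> = G by exact: sigma_algebra_id.
split=> [mf _ B mB|mf B mB].
  by rewrite setTI; rewrite /measurable /= GE; exact: mf.
have := mf measurableT B mB.
by rewrite setTI /measurable /= GE.
Qed.

Lemma wrt_cst (k : R) : measurable_wrt G (fun _ : O => k).
Proof. exact/measurable_wrtP. Qed.

Lemma wrtD (f g : O -> R) : measurable_wrt G f -> measurable_wrt G g ->
  measurable_wrt G (fun w => f w + g w).
Proof. by move=> /measurable_wrtP mf /measurable_wrtP mg; apply/measurable_wrtP; exact: measurable_funD. Qed.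

Lemma wrtB (f g : O -> R) : measurable_wrt G f -> measurable_wrt G g ->
  measurable_wrt G (fun w => f w - g w).
Proof. by move=> /measurable_wrtP mf /measurable_wrtP mg; apply/measurable_wrtP; exact: measurable_funB. Qed.

Lemma wrtM (f g : O -> R) : measurable_wrt G f -> measurable_wrt G g ->
  measurable_wrt G (fun w => f w * g w).
Proof. by move=> /measurable_wrtP mf /measurable_wrtP mg; apply/measurable_wrtP; exact: measurable_funM. Qed.

Lemma wrt_comp (g : R -> R) (f : O -> R) : measurable_fun setT g ->
  measurable_wrt G f -> measurable_wrt G (fun w => g (f w)).
Proof. by move=> mg /measurable_wrtP mf; apply/measurable_wrtP; exact: measurableT_comp. Qed.

Lemma wrt_sum (I : Type) (s : seq I) (f : I -> O -> R) :
  (forall i, measurable_wrt G (f i)) -> measurable_wrt G (fun w => \sum_(i <- s) f i w).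
Proof.
move=> mf; apply/measurable_wrtP; apply: measurable_sum => i.
exact/measurable_wrtP.
Qed.

Lemma wrt_indic (A : set O) : G A -> measurable_wrt G (\1_A : O -> R).
Proof.
move=> GA; apply/measurable_wrtP; apply: measurable_indic.
by rewrite /measurable /=; exact: sub_sigma_algebra.
Qed.

End measurable_wrt.

Lemma wrtS {dO : measure_display} {O : measurableType dO} dT (T : measurableType dT)
  (G H : set (set O)) (f : O -> T) :
  G `<=` H -> measurable_wrt G f -> measurable_wrt H f.
Proof. by move=> GH mf B mB; exact/GH/mf. Qed.

Lemma wrt_measurable {dO : measure_display} {O : measurableType dO} dT (T : measurableType dT)
  (G : set (set O)) (f : O -> T) :
  G `<=` measurable -> measurable_wrt G f -> measurable_fun setT f.
Proof. by move=> GH mf _ B mB; rewrite setTI; exact/GH/mf. Qed.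

Section martingales.
Context {dO : measure_display} {O : measurableType dO} {R : realType}.
Variables (P : probability O R) (F : R -> set (set O)).
Hypothesis uh : usual_hypotheses P F.

Local Notation leb := (@lebesgue_measure R).
Local Notation Q := (P \x leb)%E.
Implicit Types (I J Z : R -> O -> R) (s t : R) (psi xi : O -> R).

Definition strip s t : set (O * measurableTypeR R) := setT `*` `]s, t].

Lemma measurable_strip s t : measurable (strip s t).
Proof. by apply: measurableX => //. Qed.

Lemma strip_fin s t : (Q (strip s t) < +oo)%E.
Proof.
rewrite product_measure1E//= probability_setT mul1e lebesgue_measure_itv/=.
by case: ifP => _ //; rewrite -EFinB ltry.
Qed.

Lemma in_strip s t (w : O) (r : R) : ((w, r) \in strip s t) = (s < r <= t).
Proof.
apply/idP/idP; first by rewrite inE => -[_] /=; rewrite in_itv.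
by move=> h; rewrite inE; split => //=; rewrite in_itv.
Qed.

Lemma Fsig t : 0 <= t -> sigma_algebra [set: O] (F t).
Proof. exact: (uh_sigma uh). Qed.

Lemma Fmeas t d' (T : measurableType d') (f : O -> T) : 0 <= t -> measurable_wrt (F t) f -> measurable_fun setT f.
Proof. by move=> t0; apply: wrt_measurable; exact: (uh_sub uh). Qed.

Lemma Fmono s t d' (T : measurableType d') (f : O -> T) : 0 <= s -> s <= t ->
  measurable_wrt (F s) f -> measurable_wrt (F t) f.
Proof. by move=> s0 st; apply: wrtS; exact: (uh_mono uh). Qed.

(** Square-integrable martingales without conditional expectations: increments are orthogonal to
    everything known before. The test variables range over L^2 and not only over bounded variables,
    because in [biorth_transform] they contain increments of another martingale. *)
Definition mart I : Prop := [/\ adapted F I,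
  forall t, 0 <= t -> L2 P setT (I t) &
  forall s t psi, 0 <= s -> s <= t -> measurable_wrt (F s) psi -> L2 P setT psi ->
    \int[P]_w (psi w * (I t w - I s w)) = 0].

Definition biorth I J (q : O * measurableTypeR R -> R) : Prop :=
  [/\ measurable_fun setT q, exists M : R, forall z, `|q z| <= M &
  forall s t psi, 0 <= s -> s <= t -> measurable_wrt (F s) psi ->
    (exists M : R, forall w, `|psi w| <= M) ->
    \int[P]_w (psi w * ((I t w - I s w) * (J t w - J s w))) =
    \int[Q]_(z in strip s t) (psi z.1 * q z)].

Let PT : (P setT < +oo)%E. Proof. by rewrite probability_setT ltry. Qed.

Lemma mart_incr I s t : mart I -> 0 <= s -> s <= t -> L2 P setT (fun w => I t w - I s w).
Proof. by move=> [_ mI _] s0 st; apply: L2B => //; apply: mI => //; exact: le_trans st. Qed.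

Lemma mart0 : mart (fun _ _ => 0).
Proof.
split.
- by move=> t t0; apply: wrt_cst; exact: Fsig.
- by move=> t _; apply: (@L2_bnd _ _ _ _ _ _ 0) => // w _; rewrite normr0.
- move=> s t psi _ _ _ _; under eq_Rintegral do rewrite subrr mulr0.
  by rewrite /Rintegral integral0.
Qed.

Lemma martD I J : mart I -> mart J -> mart (fun t w => I t w + J t w).
Proof.
move=> mI mJ; split.
- by move=> t t0; apply: wrtD; [exact: Fsig|case: mI => + _ _; exact|case: mJ => + _ _; exact].
- by move=> t t0; apply: L2D => //; [case: mI => _ + _; exact|case: mJ => _ + _; exact].
- move=> s t psi s0 st mpsi ipsi.
  transitivity (\int[P]_w (psi w * (I t w - I s w) + psi w * (J t w - J s w))).
    by apply: eq_Rintegral => w _; ring.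
  rewrite RintegralDr//; try by apply: L2M => //; exact: mart_incr.
  by case: mI => _ _ ->//; case: mJ => _ _ ->//; rewrite addr0.
Qed.

Lemma martZ I k : mart I -> mart (fun t w => k * I t w).
Proof.
move=> mI; split.
- by move=> t t0; apply: wrtM; [exact: Fsig|by apply: wrt_cst; exact: Fsig|case: mI => aI _ _; exact: aI].
- by move=> t t0; apply: L2Z => //; case: mI => _ + _; exact.
- move=> s t psi s0 st mpsi ipsi.
  transitivity (\int[P]_w (k * (psi w * (I t w - I s w)))).
    by apply: eq_Rintegral => w _; ring.
  rewrite RintegralZl//; last by apply: L2M => //; exact: mart_incr.
  by case: mI => _ _ ->//; rewrite mulr0.
Qed.

Lemma mart_sum (K : Type) (r : seq K) (I : K -> R -> O -> R) :
  (forall k, mart (I k)) -> mart (fun t w => \sum_(k <- r) I k t w).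
Proof.
move=> mI; elim: r => [|k r IH].
  have -> : (fun t w => \sum_(k <- [::]) I k t w) = fun _ _ => 0.
    by apply/funext => t; apply/funext => w; rewrite big_nil.
  exact: mart0.
have -> : (fun t w => \sum_(j <- k :: r) I j t w) = fun t w => I k t w + \sum_(j <- r) I j t w.
  by apply/funext => t; apply/funext => w; rewrite big_cons.
exact: martD.
Qed.

Lemma L1_strip s t (psi : O -> R) (q : O * measurableTypeR R -> R) :
  measurable_fun setT psi -> (exists M : R, forall w, `|psi w| <= M) ->
  measurable_fun setT q -> (exists M : R, forall z, `|q z| <= M) ->
  L1 Q (strip s t) (fun z => psi z.1 * q z).
Proof.
move=> mpsi [M psiM] mq [M' qM'].
apply: (@L1_bnd _ _ _ _ _ _ (M * M')).
- exact: measurable_strip.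
- exact: strip_fin.
- apply: measurable_funTS; apply: measurable_funM => //.
  exact: measurableT_comp.
- by move=> z _; rewrite normrM ler_pM.
Qed.

Lemma L1_biorth I J s t psi : mart I -> mart J -> 0 <= s -> s <= t ->
  measurable_fun setT psi -> (exists M : R, forall w, `|psi w| <= M) ->
  L1 P setT (fun w => psi w * ((I t w - I s w) * (J t w - J s w))).
Proof.
move=> mI mJ s0 st mpsi [M psiM]; apply: (@L1Mb _ _ _ _ _ _ _ M) => //.
by apply: L2M => //; exact: mart_incr.
Qed.

Lemma biorthC I J q : biorth I J q -> biorth J I q.
Proof.
move=> [mq bq H]; split => // s t psi s0 st mpsi bpsi.
by rewrite -H//; apply: eq_Rintegral => w _; ring.
Qed.

Lemma biorth0 J : biorth (fun _ _ => 0) J (fun=> 0).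
Proof.
split => //.
- by exists 0 => z; rewrite normr0.
- move=> s t psi _ _ _ _; under eq_Rintegral do rewrite subrr mul0r mulr0.
  under [RHS]eq_Rintegral do rewrite mulr0.
  by rewrite /Rintegral !integral0.
Qed.

Lemma biorthD I1 I2 J q1 q2 : mart I1 -> mart I2 -> mart J ->
  biorth I1 J q1 -> biorth I2 J q2 ->
  biorth (fun t w => I1 t w + I2 t w) J (fun z => q1 z + q2 z).
Proof.
move=> m1 m2 mJ [mq1 [M1 bq1] H1] [mq2 [M2 bq2] H2]; split.
- exact: measurable_funD.
- by exists (M1 + M2) => z; rewrite (le_trans (ler_normD _ _))// lerD.
- move=> s t psi s0 st mpsi bpsi; have mpsi' := Fmeas s0 mpsi.
  transitivity (\int[P]_w (psi w * ((I1 t w - I1 s w) * (J t w - J s w)) +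
                           psi w * ((I2 t w - I2 s w) * (J t w - J s w)))).
    by apply: eq_Rintegral => w _; ring.
  rewrite RintegralDr//; try exact: L1_biorth.
  rewrite H1// H2// -RintegralDr//.
  + by apply: eq_Rintegral => z _; ring.
  + exact: measurable_strip.
  + by apply: L1_strip => //; exists M1.
  + by apply: L1_strip => //; exists M2.
Qed.

Lemma biorthZ I J q k : mart I -> mart J -> biorth I J q ->
  biorth (fun t w => k * I t w) J (fun z => k * q z).
Proof.
move=> m1 mJ [mq1 [M1 bq1] H1]; split.
- exact: measurable_funM.
- by exists (`|k| * M1) => z; rewrite normrM ler_wpM2l.
- move=> s t psi s0 st mpsi bpsi; have mpsi' := Fmeas s0 mpsi.
  transitivity (\int[P]_w (k * (psi w * ((I t w - I s w) * (J t w - J s w))))).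
    by apply: eq_Rintegral => w _; ring.
  rewrite RintegralZl//; last exact: L1_biorth.
  rewrite H1// -RintegralZl//.
  + by apply: eq_Rintegral => z _; ring.
  + exact: measurable_strip.
  + by apply: L1_strip => //; exists M1.
Qed.

Lemma biorth_sum (K : Type) (r : seq K) (I : K -> R -> O -> R) J q :
  (forall k, mart (I k)) -> mart J -> (forall k, biorth (I k) J (q k)) ->
  biorth (fun t w => \sum_(k <- r) I k t w) J (fun z => \sum_(k <- r) q k z).
Proof.
move=> mI mJ bI; elim: r => [|k r IH].
  have -> : (fun t w => \sum_(k <- [::]) I k t w) = fun _ _ => 0.
    by apply/funext => t; apply/funext => w; rewrite big_nil.
  have -> : (fun z => \sum_(k <- [::]) q k z) = fun _ => 0.
    by apply/funext => t; rewrite big_nil.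
  exact: biorth0.
have -> : (fun t w => \sum_(j <- k :: r) I j t w) = fun t w => I k t w + \sum_(j <- r) I j t w.
  by apply/funext => t; apply/funext => w; rewrite big_cons.
have -> : (fun z => \sum_(j <- k :: r) q j z) = fun z => q k z + \sum_(j <- r) q j z.
  by apply/funext => z; rewrite big_cons.
by apply: biorthD => //; exact: mart_sum.
Qed.

Lemma biorth_sum2 (K L : Type) (r : seq K) (r' : seq L) (I : K -> R -> O -> R)
    (J : L -> R -> O -> R) q :
  (forall k, mart (I k)) -> (forall l, mart (J l)) -> (forall k l, biorth (I k) (J l) (q k l)) ->
  biorth (fun t w => \sum_(k <- r) I k t w) (fun t w => \sum_(l <- r') J l t w)
    (fun z => \sum_(k <- r) \sum_(l <- r') q k l z).
Proof.
move=> mI mJ bIJ; apply: biorth_sum => //; first exact: mart_sum.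
by move=> k; apply: biorthC; apply: biorth_sum => // l; exact: biorthC.
Qed.

Section transform.
Variables (lo hi : R) (xi : O -> R) (Z : R -> O -> R).
Hypotheses (lohi : 0 <= lo <= hi) (mxi : measurable_wrt (F lo) xi).
Hypothesis bxi : exists M : R, forall w, `|xi w| <= M.
Hypothesis mZ : mart Z.

(** The integral of xi 1_(lo, hi] against Z; simple integrals, Brownian or Poisson, are finite sums
    of these. *)
Definition transform t w := xi w * (Z (Num.min hi t) w - Z (Num.min lo t) w).

Let lo0 : 0 <= lo. Proof. by case/andP: lohi. Qed.
Let lh : lo <= hi. Proof. by case/andP: lohi. Qed.

Lemma transform_incr0 s t w : s <= t -> Num.min hi t <= Num.max lo s ->
  transform t w = transform s w.
Proof.
move=> st; rewrite le_max !ge_min /transform.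
case/orP => /orP[h|h].
- have -> : hi = lo by apply/eqP; rewrite eq_le h lh.
  by rewrite !subrr.
- have -> : Num.min lo t = t by exact/min_idPr.
  have -> : Num.min hi t = t by apply/min_idPr; exact: le_trans h lh.
  have -> : Num.min lo s = s by apply/min_idPr; exact: le_trans st h.
  have -> : Num.min hi s = s by apply/min_idPr/(le_trans st)/(le_trans h lh).
  by rewrite !subrr.
- have -> : Num.min hi t = hi by apply/min_idPl; exact: le_trans h st.
  have -> : Num.min hi s = hi by exact/min_idPl.
  have -> : Num.min lo t = lo by apply/min_idPl/(le_trans lh)/(le_trans h st).
  have -> // : Num.min lo s = lo by apply/min_idPl/(le_trans lh h).
- by have -> : t = s by apply/eqP; rewrite eq_le h st.
Qed.

Lemma transform_incr s t w : s <= t -> Num.max lo s < Num.min hi t ->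
  transform t w - transform s w = xi w * (Z (Num.min hi t) w - Z (Num.max lo s) w).
Proof.
move=> st; rewrite gt_max !lt_min /transform => /andP[/andP[_ lt] /andP[sh _]].
have -> : Num.min lo t = lo by apply/min_idPl/ltW.
have -> : Num.min hi s = s by apply/min_idPr/ltW.
by have [ls|sl] := leP lo s; ring.
Qed.

Lemma mart_transform : mart transform.
Proof.
have [aZ lZ eZ] := mZ; have [M xiM] := bxi; have mxi' := Fmeas lo0 mxi.
have hi0 : 0 <= hi by exact: le_trans lh.
split.
- move=> t t0; have [tlo|lot] := leP t lo.
    have -> : transform t = fun=> 0.
      apply/funext => w; rewrite /transform.
      have -> : Num.min lo t = t by exact/min_idPr.
      have -> : Num.min hi t = t by apply/min_idPr/(le_trans tlo).
      by rewrite subrr mulr0.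
    by apply: wrt_cst; exact: Fsig.
  have Ft := Fsig t0.
  apply: (wrtM Ft); first by apply: Fmono mxi => //; exact: ltW.
  apply: (wrtB Ft).
  + by apply: (@Fmono (Num.min hi t)); rewrite ?le_min ?hi0 ?t0// ?ge_min ?lexx ?orbT//;
      apply: aZ; rewrite le_min hi0.
  + by apply: (@Fmono (Num.min lo t)); rewrite ?le_min ?lo0 ?t0// ?ge_min ?lexx ?orbT//;
      apply: aZ; rewrite le_min lo0.
- move=> t t0; apply: (@L2Mb _ _ _ _ _ _ _ M) => //.
  by apply: L2B => //; apply: lZ; rewrite le_min ?hi0 ?lo0.
- move=> s t psi s0 st mpsi ipsi.
  have [h|h] := leP (Num.min hi t) (Num.max lo s).
    under eq_Rintegral do rewrite (transform_incr0 _ st h) subrr mulr0.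
    by rewrite /Rintegral integral0.
  under eq_Rintegral do rewrite (transform_incr _ st h) mulrA.
  apply: (eZ (Num.max lo s) (Num.min hi t)).
  + by rewrite le_max lo0.
  + exact: ltW.
  + apply: (wrtM (Fsig _)); first by rewrite le_max lo0.
    * by apply: Fmono mpsi => //; rewrite le_max lexx orbT.
    * by apply: Fmono mxi => //; rewrite le_max lexx.
  + have -> : (fun w => psi w * xi w) = (fun w => xi w * psi w).
      by apply/funext => w; rewrite mulrC.
    exact: (@L2Mb _ _ _ _ _ _ _ M).
Qed.

(** The transform moves only on (a, b], the intersection of (lo, hi] and (s, t]. The increment of J
    after b is orthogonal to what is known at b, and its increment before a is known at a, where the
    increment of Z is orthogonal to it; only the bracket over (a, b] survives. Using it on each side
    in turn, through [biorthC], gives the bracket of two transforms. *)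
Lemma biorth_transform J q : mart J -> biorth Z J q ->
  biorth transform J (fun z => xi z.1 * \1_(`]lo, hi]) z.2 * q z).
Proof.
move=> mJ [mq [Mq bq] H]; have [M xiM] := bxi; have mxi' := Fmeas lo0 mxi.
have mq' : measurable_fun setT (fun z : O * measurableTypeR R => xi z.1 * \1_(`]lo, hi]) z.2 * q z).
  apply: measurable_funM => //; apply: measurable_funM.
    exact: measurableT_comp.
  have m1 : measurable_fun setT (\1_(`]lo, hi]%classic) : measurableTypeR R -> R).
    exact: measurable_indic.
  exact: (measurableT_comp m1 measurable_snd).
split => //.
  exists (M * Mq) => z; rewrite normrM ler_pM// normrM -[M]mulr1 ler_pM//.
  by rewrite indicE; case: (_ \in _); rewrite ?normr1 ?normr0.
move=> s t psi s0 st mpsi [M' psiM']; have mpsi' := Fmeas s0 mpsi.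
set a := Num.max lo s; set b := Num.min hi t.
have a0 : 0 <= a by rewrite le_max lo0.
have sa : s <= a by rewrite le_max lexx orbT.
have bt : b <= t by rewrite ge_min lexx orbT.
have E : \int[Q]_(z in strip s t) (psi z.1 * (xi z.1 * \1_(`]lo, hi]) z.2 * q z)) =
         \int[Q]_(z in strip a b) (psi z.1 * xi z.1 * q z).
  rewrite Rintegral_mkcond [RHS]Rintegral_mkcond; apply: eq_Rintegral => -[w r] _.
  rewrite !patchE /= !indicE.
  have -> : (r \in (`]lo, hi]%classic : set R)) = (lo < r <= hi).
    by rewrite mem_setE in_itv.
  rewrite !in_strip /a /b gt_max le_min.
  by case: (lo < r); case: (s < r); case: (r <= hi); case: (r <= t);
    rewrite /= ?mulr1 ?mulr0 ?mul0r ?mulr0//; ring.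
rewrite E; have [h|ab] := leP b a.
  under eq_Rintegral do rewrite (transform_incr0 _ st h) subrr mul0r mulr0.
  have -> : strip a b = set0.
    by rewrite /strip set_itv_ge ?setX0// -leNgt bnd_simp.
  by rewrite /Rintegral integral0 integral_set0.
have b0 : 0 <= b by rewrite (le_trans a0)// ltW.
have ab' := ltW ab.
have mpx : measurable_wrt (F a) (fun w => psi w * xi w).
  apply: (wrtM (Fsig a0)); first exact: Fmono mpsi.
  by apply: Fmono mxi => //; rewrite le_max lexx.
have bpx : exists M0 : R, forall w, `|psi w * xi w| <= M0.
  by exists (M' * M) => w; rewrite normrM ler_pM.
have [Mpx pxM] := bpx.
have mpx' := Fmeas a0 mpx.
have [aZ lZ eZ] := mZ; have [aJ lJ eJ] := mJ.
rewrite -(H a b _ a0 ab' mpx bpx).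
have iZ := mart_incr mZ a0 ab'.
have iZ2 : L2 P setT (fun w => psi w * xi w * (Z b w - Z a w)) by exact: (@L2Mb _ _ _ _ _ _ _ Mpx).
have iJ0 := mart_incr mJ s0 sa.
have iJ1 := mart_incr mJ b0 bt.
have iJ2 : L2 P setT (fun w => psi w * xi w * (J a w - J s w)) by exact: (@L2Mb _ _ _ _ _ _ _ Mpx).
transitivity (\int[P]_w ((psi w * xi w * (Z b w - Z a w)) * (J t w - J b w) +
   psi w * xi w * ((Z b w - Z a w) * (J b w - J a w)) +
   (psi w * xi w * (J a w - J s w)) * (Z b w - Z a w))).
  by apply: eq_Rintegral => w _; rewrite (transform_incr _ st ab) -/a -/b; ring.
have i1 : L1 P setT (fun w => (psi w * xi w * (Z b w - Z a w)) * (J t w - J b w)) by exact: L2M.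
have i2 : L1 P setT (fun w => psi w * xi w * ((Z b w - Z a w) * (J b w - J a w))) by exact: L1_biorth.
have i3 : L1 P setT (fun w => (psi w * xi w * (J a w - J s w)) * (Z b w - Z a w)) by exact: L2M.
rewrite RintegralDr//; last exact: L1D.
rewrite RintegralDr// (eJ b t)// ?(eZ a b)// ?add0r ?addr0//.
- apply: (wrtM (Fsig a0)) => //; apply: (wrtB (Fsig a0)); first exact: aJ.
  by apply: (@Fmono s) => //; exact: aJ.
- apply: (wrtM (Fsig b0)); first exact: Fmono mpx.
  apply: (wrtB (Fsig b0)); first exact: aZ.
  by apply: (@Fmono a) => //; exact: aZ.
Qed.

End transform.

End martingales.

(** * Brownian increments *)

Section strip_fubini.
Context {dO : measure_display} {O : measurableType dO} {R : realType}.
Variables (P : probability O R).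
Local Notation leb := (@lebesgue_measure R).
Local Notation Q := (P \x leb)%E.

Lemma ge0_strip_fubini (s t : R) (f : O * measurableTypeR R -> \bar R) :
  measurable_fun setT f -> (forall z, (0 <= f z)%E) ->
  (\int[Q]_(z in strip s t) f z = \int[P]_w \int[leb]_(r in `]s, t]) f (w, r))%E.
Proof.
move=> mf f0.
have mfr : measurable_fun setT (f \_ (strip s t)).
  by apply/(measurable_restrictT f) => //; [exact: measurable_strip|exact: measurable_funTS].
have fr0 z : (0 <= (f \_ (strip s t)) z)%E by apply: erestrict_ge0 => *; exact: f0.
rewrite integral_mkcond (fubini_tonelli1 _ mfr fr0).
apply: eq_integral => w _; rewrite /fubini_F [RHS]integral_mkcond.
apply: eq_integral => r _; rewrite !patchE in_strip.
by rewrite (_ : (r \in _) = (s < r <= t))// mem_setE in_itv.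
Qed.

Lemma strip_fubini (s t : R) (f : O * measurableTypeR R -> R) :
  L1 Q (strip s t) f ->
  \int[Q]_(z in strip s t) f z = \int[P]_w \int[leb]_(r in `]s, t]) f (w, r).
Proof.
move=> /integrable_mkcond => /(_ (measurable_strip _ _)) fi.
rewrite Rintegral_mkcond /Rintegral.
have H := integral12_prod_meas1 fi.
have -> : (\int[Q]_x ((f \_ (strip s t)) x)%:E = \int[Q]_z ((EFin \o f) \_ (strip s t)) z)%E.
  by rewrite restrict_EFin.
rewrite -H; congr fine.
have /ae_integrable1 aei := fi.
apply: ae_eq_integral => //.
- exact: (measurable_fubini_F fi).
- apply/measurable_EFinP; apply: (eq_measurable_fun (fun w => fine (fubini_F leb ((EFin \o f) \_ (strip s t)) w))).
    move=> w _; rewrite /fubini_F; congr fine; rewrite [RHS]integral_mkcond.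
    apply: eq_integral => r _; rewrite !patchE in_strip.
    by rewrite (_ : (r \in _) = (s < r <= t))// mem_setE in_itv.
  by apply: measurableT_comp; [exact: fine_measurable|exact: (measurable_fubini_F fi)].
- apply: filterS aei => w iw _.
  have e : (\int[leb]_(r in `]s, t]) (f (w, r))%:E = fubini_F leb ((EFin \o f) \_ (strip s t)) w)%E.
    rewrite /fubini_F [LHS]integral_mkcond; apply: eq_integral => r _; rewrite !patchE in_strip.
    by rewrite (_ : (r \in _) = (s < r <= t))// mem_setE in_itv.
  rewrite /Rintegral /= -/(Rintegral _ _ _) /Rintegral e fineK//.
  exact: integrable_fin_num.
Qed.

Lemma strip_Rint_cst (s t k : R) (psi : O -> R) : s <= t -> measurable_fun setT psi ->
  (exists M : R, forall w, `|psi w| <= M) ->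
  \int[Q]_(z in strip s t) (psi z.1 * k) = (t - s) * k * \int[P]_w psi w.
Proof.
move=> st mpsi bpsi.
have fi : L1 Q (strip s t) (fun z => psi z.1 * k).
  by apply: L1_strip => //; exists `|k|.
rewrite (strip_fubini fi).
have Pi : L1 P setT psi.
  have PT : (P setT < +oo)%E by rewrite probability_setT ltry.
  by have [M psiM] := bpsi; exact: (@L1_bnd _ _ _ _ _ _ M).
rewrite -RintegralZl//; apply: eq_Rintegral => w _.
rewrite /= Rintegral_cst//= lebesgue_measure_itv/= lte_fin.
have [h|h] := ltP s t; first by rewrite /= ; ring.
have -> : t = s by apply/eqP; rewrite eq_le st h.
by rewrite /=; ring.
Qed.

End strip_fubini.

Section brownian.
Context {dO : measure_display} {O : measurableType dO} {R : realType}.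
Variables (P : probability O R) (F : R -> set (set O)) (d : nat) (W : R -> O -> 'cV[R]_d).
Hypothesis uh : usual_hypotheses P F.
Hypothesis bm : brownian_motion P F W.

Local Notation Wc j := (fun t w => W t w j ord0).

Let PT : (P setT < +oo)%E. Proof. by rewrite probability_setT ltry. Qed.

Let mW t (j : 'I_d) : 0 <= t -> measurable_fun setT (fun w => W t w j ord0).
Proof. by move=> t0; apply: (Fmeas uh t0); exact: (bm_adapted bm). Qed.

Section increment.
Variables (s t : R).
Hypotheses (s0 : 0 <= s) (st : s < t).
Local Notation N := (normal_prob 0 (Num.sqrt (t - s))).
Let dW (j : 'I_d) w := W t w j ord0 - W s w j ord0.

Let t0 : 0 <= t. Proof. exact: le_trans (ltW st). Qed.

Let mdW j : measurable_fun setT (dW j).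
Proof. by apply: measurable_funB; exact: mW. Qed.

Let mdW' j : measurable_fun [set: O] (dW j : O -> measurableTypeR R).
Proof. exact: mdW. Qed.

Let FsT : F s setT.
Proof. have [h1 h2 h3] := Fsig uh s0. by rewrite -(setD0 setT); apply: h2. Qed.

Let bm1 (j : 'I_d) A (B : set R) : F s A -> measurable B ->
  P (A `&` dW j @^-1` B) = (P A * N B)%E.
Proof.
move=> FA mB; pose C (i : 'I_d) := if i == j then B else setT.
have := bm_incr bm s0 st FA (B := C).
rewrite (bigD1 j)//= /C eqxx big1 ?mule1; last first.
  by move=> i /negPf ->; exact: probability_setT.
move=> <-; last by move=> i; case: ifP.
congr (P (A `&` _)); apply/seteqP; split => w /=.
  by move=> h i; case: eqP => [->|].
by move=> /(_ j); rewrite eqxx.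
Qed.

Let bm2 (i j : 'I_d) A (B C : set R) : i != j -> F s A -> measurable B -> measurable C ->
  P (A `&` dW i @^-1` B `&` dW j @^-1` C) = (P A * N B * N C)%E.
Proof.
move=> ij FA mB mC; pose D (k : 'I_d) := if k == i then B else if k == j then C else setT.
have := bm_incr bm s0 st FA (B := D).
have ji : j != i by rewrite eq_sym.
rewrite (bigD1 i)//= (bigD1 j)//= /D !eqxx (negPf ji) big1 ?mule1; last first.
  by move=> k /andP[/negPf -> /negPf ->]; exact: probability_setT.
rewrite muleA => <-; last by move=> k; case: ifP => // _; case: ifP.
congr (P _); apply/seteqP; split => w /=.
  by move=> [[Aw Bw] Cw]; split => // k; case: eqP => [->//|_]; case: eqP => [->|].
by move=> [Aw h]; have := h i; have := h j; rewrite !eqxx (negPf ji).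
Qed.

Let dWE (j : 'I_d) (B : set R) : measurable B -> P (dW j @^-1` B) = N B.
Proof. by move=> mB; have := bm1 j FsT mB; rewrite setTI probability_setT mul1e. Qed.

Let sq : Num.sqrt (t - s) ^+ 2 = t - s.
Proof. by rewrite sqr_sqrtr// subr_ge0 ltW. Qed.

Let sp : 0 < Num.sqrt (t - s).
Proof. by rewrite sqrtr_gt0 subr_gt0. Qed.

Let dW_dist (j : 'I_d) : {mfun O >-> measurableTypeR R} :=
  HB.pack (dW j) (isMeasurableFun.Build _ _ _ _ _ (mdW' j)).

Let distE j (B : set (measurableTypeR R)) : measurable B ->
  distribution P (dW_dist j) B = N B.
Proof. exact: dWE. Qed.

Let dW_sqr j : (\int[P]_w (dW j w ^+ 2)%:E = (t - s)%:E)%E.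
Proof.
have <- : (\int[N]_x (x ^+ 2)%:E = (t - s)%:E)%E by rewrite integral_sqr_normal// sq.
transitivity (\int[distribution P (dW_dist j)]_x (x ^+ 2)%:E)%E.
  rewrite ge0_integral_distribution//.
  - by apply/measurable_EFinP; exact: measurable_funX.
  - by move=> y; rewrite lee_fin sqr_ge0.
by apply: eq_measure_integral => A mA _; exact: distE.
Qed.

Lemma bm_incr_L2 j : L2 P setT (dW j).
Proof.
split => //; apply/integrableP; split; first by apply/measurable_EFinP; exact: measurable_funX.
under eq_integral do rewrite /= ger0_norm ?sqr_ge0//.
by rewrite dW_sqr ltry.
Qed.

Let L1dW j : L1 P setT (dW j). Proof. exact/L2_L1/bm_incr_L2. Qed.

Lemma bm_incr_mean j : \int[P]_w dW j w = 0.
Proof.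
rewrite -(Rintegral_normal sp) /Rintegral; congr fine.
transitivity (\int[distribution P (dW_dist j)]_x x%:E)%E.
  rewrite (integral_distribution (X := dW_dist j) (f := EFin))//; exact: L1dW.
by apply: eq_measure_integral => A mA _; exact: distE.
Qed.

Lemma bm_incr_indep j (psi : O -> R) (g : R -> R) : measurable_wrt (F s) psi -> L1 P setT psi ->
  measurable_fun setT g -> L1 P setT (g \o dW j) ->
  L1 P setT (fun w => psi w * g (dW j w)) /\
  \int[P]_w (psi w * g (dW j w)) = (\int[P]_w psi w) * (\int[P]_w g (dW j w)).
Proof.
move=> mpsi ipsi mg ig.
apply: (@indep_Rint _ _ _ _ _ _ _ _ psi (dW j) id g) => //.
- exact: (Fmeas uh s0).
- by move=> A B mA mB; rewrite bm1 ?dWE//; exact: mpsi.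
Qed.

Lemma bm_incr_cross i j (psi : O -> R) : i != j -> measurable_wrt (F s) psi ->
  (exists M : R, forall w, `|psi w| <= M) ->
  \int[P]_w (psi w * (dW i w * dW j w)) = 0.
Proof.
move=> ij mpsi [M psiM].
have mpsi' := Fmeas uh s0 mpsi.
have mpsiR : measurable_fun [set: O] (psi : O -> measurableTypeR R) by [].
have mX : measurable_fun setT (fun w => (psi w, dW i w) : measurableTypeR R * measurableTypeR R)
  by exact: measurable_fun_pair.
pose X : {mfun O >-> (measurableTypeR R * measurableTypeR R)%type} :=
  HB.pack (fun w => (psi w, dW i w)) (isMeasurableFun.Build _ _ _ _ _ mX).
pose Y : {mfun O >-> measurableTypeR R} :=
  HB.pack psi (isMeasurableFun.Build _ _ _ _ _ mpsiR).
have i2 : L2 P setT (fun w => psi w * dW i w).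
  by apply: (@L2Mb _ _ _ _ _ _ _ M) => //; exact: bm_incr_L2.
have i1 : L1 P setT (fun w => psi w * dW i w) by exact: L2_L1.
have mm : measurable_fun [set: R * R] (fun z : R * R => z.1 * z.2).
  by apply: measurable_funM; [exact: measurable_fst|exact: measurable_snd].
have [_] : L1 P setT (fun w => (psi w * dW i w) * dW j w) /\
  \int[P]_w ((psi w * dW i w) * dW j w) = (\int[P]_w (psi w * dW i w)) * (\int[P]_w dW j w).
  apply: (@indep_Rint _ _ _ _ _ _ _ _ (fun w => (psi w, dW i w)) (dW j)
     (fun z : R * R => z.1 * z.2) id) => //; last exact: L1dW.
  move=> C B mC mB; rewrite dWE//.
  have mBj : measurable (dW j @^-1` B) by rewrite -(setTI (_ @^-1` _)); exact: mdW.
  have NBf : N B \is a fin_num by exact: fin_num_measure.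
  have NB0 : 0 <= fine (N B) by rewrite fine_ge0.
  (* For fixed B both sides are measures in C. On rectangles they are evaluated by [bm2] and [bm1]
     and agree with one product measure, hence they agree on every C. The mass of B is put into [m2]
     to make this a product. *)
  pose m1 := distribution P Y.
  pose m2 := mscale (NngNum NB0) N.
  pose ma := pushforward (mrestr P mBj) X.
  pose mb := mscale (NngNum NB0) (distribution P X).
  have hb A1 A2 : measurable A1 -> measurable A2 -> mb (A1 `*` A2) = (m1 A1 * m2 A2)%E.
    move=> mA1 mA2; rewrite /mb /m2 /mscale /= fineK// /m1 /distribution /pushforward /=.
    rewrite (_ : _ @^-1` (A1 `*` A2) = psi @^-1` A1 `&` dW i @^-1` A2)//.
    rewrite bm1//; last exact: mpsi.
    by rewrite muleCA.
  have ha A1 A2 : measurable A1 -> measurable A2 -> ma (A1 `*` A2) = (m1 A1 * m2 A2)%E.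
    move=> mA1 mA2; rewrite /ma /pushforward /mrestr /m2 /mscale /= fineK// /m1 /distribution /pushforward /=.
    rewrite (_ : _ @^-1` (A1 `*` A2) = psi @^-1` A1 `&` dW i @^-1` A2)//.
    rewrite bm2//; last exact: mpsi.
    by rewrite muleAC -muleA.
  have e1 := product_measure_unique ha mC.
  have e2 := product_measure_unique hb mC.
  transitivity (mb C); last by rewrite /mb /mscale /= fineK// muleC.
  exact: etrans (esym (e1 mX)) e2.
rewrite bm_incr_mean mulr0 => <-.
by apply: eq_Rintegral => w _; rewrite mulrA.
Qed.

Lemma bm_incr_sqr j (psi : O -> R) : measurable_wrt (F s) psi -> L1 P setT psi ->
  \int[P]_w (psi w * dW j w ^+ 2) = (t - s) * \int[P]_w psi w.
Proof.
move=> mpsi ipsi.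
have m2 : measurable_fun setT (fun x : R => x ^+ 2) by exact: measurable_funX.
have [_] := bm_incr_indep mpsi ipsi m2 (bm_incr_L2 j).2.
by move=> ->; rewrite mulrC; congr (_ * _); rewrite /Rintegral dW_sqr.
Qed.

End increment.

Let W0 j : {ae P, forall w, W 0 w j ord0 = 0}.
Proof. by apply: filterS (bm_start bm) => w ->; rewrite mxE. Qed.

Lemma mart_bm j : mart P F (Wc j).
Proof.
have W02 : L2 P setT (Wc j 0).
  apply: (@ae_L2 _ _ _ _ _ (fun=> 0)) => //.
  - exact: mW.
  - by apply: filterS (W0 j) => w ->.
  - by apply: (@L2_bnd _ _ _ _ _ _ 0) => // w _; rewrite normr0.
split.
- by move=> t t0; exact: (bm_adapted bm).
- move=> t; rewrite le_eqVlt => /orP[/eqP <-//|t0].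
  have -> : Wc j t = (fun w => (W t w j ord0 - W 0 w j ord0) + W 0 w j ord0).
    by apply/funext => w; rewrite subrK.
  by apply: L2D => //; exact: bm_incr_L2.
- move=> s t psi s0; rewrite le_eqVlt => /orP[/eqP <-|st] mpsi ipsi.
    under eq_Rintegral do rewrite subrr mulr0.
    by rewrite /Rintegral integral0.
  have mid : measurable_fun setT (@id R) by exact: measurable_id.
  have [_ ->] := bm_incr_indep s0 st (j := j) mpsi (L2_L1 measurableT PT ipsi) mid
    (L2_L1 measurableT PT (bm_incr_L2 s0 st j)).
  by rewrite bm_incr_mean// mulr0.
Qed.

Lemma biorth_bm i j : biorth P F (Wc i) (Wc j) (fun=> (i == j)%:R).
Proof.
split => //; first by exists 1 => _; case: eqP => _; rewrite ?normr1 ?normr0.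
move=> s t psi s0 st mpsi bpsi; have mpsi' := Fmeas uh s0 mpsi.
have ipsi : L1 P setT psi by have [M psiM] := bpsi; exact: (@L1_bnd _ _ _ _ _ _ M).
rewrite strip_Rint_cst//.
move: st; rewrite le_eqVlt => /orP[/eqP <-|st].
  under eq_Rintegral do rewrite subrr mul0r mulr0.
  by rewrite subrr !mul0r /Rintegral integral0.
have [<-|ij] := eqVneq i j.
  by rewrite mulr1 -(bm_incr_sqr s0 st i)//; apply: eq_Rintegral => w _; rewrite expr2.
by rewrite bm_incr_cross// mulr0 mul0r.
Qed.

End brownian.

(** * Compensated Poisson counts *)

Section poisson.
Context {dO : measure_display} {O : measurableType dO} {R : realType}.
Variables (P : probability O R) (F : R -> set (set O)).
Context {dU : measure_display} {U : measurableType dU}.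
Variables (nu : {sigma_finite_measure set U -> \bar R}) (p : O -> R -> option U).
Hypothesis uh : usual_hypotheses P F.
Hypothesis pp : poisson_point_process P F nu p.

Let PT : (P setT < +oo)%E. Proof. by rewrite probability_setT ltry. Qed.

Let pts w (B : set (R * U)) := [set s | 0 < s /\ exists2 u, p w s = Some u & B (s, u)].

(** Only countably many times carry a point, so the set is measurable whatever B is, and additivity
    of the counting measure applies. *)
Let mpts w B : measurable (pts w B : set (measurableTypeR R)).
Proof.
have h : countable (pts w B).
  apply: (@sub_countable _ _ _ [set s | 0 < s /\ p w s <> None]); last exact: (pp_countable pp).
  by apply: subset_card_le => s [s0 [u pu _]]; split => //; rewrite pu.
apply: (@countable_measurable _ (measurableTypeR R) _ _ h) => t; exact: measurable_set1.
Qed.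

(** A time carries a single mark, so disjoint sets of time-mark pairs select disjoint sets of
    times. *)
Lemma NmeasU w (B C : set (R * U)) : B `&` C = set0 ->
  Nmeas p w (B `|` C) = (Nmeas p w B + Nmeas p w C)%E.
Proof.
move=> BC; rewrite /Nmeas -/(pts w B) -/(pts w C).
have -> : [set s | 0 < s /\ exists2 u, p w s = Some u & (B `|` C) (s, u)] = pts w B `|` pts w C.
  apply/seteqP; split => s /=.
    by move=> [s0 [u pu [Bu|Cu]]]; [left|right]; split => //; exists u.
  by move=> [|] [s0 [u pu h]]; split => //; exists u => //; [left|right].
rewrite -[LHS]/((counting : set (measurableTypeR R) -> \bar R) _) measureU//.
rewrite -subset0 => s [[_ [u pu Bu]] [_ [v pv Cv]]].
move: Cv; have -> : v = u by move: pv; rewrite pu => -[->].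
by move=> Cu; have : (B `&` C) (s, u) by []; rewrite BC.
Qed.

Let N s t (A : set U) w := Nmeas p w (`]s, t] `*` A).

Lemma Nmeas_split_time s r t A w : s <= r -> r <= t -> N s t A w = (N s r A w + N r t A w)%E.
Proof.
move=> sr rt; rewrite /N -NmeasU.
  congr Nmeas; apply/seteqP; split => -[x u] /=; rewrite !in_itv/=.
  - move=> [/andP[sx xt] Au]; have [xr|rx] := leP x r; [left|right]; split => //.
      by rewrite sx.
  - by move=> [|] [/andP[h1 h2] Au]; split => //; rewrite ?(lt_le_trans _ h1) ?h1 ?(le_trans h2) ?h2// (le_lt_trans sr h1).
rewrite -subset0 => -[x u] [[/= h1 _] [/= h2 _]]; move: h1 h2; rewrite !in_itv/=.
by move=> /andP[_ xr] /andP[rx _]; move: (lt_le_trans rx xr); rewrite ltxx.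
Qed.

Lemma Nmeas_split_set s t A B w : A `&` B = set0 -> N s t (A `|` B) w = (N s t A w + N s t B w)%E.
Proof.
move=> AB; rewrite /N -NmeasU.
  by congr Nmeas; apply/seteqP; split => -[x u] /=; tauto.
rewrite -subset0 => -[x u] [[/= _ Au] [_ Bu]].
by have : (A `&` B) u by []; rewrite AB.
Qed.

Section increment.
Variables (s t : R) (A : set U).
Hypotheses (s0 : 0 <= s) (st : s <= t) (mA : measurable A) (finA : (nu A < +oo)%E).

Let lam := (t - s) * fine (nu A).

Let nuA : nu A \is a fin_num. Proof. by rewrite ge0_fin_numE. Qed.

Let lam0 : 0 <= lam.
Proof. by rewrite mulr_ge0// ?subr_ge0// fine_ge0. Qed.

Let mB : measurable (`]s, t]%classic `*` A : set (measurableTypeR R * U)).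
Proof. by apply: measurableX. Qed.

Let intE : intensity nu (`]s, t] `*` A) = lam%:E.
Proof.
rewrite /intensity (_ : _ `&` _ = `]s, t]%classic `*` A); last first.
  apply/seteqP; split => -[x u] /=; rewrite !in_itv/= andbT; first by case.
  move=> [/andP[sx xt] Au]; have x0 : 0 <= x := le_trans s0 (ltW sx).
  by rewrite sx xt x0.
rewrite product_measure1E//=.
rewrite lebesgue_measure_itv/= lte_fin /lam.
have [h|h] := ltP s t; first by rewrite EFinM EFinB fineK.
have -> : t = s by apply/eqP; rewrite eq_le st h.
by rewrite subrr mul0r mul0e.
Qed.

Let mN : measurable_fun setT (N s t A).
Proof. exact: (pp_measurable pp). Qed.

Let NE (k : nat) : P [set w | N s t A w = k%:R%:E] = poisson_prob lam 0%N [set k].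
Proof.
by have := pp_law pp mB; rewrite intE ltry => /(_ isT k).
Qed.

Lemma Nmeas_ae_nat : {ae P, forall w, exists k : nat, N s t A w = k%:R%:E}.
Proof. exact: (poisson_ae_nat mN NE). Qed.

Definition compN w := fine (N s t A w) - (t - s) * fine (nu A).

Let L2N := poisson_count_L2 lam0 mN NE.

Lemma compN_L2 : L2 P setT compN.
Proof.
apply: L2B => //; exact: (@L2_bnd _ _ _ _ _ _ `|lam|).
Qed.

Let L1N : L1 P setT (fun w => fine (N s t A w)). Proof. exact: L2_L1. Qed.

Lemma compN_mean : \int[P]_w compN w = 0.
Proof.
rewrite /compN RintegralBr//; last exact: (@L1_bnd _ _ _ _ _ _ `|lam|).
by rewrite (poisson_mean lam0 mN NE) Rintegral_cst//= probability_setT/= mulr1 subrr.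
Qed.

Lemma compN_sqr : \int[P]_w (compN w ^+ 2) = lam.
Proof.
transitivity (\int[P]_w (fine (N s t A w) ^+ 2 - (2 * lam) * fine (N s t A w) + lam ^+ 2)).
  by apply: eq_Rintegral => w _; rewrite /compN -/lam; ring.
have i1 : L1 P setT (fun w => fine (N s t A w) ^+ 2) by exact: L2N.2.
have i2 : L1 P setT (fun w => (2 * lam) * fine (N s t A w)) by exact: L1Z.
have i3 : L1 P setT (fun=> lam ^+ 2) by exact: (@L1_bnd _ _ _ _ _ _ `|lam ^+ 2|).
rewrite RintegralDr//; last exact: L1B.
rewrite RintegralBr// RintegralZl// (poisson_mean lam0 mN NE).
rewrite (poisson_second_moment lam0 mN NE) Rintegral_cst//= probability_setT/=.
by ring.
Qed.

Let N_after (C : set R) : measurable C -> sigma_of_N_after p s ((fun w => fine (N s t A w)) @^-1` C).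
Proof.
move=> mC; apply: sub_sigma_algebra.
exists (`]s, t]%classic `*` A), (fine @^-1` C); split => //.
- by move=> -[x u] [/= + _]; rewrite in_itv/= => /andP[sx _]; split => //=; rewrite in_itv/= sx.
- by rewrite -(setTI (_ @^-1` _)); exact: (fine_measurable measurableT measurableT).
Qed.

Lemma fineN_indep (psi : O -> R) (g : R -> R) : measurable_wrt (F s) psi -> L1 P setT psi ->
  measurable_fun setT g -> L1 P setT (fun w => g (fine (N s t A w))) ->
  L1 P setT (fun w => psi w * g (fine (N s t A w))) /\
  \int[P]_w (psi w * g (fine (N s t A w))) = (\int[P]_w psi w) * (\int[P]_w g (fine (N s t A w))).
Proof.
move=> mpsi ipsi mg ig.
have mid : measurable_fun setT (@id R) by exact: measurable_id.
have mfN : measurable_fun setT (fun w => fine (N s t A w)) by exact: L2N.1.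
apply: (indep_Rint (f := id)) => //.
- exact: (Fmeas uh s0).
- by move=> B C mB' mC; apply: (pp_future pp s0); [exact: mpsi|exact: N_after].
Qed.

Lemma compN_indep (psi : O -> R) : measurable_wrt (F s) psi -> L1 P setT psi ->
  \int[P]_w (psi w * compN w) = 0.
Proof.
move=> mpsi ipsi.
have mg : measurable_fun setT (fun x : R => x - lam) by exact: measurable_funB.
have [_] := fineN_indep mpsi ipsi mg (L2_L1 measurableT PT compN_L2).
by rewrite -[X in _ -> X]/(\int[P]_w (psi w * (fine (N s t A w) - lam)) = 0) => ->;
  rewrite -[X in _ * X]/(\int[P]_w compN w) compN_mean mulr0.
Qed.

Lemma compN_indep_sqr (psi : O -> R) : measurable_wrt (F s) psi -> L1 P setT psi ->
  \int[P]_w (psi w * compN w ^+ 2) = lam * \int[P]_w psi w.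
Proof.
move=> mpsi ipsi.
have mg : measurable_fun setT (fun x : R => (x - lam) ^+ 2).
  by apply: measurable_funX; exact: measurable_funB.
have [_] := fineN_indep mpsi ipsi mg compN_L2.2.
rewrite -[X in _ -> X]/(\int[P]_w (psi w * (fine (N s t A w) - lam) ^+ 2) = lam * \int[P]_w psi w) => ->.
by rewrite -[X in _ * X]/(\int[P]_w (compN w ^+ 2)) compN_sqr mulrC.
Qed.

Lemma Nmeas_indep_mean (psi : O -> R) : measurable_wrt (F s) psi -> L1 P setT psi ->
  L1 P setT (fun w => psi w * fine (N s t A w)) /\
  \int[P]_w (psi w * fine (N s t A w)) = lam * \int[P]_w psi w.
Proof.
move=> mpsi ipsi.
have mid : measurable_fun setT (@id R) by exact: measurable_id.
have [h ->] := fineN_indep mpsi ipsi mid L1N.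
by split => //; rewrite (poisson_mean lam0 mN NE) mulrC.
Qed.

End increment.

Let measure_fin_sub (A B : set U) : measurable A -> measurable B -> A `<=` B -> (nu B < +oo)%E -> (nu A < +oo)%E.
Proof. by move=> mA mB AB; apply: le_lt_trans; apply: le_measure; rewrite ?inE. Qed.

(** Almost surely only, since [fine] is additive on finite counts but not at +oo. *)
Lemma compN_split_time (s r t : R) (A : set U) : 0 <= s -> s <= r -> r <= t -> measurable A -> (nu A < +oo)%E ->
  {ae P, forall w, compN s t A w = compN s r A w + compN r t A w}.
Proof.
move=> s0 sr rt mA fA; have r0 := le_trans s0 sr.
apply: filterS2 (Nmeas_ae_nat s0 sr mA fA) (Nmeas_ae_nat r0 rt mA fA) => w [k Nk] [l Nl].
by rewrite /compN (Nmeas_split_time _ _ sr rt) Nk Nl /=; ring.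
Qed.

Lemma compN_split_set (s t : R) (A B : set U) : 0 <= s -> s <= t -> measurable A -> measurable B ->
  (nu A < +oo)%E -> (nu B < +oo)%E -> A `&` B = set0 ->
  {ae P, forall w, compN s t (A `|` B) w = compN s t A w + compN s t B w}.
Proof.
move=> s0 st mA mB fA fB AB.
apply: filterS2 (Nmeas_ae_nat s0 st mA fA) (Nmeas_ae_nat s0 st mB fB) => w [k Nk] [l Nl].
rewrite /compN (Nmeas_split_set _ _ _ AB) Nk Nl measureU//= fineD ?ge0_fin_numE//.
by rewrite mulrDr; lra.
Qed.

Let bnd (psi : O -> R) s : 0 <= s -> measurable_wrt (F s) psi ->
  (exists M : R, forall w, `|psi w| <= M) -> L1 P setT psi.
Proof. by move=> s0 mpsi [M psiM]; apply: (@L1_bnd _ _ _ _ _ _ M) => //; exact: (Fmeas uh s0). Qed.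

(** Polarization: the conditional variance is linear in nu, so the variance of the count on the
    union is the sum of the two variances, and the cross term must vanish. *)
Let compN_cross_disj (s t : R) (A B : set U) (psi : O -> R) : 0 <= s -> s <= t -> measurable A -> measurable B ->
  (nu A < +oo)%E -> (nu B < +oo)%E -> A `&` B = set0 ->
  measurable_wrt (F s) psi -> (exists M : R, forall w, `|psi w| <= M) ->
  \int[P]_w (psi w * (compN s t A w * compN s t B w)) = 0.
Proof.
move=> s0 st mA mB fA fB AB mpsi bpsi; have ipsi := bnd s0 mpsi bpsi.
have mpsi' := Fmeas uh s0 mpsi; have [M psiM] := bpsi.
have mAB : measurable (A `|` B) by exact: measurableU.
have fAB : (nu (A `|` B) < +oo)%E by rewrite measureU// lte_add_pinfty.
have LA := compN_L2 s0 st mA fA; have LB := compN_L2 s0 st mB fB.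
have LAB := compN_L2 s0 st mAB fAB.
have sq (f : O -> R) : L2 P setT f -> L1 P setT (fun w => psi w * f w ^+ 2).
  by move=> [_ h]; exact: (@L1Mb _ _ _ _ _ _ _ M).
have cr (f g : O -> R) : L2 P setT f -> L2 P setT g -> L1 P setT (fun w => psi w * (f w * g w)).
  by move=> h h'; apply: (@L1Mb _ _ _ _ _ _ _ M) => //; exact: L2M.
have := compN_indep_sqr s0 st mAB fAB mpsi ipsi.
have -> : \int[P]_w (psi w * compN s t (A `|` B) w ^+ 2) =
  \int[P]_w (psi w * compN s t A w ^+ 2 + psi w * compN s t B w ^+ 2 +
     2 * (psi w * (compN s t A w * compN s t B w))).
  apply: ae_eq_Rint => //.
  - by apply: (L1_meas (mu := P)); exact: sq LAB.
  - by apply: (L1_meas (mu := P)); apply: L1D => //; [apply: L1D => //; exact: sq|apply: L1Z => //; exact: cr].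
  - apply: filterS (compN_split_set s0 st mA mB fA fB AB) => w -> _; ring.
rewrite RintegralDr//; [|by apply: L1D => //; exact: sq|by apply: L1Z => //; exact: cr].
rewrite RintegralDr//; [|exact: sq|exact: sq].
rewrite RintegralZl//; last exact: cr.
rewrite !compN_indep_sqr// measureU// fineD ?ge0_fin_numE//.
by lra.
Qed.

(** A and B are cut into A minus B, B minus A and their intersection; among the resulting products
    only the square on the intersection has a nonzero mean. *)
Lemma compN_cross (s t : R) (A B : set U) (psi : O -> R) : 0 <= s -> s <= t -> measurable A -> measurable B ->
  (nu A < +oo)%E -> (nu B < +oo)%E ->
  measurable_wrt (F s) psi -> (exists M : R, forall w, `|psi w| <= M) ->
  \int[P]_w (psi w * (compN s t A w * compN s t B w)) =
  (t - s) * fine (nu (A `&` B)) * \int[P]_w psi w.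
Proof.
move=> s0 st mA mB fA fB mpsi bpsi; have ipsi := bnd s0 mpsi bpsi.
have mpsi' := Fmeas uh s0 mpsi; have [M psiM] := bpsi.
pose C := A `&` B; pose A' := A `\` B; pose B' := B `\` A.
have mC : measurable C by exact: measurableI.
have mA' : measurable A' by exact: measurableD.
have mB' : measurable B' by exact: measurableD.
have fC : (nu C < +oo)%E by apply: measure_fin_sub fA => //; exact: subIsetl.
have fA' : (nu A' < +oo)%E by apply: measure_fin_sub fA => //; exact: subDsetl.
have fB' : (nu B' < +oo)%E by apply: measure_fin_sub fB => //; exact: subDsetl.
have AE : A = A' `|` C by rewrite /A' /C setUC setUIDK.
have BE : B = B' `|` C by rewrite /B' /C setIC setUC setUIDK.
have dA : A' `&` C = set0 by rewrite /A' /C -subset0 => x [[_ nB] [_ Bx]].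
have dB : B' `&` C = set0 by rewrite /B' /C -subset0 => x [[_ nA] [Ax _]].
have dAB : A' `&` B' = set0 by rewrite /A' /B' -subset0 => x [[Ax _] [_ nA]].
have dC : C `&` B' = set0 by rewrite setIC.
have LC := compN_L2 s0 st mC fC; have LA' := compN_L2 s0 st mA' fA'.
have LB' := compN_L2 s0 st mB' fB'.
have cr (f g : O -> R) : L2 P setT f -> L2 P setT g -> L1 P setT (fun w => psi w * (f w * g w)).
  by move=> h h'; apply: (@L1Mb _ _ _ _ _ _ _ M) => //; exact: L2M.
have sqC : L1 P setT (fun w => psi w * compN s t C w ^+ 2).
  by apply: (@L1Mb _ _ _ _ _ _ _ M) => //; exact: LC.2.
have hA : {ae P, forall w, compN s t A w = compN s t A' w + compN s t C w}.
  by have := compN_split_set s0 st mA' mC fA' fC dA; rewrite -AE.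
have hB : {ae P, forall w, compN s t B w = compN s t B' w + compN s t C w}.
  by have := compN_split_set s0 st mB' mC fB' fC dB; rewrite -BE.
transitivity (\int[P]_w (psi w * (compN s t A' w * compN s t B' w) +
   psi w * (compN s t A' w * compN s t C w) +
   (psi w * (compN s t C w * compN s t B' w) + psi w * compN s t C w ^+ 2))).
  apply: ae_eq_Rint => //.
  - by apply: (L1_meas (mu := P)); apply: cr; exact: compN_L2.
  - by apply: (L1_meas (mu := P)); apply: L1D => //; apply: L1D => //; exact: cr.
  - by apply: filterS2 hA hB => w -> -> _; ring.
rewrite RintegralDr//; [|by apply: L1D => //; exact: cr|by apply: L1D => //; exact: cr].
rewrite RintegralDr//; [|exact: cr|exact: cr].
rewrite RintegralDr//; [|exact: cr].
rewrite (compN_indep_sqr s0 st mC fC mpsi ipsi) !compN_cross_disj//.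
by rewrite !add0r.
Qed.

Definition compZ (A : set U) t w := compN 0 t A w.

Lemma compZ_incr (s t : R) (A : set U) : 0 <= s -> s <= t -> measurable A -> (nu A < +oo)%E ->
  {ae P, forall w, compZ A t w - compZ A s w = compN s t A w}.
Proof.
move=> s0 st mA fA; apply: filterS (compN_split_time (lexx 0) s0 st mA fA) => w.
by rewrite /compZ => ->; ring.
Qed.

Lemma mart_compZ A : measurable A -> (nu A < +oo)%E -> mart P F (compZ A).
Proof.
move=> mA fA; split.
- move=> t t0; have Ft := Fsig uh t0.
  apply: (wrtB Ft); last exact: (wrt_cst Ft).
  move=> B mB; rewrite -[_ @^-1` B]/((fun w => N 0 t A w) @^-1` (fine @^-1` B)).
  apply: (pp_adapted pp t0 mA).
  by rewrite -(setTI (_ @^-1` _)); exact: (fine_measurable measurableT measurableT).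
- by move=> t t0; exact: compN_L2.
- move=> s t psi s0 st mpsi ipsi.
  rewrite -(compN_indep s0 st mA fA mpsi (L2_L1 measurableT PT ipsi)).
  have t0 := le_trans s0 st.
  apply: ae_eq_Rint => //.
  + apply: (L1_meas (mu := P)); apply: L2M => //; apply: L2B => //; exact: compN_L2.
  + by apply: (L1_meas (mu := P)); apply: L2M => //; exact: compN_L2.
  + by apply: filterS (compZ_incr s0 st mA fA) => w ->.
Qed.

Lemma biorth_compZ A B : measurable A -> (nu A < +oo)%E -> measurable B -> (nu B < +oo)%E ->
  biorth P F (compZ A) (compZ B) (fun=> fine (nu (A `&` B))).
Proof.
move=> mA fA mB fB; split => //; first by exists `|fine (nu (A `&` B))|.
move=> s t psi s0 st mpsi bpsi; have mpsi' := Fmeas uh s0 mpsi; have t0 := le_trans s0 st.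
have ipsi := bnd s0 mpsi bpsi; have [M psiM] := bpsi.
have cr (f g : O -> R) : L2 P setT f -> L2 P setT g -> L1 P setT (fun w => psi w * (f w * g w)).
  by move=> h h'; apply: (@L1Mb _ _ _ _ _ _ _ M) => //; exact: L2M.
rewrite strip_Rint_cst// -compN_cross//.
apply: ae_eq_Rint => //.
- by apply: (L1_meas (mu := P)); apply: cr; apply: L2B => //; exact: compN_L2.
- by apply: (L1_meas (mu := P)); apply: cr; exact: compN_L2.
- by apply: filterS2 (compZ_incr s0 st mA fA) (compZ_incr s0 st mB fB) => w -> ->.
Qed.

End poisson.

(** * Ito integrals *)

Lemma ereal_cvg0_le (R : realType) (u : nat -> \bar R) (e : R) :
  u @ \oo --> 0%E -> 0 < e -> (forall k, 0 <= u k)%E ->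
  \forall k \near \oo, (u k <= e%:E)%E.
Proof.
move=> /fine_cvgP[fu cu] e0 u0.
have := cvgr0_norm_le _ cu _ e0.
move=> h; near=> k.
have fk : u k \is a fin_num by near: k.
rewrite -(fineK fk) lee_fin (le_trans (ler_norm _))//.
by near: k; exact: h.
Unshelve. all: by end_near. Qed.

(** Young's inequality for x = y + (x - y). The coefficient of y^2 can be brought as close to 1 as
    desired, which keeps the isometry sharp under approximation. *)
Lemma sqr_eta (R : realType) (eta x y : R) : 0 < eta ->
  x ^+ 2 <= (1 + eta) * y ^+ 2 + (1 + eta^-1) * (x - y) ^+ 2.
Proof.
move=> e0; have i0 : 0 < eta^-1 by rewrite invr_gt0.
have ei : eta * eta^-1 = 1 by rewrite divff// gt_eqF.
have : 0 <= eta * (y - eta^-1 * (x - y)) ^+ 2 by rewrite mulr_ge0 ?sqr_ge0// ltW.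
have -> : eta * (y - eta^-1 * (x - y)) ^+ 2 =
  eta * y ^+ 2 - 2 * (eta * eta^-1) * y * (x - y) + (eta * eta^-1) * eta^-1 * (x - y) ^+ 2 by ring.
rewrite ei; nra.
Qed.

(** The constant is crude; it only multiplies approximation errors that tend to 0. *)
Lemma sqr_sum_le (R : realType) (I : Type) (r : seq I) (a : I -> R) :
  (\sum_(i <- r) a i) ^+ 2 <= 2 ^+ size r * \sum_(i <- r) a i ^+ 2.
Proof.
elim: r => [|i r IH]; first by rewrite !big_nil expr0n mulr0.
rewrite !big_cons /= [2 ^+ _]exprS; set S := \sum_(_ <- r) _; set T := \sum_(_ <- r) _.
have T0 : 0 <= T by apply: sumr_ge0 => *; exact: sqr_ge0.
have p1 : 1 <= 2 ^+ size r :> R by rewrite exprn_ege1// ler1n.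
move: IH; rewrite -/S -/T; move: (2 ^+ size r) p1 => q q1 IH.
have : 0 <= (q - 1) * a i ^+ 2 by rewrite mulr_ge0 ?sqr_ge0// subr_ge0.
have := sqr_ge0 (a i - S) => h1 h2.
have -> : (a i + S) ^+ 2 = 2 * a i ^+ 2 + 2 * S ^+ 2 - (a i - S) ^+ 2 by ring.
have -> : 2 * q * (a i ^+ 2 + T) = 2 * (q * a i ^+ 2) + 2 * (q * T) by ring.
lra.
Qed.

(** Turns smallness in L^2 into smallness in L^1 with a free parameter, in place of the
    Cauchy-Schwarz inequality for integrals. *)
Lemma norm_le_sqr (R : realType) (th x : R) : 0 < th -> `|x| <= th + th^-1 * x ^+ 2.
Proof.
move=> t0; rewrite -[x ^+ 2]real_normK ?num_real//; move: (`|x|) => y.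
have k0 : 0 < th^-1 by rewrite invr_gt0.
have e : th * th^-1 = 1 by rewrite divff// gt_eqF.
move: (th^-1) k0 e => k k0 e.
have : 0 <= k * (y - th) ^+ 2 by rewrite mulr_ge0 ?sqr_ge0// ltW.
have -> : k * (y - th) ^+ 2 = k * y ^+ 2 - 2 * (th * k) * y + (th * k) * th by ring.
have : 0 <= k * y ^+ 2 by rewrite mulr_ge0 ?sqr_ge0// ltW.
by rewrite e; lra.
Qed.

Section ito.
Context {dO : measure_display} {O : measurableType dO} {R : realType}.
Variables (P : probability O R) (F : R -> set (set O)) (d : nat) (W : R -> O -> 'cV[R]_d).
Hypothesis uh : usual_hypotheses P F.
Hypothesis bm : brownian_motion P F W.
Local Notation leb := (@lebesgue_measure R).
Local Notation Q := (P \x leb)%E.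
Local Notation Wc j := (fun t w => W t w j ord0).

Let PT : (P setT < +oo)%E. Proof. by rewrite probability_setT ltry. Qed.

Definition sp_fun (H : simple_process F) (z : O * measurableTypeR R) : R := sp_eval H z.2 z.1.

Lemma sp_funE (H : simple_process F) z :
  sp_fun H z = \sum_(i < sp_size H) sp_xi i z.1 * \1_(`]sp_lo i, sp_hi i]%classic) z.2.
Proof. by []. Qed.

Let lo0 (H : simple_process F) (i : 'I_(sp_size H)) : 0 <= sp_lo i.
Proof. by case/andP: (sp_ord i). Qed.

Let bxi (H : simple_process F) (i : 'I_(sp_size H)) : exists M : R, forall w, `|sp_xi i w| <= M.
Proof. by have [M h] := sp_bounded H; exists M. Qed.

Lemma measurable_sp_fun H : measurable_fun setT (sp_fun H).
Proof.
rewrite /sp_fun /sp_eval; apply: measurable_sum => i; apply: measurable_funM.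
  apply: measurableT_comp => //; exact: (Fmeas uh (lo0 i) (@sp_meas _ _ _ H i)).
have m1 : measurable_fun setT (\1_(`]sp_lo i, sp_hi i]%classic) : measurableTypeR R -> R).
  exact: measurable_indic.
exact: (measurableT_comp m1 measurable_snd).
Qed.

Lemma bounded_sp_fun H : exists M : R, forall z, `|sp_fun H z| <= M.
Proof.
have [M h] := sp_bounded H; exists (\sum_(i < sp_size H) M) => z.
rewrite /sp_fun /sp_eval (le_trans (ler_norm_sum _ _ _))//; apply: ler_sum => i _.
rewrite normrM -[M]mulr1 ler_pM//.
by rewrite indicE; case: (_ \in _); rewrite ?normr1 ?normr0.
Qed.

Section simple.
Variables (j : 'I_d).
Lemma mart_sp (H : simple_process F) : mart P F (sp_integral H (Wc j)).
Proof.
apply: (mart_sum uh) => i.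
exact: (mart_transform uh (@sp_ord _ _ _ H i) (@sp_meas _ _ _ H i) (bxi i) (mart_bm uh bm j)).
Qed.
End simple.

Lemma biorth_sp i j (H H' : simple_process F) :
  biorth P F (sp_integral H (Wc i)) (sp_integral H' (Wc j)) (fun z => (i == j)%:R * (sp_fun H z * sp_fun H' z)).
Proof.
have mt k (G : simple_process F) (l : 'I_(sp_size G)) :
    mart P F (transform (sp_lo l) (sp_hi l) (sp_xi l) (Wc k)).
  exact: (mart_transform uh (@sp_ord _ _ _ G l) (@sp_meas _ _ _ G l) (bxi l) (mart_bm uh bm k)).
have -> : (fun z => (i == j)%:R * (sp_fun H z * sp_fun H' z)) =
  (fun z => \sum_(k < sp_size H) \sum_(l < sp_size H')
     (sp_xi l z.1 * \1_(`]sp_lo l, sp_hi l]%classic) z.2 * (sp_xi k z.1 * \1_(`]sp_lo k, sp_hi k]%classic) z.2 * (i == j)%:R))).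
  apply/funext => z; rewrite !sp_funE big_distrlr /= mulr_sumr; apply: eq_bigr => k _.
  by rewrite mulr_sumr; apply: eq_bigr => l _; ring.
apply: (biorth_sum2 uh) => [k|l|k l]; [exact: mt|exact: mt|].
apply: biorthC.
apply: (biorth_transform uh (@sp_ord _ _ _ H' l) (@sp_meas _ _ _ H' l) (bxi l) (mart_bm uh bm j) (mt _ _ _)).
apply: biorthC.
apply: (biorth_transform uh (@sp_ord _ _ _ H k) (@sp_meas _ _ _ H k) (bxi k) (mart_bm uh bm i) (mart_bm uh bm j)).
exact: biorth_bm.
Qed.

Section approx.
Variables (j : 'I_d) (h : R -> O -> R) (I : R -> O -> R).
Hypothesis hI : is_ito_integral P F (Wc j) h I.
Hypothesis mh : measurable_fun [set: O * measurableTypeR R] (fun z => h z.2 z.1).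

Let mI t : 0 <= t -> measurable_fun setT (I t).
Proof. by move=> t0; apply: (Fmeas uh t0); case: hI => + _ _; apply. Qed.

(** The errors at s, at t and in the integrand tend to 0 along the same sequence, so one index makes
    all three small at once. *)
Lemma ito_approx (s t e : R) : 0 <= s -> s <= t -> 0 < e ->
  exists H : simple_process F,
  [/\ L2 P setT (fun w => sp_integral H (Wc j) s w - I s w) /\
        \int[P]_w ((sp_integral H (Wc j) s w - I s w) ^+ 2) <= e,
      L2 P setT (fun w => sp_integral H (Wc j) t w - I t w) /\
        \int[P]_w ((sp_integral H (Wc j) t w - I t w) ^+ 2) <= e &
      L2 Q (strip s t) (fun z => sp_fun H z - h z.2 z.1) /\
      \int[Q]_(z in strip s t) ((sp_fun H z - h z.2 z.1) ^+ 2) <= e].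
Proof.
move=> s0 st e0; have t0 := le_trans s0 st.
have [aI cI [H HI]] := hI.
have [_ hs] := HI s s0; have [ht1 ht2] := HI t t0.
have fs : \forall k \near \oo, (\int[P]_w ((sp_integral (H k) (Wc j) s w - I s w) ^+ 2)%:E <= e%:E)%E.
  by apply: (ereal_cvg0_le hs e0) => k; apply: integral_ge0 => w _; rewrite lee_fin sqr_ge0.
have ft : \forall k \near \oo, (\int[P]_w ((sp_integral (H k) (Wc j) t w - I t w) ^+ 2)%:E <= e%:E)%E.
  by apply: (ereal_cvg0_le ht2 e0) => k; apply: integral_ge0 => w _; rewrite lee_fin sqr_ge0.
have fh : \forall k \near \oo, (\int[P]_w \int[lebesgue_measure]_(r in `]0%R, t])
           ((sp_eval (H k) r w - h r w) ^+ 2)%:E <= e%:E)%E.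
  apply: (ereal_cvg0_le ht1 e0) => k; apply: integral_ge0 => w _; apply: integral_ge0 => r _.
  by rewrite lee_fin sqr_ge0.
have [k [[k1 k2] k3]] := filter_ex (filterI (filterI fs ft) fh).
have aux (f : O -> R) : measurable_fun setT f ->
    (\int[P]_w (f w ^+ 2)%:E <= e%:E)%E -> L2 P setT f /\ \int[P]_w (f w ^+ 2) <= e.
  move=> mf fe; have l2 : L2 P setT f.
    split => //; apply/integrableP; split; first by apply/measurable_EFinP; exact: measurable_funX.
    under eq_integral do rewrite /= ger0_norm ?sqr_ge0//.
    by rewrite (le_lt_trans fe)// ltry.
  by split => //; rewrite -lee_fin RintegralE//; exact: l2.2.
exists (H k); split.
- apply: aux => //; apply: measurable_funB; last exact: mI.
  by have [_ h' _] := mart_sp j (H k); case: (h' s s0).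
- apply: aux => //; apply: measurable_funB; last exact: mI.
  by have [_ h' _] := mart_sp j (H k); case: (h' t t0).
- have md : measurable_fun setT (fun z => sp_fun (H k) z - h z.2 z.1).
    by apply: measurable_funB => //; exact: measurable_sp_fun.
  have md2 : measurable_fun setT (fun z => ((sp_fun (H k) z - h z.2 z.1) ^+ 2)%:E).
    by apply/measurable_EFinP; exact: measurable_funX.
  have le1 : (\int[Q]_(z in strip s t) ((sp_fun (H k) z - h z.2 z.1) ^+ 2)%:E <= e%:E)%E.
    apply: le_trans k3.
    rewrite -[leRHS](@ge0_strip_fubini _ _ _ P 0 t (fun z => ((sp_fun (H k) z - h z.2 z.1) ^+ 2)%:E))//; last first.
      by move=> z; rewrite lee_fin sqr_ge0.
    apply: ge0_subset_integral => //; try exact: measurable_strip.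
    + exact: measurable_funTS.
    + by move=> z _; rewrite lee_fin sqr_ge0.
    + by move=> [w r] [_ /=]; rewrite in_itv/= => /andP[sr rt]; split => //=; rewrite in_itv/= rt (le_lt_trans s0).
  have l2 : L2 Q (strip s t) (fun z => sp_fun (H k) z - h z.2 z.1).
    split; first exact: measurable_funTS.
    apply/integrableP; split; first exact: measurable_funTS.
    under eq_integral do rewrite /= ger0_norm ?sqr_ge0//.
    by rewrite (le_lt_trans le1)// ltry.
  split => //; rewrite -lee_fin RintegralE//; [exact: measurable_strip|exact: l2.2].
Qed.

Lemma ito_L2 t : 0 <= t -> L2 P setT (I t).
Proof.
move=> t0; have [H [_ [h2 _] _]] := ito_approx t0 (lexx t) ltr01.
have [_ l2 _] := mart_sp j H.
have -> : I t = (fun w => sp_integral H (Wc j) t w - (sp_integral H (Wc j) t w - I t w)).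
  by apply/funext => w; ring.
by apply: L2B => //; exact: l2.
Qed.

End approx.

Lemma ito_incr_mean (j : 'I_d) (h : R -> O -> R) (I : R -> O -> R) (s t : R) (psi : O -> R) :
  is_ito_integral P F (Wc j) h I ->
  measurable_fun [set: O * measurableTypeR R] (fun z => h z.2 z.1) ->
  0 <= s -> s <= t -> measurable_wrt (F s) psi -> (exists M : R, forall w, `|psi w| <= M) ->
  \int[P]_w (psi w * (I t w - I s w)) = 0.
Proof.
move=> hI mh s0 st mpsi [M0 psiM0]; have t0 := le_trans s0 st.
have [M Mp psiM] : exists2 M : R, 0 < M & forall w, `|psi w| <= M.
  exists (`|M0| + 1); first by rewrite ltr_pwDr.
  by move=> w; rewrite (le_trans (psiM0 w))// (le_trans (ler_norm _))// lerDl.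
have mpsi' := Fmeas uh s0 mpsi.
have lI := ito_L2 hI mh s0; have lt := ito_L2 hI mh t0.
have lpsi : L2 P setT psi by exact: (@L2_bnd _ _ _ _ _ _ M).
apply/eqP; rewrite -normr_le0.
apply/ler_addgt0Pr => e e0; rewrite add0r.
(* With both endpoint errors at most th^2 / 4 the square of X integrates to at most th^2, and the
   final bound M (th + th^-1 th^2) = 2 M th is e. *)
have [th thE th0] : exists2 th, th = e / (2 * M) & 0 < th.
  by exists (e / (2 * M)) => //; rewrite divr_gt0// mulr_gt0.
have th2 : 0 < th ^+ 2 / 4 by rewrite divr_gt0// exprn_gt0.
have [H [[a1 a2] [b1 b2] _]] := ito_approx hI mh s0 st th2.
have mH := mart_sp j H; have [_ lH eH] := mH.
pose X w := (sp_integral H (Wc j) t w - I t w) - (sp_integral H (Wc j) s w - I s w).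
have lX : L2 P setT X by exact: L2B.
have -> : \int[P]_w (psi w * (I t w - I s w)) = - \int[P]_w (psi w * X w).
  rewrite -[LHS]opprK; congr (- _); rewrite -[LHS]sub0r -(eH s t psi s0 st mpsi lpsi).
  rewrite -RintegralBr//.
  - by apply: eq_Rintegral => w _; rewrite /X; ring.
  - by apply: L2M => //; exact: (mart_incr mH).
  - by apply: L2M => //; exact: L2B.
rewrite normrN.
have i2 : L1 P setT (fun w => th^-1 * X w ^+ 2) by apply: L1Z => //; exact: lX.2.
have ith : L1 P setT (fun=> th) by exact: (@L1_bnd _ _ _ _ _ _ `|th|).
have bnd w : [set: O] w -> `|psi w * X w| <= M * (th + th^-1 * X w ^+ 2).
  by move=> _; rewrite normrM ler_pM// norm_le_sqr.
have iM := L1Z M measurableT (L1D measurableT ith i2).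
apply: le_trans (le_norm_Rint measurableT (L2M measurableT lpsi lX) iM bnd) _.
  rewrite RintegralZl//; last exact: L1D.
  rewrite RintegralDr// RintegralZl//; last exact: lX.2.
  rewrite Rintegral_cst//= probability_setT /= mulr1.
  have XE : \int[P]_w (X w ^+ 2) <= th ^+ 2.
    apply: (@le_trans _ _ (\int[P]_w (2 * (sp_integral H (Wc j) t w - I t w) ^+ 2 + 2 * (sp_integral H (Wc j) s w - I s w) ^+ 2))).
      apply: ler_Rint => //; first exact: lX.2.
      - by apply: L1D => //; apply: L1Z => //; [exact: b1.2|exact: a1.2].
      - move=> w _; rewrite /X; set u := sp_integral H _ t w - _; set v := sp_integral H _ s w - _.
        have := sqr_ge0 (u + v); nra.
    rewrite RintegralDr//; [|by apply: L1Z => //; exact: b1.2|by apply: L1Z => //; exact: a1.2].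
    rewrite !RintegralZl//; [|exact: a1.2|exact: b1.2].
    lra.
  have -> : e = M * (th + th^-1 * th ^+ 2).
    rewrite expr2 mulKf ?gt_eqF// thE; have M0' : M != 0 by rewrite gt_eqF.
    by field.
  by rewrite ler_wpM2l ?(ltW Mp)// lerD2l ler_wpM2l// invr_ge0 ltW.
Qed.

(** For simple integrands the bracket gives equality, with the cross terms between different
    Brownian coordinates absent. Passing from the integrals to simple ones, and from the simple
    integrands back to h1 - h2, costs one use of [sqr_eta] each, hence a factor (1 + eta)^2 and an
    error proportional to e. The error e goes to 0 first, at fixed eta, and then eta. *)
Lemma ito_incr_sqr (h1 h2 I1 I2 : 'I_d -> R -> O -> R) (s t : R) (phi : O -> R) (M : R) :
  (forall j, is_ito_integral P F (Wc j) (h1 j) (I1 j)) ->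
  (forall j, is_ito_integral P F (Wc j) (h2 j) (I2 j)) ->
  (forall j, measurable_fun [set: O * measurableTypeR R] (fun z => h1 j z.2 z.1)) ->
  (forall j, measurable_fun [set: O * measurableTypeR R] (fun z => h2 j z.2 z.1)) ->
  (forall j, L2 Q (strip s t) (fun z => h1 j z.2 z.1)) ->
  (forall j, L2 Q (strip s t) (fun z => h2 j z.2 z.1)) ->
  0 <= s -> s <= t -> measurable_wrt (F s) phi -> (forall w, 0 <= phi w <= M) ->
  \int[P]_w (phi w * (\sum_(j < d) ((I1 j t w - I2 j t w) - (I1 j s w - I2 j s w))) ^+ 2) <=
  \int[Q]_(z in strip s t) (phi z.1 * \sum_(j < d) (h1 j z.2 z.1 - h2 j z.2 z.1) ^+ 2).
Proof.
move=> hI1 hI2 mh1 mh2 lh1 lh2 s0 st mphi phiM; have t0 := le_trans s0 st.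
have mphi' := Fmeas uh s0 mphi; have ms := @measurable_strip _ O R s t.
have phin w : `|phi w| <= M by have /andP[p0 pM] := phiM w; rewrite ger0_norm.
have M0 : 0 <= M by have /andP[p0 pM] := phiM point; exact: le_trans pM.
have mphiQ : measurable_fun (strip s t) (fun z => phi z.1).
  by apply: measurable_funTS; exact: measurableT_comp.
pose Y w := \sum_(j < d) ((I1 j t w - I2 j t w) - (I1 j s w - I2 j s w)).
pose hz j (z : O * measurableTypeR R) := h1 j z.2 z.1 - h2 j z.2 z.1.
have lI r j : 0 <= r -> L2 P setT (fun w => I1 j r w - I2 j r w).
  by move=> r0; apply: L2B => //; [exact: (ito_L2 (hI1 j))|exact: (ito_L2 (hI2 j))].
have lY : L2 P setT Y by apply: L2_sum => // j; apply: L2B => //; exact: lI.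
have lhz j : L2 Q (strip s t) (hz j) by exact: L2B.
pose X := \int[Q]_(z in strip s t) (phi z.1 * \sum_(j < d) hz j z ^+ 2).
have phiL1 (f : O * measurableTypeR R -> R) : L1 Q (strip s t) f -> L1 Q (strip s t) (fun z => phi z.1 * f z).
  by move=> fi; apply: (@L1Mb _ _ _ _ _ _ _ M).
have phiP (f : O -> R) : L1 P setT f -> L1 P setT (fun w => phi w * f w).
  by move=> fi; apply: (@L1Mb _ _ _ _ _ _ _ M).
have iX : L1 Q (strip s t) (fun z => \sum_(j < d) hz j z ^+ 2).
  by apply: L1_sum => // j; exact: (lhz j).2.
have X0 : 0 <= X.
  apply: Rintegral_ge0 => z _; rewrite mulr_ge0//; first by case/andP: (phiM z.1).
  by apply: sumr_ge0 => j _; exact: sqr_ge0.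
(* 2^d comes from squaring a sum over d coordinates; each coordinate has four endpoint errors, each
   at most e and with weight 4. *)
pose Cd : R := 2 ^+ size (index_enum 'I_d) * (d%:R * 16).
have Cd0 : 0 <= Cd by rewrite mulr_ge0// ?exprn_ge0// mulr_ge0.
suff main (eta e : R) : 0 < eta -> 0 < e ->
  \int[P]_w (phi w * Y w ^+ 2) <= (1 + eta) * ((1 + eta) * X + (1 + eta^-1) * (M * (d%:R * 4) * e)) +
    (1 + eta^-1) * (M * Cd * e).
  have main2 (eta : R) : 0 < eta -> \int[P]_w (phi w * Y w ^+ 2) <= (1 + eta) * ((1 + eta) * X).
    move=> eta0; apply/ler_addgt0Pr => e e0.
    have i0 : 0 < eta^-1 by rewrite invr_gt0.
    pose B := (1 + eta) * ((1 + eta^-1) * (M * (d%:R * 4))) + (1 + eta^-1) * (M * Cd).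
    have B0 : 0 <= B by rewrite addr_ge0// !mulr_ge0// ?addr_ge0// ltW.
    have B1 : 0 < B + 1 by rewrite ltr_wpDl.
    have := main eta (e / (B + 1)) eta0 (divr_gt0 e0 B1).
    move=> /le_trans; apply.
    have -> : (1 + eta) * ((1 + eta) * X + (1 + eta^-1) * (M * (d%:R * 4) * (e / (B + 1)))) +
      (1 + eta^-1) * (M * Cd * (e / (B + 1))) = (1 + eta) * ((1 + eta) * X) + B * (e / (B + 1)).
      by rewrite /B; ring.
    by rewrite lerD2l mulrCA ler_piMr// ?(ltW e0)// ler_pdivrMr// mul1r lerDl.
  apply/ler_addgt0Pr => e e0; rewrite -/X.
  (* For eta <= 1 one has (1 + eta)^2 <= 1 + 3 eta, so the surplus is at most 3 eta X <= e. *)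
  pose eta := Num.min 1 (e / (3 * X + 1)).
  have X1 : 0 < 3 * X + 1 by rewrite ltr_wpDl// mulr_ge0.
  have eta0 : 0 < eta by rewrite lt_min ltr01 divr_gt0.
  have eta1 : eta <= 1 by rewrite ge_min lexx.
  have etae : eta * (3 * X + 1) <= e by rewrite -ler_pdivlMr// ge_min lexx orbT.
  by have := main2 eta eta0; nra.
move=> eta0 e0; have i0 : 0 < eta^-1 by rewrite invr_gt0.
have /choice[H1 H1P] : forall j, exists H : simple_process F, _ := fun j => ito_approx (hI1 j) (mh1 j) s0 st e0.
have /choice[H2 H2P] : forall j, exists H : simple_process F, _ := fun j => ito_approx (hI2 j) (mh2 j) s0 st e0.
pose J j r w := sp_integral (H1 j) (Wc j) r w + (-1) * sp_integral (H2 j) (Wc j) r w.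
pose q j (z : O * measurableTypeR R) := sp_fun (H1 j) z + (-1) * sp_fun (H2 j) z.
have mJ j : mart P F (J j).
  by apply: (martD uh); [exact: mart_sp|apply: (martZ uh); exact: mart_sp].
have bJ i j : biorth P F (J i) (J j) (fun z => (i == j)%:R * (q i z * q j z)).
  have -> : (fun z => (i == j)%:R * (q i z * q j z)) = (fun z =>
     ((i == j)%:R * (sp_fun (H1 j) z * sp_fun (H1 i) z) + (-1) * ((i == j)%:R * (sp_fun (H1 j) z * sp_fun (H2 i) z))) +
     (-1) * ((i == j)%:R * (sp_fun (H2 j) z * sp_fun (H1 i) z) + (-1) * ((i == j)%:R * (sp_fun (H2 j) z * sp_fun (H2 i) z)))).
    by apply/funext => z; rewrite /q; ring.
  have m k (H : simple_process F) : mart P F (sp_integral H (Wc k)) by exact: mart_sp.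
  have mZ k (H : simple_process F) : mart P F (fun t w => (-1) * sp_integral H (Wc k) t w) by exact: (martZ uh).
  have b (H H' : simple_process F) : biorth P F (sp_integral H (Wc j)) (sp_integral H' (Wc i))
      (fun z => (i == j)%:R * (sp_fun H z * sp_fun H' z)).
    by have := biorth_sp j i H H'; rewrite eq_sym.
  have b2 (H : simple_process F) : biorth P F (sp_integral H (Wc j)) (J i)
    (fun z => (i == j)%:R * (sp_fun H z * sp_fun (H1 i) z) + (-1) * ((i == j)%:R * (sp_fun H z * sp_fun (H2 i) z))).
    apply: biorthC; apply: (biorthD uh) => //; first exact: biorthC.
    by apply: (biorthZ uh) => //; exact: biorthC.
  apply: biorthC; apply: (biorthD uh) => //.
  exact: (biorthZ uh).
have [_ _] := biorth_sum2 uh (index_enum 'I_d) (index_enum 'I_d) mJ mJ bJ.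
move=> /(_ s t phi s0 st mphi (ex_intro _ M phin)).
set V := fun w => (\sum_(k < d) J k t w - \sum_(k < d) J k s w).
have -> : \int[P]_w (phi w * ((\sum_(k < d) J k t w - \sum_(k < d) J k s w) * (\sum_(l < d) J l t w - \sum_(l < d) J l s w))) = \int[P]_w (phi w * V w ^+ 2).
  by apply: eq_Rintegral => w _; rewrite /V expr2.
have -> : \int[Q]_(z in strip s t) (phi z.1 * (\sum_(k < d) \sum_(l < d) (k == l)%:R * (q k z * q l z))) =
  \int[Q]_(z in strip s t) (phi z.1 * \sum_(j < d) q j z ^+ 2).
  apply: eq_Rintegral => z _; congr (_ * _); apply: eq_bigr => k _.
  rewrite (bigD1 k)//= eqxx mul1r expr2 big1 ?addr0// => l.
  by rewrite eq_sym => /negPf ->; rewrite mul0r.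
move=> VE.
have lV : L2 P setT V.
  apply: L2B => //; apply: L2_sum => // j; have [_ l _] := mJ j; exact: l.
have lYV : L2 P setT (fun w => Y w - V w) by exact: L2B.
have lerr r j : 0 <= r -> L2 P setT (fun w => sp_integral (H1 j) (Wc j) r w - I1 j r w).
  by move=> r0; apply: L2B => //; [have [_ l _] := mart_sp j (H1 j); exact: l|exact: (ito_L2 (hI1 j))].
have lerr2 r j : 0 <= r -> L2 P setT (fun w => sp_integral (H2 j) (Wc j) r w - I2 j r w).
  by move=> r0; apply: L2B => //; [have [_ l _] := mart_sp j (H2 j); exact: l|exact: (ito_L2 (hI2 j))].
have errYV : \int[P]_w (phi w * (Y w - V w) ^+ 2) <= M * Cd * e.
  pose E w := \sum_(j < d) (4 * ((sp_integral (H1 j) (Wc j) t w - I1 j t w) ^+ 2) + 4 * ((sp_integral (H1 j) (Wc j) s w - I1 j s w) ^+ 2)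
     + (4 * ((sp_integral (H2 j) (Wc j) t w - I2 j t w) ^+ 2) + 4 * ((sp_integral (H2 j) (Wc j) s w - I2 j s w) ^+ 2))).
  have iE j : L1 P setT (fun w => (4 * ((sp_integral (H1 j) (Wc j) t w - I1 j t w) ^+ 2) + 4 * ((sp_integral (H1 j) (Wc j) s w - I1 j s w) ^+ 2)
     + (4 * ((sp_integral (H2 j) (Wc j) t w - I2 j t w) ^+ 2) + 4 * ((sp_integral (H2 j) (Wc j) s w - I2 j s w) ^+ 2)))).
    by apply: L1D => //; apply: L1D => //; apply: L1Z => //; [exact: (lerr t j t0).2|exact: (lerr s j s0).2|
      exact: (lerr2 t j t0).2|exact: (lerr2 s j s0).2].
  have iE' : L1 P setT E by exact: L1_sum.
  apply: (@le_trans _ _ (\int[P]_w ((M * 2 ^+ size (index_enum 'I_d)) * E w))).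
    apply: ler_Rint => //; [by apply: phiP; exact: lYV.2|exact: L1Z|].
    move=> w _; rewrite -mulrA; have /andP[p0 pM] := phiM w; apply: ler_pM => //; first exact: sqr_ge0.
    have -> : Y w - V w = \sum_(j < d) ((sp_integral (H1 j) (Wc j) s w - I1 j s w) - (sp_integral (H1 j) (Wc j) t w - I1 j t w)
       + ((sp_integral (H2 j) (Wc j) t w - I2 j t w) - (sp_integral (H2 j) (Wc j) s w - I2 j s w))).
      by rewrite /Y /V -sumrB -sumrB; apply: eq_bigr => j _; rewrite /J; ring.
    apply: le_trans (sqr_sum_le _ _) _; rewrite ler_wpM2l ?exprn_ge0//.
    apply: ler_sum => j _; set a := _ - I1 j s w; set b := _ - I1 j t w; set c := _ - I2 j t w; set c' := _ - I2 j s w.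
    have := sqr_ge0 (a + b); have := sqr_ge0 (c + c'); have := sqr_ge0 ((a - b) - (c - c')); nra.
  rewrite RintegralZl// Rintegral_sumr// /Cd !mulrA -[leLHS]mulrA -![leRHS]mulrA ler_wpM2l//.
  rewrite ler_wpM2l ?exprn_ge0//.
  have -> : d%:R * (16 * e) = \sum_(j < d) (16 * e) by rewrite sumr_const card_ord mulr_natl.
  apply: ler_sum => j _.
  have [[_ a1] [_ a2] _] := H1P j; have [[_ b1] [_ b2] _] := H2P j.
  have l1 := (lerr t j t0).2; have l2 := (lerr s j s0).2; have l3 := (lerr2 t j t0).2; have l4 := (lerr2 s j s0).2.
  rewrite RintegralDr//; [|by apply: L1D => //; exact: L1Z|by apply: L1D => //; exact: L1Z].
  rewrite RintegralDr//; [|exact: L1Z|exact: L1Z].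
  rewrite RintegralDr//; [|exact: L1Z|exact: L1Z].
  rewrite !RintegralZl//.
  by move: a1 a2 b1 b2; move: (\int[_]_w _) (\int[_]_w _) (\int[_]_w _) (\int[_]_w _) => ? ? ? ?; lra.
have lq j : L2 Q (strip s t) (q j).
  have m1 := measurable_sp_fun (H1 j); have m2 := measurable_sp_fun (H2 j).
  have [B1 hB1] := bounded_sp_fun (H1 j); have [B2 hB2] := bounded_sp_fun (H2 j).
  apply: (@L2_bnd _ _ _ _ _ _ (B1 + B2)) => //.
  - exact: strip_fin.
  - by apply: measurable_funTS; apply: measurable_funD => //; exact: measurable_funM.
  - move=> z _; rewrite /q (le_trans (ler_normD _ _))// lerD// normrM normrN normr1 mul1r//.
have le1 j : L2 Q (strip s t) (fun z => sp_fun (H1 j) z - h1 j z.2 z.1) by have [_ _ []] := H1P j.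
have le2 j : L2 Q (strip s t) (fun z => sp_fun (H2 j) z - h2 j z.2 z.1) by have [_ _ []] := H2P j.
have errq : \int[Q]_(z in strip s t) (phi z.1 * \sum_(j < d) q j z ^+ 2) <=
   (1 + eta) * X + (1 + eta^-1) * (M * (d%:R * 4) * e).
  pose G (j : 'I_d) (z : O * measurableTypeR R) := 2 * (sp_fun (H1 j) z - h1 j z.2 z.1) ^+ 2 + 2 * (sp_fun (H2 j) z - h2 j z.2 z.1) ^+ 2.
  have iG j : L1 Q (strip s t) (G j).
    by apply: L1D => //; apply: L1Z => //; [exact: (le1 j).2|exact: (le2 j).2].
  have iSG : L1 Q (strip s t) (fun z => \sum_(j < d) G j z) by exact: L1_sum.
  apply: (@le_trans _ _ (\int[Q]_(z in strip s t) ((1 + eta) * (phi z.1 * \sum_(j < d) hz j z ^+ 2) +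
     (1 + eta^-1) * (M * \sum_(j < d) G j z)))).
    apply: ler_Rint => //.
    - by apply: phiL1; apply: L1_sum => // j; exact: (lq j).2.
    - by apply: L1D => //; apply: L1Z => //; [exact: phiL1|exact: L1Z].
    - move=> z _; have /andP[p0 pM] := phiM z.1.
      apply: (@le_trans _ _ (phi z.1 * \sum_(j < d) ((1 + eta) * hz j z ^+ 2 + (1 + eta^-1) * G j z))).
        apply: ler_wpM2l => //; apply: ler_sum => j _.
        apply: le_trans (sqr_eta _ (hz j z) eta0) _; rewrite lerD2l ler_wpM2l ?addr_ge0 ?(ltW i0)//.
        rewrite /q /hz /G; set a := sp_fun (H1 j) z; set b := sp_fun (H2 j) z; set a' := h1 j _ _; set b' := h2 j _ _.
        have := sqr_ge0 ((a - a') + (b - b')); nra.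
      rewrite big_split /= -!mulr_sumr mulrDr mulrCA lerD2l mulrCA.
      rewrite ler_wpM2l ?addr_ge0 ?(ltW i0)// ler_wpM2r//.
      by apply: sumr_ge0 => j _; rewrite /G; apply: addr_ge0; apply: mulr_ge0 => //; exact: sqr_ge0.
  rewrite RintegralDr//; [|by apply: L1Z => //; exact: phiL1|by apply: L1Z => //; exact: L1Z].
  rewrite !RintegralZl//; [|exact: L1Z|exact: phiL1].
  rewrite lerD2l ler_wpM2l ?addr_ge0 ?(ltW i0)// -mulrA ler_wpM2l// Rintegral_sumr//.
  have -> : d%:R * 4 * e = \sum_(j < d) (4 * e) by rewrite sumr_const card_ord -mulrA mulr_natl.
  apply: ler_sum => j _.
  have [_ _ [_ a1]] := H1P j; have [_ _ [_ b1]] := H2P j.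
  rewrite -[leLHS]/(\int[Q]_(z in strip s t)
    (2 * (sp_fun (H1 j) z - h1 j z.2 z.1) ^+ 2 + 2 * (sp_fun (H2 j) z - h2 j z.2 z.1) ^+ 2)).
  rewrite RintegralDr//; [|by apply: L1Z => //; exact: (le1 j).2|by apply: L1Z => //; exact: (le2 j).2].
  rewrite !RintegralZl//; [|exact: (le2 j).2|exact: (le1 j).2].
  by move: a1 b1; move: (Rintegral _ _ _) (Rintegral _ _ _) => ? ?; lra.
have iV := phiP _ lV.2; have iYV := phiP _ lYV.2.
apply: (@le_trans _ _ (\int[P]_w ((1 + eta) * (phi w * V w ^+ 2) + (1 + eta^-1) * (phi w * (Y w - V w) ^+ 2)))).
  apply: ler_Rint => //; [by apply: phiP; exact: lY.2|by apply: L1D => //; exact: L1Z|].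
  move=> w _; have /andP[p0 _] := phiM w.
  have -> : (1 + eta) * (phi w * V w ^+ 2) + (1 + eta^-1) * (phi w * (Y w - V w) ^+ 2) =
    phi w * ((1 + eta) * V w ^+ 2 + (1 + eta^-1) * (Y w - V w) ^+ 2) by ring.
  by rewrite ler_wpM2l// sqr_eta.
rewrite RintegralDr//; [|exact: L1Z|exact: L1Z].
rewrite !RintegralZl// VE lerD// ler_wpM2l// ?addr_ge0// ltW//.
Qed.

End ito.

(** * Simple jump fields *)

Section poisson_elementary.
Context {dO : measure_display} {O : measurableType dO} {R : realType}.
Variables (P : probability O R) (F : R -> set (set O)).
Context {dU : measure_display} {U : measurableType dU}.
Variables (nu : {sigma_finite_measure set U -> \bar R}) (p : O -> R -> option U).
Hypothesis uh : usual_hypotheses P F.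
Hypothesis pp : poisson_point_process P F nu p.
Local Notation leb := (@lebesgue_measure R).
Local Notation Q := (P \x leb)%E.
Local Notation QN := ((P \x leb) \x nu)%E.
Local Notation OR := (O * measurableTypeR R)%type.

Let PT : (P setT < +oo)%E. Proof. by rewrite probability_setT ltry. Qed.

Let Q_sigma_finite : sigma_finite setT Q.
Proof.
exists (fun k => setT `*` `[- k%:R, k%:R]).
  apply/seteqP; split => // -[w r] _; exists (Num.bound `|r|) => //; split => //=.
  rewrite in_itv/= -ler_norml ltW//.
  exact: archi_boundP.
move=> k; split; first exact: measurableX.
rewrite product_measure1E//= probability_setT mul1e lebesgue_measure_itv/=.
by case: ifP => _ //; rewrite -EFinB ltry.
Qed.

(* The library only infers sigma-finiteness of products of subprobabilities. *)
Definition time_measure : {sigma_finite_measure set OR -> \bar R} :=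
  HB.pack Q (@Measure_isSigmaFinite.Build _ _ _ Q Q_sigma_finite).

Let fin_sub (A B : set U) : measurable A -> measurable B -> A `<=` B -> (nu B < +oo)%E -> (nu A < +oo)%E.
Proof. by move=> mA mB AB; apply: le_lt_trans; apply: le_measure; rewrite ?inE. Qed.

Definition slab s t : set (OR * U) := strip s t `*` setT.

Lemma measurable_slab s t : measurable (slab s t).
Proof. by apply: measurableX => //; exact: measurable_strip. Qed.

Lemma in_slab s t (z : OR) (u : U) : ((z, u) \in slab s t) = (z \in strip s t).
Proof. by apply/idP/idP => /set_mem h; apply/mem_set; [case: h|split]. Qed.

Lemma slab_indic (s t : R) (a : OR -> R) (A : set U) : measurable A -> (nu A < +oo)%E ->
  measurable_fun setT a -> (exists M : R, forall z, `|a z| <= M) ->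
  L1 QN (slab s t) (fun y => a y.1 * \1_A y.2) /\
  \int[QN]_(y in slab s t) (a y.1 * \1_A y.2) = fine (nu A) * \int[Q]_(z in strip s t) a z.
Proof.
move=> mA fA ma [M aM].
have ia : L1 Q (strip s t) a.
  apply: (@L1_bnd _ _ _ _ _ _ M) => //; [exact: measurable_strip|exact: strip_fin|exact: measurable_funTS].
have ia' : L1 Q setT (a \_ (strip s t)).
  by move: ia => /integrable_mkcond => /(_ (measurable_strip _ _)); rewrite restrict_EFin.
have iA : L1 nu setT (\1_A : U -> R).
  apply/integrableP; split; first by apply/measurable_EFinP; exact: measurable_indic.
  under eq_integral do rewrite /= ger0_norm//.
  by rewrite integral_indic// setIT.
have [i e] := Rint_prod (m1 := time_measure) (m2 := nu) ia' iA.
have E : (fun y : OR * U => (a \_ (strip s t)) y.1 * \1_A y.2) =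
    (fun y => a y.1 * \1_A y.2) \_ (slab s t).
  apply/funext => -[z u]; rewrite !patchE in_slab /=.
  by case: ifP => _ //; rewrite mul0r.
split.
  apply/integrable_mkcond; first exact: measurable_slab.
  by rewrite restrict_EFin -E.
rewrite Rintegral_mkcond -E e -Rintegral_mkcond mulrC; congr (_ * _).
by rewrite /Rintegral integral_indic// setIT.
Qed.

Section family.
Variables (K : finType) (lo hi : K -> R) (xi : K -> O -> R) (A : K -> set U).
Hypothesis lohi : forall k, 0 <= lo k <= hi k.
Hypothesis mxi : forall k, measurable_wrt (F (lo k)) (xi k).
Hypothesis bxi : forall k, exists M : R, forall w, `|xi k w| <= M.
Hypothesis mA : forall k, measurable (A k).
Hypothesis fA : forall k, (nu (A k) < +oo)%E.

(** The index type is an arbitrary finite type so that the difference of two simple fields is again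
    such a family, indexed by the sum of their index types. *)
Definition fam_integral t w := \sum_k transform (lo k) (hi k) (xi k) (compZ nu p (A k)) t w.
Definition fam_fun (y : OR * U) : R :=
  \sum_k xi k y.1.1 * \1_(`]lo k, hi k]%classic) y.1.2 * \1_(A k) y.2.

Let lo0 k : 0 <= lo k. Proof. by case/andP: (lohi k). Qed.

Let mxi' k : measurable_fun setT (xi k). Proof. exact: (Fmeas uh (lo0 k)). Qed.

Let mT k : mart P F (transform (lo k) (hi k) (xi k) (compZ nu p (A k))).
Proof. by apply: (mart_transform uh) => //; exact: (mart_compZ uh pp). Qed.

Lemma mart_fam : mart P F fam_integral.
Proof. exact: (mart_sum uh). Qed.

Let measurable_xi k : measurable_fun setT (fun z : OR => xi k z.1 * \1_(`]lo k, hi k]%classic) z.2).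
Proof.
apply: measurable_funM; first exact: measurableT_comp.
have m1 : measurable_fun setT (\1_(`]lo k, hi k]%classic) : measurableTypeR R -> R).
  exact: measurable_indic.
exact: (measurableT_comp m1 measurable_snd).
Qed.

Let bounded_xi k : exists M : R, forall z : OR, `|xi k z.1 * \1_(`]lo k, hi k]%classic) z.2| <= M.
Proof.
have [M h] := bxi k; exists M => z; rewrite normrM -[M]mulr1 ler_pM//.
by rewrite indicE; case: (_ \in _); rewrite ?normr1 ?normr0.
Qed.

Lemma measurable_fam_fun : measurable_fun setT fam_fun.
Proof.
apply: measurable_sum => k; apply: measurable_funM.
  exact: (measurableT_comp (measurable_xi k) measurable_fst).
have m1 : measurable_fun setT (\1_(A k) : U -> R) by exact: measurable_indic.
exact: (measurableT_comp m1 measurable_snd).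
Qed.

(** Expanding the square gives a double sum; the bracket of the counts on A k and A l has density
    nu(A k [&] A l), which is the integral over U of the product of the two indicators. *)
Lemma fam_isometry (s t : R) (phi : O -> R) : 0 <= s -> s <= t -> measurable_wrt (F s) phi ->
  (exists M : R, forall w, `|phi w| <= M) ->
  L1 QN (slab s t) (fun y => phi y.1.1 * fam_fun y ^+ 2) /\
  \int[P]_w (phi w * (fam_integral t w - fam_integral s w) ^+ 2) =
  \int[QN]_(y in slab s t) (phi y.1.1 * fam_fun y ^+ 2).
Proof.
move=> s0 st mphi bphi; have mphi' := Fmeas uh s0 mphi.
have mZ k := mart_compZ uh pp (mA k) (fA k).
have b k l : biorth P F (transform (lo k) (hi k) (xi k) (compZ nu p (A k)))
   (transform (lo l) (hi l) (xi l) (compZ nu p (A l)))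
   (fun z => xi l z.1 * \1_(`]lo l, hi l]%classic) z.2 *
     (xi k z.1 * \1_(`]lo k, hi k]%classic) z.2 * fine (nu (A k `&` A l)))).
  apply: biorthC; apply: (biorth_transform uh) => //.
  apply: biorthC; apply: (biorth_transform uh) => //.
  exact: (biorth_compZ uh pp).
have [_ _] := biorth_sum2 uh (index_enum K) (index_enum K) mT mT b.
move=> /(_ s t phi s0 st mphi bphi) H.
pose q k l (z : OR) := phi z.1 * (xi l z.1 * \1_(`]lo l, hi l]%classic) z.2 *
     (xi k z.1 * \1_(`]lo k, hi k]%classic) z.2)).
have mq k l : measurable_fun setT (q k l).
  apply: measurable_funM; first exact: measurableT_comp.
  by apply: measurable_funM.
have bq k l : exists M : R, forall z, `|q k l z| <= M.
  have [M0 h0] := bphi; have [M1 h1] := bounded_xi l; have [M2 h2] := bounded_xi k.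
  by exists (M0 * (M1 * M2)) => z; rewrite /q 2!normrM; apply: ler_pM => //; apply: ler_pM.
have fAB k l : (nu (A k `&` A l) < +oo)%E.
  by apply: fin_sub (fA k) => //; exact: measurableI.
have mAB k l : measurable (A k `&` A l) by exact: measurableI.
have Fk k l := slab_indic s t (mAB k l) (fAB k l) (mq k l) (bq k l).
have E : (fun y : OR * U => phi y.1.1 * fam_fun y ^+ 2) =
  (fun y => \sum_k \sum_l (q k l y.1 * \1_(A k `&` A l) y.2)).
  apply/funext => y; rewrite expr2 /fam_fun big_distrlr /= mulr_sumr; apply: eq_bigr => k _.
  rewrite mulr_sumr; apply: eq_bigr => l _; rewrite /q indicI /=; ring.
have mD := measurable_slab s t.
have i2 k : L1 QN (slab s t) (fun y => \sum_l (q k l y.1 * \1_(A k `&` A l) y.2)).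
  by apply: L1_sum => // l; case: (Fk k l).
rewrite E; split; first exact: L1_sum.
transitivity (\int[P]_w (phi w * ((fam_integral t w - fam_integral s w) * (fam_integral t w - fam_integral s w)))).
  by apply: eq_Rintegral => w _; rewrite expr2.
rewrite H Rintegral_sumr//.
have ms := @measurable_strip _ O R s t.
have iq k l : L1 Q (strip s t) (fun z => fine (nu (A k `&` A l)) * q k l z).
  apply: L1Z => //; have [M h] := bq k l.
  by apply: (@L1_bnd _ _ _ _ _ _ M) => //; [exact: strip_fin|exact: measurable_funTS].
transitivity (\int[Q]_(z in strip s t) (\sum_k \sum_l (fine (nu (A k `&` A l)) * q k l z))).
  apply: eq_Rintegral => z _; rewrite mulr_sumr; apply: eq_bigr => k _.
  by rewrite mulr_sumr; apply: eq_bigr => l _; rewrite /q; ring.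
rewrite Rintegral_sumr//; last by move=> k; exact: L1_sum.
apply: eq_bigr => k _; rewrite Rintegral_sumr// Rintegral_sumr//; last by move=> l; case: (Fk k l).
apply: eq_bigr => l _; have [_ ->] := Fk k l.
rewrite RintegralZl//; have [M h] := bq k l.
by apply: (@L1_bnd _ _ _ _ _ _ M) => //; [exact: strip_fin|exact: measurable_funTS].
Qed.

End family.

Section atoms.
Variables (K : finType) (A : K -> set U).
Hypothesis mA : forall k, measurable (A k).
Hypothesis fA : forall k, (nu (A k) < +oo)%E.

(** The sets A k may overlap, while the absolute value of a sum of indicators splits only over
    disjoint sets. They are therefore cut into the atoms [at_ J] of the algebra they generate. The
    atom of the empty code may have infinite measure, but it meets no A k and is left out. *)
Let code u : {set K} := [set k | u \in A k]%SET.
Let at_ (J : {set K}) := [set u | code u = J].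

Let mat J : measurable (at_ J).
Proof.
have -> : at_ J = \bigcap_(k in [set: K]) (if k \in J then A k else ~` A k).
  apply/seteqP; split => u /=.
    by move=> <- k _; rewrite inE; case: ifPn => [/set_mem//|/negP h]; move=> Ak; apply: h; exact/mem_set.
  move=> h; apply/setP => k; rewrite inE; have := h k I.
  by case: ifPn => _ hk; [exact: mem_set|exact: memNset].
apply: fin_bigcap_measurable; first exact: finite_finset.
by move=> k _; case: ifPn => _ //; exact: measurableC.
Qed.

Let fat J : J != finset.set0 -> (nu (at_ J) < +oo)%E.
Proof.
move=> /set0Pn[k kJ]; apply: fin_sub (fA k) => //.
by move=> u /= cu; move: kJ; rewrite -cu inE => /set_mem.
Qed.

Section increment.
Variables (s t : R).
Hypotheses (s0 : 0 <= s) (st : s <= t).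
Local Notation cN := (compN nu p s t).

Let cN_union (r : seq {set K}) : uniq r -> all (fun J => J != finset.set0) r ->
  {ae P, forall w, cN [set u | code u \in r] w = \sum_(J <- r) cN (at_ J) w} /\
  (measurable [set u | code u \in r] /\ (nu [set u | code u \in r] < +oo)%E).
Proof.
elim: r => [_ _|J r IH /= /andP[Jr ur] /andP[J0 r0]].
  have -> : [set u | code u \in [::]] = set0 by apply/seteqP; split.
  split; last by rewrite measure0 ltry.
  apply: nearW => w; rewrite big_nil /compN measure0 mulr0 subr0.
  by rewrite setX0 /Nmeas (_ : [set s | _] = set0) ?measure0//; rewrite -subset0 => x [_ []].
have [h [m f]] := IH ur r0.
have -> : [set u | code u \in J :: r] = at_ J `|` [set u | code u \in r].
  apply/seteqP; split => u /=; rewrite in_cons.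
    by move=> /orP[/eqP e|h']; [left; rewrite /at_ /= e|right].
  by move=> [e|->]; rewrite ?orbT// [code u]e eqxx.
have dj : at_ J `&` [set u | code u \in r] = set0.
  by rewrite -subset0 => u [/= -> Jr']; rewrite Jr' in Jr.
split; last first.
  split; first exact: measurableU.
  by rewrite measureU// lte_add_pinfty// fat.
apply: filterS2 h (compN_split_set pp s0 st (mat J) m (fat J0) f dj) => w h1 h2.
by rewrite big_cons h2 h1.
Qed.

Let cN_atoms : {ae P, forall w, forall k, cN (A k) w = \sum_(J : {set K} | k \in J) cN (at_ J) w}.
Proof.
apply: filter_forall => k.
pose r := [seq J : {set K} <- enum {: {set K}} | k \in J].
have ur : uniq r by rewrite filter_uniq// enum_uniq.
have r0 : all (fun J : {set K} => J != finset.set0) r.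
  by apply/allP => J; rewrite mem_filter => /andP[kJ _]; apply/set0Pn; exists k.
have [+ _] := cN_union ur r0.
have -> : [set u | code u \in r] = A k.
  apply/seteqP; split => u /=; rewrite mem_filter mem_enum andbT inE; [exact: set_mem|exact: mem_set].
by apply: filterS => w ->; rewrite big_filter big_enum_cond.
Qed.

(** On an atom the integrand is the single coefficient [zeta J], so the absolute value passes inside
    the sum. There |N - lam| <= N + lam, and both terms have the same mean against a variable known
    at s: this is the factor 2. *)
Lemma compN_sum_L1 (c : K -> O -> R) (phi : O -> R) :
  (forall k, measurable_wrt (F s) (c k)) -> (forall k, exists M : R, forall w, `|c k w| <= M) ->
  measurable_wrt (F s) phi -> (forall w, 0 <= phi w) -> (exists M : R, forall w, `|phi w| <= M) ->
  L1 QN (slab s t) (fun y => phi y.1.1 * `|\sum_k c k y.1.1 * \1_(A k) y.2|) /\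
  \int[P]_w (phi w * `|\sum_k c k w * cN (A k) w|) <=
  2 * \int[QN]_(y in slab s t) (phi y.1.1 * `|\sum_k c k y.1.1 * \1_(A k) y.2|).
Proof.
move=> mc bc mphi phi0 bphi; have Fs := Fsig uh s0.
have mphi' := Fmeas uh s0 mphi.
pose zeta (J : {set K}) w := \sum_(k in J) c k w.
have mzeta J : measurable_wrt (F s) (zeta J).
  have -> : zeta J = fun w => \sum_k (if k \in J then c k w else 0).
    by apply/funext => w; rewrite /zeta big_mkcond.
  apply: (wrt_sum Fs) => k; case: (k \in J); [exact: mc|exact: (wrt_cst Fs)].
have bzeta J : exists M : R, forall w, `|zeta J w| <= M.
  have /choice[B hB] := bc; exists (\sum_(k in J) B k) => w.
  by rewrite (le_trans (ler_norm_sum _ _ _))//; apply: ler_sum => k _.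
have zeta0 w : zeta finset.set0 w = 0 by rewrite /zeta big_set0.
pose psi J w := phi w * `|zeta J w|.
have mpsi J : measurable_wrt (F s) (psi J).
  by apply: (wrtM Fs) => //; apply: (wrt_comp Fs (g := fun x : R => `|x|) _ (mzeta J)); exact: normr_measurable.
have bpsi J : exists M : R, forall w, `|psi J w| <= M.
  have [M1 h1] := bphi; have [M2 h2] := bzeta J.
  by exists (M1 * M2) => w; rewrite normrM normr_id ler_pM.
have mpsi' J : measurable_fun setT (psi J) by exact: (Fmeas uh s0).
have ipsi J : L1 P setT (psi J).
  by have [M h] := bpsi J; exact: (@L1_bnd _ _ _ _ _ _ M).
have psi0 J w : 0 <= psi J w by rewrite mulr_ge0.
have E (y : OR * U) : phi y.1.1 * `|\sum_k c k y.1.1 * \1_(A k) y.2| =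
   \sum_(J : {set K} | J != finset.set0) psi J y.1.1 * \1_(at_ J) y.2.
  have -> : \sum_k c k y.1.1 * \1_(A k) y.2 = zeta (code y.2) y.1.1.
    rewrite /zeta [RHS]big_mkcond; apply: eq_bigr => k _; rewrite indicE inE.
    by case: (_ \in A k); rewrite ?mulr1 ?mulr0.
  have [c0|c0] := eqVneq (code y.2) finset.set0.
    rewrite c0 zeta0 normr0 mulr0 big1// => J J0.
    rewrite indicE memNset ?mulr0//= => e; by rewrite -e c0 eqxx in J0.
  rewrite (bigD1 (code y.2))//= indicE mem_set// mulr1 big1 ?addr0// => J /andP[_ Jc].
  by rewrite indicE memNset ?mulr0//= => e; rewrite -e eqxx in Jc.
have mD := measurable_slab s t.
have sl J : J != finset.set0 -> L1 QN (slab s t) (fun y => psi J y.1.1 * \1_(at_ J) y.2) /\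
  \int[QN]_(y in slab s t) (psi J y.1.1 * \1_(at_ J) y.2) = (t - s) * fine (nu (at_ J)) * \int[P]_w psi J w.
  move=> J0; have mm : measurable_fun setT (fun z : OR => psi J z.1) by exact: measurableT_comp.
  have bb : exists M : R, forall z : OR, `|psi J z.1| <= M by have [M h] := bpsi J; exists M.
  have [h1 h2] := slab_indic s t (mat J) (fat J0) mm bb; split => //.
  rewrite h2; have := strip_Rint_cst P 1 st (mpsi' J) (bpsi J).
  have -> : \int[Q]_(z in strip s t) (psi J z.1 * 1) = \int[Q]_(z in strip s t) psi J z.1.
    by apply: eq_Rintegral => z _; rewrite mulr1.
  by move=> ->; ring.
pose g (J : {set K}) (y : OR * U) : R := if J != finset.set0 then psi J y.1.1 * \1_(at_ J) y.2 else 0.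
have ig J : L1 QN (slab s t) (g J).
  rewrite /g; have [/sl[]//|_] := boolP (J != finset.set0).
  by apply: (eq_integrable mD (cst 0%E)) => //; exact: integrable0.
have Eg : (fun y : OR * U => phi y.1.1 * `|\sum_k c k y.1.1 * \1_(A k) y.2|) = (fun y => \sum_J g J y).
  by apply/funext => y; rewrite E big_mkcond.
rewrite Eg; split; first exact: L1_sum.
rewrite Rintegral_sumr//.
have bound J : J != finset.set0 -> L1 P setT (fun w => psi J w * `|cN (at_ J) w|) /\
   \int[P]_w (psi J w * `|cN (at_ J) w|) <= 2 * \int[QN]_(y in slab s t) g J y.
  move=> J0; rewrite /g J0; have [_ ->] := sl _ J0.
  have [i1 e1] := Nmeas_indep_mean uh pp s0 st (mat J) (fat J0) (mpsi J) (ipsi J).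
  have lc := compN_L2 pp s0 st (mat J) (fat J0).
  have iJ : L1 P setT (fun w => psi J w * `|cN (at_ J) w|).
    have [M h] := bpsi J; apply: (@L1Mb _ _ _ _ _ _ _ M) => //.
    by apply: L1_norm => //; exact: L2_L1.
  split => //.
  have i2 : L1 P setT (fun w => ((t - s) * fine (nu (at_ J))) * psi J w) by exact: L1Z.
  apply: (@le_trans _ _ (\int[P]_w (psi J w * fine (Nmeas p w (`]s, t] `*` at_ J)) + ((t - s) * fine (nu (at_ J))) * psi J w))).
    apply: ler_Rint => //; first exact: L1D.
    move=> w _; rewrite /compN (mulrC _ (psi J w)) -mulrDr ler_wpM2l//.
    have n0 : 0 <= fine (Nmeas p w (`]s, t] `*` at_ J)) by rewrite fine_ge0// measure_ge0.
    have l0 : 0 <= (t - s) * fine (nu (at_ J)) by rewrite mulr_ge0 ?subr_ge0// fine_ge0.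
    by rewrite (le_trans (ler_normB _ _))// !ger0_norm.
  rewrite RintegralDr// e1 RintegralZl//; last exact: ipsi.
  by rewrite -mulr2n mulr_natl.
pose b (J : {set K}) w : R := if J != finset.set0 then psi J w * `|cN (at_ J) w| else 0.
have ib J : L1 P setT (b J).
  rewrite /b; have [/bound[]//|_] := boolP (J != finset.set0).
  by apply: (@L1_bnd _ _ _ _ _ _ 0) => // w _; rewrite normr0.
apply: (@le_trans _ _ (\int[P]_w (\sum_J b J w))); last first.
  rewrite Rintegral_sumr// mulr_sumr; apply: ler_sum => J _.
  have [J0|J0] := boolP (J != finset.set0).
    have [_] := bound _ J0; apply: le_trans; rewrite le_eqVlt; apply/orP; left; apply/eqP.
    by apply: eq_Rintegral => w _; rewrite /b J0.
  have -> : \int[P]_w b J w = 0.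
    by rewrite /Rintegral; under eq_integral do rewrite /b (negPf J0); rewrite integral0.
  rewrite mulr_ge0// Rintegral_ge0// => y _; rewrite /g (negPf J0).
  by [].
have mcN k : L2 P setT (cN (A k)) by exact: (compN_L2 pp s0 st (mA k) (fA k)).
have iis : L1 P setT (fun w => phi w * `|\sum_k c k w * cN (A k) w|).
  have [M h] := bphi; apply: (@L1Mb _ _ _ _ _ _ _ M) => //; apply: L1_norm => //.
  apply: L1_sum => // k; have [M' h'] := bc k; apply: (@L1Mb _ _ _ _ _ _ _ M') => //.
    exact: (Fmeas uh s0 (mc k)).
  exact: L2_L1.
apply: ae_ler_Rint => //; first exact: L1_sum.
apply: filterS cN_atoms => w cw _.
have -> : \sum_k c k w * cN (A k) w = \sum_(J : {set K} | J != finset.set0) zeta J w * cN (at_ J) w.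
  transitivity (\sum_k \sum_(J : {set K} | k \in J) c k w * cN (at_ J) w).
    by apply: eq_bigr => k _; rewrite cw mulr_sumr.
  rewrite (exchange_big_dep (fun J : {set K} => J != finset.set0))/=; last first.
    by move=> k J _ kJ; apply/set0Pn; exists k.
  by apply: eq_bigr => J _; rewrite /zeta mulr_suml.
rewrite (le_trans (ler_wpM2l (phi0 w) (ler_norm_sum _ _ _)))//.
rewrite mulr_sumr /b -big_mkcond /=; apply: ler_sum => J _.
by rewrite /psi normrM mulrA.
Qed.

End increment.
End atoms.

End poisson_elementary.

Section poisson_family.
Context {dO : measure_display} {O : measurableType dO} {R : realType}.
Variables (P : probability O R) (F : R -> set (set O)).
Context {dU : measure_display} {U : measurableType dU}.
Variables (nu : {sigma_finite_measure set U -> \bar R}) (p : O -> R -> option U).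
Hypothesis uh : usual_hypotheses P F.
Hypothesis pp : poisson_point_process P F nu p.
Local Notation leb := (@lebesgue_measure R).
Local Notation Q := (P \x leb)%E.
Local Notation QN := ((P \x leb) \x nu)%E.
Local Notation OR := (O * measurableTypeR R)%type.

Let PT : (P setT < +oo)%E. Proof. by rewrite probability_setT ltry. Qed.

Variables (K : finType) (lo hi : K -> R) (xi : K -> O -> R).
Hypothesis lohi : forall k, 0 <= lo k <= hi k.
Hypothesis mxi : forall k, measurable_wrt (F (lo k)) (xi k).
Hypothesis bxi : forall k, exists M : R, forall w, `|xi k w| <= M.

Let lo0 k : 0 <= lo k. Proof. by case/andP: (lohi k). Qed.
Let mxi' k : measurable_fun setT (xi k). Proof. exact: (Fmeas uh (lo0 k)). Qed.

Section fixed_sets.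
Variable A : K -> set U.
Hypothesis mA : forall k, measurable (A k).
Hypothesis fA : forall k, (nu (A k) < +oo)%E.
Local Notation FI := (fam_integral nu p lo hi xi A).
Local Notation FF := (fam_fun lo hi xi A).

Lemma fam_fun_L1 (s t : R) (phi : O -> R) : measurable_fun setT phi ->
  (exists M : R, forall w, `|phi w| <= M) ->
  L1 QN (slab s t) (fun y => phi y.1.1 * `|FF y|).
Proof.
move=> mphi [M phiM].
have mD : measurable (slab s t : set (OR * U)) by exact: measurable_slab.
apply: (@L1Mb _ _ _ _ _ _ _ M) => //.
  apply: measurable_funTS; apply: measurableT_comp => //; exact: measurableT_comp.
apply: L1_norm => //; apply: L1_sum => // k.
have mm : measurable_fun setT (fun z : OR => xi k z.1 * \1_(`]lo k, hi k]%classic) z.2).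
  apply: measurable_funM; first exact: measurableT_comp.
  have m1 : measurable_fun setT (\1_(`]lo k, hi k]%classic) : measurableTypeR R -> R).
    exact: measurable_indic.
  exact: (measurableT_comp m1 measurable_snd).
have bb : exists M : R, forall z : OR, `|xi k z.1 * \1_(`]lo k, hi k]%classic) z.2| <= M.
  have [M' h] := bxi k; exists M' => z; rewrite normrM -[M']mulr1 ler_pM//.
  by rewrite indicE; case: (_ \in _); rewrite ?normr1 ?normr0.
by have [] := slab_indic P s t (mA k) (fA k) mm bb.
Qed.

Let lI (s t : R) : 0 <= s -> s <= t -> L2 P setT (fun w => FI t w - FI s w).
Proof. by move=> s0 st; exact: (mart_incr (mart_fam uh pp lohi mxi bxi mA fA)). Qed.

Let iI (s t : R) (phi : O -> R) : 0 <= s -> s <= t -> measurable_fun setT phi ->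
  (exists M : R, forall w, `|phi w| <= M) -> L1 P setT (fun w => phi w * `|FI t w - FI s w|).
Proof.
move=> s0 st mphi [M phiM]; apply: (@L1Mb _ _ _ _ _ _ _ M) => //.
by apply: L1_norm => //; apply: L2_L1 => //; exact: lI.
Qed.

Let slab_split (s r t : R) (f : OR * U -> R) : s <= r -> r <= t ->
  L1 QN (slab s t) f ->
  \int[QN]_(y in slab s t) f y = \int[QN]_(y in slab s r) f y + \int[QN]_(y in slab r t) f y.
Proof.
move=> sr rt fi.
have e : slab s t = slab s r `|` slab r t :> set (OR * U).
  apply/seteqP; split => -[[w x] u].
    move=> [[_ /=]]; rewrite in_itv/= => /andP[h1 h2] _; have [xr|rx] := leP x r; [left|right];
    by split => //; split => //=; rewrite in_itv/= ?h1 ?h2 ?xr ?rx.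
  by move=> [] [[_ /=]]; rewrite in_itv/= => /andP[h1 h2] _; split => //; split => //=;
    rewrite in_itv/= ?h1 ?h2 ?(le_trans h2) ?(le_lt_trans sr h1).
rewrite e Rintegral_setU//; try exact: measurable_slab.
- by rewrite -e.
- rewrite disj_set2E; apply/eqP; rewrite -subset0 => -[[w x] u] [[[_ /=] + _] [[_ /=] + _]].
  by rewrite !in_itv/= => /andP[_ h1] /andP[h2 _]; have := le_lt_trans h1 h2; rewrite ltxx.
Qed.

(** When no endpoint lies strictly between s and t, each term is either active on the whole of (s,
    t] or does not move at all, so the coefficients are constant in time and [compN_sum_L1]
    applies. *)
Let base (s t : R) (phi : O -> R) : 0 <= s -> s < t ->
  (forall k, ~~ (s < lo k < t) /\ ~~ (s < hi k < t)) ->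
  measurable_wrt (F s) phi -> (forall w, 0 <= phi w) -> (exists M : R, forall w, `|phi w| <= M) ->
  \int[P]_w (phi w * `|FI t w - FI s w|) <= 2 * \int[QN]_(y in slab s t) (phi y.1.1 * `|FF y|).
Proof.
move=> s0 st hk mphi phi0 bphi; have mphi' := Fmeas uh s0 mphi.
pose act k := (lo k <= s) && (t <= hi k).
have nact k : ~~ act k -> (t <= lo k) || (hi k <= s).
  have [/negP h1 /negP h2] := hk k; rewrite negb_and -!ltNge => /orP[h|h].
    by rewrite leNgt; apply/orP; left; apply/negP => h'; apply: h1; rewrite h h'.
  by rewrite (leNgt (hi k)); apply/orP; right; apply/negP => h'; apply: h2; rewrite h h'.
pose c k w := if act k then xi k w else 0.
have mc k : measurable_wrt (F s) (c k).
  rewrite /c; have [/andP[h _]|_] := boolP (act k); last exact: (wrt_cst (Fsig uh s0)).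
  exact: (Fmono uh (lo0 k) h).
have bc k : exists M : R, forall w, `|c k w| <= M.
  rewrite /c; have [_|_] := boolP (act k); first exact: bxi.
  by exists 0 => w; rewrite normr0.
have [_ H] := compN_sum_L1 uh pp mA fA s0 (ltW st) mc bc mphi phi0 bphi.
have -> : \int[QN]_(y in slab s t) (phi y.1.1 * `|FF y|) =
   \int[QN]_(y in slab s t) (phi y.1.1 * `|\sum_k c k y.1.1 * \1_(A k) y.2|).
  apply: eq_Rintegral => -[[w x] u]; rewrite in_slab in_strip => /andP[sx xt] /=.
  congr (_ * `|_|); apply: eq_bigr => k _ /=; congr (_ * _).
  rewrite /c indicE; have [/andP[h1 h2]|na] := boolP (act k).
    by rewrite mem_setE in_itv/= (le_lt_trans h1 sx) (le_trans xt h2) mulr1.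
  rewrite mem_setE in_itv/=; have /orP[h|h] := nact _ na.
    by rewrite ltNge (le_trans xt h) mulr0.
  by rewrite [x <= _]leNgt (le_lt_trans h sx) andbF mulr0.
apply: le_trans H; rewrite le_eqVlt; apply/orP; left; apply/eqP.
apply: ae_eq_Rint => //.
- by apply: (L1_meas (mu := P)); apply: iI => //; exact: ltW.
- apply: measurable_funM => //; apply: measurableT_comp => //; apply: measurable_sum => k.
  apply: measurable_funM; first exact: (Fmeas uh s0).
  by have [] := compN_L2 pp s0 (ltW st) (mA k) (fA k).
have Hk : {ae P, forall w, forall k, compZ nu p (A k) t w - compZ nu p (A k) s w = compN nu p s t (A k) w}.
  by apply: filter_forall => k; exact: (compZ_incr pp s0 (ltW st) (mA k) (fA k)).
apply: filterS Hk => w Hk _; congr (_ * `|_|).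
rewrite /fam_integral -sumrB; apply: eq_bigr => k _; rewrite /c -Hk.
have lh : lo k <= hi k by case/andP: (lohi k).
have [ha|na] := boolP (act k).
  have [/max_idPr e1 /min_idPr e2] := andP ha.
  by rewrite transform_incr ?e1 ?e2// ltW.
have mm : Num.min (hi k) t <= Num.max (lo k) s.
  by rewrite le_max !ge_min; have /orP[->|->] := nact _ na; rewrite ?orbT.
by rewrite (transform_incr0 _ _ (lohi k) w (ltW st) mm) subrr mul0r.
Qed.

(** Induction on a list containing all endpoints strictly inside (s, t): cutting the interval at the
    head of the list removes that endpoint on both halves, and both sides of the bound are
    compatible with cutting. *)
Lemma fam_L1 (s t : R) (phi : O -> R) : 0 <= s -> s <= t -> measurable_wrt (F s) phi ->
  (forall w, 0 <= phi w) -> (exists M : R, forall w, `|phi w| <= M) ->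
  \int[P]_w (phi w * `|FI t w - FI s w|) <= 2 * \int[QN]_(y in slab s t) (phi y.1.1 * `|FF y|).
Proof.
move=> s0 st mphi phi0 bphi.
have : forall k, (s < lo k < t -> lo k \in codom lo ++ codom hi) /\
   (s < hi k < t -> hi k \in codom lo ++ codom hi).
  by move=> k; split => _; rewrite mem_cat !codom_f ?orbT.
elim: (codom lo ++ codom hi) s t s0 st mphi => [|r l IH] s t s0 st mphi hk.
  have [->|st'] := eqVneq s t.
    under eq_Rintegral do rewrite subrr normr0 mulr0.
    rewrite /Rintegral integral0/= mulr_ge0// Rintegral_ge0// => y _.
    by rewrite mulr_ge0.
  apply: base => //; first by rewrite lt_neqAle st'.
  by move=> k; have [h1 h2] := hk k; split; [apply/negP => /h1|apply/negP => /h2].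
have [/andP[sr rt]|nr] := boolP (s < r < t); last first.
  apply: IH => // k; have [h1 h2] := hk k; split => h; [have := h1 h|have := h2 h];
  by rewrite in_cons => /orP[/eqP e|//]; rewrite -e h in nr.
have r0 := le_trans s0 (ltW sr).
have mphi' := Fmeas uh s0 mphi.
have I1 := IH s r s0 (ltW sr) mphi; have I2 := IH r t r0 (ltW rt) (Fmono uh s0 (ltW sr) mphi).
rewrite (slab_split (ltW sr) (ltW rt)); last exact: fam_fun_L1.
rewrite mulrDr addrC.
apply: (@le_trans _ _ (\int[P]_w (phi w * `|FI t w - FI r w| + phi w * `|FI r w - FI s w|))).
  apply: ler_Rint => //; first exact: iI.
    by apply: L1D => //; apply: iI => //; exact: ltW.
  move=> w _; rewrite -mulrDr ler_wpM2l// (le_trans _ (ler_normD _ _))//.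
  by rewrite addrA subrK.
rewrite RintegralDr//; [|by apply: iI => //; exact: ltW|by apply: iI => //; exact: ltW].
apply: lerD; [apply: I2|apply: I1] => k; have [h1 h2] := hk k; split => /andP[h h'].
- have /h1 : s < lo k < t by rewrite (lt_trans sr h) h'.
  by rewrite in_cons => /orP[/eqP e|//]; rewrite e ltxx in h.
- have /h2 : s < hi k < t by rewrite (lt_trans sr h) h'.
  by rewrite in_cons => /orP[/eqP e|//]; rewrite e ltxx in h.
- have /h1 : s < lo k < t by rewrite h (lt_trans h' rt).
  by rewrite in_cons => /orP[/eqP e|//]; rewrite e ltxx in h'.
- have /h2 : s < hi k < t by rewrite h (lt_trans h' rt).
  by rewrite in_cons => /orP[/eqP e|//]; rewrite e ltxx in h'.
Qed.

(** The bound through the isometry, meant for the part of the mark space where the integrand is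
    small in L^2 but nu may be infinite. *)
Lemma fam_L1_sqr (s t th M : R) (phi : O -> R) : 0 <= s -> s <= t -> measurable_wrt (F s) phi ->
  (forall w, 0 <= phi w <= M) -> 0 < th ->
  \int[P]_w (phi w * `|FI t w - FI s w|) <=
    M * th + th^-1 * \int[QN]_(y in slab s t) (phi y.1.1 * FF y ^+ 2).
Proof.
move=> s0 st mphi phiM th0; have mphi' := Fmeas uh s0 mphi.
have bphi : exists M : R, forall w, `|phi w| <= M.
  by exists M => w; have /andP[h0 h1] := phiM w; rewrite ger0_norm.
have [_ <-] := fam_isometry uh pp lohi mxi bxi mA fA s0 st mphi bphi.
have [B hB] := bphi.
have i1 : L1 P setT (fun w => phi w * (FI t w - FI s w) ^+ 2).
  by apply: (@L1Mb _ _ _ _ _ _ _ B) => //; exact: (lI s0 st).2.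
have i2 : L1 P setT (fun=> M * th) by exact: (@L1_bnd _ _ _ _ _ _ `|M * th|).
apply: (@le_trans _ _ (\int[P]_w (M * th + th^-1 * (phi w * (FI t w - FI s w) ^+ 2)))).
  apply: ler_Rint => //; first exact: iI.
    by apply: L1D => //; exact: L1Z.
  move=> w _; have /andP[h0 h1] := phiM w.
  apply: (le_trans (ler_wpM2l h0 (norm_le_sqr _ th0))).
  by rewrite mulrDr mulrCA lerD2r ler_wpM2r// ltW.
rewrite RintegralDr//; last exact: L1Z.
rewrite Rintegral_cst//= probability_setT mulr1 RintegralZl//; exact: i1.
Qed.

End fixed_sets.

Lemma fam_split (A : K -> set U) (B : set U) (t : R) :
  (forall k, measurable (A k)) -> (forall k, (nu (A k) < +oo)%E) -> measurable B -> 0 <= t ->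
  {ae P, forall w, fam_integral nu p lo hi xi A t w =
    fam_integral nu p lo hi xi (fun k => A k `&` B) t w +
    fam_integral nu p lo hi xi (fun k => A k `&` ~` B) t w}.
Proof.
move=> mA fA mB t0.
have H u : 0 <= u -> {ae P, forall w, forall k, compZ nu p (A k) u w =
   compZ nu p (A k `&` B) u w + compZ nu p (A k `&` ~` B) u w}.
  move=> u0; apply: filter_forall => k.
  have mB' : measurable (A k `&` B) by exact: measurableI.
  have mC : measurable (A k `&` ~` B) by apply: measurableI => //; exact: measurableC.
  have e : A k = (A k `&` B) `|` (A k `&` ~` B) by rewrite -setIUr setUv setIT.
  have dj : (A k `&` B) `&` (A k `&` ~` B) = set0 by rewrite setIACA setICr setI0.
  have fin C : measurable C -> C `<=` A k -> (nu C < +oo)%E.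
    by move=> mC' CA; apply: le_lt_trans (fA k); apply: le_measure; rewrite ?inE.
  have := compN_split_set pp (lexx 0) u0 mB' mC (fin _ mB' (@subIsetl _ _ _)) (fin _ mC (@subIsetl _ _ _)) dj.
  by rewrite -e.
have hi0 k : 0 <= hi k by case/andP: (lohi k) => h /(le_trans h).
have G : {ae P, forall w, forall k, (forall l, compZ nu p (A l) (Num.min (hi k) t) w =
   compZ nu p (A l `&` B) (Num.min (hi k) t) w + compZ nu p (A l `&` ~` B) (Num.min (hi k) t) w) /\
   (forall l, compZ nu p (A l) (Num.min (lo k) t) w =
   compZ nu p (A l `&` B) (Num.min (lo k) t) w + compZ nu p (A l `&` ~` B) (Num.min (lo k) t) w)}.
  by apply: filter_forall => k; apply: filterI; apply: H; rewrite le_min t0 ?lo0 ?hi0.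
apply: filterS G => w Gw; rewrite /fam_integral -big_split; apply: eq_bigr => k _.
have [h1 h2] := Gw k; rewrite /transform h1 h2 /=; ring.
Qed.

End poisson_family.

(** * Poisson integrals *)

Lemma Rint_dominated d (T : measurableType d) (R : realType) (mu : {measure set T -> \bar R})
    (D : set T) (f_ : nat -> T -> R) (f g : T -> R) : measurable D ->
  (forall n, measurable_fun D (f_ n)) -> L1 mu D g ->
  (forall n x, D x -> `|f_ n x| <= g x) ->
  (forall x, D x -> f_ n x @[n --> \oo] --> f x) ->
  measurable_fun D f ->
  \int[mu]_(x in D) f_ n x @[n --> \oo] --> \int[mu]_(x in D) f x.
Proof.
move=> mD mf ig fg cf mF.
have H : [/\ mu.-integrable D (EFin \o f),
    [sequence \int[mu]_(x in D) `|(EFin \o f_ n) x - (EFin \o f) x|]_n @ \oo --> 0 &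
    [sequence \int[mu]_(x in D) (EFin \o f_ n) x]_n @ \oo --> \int[mu]_(x in D) (EFin \o f) x]%E.
  apply: (@dominated_convergence _ _ _ mu D mD _ _ (EFin \o g)) => //.
  - by move=> n; exact/measurable_EFinP.
  - exact/measurable_EFinP.
  - by apply: aeW => x Dx; apply: cvg_EFin; [exact: nearW|exact: cf].
  - by apply: aeW => x Dx n; rewrite lee_fin; exact: fg.
have [i1 _ c] := H.
by apply: fine_cvg; rewrite RintegralE.
Qed.

Lemma ler_addC_eps (R : realType) (x y C : R) : (forall e, 0 < e -> x <= y + C * e) -> x <= y.
Proof.
move=> h; apply/ler_addgt0Pr => e e0.
have C1 : 0 < `|C| + 1 by rewrite ltr_wpDl.
apply: le_trans (h (e / (`|C| + 1)) (divr_gt0 e0 C1)) _; rewrite lerD2l mulrCA ler_piMr ?(ltW e0)//.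
by rewrite ler_pdivrMr// mul1r (le_trans (ler_norm _))// lerDl.
Qed.

Section poisson_estimate.
Context {dO : measure_display} {O : measurableType dO} {R : realType}.
Variables (P : probability O R) (F : R -> set (set O)).
Context {dU : measure_display} {U : measurableType dU}.
Variables (nu : {sigma_finite_measure set U -> \bar R}) (p : O -> R -> option U).
Hypothesis uh : usual_hypotheses P F.
Hypothesis pp : poisson_point_process P F nu p.
Local Notation leb := (@lebesgue_measure R).
Local Notation Q := (P \x leb)%E.
Local Notation QN := ((P \x leb) \x nu)%E.
Local Notation OR := (O * measurableTypeR R)%type.

Let PT : (P setT < +oo)%E. Proof. by rewrite probability_setT ltry. Qed.

Local Notation lo H := (@sp_lo O R F (sf_proc H)).
Local Notation hi H := (@sp_hi O R F (sf_proc H)).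
Local Notation xi H := (@sp_xi O R F (sf_proc H)).
Local Notation A_ H := (@sf_set O R F dU U nu H).
Local Notation HI H := (fam_integral nu p (lo H) (hi H) (xi H) (A_ H)).
Local Notation HF H := (fam_fun (lo H) (hi H) (xi H) (A_ H)).

Let lohi (H : simple_field F nu) k : 0 <= lo H k <= hi H k. Proof. exact: sp_ord. Qed.
Let mxi (H : simple_field F nu) k : measurable_wrt (F (lo H k)) (xi H k). Proof. exact: sp_meas. Qed.
Let bxi (H : simple_field F nu) k : exists M : R, forall w, `|xi H k w| <= M.
Proof. by have [M h] := sp_bounded (sf_proc H); exists M. Qed.

Lemma ge0_slab_fubini (s t : R) (f : OR * U -> \bar R) :
  measurable_fun setT f -> (forall y, (0 <= f y)%E) ->
  (\int[QN]_(y in slab s t) f y =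
   \int[P]_w \int[leb]_(r in `]s, t]) \int[nu]_u f ((w, r), u))%E.
Proof.
move=> mf f0.
have mD : measurable (slab s t : set (OR * U)) by exact: measurable_slab.
have mfr : measurable_fun setT (f \_ (slab s t)).
  by apply/(measurable_restrictT f) => //; exact: measurable_funTS.
have fr0 y : (0 <= (f \_ (slab s t)) y)%E by apply: erestrict_ge0 => *; exact: f0.
have mF := measurable_fun_fubini_tonelli_F (m2 := nu) f mf f0.
have F0 z : (0 <= fubini_F nu f z)%E by apply: integral_ge0.
rewrite -(ge0_strip_fubini P s t mF F0) [RHS]integral_mkcond [LHS]integral_mkcond.
rewrite (fubini_tonelli1 (m1 := time_measure P) _ mfr fr0).
apply: eq_integral => z _; rewrite /fubini_F patchE; case: ifPn => h.
  by apply: eq_integral => u _; rewrite patchE in_slab h.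
by rewrite integral0_eq// => u _; rewrite patchE in_slab (negPf h).
Qed.

Section approx.
Variables (f : R -> U -> O -> R) (I : R -> O -> R).
Hypothesis hI : is_poisson_integral P F nu p f I.
Hypothesis mf : measurable_fun [set: OR * U] (fun y => f y.1.2 y.2 y.1.1).

Let mI t : 0 <= t -> measurable_fun setT (I t).
Proof. by move=> t0; apply: (Fmeas uh t0); case: hI => + _ _; apply. Qed.

Let mH (H : simple_field F nu) : mart P F (HI H).
Proof.
exact: (mart_fam uh pp (@lohi H) (@mxi H) (@bxi H) (@sf_set_meas _ _ _ _ _ _ H) (@sf_set_fin _ _ _ _ _ _ H)).
Qed.

(** [sf_integral] counts on (lo, hi] directly, the family integral subtracts the count on (0, lo]
    from that on (0, hi]; the two agree where the counts are finite. *)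
Let sfE (H : simple_field F nu) t : 0 <= t -> {ae P, forall w, sf_integral H p t w = HI H t w}.
Proof.
move=> t0.
have hi0 k : 0 <= hi H k by case/andP: (lohi (H := H) k) => h /(le_trans h).
have lo0 k : 0 <= lo H k by case/andP: (lohi (H := H) k).
have G : {ae P, forall w, forall k, compZ nu p (A_ H k) (Num.min (hi H k) t) w - compZ nu p (A_ H k) (Num.min (lo H k) t) w
  = compN nu p (Num.min (lo H k) t) (Num.min (hi H k) t) (A_ H k) w}.
  apply: filter_forall => k; apply: (compZ_incr pp) => //; [by rewrite le_min lo0 t0| |exact: sf_set_meas|exact: sf_set_fin].
  by rewrite le_min ge_min ge_min lexx orbT andbT; case/andP: (lohi (H := H) k) => _ ->.
apply: filterS G => w Gw; rewrite /sf_integral /fam_integral; apply: eq_bigr => k _.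
by rewrite /transform Gw.
Qed.

Let msf (H : simple_field F nu) t : 0 <= t -> measurable_fun setT (sf_integral H p t).
Proof.
move=> t0.
have lo0 k : 0 <= lo H k by case/andP: (lohi (H := H) k).
apply: measurable_sum => k; apply: measurable_funM; first exact: (Fmeas uh (lo0 k) (@mxi H k)).
have h1 : 0 <= Num.min (lo H k) t by rewrite le_min lo0 t0.
have h2 : Num.min (lo H k) t <= Num.min (hi H k) t.
  by rewrite le_min ge_min ge_min lexx orbT andbT; case/andP: (lohi (H := H) k) => _ ->.
by have [] := compN_L2 pp h1 h2 (@sf_set_meas _ _ _ _ _ _ H k) (@sf_set_fin _ _ _ _ _ _ H k).
Qed.

Lemma poisson_approx (s t e : R) : 0 <= s -> s <= t -> 0 < e ->
  exists H : simple_field F nu,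
  [/\ L2 P setT (fun w => HI H s w - I s w) /\
        \int[P]_w ((HI H s w - I s w) ^+ 2) <= e,
      L2 P setT (fun w => HI H t w - I t w) /\
        \int[P]_w ((HI H t w - I t w) ^+ 2) <= e &
      L2 QN (slab s t) (fun y => HF H y - f y.1.2 y.2 y.1.1) /\
      \int[QN]_(y in slab s t) ((HF H y - f y.1.2 y.2 y.1.1) ^+ 2) <= e].
Proof.
move=> s0 st e0; have t0 := le_trans s0 st.
have [aI cI [H HP]] := hI.
have [_ hs] := HP s s0; have [ht1 ht2] := HP t t0.
have fs : \forall k \near \oo, (\int[P]_w ((sf_integral (H k) p s w - I s w) ^+ 2)%:E <= e%:E)%E.
  by apply: (ereal_cvg0_le hs e0) => k; apply: integral_ge0 => w _; rewrite lee_fin sqr_ge0.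
have ft : \forall k \near \oo, (\int[P]_w ((sf_integral (H k) p t w - I t w) ^+ 2)%:E <= e%:E)%E.
  by apply: (ereal_cvg0_le ht2 e0) => k; apply: integral_ge0 => w _; rewrite lee_fin sqr_ge0.
have fh : \forall k \near \oo, (\int[P]_w \int[lebesgue_measure]_(r in `]0%R, t]) \int[nu]_u
           ((sf_eval (H k) r u w - f r u w) ^+ 2)%:E <= e%:E)%E.
  apply: (ereal_cvg0_le ht1 e0) => k; do 3 (apply: integral_ge0 => ? _).
  by rewrite lee_fin sqr_ge0.
have [k [[k1 k2] k3]] := filter_ex (filterI (filterI fs ft) fh).
have aux r : 0 <= r ->
    (\int[P]_w ((sf_integral (H k) p r w - I r w) ^+ 2)%:E <= e%:E)%E ->
    L2 P setT (fun w => HI (H k) r w - I r w) /\ \int[P]_w ((HI (H k) r w - I r w) ^+ 2) <= e.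
  move=> r0 fe.
  have mhi : measurable_fun setT (fun w => HI (H k) r w - I r w).
    by apply: measurable_funB; [have [_ l _] := mH (H k); case: (l r r0)|exact: mI].
  have E : (\int[P]_w ((HI (H k) r w - I r w) ^+ 2)%:E =
      \int[P]_w ((sf_integral (H k) p r w - I r w) ^+ 2)%:E)%E.
    apply: ae_eq_integral => //.
    - by apply/measurable_EFinP; exact: measurable_funX.
    - by apply/measurable_EFinP; apply: measurable_funX; apply: measurable_funB; [exact: msf|exact: mI].
    - by apply: filterS (sfE (H k) r0) => w -> _.
  have l2 : L2 P setT (fun w => HI (H k) r w - I r w).
    split => //; apply/integrableP; split; first by apply/measurable_EFinP; exact: measurable_funX.
    under eq_integral do rewrite /= ger0_norm ?sqr_ge0//.
    by rewrite E (le_lt_trans fe)// ltry.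
  by split => //; rewrite -lee_fin RintegralE//; [rewrite E|exact: l2.2].
exists (H k); split; [exact: aux|exact: aux|].
have mD : measurable (slab s t : set (OR * U)) by exact: measurable_slab.
have md : measurable_fun setT (fun y => HF (H k) y - f y.1.2 y.2 y.1.1).
  apply: measurable_funB => //.
  exact: (measurable_fam_fun uh (@lohi (H k)) (@mxi (H k)) (@sf_set_meas _ _ _ _ _ _ (H k))).
have md2 : measurable_fun setT (fun y => ((HF (H k) y - f y.1.2 y.2 y.1.1) ^+ 2)%:E).
  by apply/measurable_EFinP; exact: measurable_funX.
have le1 : (\int[QN]_(y in slab s t) ((HF (H k) y - f y.1.2 y.2 y.1.1) ^+ 2)%:E <= e%:E)%E.
  apply: le_trans k3.
  rewrite -[leRHS](@ge0_slab_fubini 0 t (fun y => ((HF (H k) y - f y.1.2 y.2 y.1.1) ^+ 2)%:E))//; last first.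
    by move=> y; rewrite lee_fin sqr_ge0.
  apply: ge0_subset_integral => //.
  + exact: measurable_slab.
  + exact: measurable_funTS.
  + by move=> y _; rewrite lee_fin sqr_ge0.
  + by move=> [[w r] u] [[_ /=]]; rewrite in_itv/= => /andP[sr rt] _; split => //; split => //=; rewrite in_itv/= rt (le_lt_trans s0).
have l2 : L2 QN (slab s t) (fun y => HF (H k) y - f y.1.2 y.2 y.1.1).
  split; first exact: measurable_funTS.
  apply/integrableP; split; first exact: measurable_funTS.
  under eq_integral do rewrite /= ger0_norm ?sqr_ge0//.
  by rewrite (le_lt_trans le1)// ltry.
by split => //; rewrite -lee_fin RintegralE//; exact: l2.2.
Qed.

Lemma poisson_L2 t : 0 <= t -> L2 P setT (I t).
Proof.
move=> t0; have [H [_ [h2 _] _]] := poisson_approx t0 (lexx t) ltr01.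
have [_ l2 _] := mH H.
have -> : I t = (fun w => HI H t w - (HI H t w - I t w)) by apply/funext => w; ring.
by apply: L2B => //; exact: l2.
Qed.

End approx.
End poisson_estimate.

Lemma sqr_subB (R : realDomainType) (a b a' b' : R) :
  (a - b - (a' - b')) ^+ 2 <= 2 * (a - a') ^+ 2 + 2 * (b - b') ^+ 2.
Proof. by have := sqr_ge0 ((a - a') + (b - b')); nra. Qed.

Lemma sqr_le2 (R : realDomainType) (a b : R) : a ^+ 2 <= 2 * (b ^+ 2 + (a - b) ^+ 2).
Proof. by have := sqr_ge0 (2 * b - a); nra. Qed.

Lemma ler_add2 (R : realDomainType) (x y e : R) : x <= e -> y <= e -> 2 * x + 2 * y <= 4 * e.
Proof. by move=> *; lra. Qed.

Section poisson_incr.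
Context {dO : measure_display} {O : measurableType dO} {R : realType}.
Variables (P : probability O R) (F : R -> set (set O)).
Context {dU : measure_display} {U : measurableType dU}.
Variables (nu : {sigma_finite_measure set U -> \bar R}) (p : O -> R -> option U).
Hypothesis uh : usual_hypotheses P F.
Hypothesis pp : poisson_point_process P F nu p.
Local Notation leb := (@lebesgue_measure R).
Local Notation QN := ((P \x leb) \x nu)%E.
Local Notation OR := (O * measurableTypeR R)%type.

Let PT : (P setT < +oo)%E. Proof. by rewrite probability_setT ltry. Qed.

Variables (f1 f2 : R -> U -> O -> R) (I1 I2 : R -> O -> R).
Hypothesis hI1 : is_poisson_integral P F nu p f1 I1.
Hypothesis hI2 : is_poisson_integral P F nu p f2 I2.
Hypothesis mf1 : measurable_fun [set: OR * U] (fun y => f1 y.1.2 y.2 y.1.1).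
Hypothesis mf2 : measurable_fun [set: OR * U] (fun y => f2 y.1.2 y.2 y.1.1).
Let g (y : OR * U) := f1 y.1.2 y.2 y.1.1 - f2 y.1.2 y.2 y.1.1.
Variables (s t : R) (phi : O -> R) (M : R).
Hypotheses (s0 : 0 <= s) (st : s <= t).
Hypothesis mphi : measurable_wrt (F s) phi.
Hypothesis phiM : forall w, 0 <= phi w <= M.
Local Notation D := (slab s t : set (OR * U)).
Hypothesis g1 : L1 QN D g.
Hypothesis g2 : L2 QN D g.

Let t0 : 0 <= t. Proof. exact: le_trans st. Qed.
Let M0 : 0 <= M. Proof. by have /andP[p0 pM] := phiM point; exact: le_trans pM. Qed.
Let phi0 w : 0 <= phi w. Proof. by case/andP: (phiM w). Qed.
Let phin w : `|phi w| <= M. Proof. by have /andP[p0 pM] := phiM w; rewrite ger0_norm. Qed.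
Let mD : measurable D. Proof. exact: measurable_slab. Qed.
Let mphi' := Fmeas uh s0 mphi.
Let Y w := (I1 t w - I2 t w) - (I1 s w - I2 s w).
Let iY : L2 P setT Y.
Proof.
have h r : 0 <= r -> L2 P setT (fun w => I1 r w - I2 r w).
  by move=> r0; apply: L2B => //; [exact: (poisson_L2 uh pp hI1)|exact: (poisson_L2 uh pp hI2)].
by apply: L2B => //; exact: h.
Qed.
Let phiP (f : O -> R) : L1 P setT f -> L1 P setT (fun w => phi w * f w).
Proof. by move=> fi; apply: (@L1Mb _ _ _ _ _ _ _ M). Qed.
Let phiQ (f : OR * U -> R) : L1 QN D f -> L1 QN D (fun y => phi y.1.1 * f y).
Proof.
move=> fi; apply: (@L1Mb _ _ _ _ _ _ _ M) => //.
by apply: measurable_funTS; apply: measurableT_comp => //; exact: measurableT_comp.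
Qed.
Let iYn : L1 P setT (fun w => phi w * `|Y w|).
Proof. by apply: phiP; apply: L1_norm => //; exact: L2_L1. Qed.
Let ign : L1 QN D (fun y => phi y.1.1 * `|g y|).
Proof. by apply: phiQ; exact: L1_norm. Qed.

Section core.
Variables (e th th' : R) (B : set U).
Hypotheses (e0 : 0 < e) (th0 : 0 < th) (th'0 : 0 < th') (mB : measurable B) (fB : (nu B < +oo)%E).
Let CB : set U := ~` B.
Let mCB : measurable CB. Proof. exact: measurableC. Qed.
Let indB (C : set U) : measurable C -> measurable_fun setT (fun y : OR * U => \1_C y.2 : R).
Proof.
move=> mC; have m1 : measurable_fun setT (\1_C : U -> R) by exact: measurable_indic.
exact: (measurableT_comp m1 measurable_snd).
Qed.

(** Y splits into an approximation error [Er], the approximating integral over B, bounded by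
    [fam_L1], and the one over the complement, bounded by [fam_L1_sqr]. The approximating integrand
    differs from g by G, which is small in L^2 only; on B, of finite measure, |G| <= th' + G^2 / th'
    makes it small in L^1. Of the coefficients of e, 16 / th comes from [Er], 8 / th from the
    complement and 8 / th' from B. In [poisson_incr_L1] the limits are taken in the order e, th', B,
    th. *)
Lemma poisson_incr_core :
  \int[P]_w (phi w * `|Y w|) <= 2 * \int[QN]_(y in D) (phi y.1.1 * `|g y|)
    + 2 * M * th
    + 2 * M * th' * \int[QN]_(y in D) (\1_B y.2 : R)
    + 2 * M * th^-1 * \int[QN]_(y in D) (g y ^+ 2 * \1_CB y.2)
    + M * (24 * th^-1 + 8 * th'^-1) * e.
Proof.
have [H1 [[as1 bs1] [at1 bt1] [aq1 bq1]]] := poisson_approx uh pp hI1 mf1 s0 st e0.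
have [H2 [[as2 bs2] [at2 bt2] [aq2 bq2]]] := poisson_approx uh pp hI2 mf2 s0 st e0.
(* The difference of the two approximating fields as one family: the terms of H1 together with those
   of H2, the latter with opposite sign. *)
pose K : finType := ('I_(sp_size (sf_proc H1)) + 'I_(sp_size (sf_proc H2)))%type.
pose lo (k : K) := match k with inl i => sp_lo i | inr i => sp_lo i end.
pose hi (k : K) := match k with inl i => sp_hi i | inr i => sp_hi i end.
pose xi (k : K) (w : O) : R := match k with inl i => sp_xi i w | inr i => (-1) * sp_xi i w end.
pose A (k : K) : set U := match k with inl i => sf_set i | inr i => sf_set i end.
have lohi k : 0 <= lo k <= hi k by case: k => i; exact: sp_ord.
have mxi k : measurable_wrt (F (lo k)) (xi k).
  case: k => i; first exact: sp_meas.
  have l0 : 0 <= @sp_lo O R F (sf_proc H2) i by case/andP: (@sp_ord O R F (sf_proc H2) i).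
  have Fl := Fsig uh l0.
  by apply: (wrtM Fl); [exact: (wrt_cst Fl)|exact: sp_meas].
have bxi k : exists M : R, forall w, `|xi k w| <= M.
  case: k => i; [have [C h] := sp_bounded (sf_proc H1)|have [C h] := sp_bounded (sf_proc H2)]; exists C => w //=.
  by rewrite normrM normrN normr1 mul1r.
have mA k : measurable (A k) by case: k => i; exact: sf_set_meas.
have fA k : (nu (A k) < +oo)%E by case: k => i; exact: sf_set_fin.
have fsub (C : set U) : measurable C -> forall k, (nu (A k `&` C) < +oo)%E.
  move=> mC k; apply: le_lt_trans (fA k); apply: le_measure; rewrite ?inE//; first exact: measurableI.
have msub (C : set U) : measurable C -> forall k, measurable (A k `&` C) by move=> mC k; exact: measurableI.
pose FI A' := fam_integral nu p lo hi xi A'.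
pose FF A' := fam_fun (U := U) lo hi xi A'.
pose h1 r w := fam_integral nu p (@sp_lo _ _ _ (sf_proc H1)) (@sp_hi _ _ _ (sf_proc H1)) (@sp_xi _ _ _ (sf_proc H1)) (@sf_set _ _ _ _ _ _ H1) r w.
pose h2 r w := fam_integral nu p (@sp_lo _ _ _ (sf_proc H2)) (@sp_hi _ _ _ (sf_proc H2)) (@sp_xi _ _ _ (sf_proc H2)) (@sf_set _ _ _ _ _ _ H2) r w.
pose q1 y := fam_fun (@sp_lo _ _ _ (sf_proc H1)) (@sp_hi _ _ _ (sf_proc H1)) (@sp_xi _ _ _ (sf_proc H1)) (@sf_set _ _ _ _ _ _ H1) y.
pose q2 y := fam_fun (@sp_lo _ _ _ (sf_proc H2)) (@sp_hi _ _ _ (sf_proc H2)) (@sp_xi _ _ _ (sf_proc H2)) (@sf_set _ _ _ _ _ _ H2) y.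
have FIE r w : FI A r w = h1 r w - h2 r w.
  rewrite /FI /fam_integral big_sumType /=; congr (_ + _).
  rewrite /h2 /fam_integral -sumrN; apply: eq_bigr => k _; rewrite /transform /=; ring.
have FFE y : FF A y = q1 y - q2 y.
  rewrite /FF /fam_fun big_sumType /=; congr (_ + _).
  rewrite /q2 /fam_fun -sumrN; apply: eq_bigr => k _ /=; ring.
have FFI (C : set U) y : FF (fun k => A k `&` C) y = FF A y * \1_C y.2.
  rewrite /FF /fam_fun mulr_suml; apply: eq_bigr => k _; rewrite indicI /=; ring.
pose E1 w := h1 t w - I1 t w; pose E2 w := h2 t w - I2 t w.
pose E3 w := h1 s w - I1 s w; pose E4 w := h2 s w - I2 s w.
pose Er w := E2 w + E3 w - E1 w - E4 w.
pose D1 w := FI (fun k => A k `&` B) t w - FI (fun k => A k `&` B) s w.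
pose D2 w := FI (fun k => A k `&` CB) t w - FI (fun k => A k `&` CB) s w.
have lEr : L2 P setT Er by apply: L2B => //; apply: L2B => //; exact: L2D.
have lD C : measurable C -> L2 P setT (fun w => FI (fun k => A k `&` C) t w - FI (fun k => A k `&` C) s w).
  by move=> mC; exact: (mart_incr (mart_fam uh pp lohi mxi bxi (msub _ mC) (fsub _ mC))).
have lD1 := lD _ mB; have lD2 := lD _ mCB.
have hs r : 0 <= r -> {ae P, forall w, FI A r w = FI (fun k => A k `&` B) r w + FI (fun k => A k `&` CB) r w}.
  by move=> r0; exact: (fam_split pp xi lohi mA fA mB r0).
have aeY : {ae P, forall w, Y w = Er w + D1 w + D2 w}.
  apply: filterS2 (hs t t0) (hs s s0) => w e1 e2.
  rewrite !FIE in e1 e2; rewrite /Y /Er /E1 /E2 /E3 /E4 /D1 /D2; lra.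
have iD1 : L1 P setT (fun w => phi w * `|D1 w|) by apply: phiP; apply: L1_norm => //; exact: L2_L1.
have iD2 : L1 P setT (fun w => phi w * `|D2 w|) by apply: phiP; apply: L1_norm => //; exact: L2_L1.
have iE : L1 P setT (fun w => phi w * `|Er w|) by apply: phiP; apply: L1_norm => //; exact: L2_L1.
have step1 : \int[P]_w (phi w * `|Y w|) <= \int[P]_w (phi w * `|Er w|) + \int[P]_w (phi w * `|D1 w|)
    + \int[P]_w (phi w * `|D2 w|).
  rewrite -RintegralDr// -RintegralDr//; last exact: L1D.
  apply: ae_ler_Rint => //; first by apply: L1D => //; exact: L1D.
  apply: filterS aeY => w -> _; rewrite -!mulrDr ler_wpM2l//.
  by rewrite (le_trans (ler_normD _ _))// lerD2r ler_normD.
have i0 : 0 <= th^-1 by rewrite invr_ge0 ltW.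
have i0' : 0 <= th'^-1 by rewrite invr_ge0 ltW.
have stepE : \int[P]_w (phi w * `|Er w|) <= M * th + M * th^-1 * 16 * e.
  have iS : L1 P setT (fun w => 4 * (E1 w ^+ 2 + E2 w ^+ 2 + (E3 w ^+ 2 + E4 w ^+ 2))).
    apply: L1Z => //; apply: L1D => //; apply: L1D => //; [exact: at1.2|exact: at2.2|exact: as1.2|exact: as2.2].
  apply: (@le_trans _ _ (\int[P]_w (M * th + M * th^-1 * (4 * (E1 w ^+ 2 + E2 w ^+ 2 + (E3 w ^+ 2 + E4 w ^+ 2)))))).
    apply: ler_Rint => //.
      by apply: L1D => //; [exact: (@L1_bnd _ _ _ _ _ _ `|M * th|)|exact: L1Z].
    move=> w _; apply: (@le_trans _ _ (M * (th + th^-1 * Er w ^+ 2))).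
      by apply: ler_pM => //; [case/andP: (phiM w)|exact: norm_le_sqr].
    rewrite mulrDr lerD2l -mulrA ler_wpM2l// ler_wpM2l// /Er.
    move: (E1 w) (E2 w) (E3 w) (E4 w) => a b c d'.
    rewrite -subr_ge0 (_ : _ - _ = (a + b) ^+ 2 + (a + c) ^+ 2 + (a - d') ^+ 2 + (b - c) ^+ 2 + (b + d') ^+ 2 + (c + d') ^+ 2); last by ring.
    by rewrite !addr_ge0 ?sqr_ge0.
  have iM : L1 P setT (fun=> M * th) by exact: (@L1_bnd _ _ _ _ _ _ `|M * th|).
  rewrite RintegralDr//; last exact: L1Z.
  rewrite Rintegral_cst//= probability_setT mulr1 lerD2l.
  rewrite RintegralZl//.
  rewrite -[leRHS]mulrA ler_wpM2l ?mulr_ge0// RintegralZl//; last first.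
    by apply: L1D => //; apply: L1D => //; [exact: at1.2|exact: at2.2|exact: as1.2|exact: as2.2].
  rewrite RintegralDr//; [|by apply: L1D => //; [exact: at1.2|exact: at2.2]|by apply: L1D => //; [exact: as1.2|exact: as2.2]].
  rewrite RintegralDr//; [|exact: at1.2|exact: at2.2].
  rewrite RintegralDr//; [|exact: as1.2|exact: as2.2].
  move: bs1 bt1 bs2 bt2; rewrite -/(E1 _).
  rewrite -[X in X <= e -> _]/(\int[P]_w (E3 w ^+ 2)) => k1.
  rewrite -[X in X <= e -> _]/(\int[P]_w (E1 w ^+ 2)) => k2.
  rewrite -[X in X <= e -> _]/(\int[P]_w (E4 w ^+ 2)) => k3.
  rewrite -[X in X <= e -> _]/(\int[P]_w (E2 w ^+ 2)) => k4.
  move: k1 k2 k3 k4; move: (\int[P]_w (E1 w ^+ 2)) (\int[P]_w (E2 w ^+ 2)) (\int[P]_w (E3 w ^+ 2)) (\int[P]_w (E4 w ^+ 2)) => ? ? ? ?; lra.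
pose G y := FF A y - g y.
have lG : L2 QN D G.
  have -> : G = (fun y => (q1 y - f1 y.1.2 y.2 y.1.1) - (q2 y - f2 y.1.2 y.2 y.1.1)).
    by apply/funext => y; rewrite /G FFE /g; ring.
  exact: L2B.
have bG : \int[QN]_(y in D) (G y ^+ 2) <= 4 * e.
  pose q1' y := (q1 y - f1 y.1.2 y.2 y.1.1) ^+ 2; pose q2' y := (q2 y - f2 y.1.2 y.2 y.1.1) ^+ 2.
  have i1 : L1 QN D q1' := aq1.2; have i2 : L1 QN D q2' := aq2.2.
  apply: (@le_trans _ _ (\int[QN]_(y in D) (2 * q1' y + 2 * q2' y))).
    apply: ler_Rint => //; [exact: lG.2|by apply: L1D => //; exact: L1Z|].
    move=> y _; rewrite /q1' /q2' /G FFE /g.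
    exact: sqr_subB.
  rewrite RintegralDr//; [|exact: L1Z|exact: L1Z].
  rewrite !RintegralZl//.
  have k1 : \int[QN]_(y in D) q1' y <= e := bq1.
  have k2 : \int[QN]_(y in D) q2' y <= e := bq2.
  exact: ler_add2.
have iB : L1 QN D (fun y => \1_B y.2 : R).
  have := slab_indic P s t mB fB (a := fun=> 1) ltac:(by []) (ex_intro _ 1 (fun z => _)).
  case; first by rewrite normr1.
  by move=> h _; apply: (eq_integrable mD (EFin \o (fun y => 1 * \1_B y.2)) _ _ h) => y _ /=; rewrite mul1r.
have mg : measurable_fun D g := L1_meas g1.
have ig2B : L1 QN D (fun y => g y ^+ 2 * \1_CB y.2).
  apply: (@L1_dom _ _ _ _ _ _ (fun y => g y ^+ 2)) => //; last exact: g2.2.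
    by apply: measurable_funM; [exact: measurable_funX|exact: measurable_funTS (indB mCB)].
  move=> y _; rewrite normrM ger0_norm ?sqr_ge0// ler_piMr ?sqr_ge0//.
  by rewrite indicE; case: (_ \in _); rewrite ?normr1 ?normr0.
have stepD1 : \int[P]_w (phi w * `|D1 w|) <= 2 * \int[QN]_(y in D) (phi y.1.1 * `|g y|)
    + 2 * M * th' * \int[QN]_(y in D) (\1_B y.2 : R) + M * 8 * th'^-1 * e.
  have bphi : exists M : R, forall w, `|phi w| <= M by exists M.
  apply: le_trans (fam_L1 uh pp lohi mxi bxi (msub _ mB) (fsub _ mB) s0 st mphi phi0 bphi) _.
  have -> : M * 8 * th'^-1 * e = 2 * (M * th'^-1 * (4 * e)) by ring.
  rewrite -!mulrA -!mulrDr ler_wpM2l//.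
  have iF := fam_fun_L1 uh lohi mxi bxi (msub _ mB) (fsub _ mB) s t mphi' bphi.
  pose r1 (y : OR * U) : R := phi y.1.1 * `|g y|.
  pose r2 (y : OR * U) : R := \1_B y.2.
  pose r3 (y : OR * U) : R := G y ^+ 2.
  have i2 : L1 QN D (fun y => (M * th') * r2 y) by exact: L1Z.
  have i3 : L1 QN D (fun y => (M * th'^-1) * r3 y) by apply: L1Z => //; exact: lG.2.
  have i12 : L1 QN D (fun y => r1 y + (M * th') * r2 y) by exact: L1D.
  apply: (@le_trans _ _ (\int[QN]_(y in D) (r1 y + (M * th') * r2 y + (M * th'^-1) * r3 y))).
    apply: ler_Rint => //; first exact: L1D.
    move=> y _; have := FFI B y; rewrite /FF => ->.
    rewrite /r1 /r2 /r3; have /andP[p0 pM] := phiM y.1.1.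
    rewrite indicE; case: (_ \in B); last first.
      rewrite !mulr0 normr0 mulr0 addr0.
      by apply: addr_ge0; apply: mulr_ge0 => //; [exact: mulr_ge0|exact: sqr_ge0].
    rewrite !mulr1 -addrA.
    apply: (@le_trans _ _ (phi y.1.1 * (`|g y| + (th' + th'^-1 * G y ^+ 2)))).
      rewrite ler_wpM2l// -[fam_fun _ _ _ _ _](subrK (g y)) addrC (le_trans (ler_normD _ _))//.
      rewrite lerD2l; exact: norm_le_sqr.
    rewrite mulrDr lerD2l -mulrA -mulrDr ler_wpM2r// addr_ge0 ?(ltW th'0)// mulr_ge0 ?sqr_ge0//.
  rewrite RintegralDr// RintegralDr//.
  rewrite !RintegralZl//; last exact: lG.2.
  by rewrite -!mulrA !lerD2l// !ler_wpM2l.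
have stepD2 : \int[P]_w (phi w * `|D2 w|) <= M * th + 2 * M * th^-1 * \int[QN]_(y in D) (g y ^+ 2 * \1_CB y.2) +
    M * 8 * th^-1 * e.
  apply: le_trans (fam_L1_sqr uh pp lohi mxi bxi (msub _ mCB) (fsub _ mCB) s0 st mphi phiM th0) _.
  rewrite -addrA lerD2l.
  have -> x : 2 * M * th^-1 * x + M * 8 * th^-1 * e = th^-1 * (2 * M * x + 2 * M * (4 * e)) by ring.
  rewrite ler_wpM2l//.
  have bphi : exists M : R, forall w, `|phi w| <= M by exists M.
  have [iF _] := fam_isometry uh pp lohi mxi bxi (msub _ mCB) (fsub _ mCB) s0 st mphi bphi.
  pose r2 (y : OR * U) : R := g y ^+ 2 * \1_CB y.2.
  pose r3 (y : OR * U) : R := G y ^+ 2.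
  have i2 : L1 QN D (fun y => (2 * M) * r2 y) by exact: L1Z.
  have i3 : L1 QN D (fun y => (2 * M) * r3 y) by apply: L1Z => //; exact: lG.2.
  apply: (@le_trans _ _ (\int[QN]_(y in D) ((2 * M) * r2 y + (2 * M) * r3 y))).
    apply: ler_Rint => //; first exact: L1D.
    move=> y _; have := FFI CB y; rewrite /FF => ->.
    rewrite /r2 /r3; have /andP[p0 pM] := phiM y.1.1.
    rewrite indicE; case: (_ \in CB); last first.
      by rewrite !mulr0 expr0n/= !mulr0 add0r; apply: mulr_ge0; [exact: mulr_ge0|exact: sqr_ge0].
    rewrite !mulr1 -mulrDr -mulrA.
    apply: (@le_trans _ _ (phi y.1.1 * (2 * (g y ^+ 2 + G y ^+ 2)))).
      by rewrite ler_wpM2l// sqr_le2.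
    by rewrite mulrCA ler_wpM2l// ler_wpM2r// addr_ge0 ?sqr_ge0.
  rewrite RintegralDr// !RintegralZl//; last exact: lG.2.
  by rewrite lerD2l ler_wpM2l// mulr_ge0.
apply: le_trans step1 _; apply: le_trans (lerD (lerD stepE stepD1) stepD2) _.
by rewrite le_eqVlt; apply/orP; left; apply/eqP; ring.
Qed.

End core.

(* On a set of finite nu-mass the integral is a difference of two L^1 terms of equal mean; on the
   complement it is small in L^2. *)
Lemma poisson_incr_L1 :
  \int[P]_w (phi w * `|(I1 t w - I2 t w) - (I1 s w - I2 s w)|) <=
  2 * \int[QN]_(y in slab s t) (phi y.1.1 * `|f1 y.1.2 y.2 y.1.1 - f2 y.1.2 y.2 y.1.1|).
Proof.
rewrite -[X in _ <= 2 * X]/(\int[QN]_(y in D) (phi y.1.1 * `|g y|)).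
rewrite -[X in X <= _]/(\int[P]_w (phi w * `|Y w|)).
have [A AT /all_and2[mA fA]] := sigma_finiteT nu.
pose B m := \big[setU/set0]_(i < m) A i.
have mB m : measurable (B m) by apply: bigsetU_measurable => i _.
have fB m : (nu (B m) < +oo)%E.
  elim: m => [|m IH]; first by rewrite /B big_ord0 measure0 ltry.
  rewrite /B big_ord_recr/=; apply: (le_lt_trans (measureU2 nu (mB m) (mA m))).
  by apply: lte_add_pinfty; [exact: IH|exact: fA].
have g20 := g2.2.
have mg : measurable_fun D g := L1_meas g1.
have T0 : \int[QN]_(y in D) (g y ^+ 2 * \1_(~` B m) y.2) @[m --> \oo] --> (0 : R).
  have -> : 0 = \int[QN]_(y in D) (0 : R) by rewrite /Rintegral integral0.
  apply: (Rint_dominated mD _ g20) => //.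
  - move=> m; apply: measurable_funM; first exact: measurable_funX.
    have mC : measurable (~` B m) by exact: measurableC.
    have m1 : measurable_fun setT (\1_(~` B m) : U -> R) by exact: measurable_indic.
    by apply: measurable_funTS; exact: (measurableT_comp m1 measurable_snd).
  - move=> m y _; rewrite normrM ger0_norm ?sqr_ge0// ler_piMr ?sqr_ge0//.
    by rewrite indicE; case: (_ \in _); rewrite ?normr1 ?normr0.
  - move=> y _; apply: cvg_near_cst.
    have : [set: U] y.2 by []; rewrite AT => -[n _ An].
    exists n.+1 => // m /= nm; rewrite indicE memNset ?mulr0// => h; apply: h.
    rewrite /B -bigcup_mkord; exists n => //.
pose Z := 2 * \int[QN]_(y in D) (phi y.1.1 * `|g y|).
apply: (@ler_addC_eps _ _ _ (2 * M)) => th th0; rewrite -/Z.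
have step m : \int[P]_w (phi w * `|Y w|) <= Z + 2 * M * th + 2 * M * th^-1 * \int[QN]_(y in D) (g y ^+ 2 * \1_(~` B m) y.2).
  apply: (@ler_addC_eps _ _ _ (2 * M * \int[QN]_(y in D) (\1_(B m) y.2 : R))) => th' th'0.
  apply: (@ler_addC_eps _ _ _ (M * (24 * th^-1 + 8 * th'^-1))) => e e0.
  apply: le_trans (poisson_incr_core e0 th0 th'0 (mB m) (fB m)) _.
  by rewrite le_eqVlt; apply/orP; left; apply/eqP; rewrite -/Z; ring.
have : Z + 2 * M * th + 2 * M * th^-1 * \int[QN]_(y in D) (g y ^+ 2 * \1_(~` B m) y.2) @[m --> \oo] -->
    Z + 2 * M * th + 2 * M * th^-1 * 0.
  by apply: cvgD; [exact: cvg_cst|exact: cvgMl_tmp].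
rewrite mulr0 addr0 => c.
by apply: (cvgr_to_ge c); apply: nearW => m; exact: step.
Qed.

End poisson_incr.

(** * The smoothed norm and the Osgood condition *)

Section smooth_norm.
Context {R : realType} {d : nat}.
Implicit Types x y dl l : 'I_d -> R.

Definition vnorm x : R := Num.sqrt (\sum_k x k ^+ 2).
Definition fnorm (e : R) x : R := Num.sqrt (\sum_k x k ^+ 2 + e ^+ 2).

Lemma sumsq_ge0 x : 0 <= \sum_k x k ^+ 2.
Proof. by apply: sumr_ge0 => k _; exact: sqr_ge0. Qed.

Lemma vnorm_ge0 x : 0 <= vnorm x. Proof. exact: sqrtr_ge0. Qed.

Lemma hsnorm_vnorm (x : 'cV[R]_d) : hsnorm x = vnorm (fun k => x k ord0).
Proof.
rewrite /hsnorm /vnorm; congr Num.sqrt; rewrite /mxtrace; apply: eq_bigr => k _.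
by rewrite mxE big_ord1 mxE expr2.
Qed.

Lemma hsnorm_sqr m n (A : 'M[R]_(m, n)) : hsnorm A ^+ 2 = \sum_i \sum_j A i j ^+ 2.
Proof.
have E : \tr (A *m A^T) = \sum_i \sum_j A i j ^+ 2.
  rewrite /mxtrace; apply: eq_bigr => i _; rewrite mxE; apply: eq_bigr => j _.
  by rewrite mxE expr2.
rewrite /hsnorm E sqr_sqrtr//; apply: sumr_ge0 => i _; apply: sumr_ge0 => j _; exact: sqr_ge0.
Qed.

Lemma le_coord_vnorm x k : `|x k| <= vnorm x.
Proof.
rewrite -sqrtr_sqr ler_wsqrtr// (bigD1 k)//= lerDl.
by apply: sumr_ge0 => j _; exact: sqr_ge0.
Qed.

Lemma fnorm_gt0 e x : 0 < e -> 0 < fnorm e x.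
Proof. by move=> e0; rewrite sqrtr_gt0 ltr_wpDl ?sumsq_ge0// exprn_gt0. Qed.

Lemma fnorm_ge e x : 0 < e -> e <= fnorm e x.
Proof.
move=> e0; rewrite -{1}(ger0_norm (ltW e0)) -sqrtr_sqr ler_wsqrtr//.
by rewrite lerDr sumsq_ge0.
Qed.

Lemma vnorm_le_fnorm e x : vnorm x <= fnorm e x.
Proof. by rewrite ler_wsqrtr// lerDl sqr_ge0. Qed.

Lemma fnorm0 e : 0 < e -> fnorm e (fun=> 0) = e.
Proof.
move=> e0; rewrite /fnorm big1 ?add0r ?sqrtr_sqr ?ger0_norm ?ltW// => k _.
by rewrite expr0n.
Qed.

Lemma vnorm0 : vnorm (fun=> 0) = 0.
Proof. by rewrite /vnorm big1 ?sqrtr0// => k _; rewrite expr0n. Qed.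

Lemma le_coord_fnorm e x k : `|x k| <= fnorm e x.
Proof. exact: le_trans (le_coord_vnorm x k) (vnorm_le_fnorm e x). Qed.

(** Concavity of the square root: the right side squared exceeds a^2 + b by (b / (2a))^2. *)
Lemma sqrt_tangent (a b : R) : 0 < a -> 0 <= a ^+ 2 + b ->
  Num.sqrt (a ^+ 2 + b) <= a + b / (2 * a).
Proof.
move=> a0 ab; have a20 : 0 < 2 * a by rewrite mulr_gt0.
have E : a + b / (2 * a) = (2 * a ^+ 2 + b) / (2 * a) by field; rewrite gt_eqF.
have r0 : 0 <= a + b / (2 * a).
  by rewrite E divr_ge0 ?(ltW a20)//; have := sqr_ge0 a; lra.
rewrite -[leRHS]ger0_norm// -sqrtr_sqr ler_wsqrtr//.
have -> : (a + b / (2 * a)) ^+ 2 = a ^+ 2 + b + (b / (2 * a)) ^+ 2 by field; rewrite gt_eqF.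
by rewrite lerDl sqr_ge0.
Qed.

(** The increment is measured in the l^1 norm because the jump estimates come one coordinate at a
    time; |x k| <= f(x) makes the cross term fit without the Cauchy-Schwarz inequality. *)
Lemma fnorm_lip e x l : 0 < e -> fnorm e (fun k => x k + l k) <= fnorm e x + \sum_k `|l k|.
Proof.
move=> e0; have f0 := fnorm_gt0 x e0.
have S0 : 0 <= \sum_k `|l k| by apply: sumr_ge0.
rewrite -[leRHS]ger0_norm ?addr_ge0 ?(ltW f0)// -sqrtr_sqr ler_wsqrtr//.
have -> : (fnorm e x + \sum_k `|l k|) ^+ 2 = fnorm e x ^+ 2 + 2 * fnorm e x * (\sum_k `|l k|) + (\sum_k `|l k|) ^+ 2.
  by ring.
have -> : fnorm e x ^+ 2 = \sum_k x k ^+ 2 + e ^+ 2.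
  by rewrite sqr_sqrtr// addr_ge0 ?sumsq_ge0 ?sqr_ge0.
have -> : \sum_k (x k + l k) ^+ 2 = \sum_k x k ^+ 2 + 2 * (\sum_k x k * l k) + \sum_k l k ^+ 2.
  by rewrite mulr_sumr -!big_split; apply: eq_bigr => k _ /=; ring.
have -> : \sum_k x k ^+ 2 + 2 * (\sum_k x k * l k) + \sum_k l k ^+ 2 + e ^+ 2 =
  \sum_k x k ^+ 2 + e ^+ 2 + 2 * (\sum_k x k * l k) + \sum_k l k ^+ 2 by ring.
rewrite -!(addrA (_ + e ^+ 2)) lerD2l; apply: lerD.
  rewrite -mulrA ler_wpM2l// mulr_sumr; apply: ler_sum => k _.
  by rewrite (le_trans (ler_norm _))// normrM ler_wpM2r// le_coord_fnorm.
rewrite expr2 mulr_suml; apply: ler_sum => k _.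
rewrite -[leLHS]real_normK ?num_real// expr2 ler_wpM2l//.
by rewrite (bigD1 k)//= lerDl sumr_ge0.
Qed.

Lemma fnorm_tangent e x dl : 0 < e ->
  fnorm e (fun k => x k + dl k) <=
  fnorm e x + (2 * (\sum_k x k * dl k) + \sum_k dl k ^+ 2) / (2 * fnorm e x).
Proof.
move=> e0; have f0 := fnorm_gt0 x e0.
have S : \sum_k (x k + dl k) ^+ 2 = \sum_k x k ^+ 2 + 2 * (\sum_k x k * dl k) + \sum_k dl k ^+ 2.
  by rewrite mulr_sumr -!big_split; apply: eq_bigr => k _ /=; ring.
have E : \sum_k (x k + dl k) ^+ 2 + e ^+ 2 = fnorm e x ^+ 2 + (2 * (\sum_k x k * dl k) + \sum_k dl k ^+ 2).
  by rewrite sqr_sqrtr ?addr_ge0 ?sumsq_ge0 ?sqr_ge0// S; ring.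
by rewrite {1}/fnorm E; apply: sqrt_tangent => //; rewrite -E addr_ge0 ?sumsq_ge0 ?sqr_ge0.
Qed.

(* The free parameter th of Young's inequality separates the squares of a and m; it is sent to 0
   so that the square of m keeps the coefficient 1/2. *)
Lemma fnorm_step e th x a m l : 0 < e -> 0 < th ->
  fnorm e (fun k => x k + a k + m k + l k) - fnorm e x <=
  (\sum_k x k * a k) / fnorm e x + (\sum_k x k * m k) / fnorm e x
  + ((1 + th) * \sum_k m k ^+ 2 + (1 + th^-1) * \sum_k a k ^+ 2) / (2 * fnorm e x)
  + \sum_k `|l k|.
Proof.
move=> e0 th0; have f0 := fnorm_gt0 x e0.
have h1 := fnorm_lip (fun k => x k + a k + m k) l e0.
have h2 := fnorm_tangent x (fun k => a k + m k) e0.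
have E : (fun k => x k + (a k + m k)) = (fun k => x k + a k + m k).
  by apply/funext => k; rewrite addrA.
rewrite E in h2; move: h1 h2; set f := fnorm e x.
have i0 : 0 < th^-1 by rewrite invr_gt0.
have sq : \sum_k (a k + m k) ^+ 2 <= (1 + th) * \sum_k m k ^+ 2 + (1 + th^-1) * \sum_k a k ^+ 2.
  rewrite !mulr_sumr -big_split; apply: ler_sum => k _ /=.
  have ei : th * th^-1 = 1 by rewrite divff// gt_eqF.
  have : 0 <= th * (m k - th^-1 * a k) ^+ 2 by rewrite mulr_ge0 ?sqr_ge0// ltW.
  have -> : th * (m k - th^-1 * a k) ^+ 2 = th * m k ^+ 2 - 2 * (th * th^-1) * (m k * a k) + (th * th^-1) * (th^-1 * a k ^+ 2) by ring.
  rewrite ei; lra.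
have -> : \sum_k x k * (a k + m k) = \sum_k x k * a k + \sum_k x k * m k.
  by rewrite -big_split; apply: eq_bigr => k _; rewrite mulrDr.
have f20 : 0 <= (2 * f)^-1 by rewrite invr_ge0 mulr_ge0// ltW.
have h3 := ler_wpM2r f20 sq.
have -> : (2 * (\sum_k x k * a k + \sum_k x k * m k) + \sum_k (a k + m k) ^+ 2) / (2 * f) =
  (\sum_k x k * a k) / f + (\sum_k x k * m k) / f + (\sum_k (a k + m k) ^+ 2) / (2 * f).
  by field; rewrite gt_eqF.
lra.
Qed.

End smooth_norm.

Section concave_modulus.
Context {R : realType}.
Variable rho : R -> R.
Hypothesis rho0 : forall r, 0 <= r -> 0 <= rho r.
Hypothesis rho_mono : forall r s, 0 <= r -> r <= s -> rho r <= rho s.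
Hypothesis rho_concave : convex_function (`[0, +oo[%classic : set R^o) (fun r : R^o => - rho r).

(** For r > m, the point m lies between 0 and r, so concavity and rho 0 >= 0 give rho m >= (m / r)
    rho r. Integrated against a variable of mean at most m, the right side is at most 2 rho m. *)
Lemma concave_le_linear m r : 0 < m -> 0 <= r -> rho r <= rho m * (1 + r / m).
Proof.
move=> m0 r0; have pm : 0 <= rho m by exact/rho0/ltW.
have [rm|mr] := leP r m.
  by rewrite (le_trans (rho_mono r0 rm))// ler_peMr// lerDl divr_ge0// ltW.
have r1 : 0 < r by exact: lt_trans mr.
have t01 : 0 <= m / r <= 1.
  by rewrite divr_ge0 ?(ltW m0) ?(ltW r1)//= ler_pdivrMr// mul1r ltW.
pose t : {i01 R} := Itv01 (andP t01).1 (andP t01).2.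
have := @rho_concave t r 0; rewrite !inE/= !in_itv/= !andbT => /(_ (ltW r1) (lexx 0)).
rewrite /conv /= => H.
have : m / r * - rho r + (1 - m / r) * - rho 0 >= - rho (m / r * r + (1 - m / r) * 0) by exact: H.
rewrite divfK ?gt_eqF// mulr0 addr0 => H'.
have p0 : 0 <= (1 - m / r) * rho 0.
  by have /andP[_ h1] := t01; rewrite mulr_ge0 ?rho0// subr_ge0.
have H2 : m / r * rho r <= rho m by lra.
have mr0 : 0 < m / r by rewrite divr_gt0.
have : rho r <= rho m * (r / m).
  by rewrite -invf_div ler_pdivlMr// mulrC.
by rewrite mulrDr mulr1; lra.
Qed.

(** The truncation at 0 is there because nothing is assumed of rho at negative arguments. *)
Lemma measurable_modulus : measurable_fun setT (fun r : R => rho (Num.max r 0)).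
Proof.
apply: nondecreasing_measurable => // x y xy.
apply: rho_mono; first by rewrite le_max lexx orbT.
by rewrite ge_max !le_max xy lexx orbT.
Qed.

Hypothesis rho_pos : forall r, 0 < r -> 0 < rho r.
Hypothesis rho_osgood : forall e : R, 0 < e ->
  (\int[lebesgue_measure]_(r in `]0%R, e[) ((rho r)^-1)%:E)%E = +oo%E.

(** If V T = v > 0, consider the levels v 2^-m. Since rho is nondecreasing, the integral of 1 / rho
    over the band from [lev m.+1] to [lev m] is at most lev (m+1) / rho (lev (m+1)). This is twice
    the height of the band below divided by rho at its top, hence at most 2 C times the time V takes
    to climb that lower band. These times add up to at most T, so 1 / rho has a finite integral on
    (0, v), against the Osgood condition. No derivative of V is involved. *)
Lemma osgood (V : R -> R) (C : R) : 0 <= C -> V 0 = 0 ->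
  (forall s t, 0 <= s -> s <= t -> V s <= V t <= V s + C * (t - s) * rho (V t)) ->
  forall t, 0 <= t -> V t = 0.
Proof.
move=> C0 V0 HV T T0.
have VT0 : 0 <= V T by have /andP[+ _] := HV 0 T (lexx 0) T0; rewrite V0.
apply/eqP; rewrite eq_le VT0 andbT leNgt; apply/negP => v0.
set v := V T in v0 VT0.
pose K := C * rho v; have K0 : 0 <= K by rewrite mulr_ge0// rho0.
have lipV s t : 0 <= s -> s <= t -> t <= T -> V t <= V s + K * (t - s).
  move=> s0 st tT; have t0 := le_trans s0 st.
  have /andP[h1 h2] := HV s t s0 st; have /andP[h3 _] := HV t T t0 tT.
  have Vt0 : 0 <= V t by have /andP[+ _] := HV 0 t (lexx 0) t0; rewrite V0.
  apply: (le_trans h2); rewrite lerD2l /K mulrAC ler_wpM2r ?subr_ge0// ler_wpM2l//.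
  exact: rho_mono.
(* Clamping the time makes a function that is Lipschitz on the whole line, to which the intermediate
   value theorem applies. *)
pose W t := V (Num.min (Num.max t 0) T).
have Wlip s t : s <= t -> 0 <= W t - W s <= K * (t - s).
  move=> st; rewrite /W; set s' := Num.min (Num.max s 0) T; set t' := Num.min (Num.max t 0) T.
  have s'0 : 0 <= s' by rewrite le_min le_max lexx orbT.
  have t'T : t' <= T by rewrite ge_min lexx orbT.
  have st' : s' <= t'.
    by rewrite /s' /t' le_min !ge_min lexx orbT andbT orbC ge_max !le_max st lexx !orbT.
  have /andP[h1 _] := HV s' t' s'0 st'; have h2 := lipV s' t' s'0 st' t'T.
  have h3 : t' - s' <= t - s.
    rewrite /s' /t' lerBlDr addr_minr le_min; apply/andP; split.
      by rewrite ge_min addr_maxr addr0 subrK ge_max !le_max lexx subr_ge0 st orbT.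
    by rewrite ge_min lerDr subr_ge0 st orbT.
  rewrite subr_ge0 h1 lerBlDl (le_trans h2)// lerD2l ler_wpM2l//.
have contW : continuous W.
  move=> x; apply/cvgrPdist_le => e e0.
  have eK : 0 < e / (K + 1) by rewrite divr_gt0// ltr_wpDl.
  near=> y.
  have dxy : `|x - y| <= e / (K + 1).
    by near: y; apply/nbhs_ballP; exists (e / (K + 1)) => // y /ltW.
  have H : `|W x - W y| <= K * `|x - y|.
    have [xy|/ltW xy] := leP y x.
      have /andP[h1 h2] := Wlip _ _ xy.
      by rewrite !ger0_norm// subr_ge0.
    have /andP[h1 h2] := Wlip _ _ xy.
    by rewrite distrC (distrC x) !ger0_norm// subr_ge0.
  apply: (le_trans H); apply: (le_trans (ler_wpM2l K0 dxy)).
  by rewrite mulrCA ler_piMr ?(ltW e0)// ler_pdivrMr ?ltr_wpDl// mul1r lerDl.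
have WE t : 0 <= t -> t <= T -> W t = V t.
  by move=> t0 tT; rewrite /W (max_idPl t0) (min_idPl tT).
have ivt t w : 0 <= t -> t <= T -> 0 <= w -> w <= V t -> exists2 u, 0 <= u <= t & V u = w.
  move=> t0 tT w0 wV.
  have c : {within `[0, t], continuous W} by exact: continuous_subspaceT.
  have := IVT t0 c (v := w); rewrite !WE// V0 => -[].
    by rewrite ge_min w0 le_max wV orbT.
  by move=> u; rewrite in_itv/= => /andP[u0 ut] Wu; exists u; rewrite ?u0 ?ut// -WE// (le_trans ut).
pose lev m := v * 2^-1 ^+ m : R.
have lev0 m : 0 < lev m by rewrite mulr_gt0// exprn_gt0// invr_gt0.
have levS m : lev m = 2 * lev m.+1 by rewrite /lev exprS; field.
pose F r := (rho (Num.max r 0))^-1.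
have FE m r : lev m < r -> F r = (rho r)^-1.
  by move=> h; rewrite /F (max_idPl _)// (le_trans (ltW (lev0 m)))// ltW.
have mF : measurable_fun setT (EFin \o F).
  apply/measurable_EFinP.
  have -> : F = (@powR R ^~ (-1)) \o (fun r => rho (Num.max r 0)).
    by apply/funext => r; rewrite /= powR_inv1// rho0// le_max lexx orbT.
  by apply: measurableT_comp; [exact: measurable_powR|exact: measurable_modulus].
have F0 r : 0 <= F r by rewrite invr_ge0 rho0// le_max lexx orbT.
(* The invariant carries the time t at which V is at [lev m.+1], one level below the integrated
   range: that band pays for the next step of the induction. *)
have bound m : exists t, [/\ 0 <= t, t <= T, V t = lev m.+1 &
   (\int[lebesgue_measure]_(r in `]lev m, v]) (F r)%:E <= (2 * C * (T - t))%:E)%E].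
  elim: m => [|m [t [t0 tT Vt H]]].
    have [||u /andP[u0 uT] Vu] := ivt T (lev 1) T0 (lexx T); first exact: ltW.
      by rewrite -/v {1}/lev expr1 ler_piMr ?ltW// invf_lt1// ltr1n.
    exists u; split => //.
    rewrite /lev expr0 mulr1 set_itvoc0 integral_set0 lee_fin.
    by rewrite !mulr_ge0// subr_ge0.
  have [||u /andP[u0 ut] Vu] := ivt t (lev m.+2) t0 tT; first exact: ltW.
    by rewrite Vt [leRHS]levS; have := lev0 m.+2; lra.
  exists u; split => //; first exact: le_trans tT.
  have lm : lev m.+1 <= lev m by rewrite [leRHS]levS; have := lev0 m.+1; lra.
  have lv : lev m <= v by rewrite /lev ler_piMr ?(ltW v0)// exprn_ile1// invf_le1// ler1n.
  rewrite (@itv_bndbnd_setU _ _ (BRight (lev m.+1)) (BRight (lev m)))// ge0_integral_setU//=; last 3 first.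
  - exact: measurable_funTS.
  - by move=> r _; rewrite lee_fin.
  - apply/disj_setPS => r [/=]; rewrite !in_itv/= => /andP[_ h1] /andP[h2 _].
    by have := lt_le_trans h2 h1; rewrite ltxx.
  have pr : 0 < rho (lev m.+1) by exact: rho_pos.
  have H1 : (\int[lebesgue_measure]_(r in `]lev m.+1, lev m]) (F r)%:E <= (2 * C * (t - u))%:E)%E.
    apply: (@le_trans _ _ (\int[lebesgue_measure]_(r in `]lev m.+1, lev m]) ((rho (lev m.+1))^-1)%:E)%E).
      apply: ge0_le_integral => //=.
      - by move=> r _; rewrite lee_fin.
      - exact: measurable_funTS.
      - move=> r; rewrite in_itv/= => /andP[h1 _]; rewrite lee_fin (FE m.+1)//.
        rewrite lef_pV2 ?posrE//; [|apply: rho_pos; exact: lt_trans h1].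
        by apply: rho_mono; exact: ltW.
    rewrite integral_cst//= lebesgue_measure_itv/= lte_fin.
    case: ifPn => [_|_]; last by rewrite mule0 lee_fin !mulr_ge0// subr_ge0.
    rewrite -EFinB -EFinM lee_fin.
    have -> : lev m - lev m.+1 = lev m.+1 by rewrite [lev m]levS; ring.
    rewrite mulrC ler_pdivrMr//.
    have /andP[_] := HV u t u0 ut; rewrite Vt Vu => h.
    by have := levS m.+1; lra.
  apply: (le_trans (leeD H1 H)); rewrite -EFinD lee_fin; lra.
have cvgI := @ge0_nondecreasing_set_cvg_integral _ (measurableTypeR R) R (fun m => `]lev m, v]%classic) (EFin \o F) (@lebesgue_measure R).
have : (\int[lebesgue_measure]_(r in `]0%R, v[) ((rho r)^-1)%:E <= (2 * C * T)%:E)%E.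
  apply: (@le_trans _ _ (\int[lebesgue_measure]_(r in \bigcup_m `]lev m, v]%classic) (F r)%:E)%E).
    have -> : (\int[lebesgue_measure]_(r in `]0%R, v[) ((rho r)^-1)%:E = \int[lebesgue_measure]_(r in `]0%R, v[) (F r)%:E)%E.
      by apply: eq_integral => r; rewrite inE/= in_itv/= => /andP[h _]; rewrite /F (max_idPl (ltW h)).
    apply: ge0_subset_integral => //=.
    - by apply: bigcup_measurable => m _; exact: measurable_itv.
    - exact: measurable_funTS.
    - by move=> r _; rewrite lee_fin.
    - move=> r /=; rewrite in_itv/= => /andP[r0 rv].
      have : lev m @[m --> \oo] --> (0 : R).
        rewrite -[X in _ --> X](mulr0 v); apply: cvgMl_tmp; apply: cvg_expr.
        by rewrite ger0_norm ?invr_ge0// invf_lt1// ltr1n.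
      move=> /cvgr_lt => /(_ _ r0) [m _ /(_ m (leqnn m)) /= mr].
      by exists m => //=; rewrite in_itv/= mr ltW.
  have cI : (\int[lebesgue_measure]_(r in `]lev m, v]) (EFin \o F) r)%E @[m --> \oo] -->
     (\int[lebesgue_measure]_(r in \bigcup_m `]lev m, v]%classic) (EFin \o F) r)%E.
    apply: cvgI.
    - move=> m k mk; apply/subsetPset => r /=; rewrite !in_itv/= => /andP[h ->]; rewrite andbT.
      apply: le_lt_trans h; rewrite /lev ler_wpM2l ?(ltW v0)//.
      by rewrite ler_wiXn2l// ?invr_ge0// invf_le1// ler1n.
    - by move=> m; exact: measurable_itv.
    - by move=> m; exact: measurable_funTS.
    - by move=> m r _; rewrite lee_fin.
  rewrite -(cvg_lim _ cI)//; apply: lime_le; first by apply/cvg_ex; eexists; exact: cI.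
  apply: nearW => m; have [t [t0 tT _ H]] := bound m.
  by apply: (le_trans H); rewrite lee_fin ler_wpM2l// ?mulr_ge0// gerBl.
by rewrite rho_osgood// leNgt ltry.
Unshelve. all: by end_near. Qed.

End concave_modulus.

(** * Cadlag paths and grids *)

Section paths.
Context {R : realType}.

Lemma near_dist_le (F : set_system R) (FF : Filter F) (f : R -> R) (l e : R) :
  f s @[s --> F] --> l -> 0 < e -> \forall s \near F, `|l - f s| <= e.
Proof. by move=> /cvgrPdist_le h e0; exact: h. Qed.

Lemma near_right_ex (P : set R) (t : R) : (\forall u \near t^'+, P u) ->
  exists2 eta : R, 0 < eta & forall u, t < u -> u < t + eta -> P u.
Proof.
move=> /nbhs_ballP[e /= e0 h]; exists e => // u tu ut; apply: h => //.
by rewrite /ball/= distrC ger0_norm ?subr_ge0 ?ltW// ltrBlDl.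
Qed.

Lemma near_left_ex (P : set R) (t : R) : (\forall u \near t^'-, P u) ->
  exists2 eta : R, 0 < eta & forall u, t - eta < u -> u < t -> P u.
Proof.
move=> /nbhs_ballP[e /= e0 h]; exists e => // u tu ut; apply: h => //.
by rewrite /ball/= ger0_norm ?subr_ge0 ?ltW// ltrBlDl -ltrBlDr.
Qed.

Lemma cadlag_bounded (x : R -> R) (T : R) :
  (forall t, 0 <= t -> x s @[s --> t^'+] --> x t) ->
  (forall t, 0 < t -> exists l : R, x s @[s --> t^'-] --> l) ->
  exists M : R, forall u, 0 <= u <= T -> `|x u| <= M.
Proof.
move=> xr xl; have := @segment_compact R 0 T => /compact_near_coveringP H.
(* The bound M is carried by the filter at +oo, so that the local bounds merge by compactness into
   one M for the whole segment. *)
suff : pinfty_nbhs R [set M : R | `[0, T]%classic `<=` (fun u => 0 <= u -> `|x u| <= M)].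
  move=> [M [_ HM]]; exists (M + 1) => u uT.
  have MM : M < M + 1 by rewrite ltrDl.
  by apply: (HM _ MM u) => /=; rewrite ?in_itv//=; case/andP: uT.
apply: (H R (pinfty_nbhs R) (fun M u => 0 <= u -> `|x u| <= M)) => t.
  rewrite /= in_itv/= => /andP[t0 tT].
  have [e1 e10 h1] := near_right_ex (near_dist_le _ (xr t t0) ltr01).
  have [e2 e20 [M2 h2]] : exists2 e2 : R, 0 < e2 & exists M2 : R, forall u, t - e2 < u -> u < t -> 0 <= u -> `|x u| <= M2.
    move: t0; rewrite le_eqVlt => /orP[/eqP <-|t0].
      by exists 1 => //; exists 0 => u _ u0; rewrite leNgt u0.
    have [l xl'] := xl t t0.
    have [e2 e20 h2] := near_left_ex (near_dist_le _ xl' ltr01).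
    exists e2 => //; exists (`|l| + 1) => u h h' _.
    by rewrite -[x u](subKr l) (le_trans (ler_normB _ _))// lerD2l h2.
  pose e := Num.min e1 e2; have e0 : 0 < e by rewrite lt_min e10.
  pose M0 := Num.max (`|x t| + 1) M2.
  exists (ball t e, [set M | M0 <= M]) => /=.
    split; first exact: nbhsx_ballx.
    by exists M0; split; [exact: num_real|move=> M /ltW].
  move=> [u M] [/= tu MM] u0; apply: le_trans MM; rewrite le_max.
  have [tu'|ut|<-] := ltgtP t u.
  - apply/orP; left; rewrite -[x u](subKr (x t)) (le_trans (ler_normB _ _))// lerD2l h1//.
    move: tu; rewrite /ball/= distrC ger0_norm ?subr_ge0 ?ltW// ltrBlDl => /lt_le_trans; apply.
    by rewrite lerD2l ge_min lexx.
  - apply/orP; right; apply: h2 => //.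
    move: tu; rewrite /ball/= ger0_norm ?subr_ge0 ?ltW// => tu.
    have : e <= e2 by rewrite ge_min lexx orbT.
    lra.
  - by rewrite lerDl ler01.
Qed.

(** Jumps of size above 1 / (m+1) are isolated from the left: just before t the path is close to its
    left limit y t, and so are the left limits there. A rational between the previous such jump and
    t can thus be chosen, and distinct jumps receive distinct rationals. *)
Lemma countable_jumps (x y : R -> R) : (forall t, 0 < t -> x s @[s --> t^'-] --> y t) ->
  countable [set t | 0 < t /\ x t <> y t].
Proof.
move=> xy.
pose D m := [set t | 0 < t /\ m.+1%:R^-1 < `|x t - y t|].
have sub : [set t | 0 < t /\ x t <> y t] `<=` \bigcup_m D m.
  move=> t [t0 /eqP xyt]; have n0 : 0 < `|x t - y t| by rewrite normr_gt0 subr_eq0.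
  have [m hm] := ltr_add_invr n0.
  by exists m => //; split => //; rewrite add0r in hm.
apply: (sub_countable (subset_card_le sub)); apply: bigcup_countable => // m _.
have ex t : exists q : rat, D m t -> ratr q < t /\ forall s, ratr q < s -> s < t -> ~ D m s.
  have [[t0 dt]|nd] := pselect (D m t); last by exists 0%Q => /nd.
  have e0 : 0 < (2 * m.+1%:R)^-1 :> R by rewrite invr_gt0 mulr_gt0.
  have [eta eta0 h] := near_left_ex (near_dist_le _ (xy t t0) e0).
  have /rat_in_itvoo[q] : t - eta < t by rewrite gtrBl.
  rewrite in_itv/= => /andP[q1 q2]; exists q => _; split => // s qs st [s0].
  apply/negP; rewrite -leNgt.
  have k1 u : t - eta < u -> u <= s -> `|y t - x u| <= (2 * m.+1%:R)^-1.
    by move=> h1 h2; apply: h => //; exact: le_lt_trans st.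
  have ts : t - eta < s by exact: lt_trans qs.
  have k2 : `|y t - y s| <= (2 * m.+1%:R)^-1.
    have c : `|y t - x u| @[u --> s^'-] --> `|y t - y s|.
      by apply: cvg_norm; apply: cvgB; [exact: cvg_cst|exact: xy].
    apply: (cvgr_to_le c); near=> u; apply: k1; first by near: u; exact: nbhs_left_gt.
    by apply: ltW; near: u; exact: nbhs_left_lt.
  have := k1 s ts (lexx s) => k3.
  have -> : m.+1%:R^-1 = (2 * m.+1%:R)^-1 + (2 * m.+1%:R)^-1 :> R by field.
  have -> : x s - y s = (y t - y s) - (y t - x s) by ring.
  by rewrite (le_trans (ler_normB _ _))// lerD.
have [f hf] := choice ex.
apply/countable_injP; exists (fun t => pickle (f t)) => t t' /set_mem Dt /set_mem Dt' /(pcan_inj (@pickleK _)) e.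
have [ft ht] := hf t Dt; have [ft' ht'] := hf t' Dt'.
have [tt|tt|//] := ltgtP t t'.
- by exfalso; apply: (ht' t) => //; rewrite -e.
- by exfalso; apply: (ht t') => //; rewrite e.
Unshelve. all: by end_near. Qed.

(* For s > 0, the largest multiple of h that is strictly below s. *)
Definition qgrid (h s : R) : R := Num.max (((Num.ceil (s / h))%:~R - 1) * h) 0.

Lemma qgrid_ge0 h s : 0 <= qgrid h s. Proof. by rewrite le_max lexx orbT. Qed.

Lemma qgrid_lt h s : 0 < h -> 0 < s -> s - h <= qgrid h s < s.
Proof.
move=> h0 s0; have /andP[c1 c2] := ceil_itv (s / h).
rewrite /qgrid le_max gt_max s0 andbT; apply/andP; split; last first.
  by rewrite -ltr_pdivlMr//; move: c1; rewrite intrB.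
by apply/orP; left; rewrite mulrBl mul1r lerD2r -ler_pdivrMr.
Qed.

Lemma qgrid_itv h s (i : nat) : 0 < h -> i%:R * h < s -> s <= i.+1%:R * h -> qgrid h s = i%:R * h.
Proof.
move=> h0 s1 s2; rewrite /qgrid.
have -> : Num.ceil (s / h) = i.+1%:Z.
  apply: ceil_def; rewrite -[X in (X - 1)]/(Posz i.+1).
  rewrite (_ : (i.+1%:Z - 1)%:~R = i%:R :> R); last by rewrite intrB /= -[i.+1%:~R]/(i.+1%:R) -natr1 addrK.
  by rewrite ltr_pdivlMr// ler_pdivrMr// s1.
rewrite -[i.+1%:~R]/(i.+1%:R) -natr1 addrK; apply/max_idPl.
by rewrite mulr_ge0// ltW.
Qed.

Lemma cvg_qgrid (T : R) (s : R) : 0 < T -> 0 < s -> qgrid (T / m.+1%:R) s @[m --> \oo] --> s.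
Proof.
move=> T0 s0.
have hm (m : nat) : 0 < T / m.+1%:R by rewrite divr_gt0.
apply: (@squeeze_cvgr _ _ _ _ (fun m => s - T / m.+1%:R) (fun=> s)); last exact: cvg_cst.
- by apply: nearW => m; have /andP[-> /ltW ->] := qgrid_lt (hm m) s0.
- rewrite -[X in _ --> X]subr0; apply: cvgB; first exact: cvg_cst.
  rewrite -[X in _ --> X](mulr0 T); apply: cvgMl_tmp; exact: cvg_harmonic.
Qed.

(** [qgrid] lies strictly below s, so sampling on the grid sees the left limit even when s is itself
    a grid point or a jump time. *)
Lemma cvg_left_qgrid (x : R -> R) (l T s : R) : 0 < T -> 0 < s ->
  x u @[u --> s^'-] --> l -> x (qgrid (T / m.+1%:R) s) @[m --> \oo] --> l.
Proof.
move=> T0 s0 /cvg_at_leftP; apply; split; last exact: cvg_qgrid.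
move=> m; have h0 : 0 < T / m.+1%:R by rewrite divr_gt0.
by have /andP[_ ->] := qgrid_lt h0 s0.
Qed.

End paths.

Lemma measurable_countable_sel d (Z : measurableType d) (R : realType) (I : countType)
   (N : Z -> I) (G : I -> Z -> R) :
  (forall i, measurable [set z | N z = i]) -> (forall i, measurable_fun setT (G i)) ->
  measurable_fun setT (fun z => G (N z) z).
Proof.
move=> mN mG _ B mB; rewrite setTI.
have -> : (fun z => G (N z) z) @^-1` B = \bigcup_i ([set z | N z = i] `&` (G i @^-1` B)).
  apply/seteqP; split => z /=; first by move=> h; exists (N z).
  by move=> [i _ [/= <-]].
apply: countable_bigcupT_measurable; first exact: countableP.
by move=> i; apply: measurableI => //; rewrite -[X in measurable X]setTI; exact: mG.
Qed.

Lemma measurable_countable_mod d (Z : measurableType d) (R : realType) (D C : set Z) (f f' : Z -> R) :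
  (forall z : Z, measurable [set z]) -> measurable D -> countable C ->
  (forall z, D z -> ~ C z -> f z = f' z) -> measurable_fun D f' -> measurable_fun D f.
Proof.
move=> m1 mD cC ff' mf' _ B mB.
have mS S : S `<=` C -> measurable S.
  by move=> SC; apply: countable_measurable => //; exact: sub_countable (subset_card_le SC) cC.
have -> : D `&` f @^-1` B = ((D `&` f' @^-1` B) `\` C) `|` ((D `&` f @^-1` B) `&` C).
  apply/seteqP; split => z /=.
    move=> [Dz Bz]; have [Cz|Cz] := pselect (C z); [by right|left].
    by split => //; split => //; rewrite -ff'.
  by move=> [[[Dz Bz] Cz]|[]//]; rewrite ff'.
apply: measurableU; last by apply: mS => z [].
by apply: measurableD; [exact: mf'|exact: mS].
Qed.

Section vectors.
Context {R : realType} {d : nat}.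

Lemma cvg_cV (T : Type) (F : set_system T) (FF : Filter F) (f : T -> 'cV[R]_d) (l : 'cV[R]_d) :
  (forall k, f s k ord0 @[s --> F] --> l k ord0) -> f s @[s --> F] --> l.
Proof.
move=> h; apply/cvg_ballP => e e0.
have : \forall s \near F, forall k, ball (l k ord0) e (f s k ord0).
  by apply: filter_forall => k; have /cvg_ballP := h k; apply.
by apply: filterS => s hs; split => // i j; rewrite ord1; exact: hs.
Qed.

Lemma cvg_vnorm (T : Type) (F : set_system T) (FF : Filter F) (f : 'I_d -> T -> R) (l : 'I_d -> R) :
  (forall k, f k s @[s --> F] --> l k) -> vnorm (fun k => f k s) @[s --> F] --> vnorm l.
Proof.
move=> h; apply: (@cvg_comp _ _ _ (fun s => \sum_k f k s ^+ 2) (@Num.sqrt R) F (nbhs (\sum_k l k ^+ 2)) _); last exact: sqrt_continuous.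
apply: (@cvg_big R^o 'I_d +%R 0 predT add_continuous _ F _ (fun k s => f k s ^+ 2)).
- by move=> k _; rewrite expr2; under eq_fun do rewrite expr2; exact: cvgM.
Qed.

(** Y is rounded down to the lattice of mesh 1 / (m+1), so that only countably many sections of G
    occur; continuity of G in its first argument lets m tend to infinity. *)
Lemma measurable_caratheodory dZ (Z : measurableType dZ) (G : 'cV[R]_d -> Z -> R) (Y : Z -> 'cV[R]_d) :
  (forall k, measurable_fun setT (fun z => Y z k ord0)) ->
  (forall z, continuous (G ^~ z)) -> (forall v, measurable_fun setT (G v)) ->
  measurable_fun setT (fun z => G (Y z) z).
Proof.
move=> mY cG mG.
pose N (m : nat) z : {ffun 'I_d -> int} := [ffun k => Num.floor (Y z k ord0 * m.+1%:R)].
pose vec (m : nat) (i : {ffun 'I_d -> int}) : 'cV[R]_d := \col_k ((i k)%:~R / m.+1%:R).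
apply: (@measurable_fun_cvg _ _ _ _ (fun m z => G (vec m (N m z)) z)).
  move=> m; apply: (@measurable_countable_sel _ _ _ _ (N m) (fun i z => G (vec m i) z)) => // i.
  have -> : [set z | N m z = i] = \bigcap_(k in [set: 'I_d]) ((fun z => Y z k ord0) @^-1` `[(i k)%:~R / m.+1%:R, (i k + 1)%:~R / m.+1%:R[).
    apply/seteqP; split => z /=.
      move=> <- k _; rewrite /= in_itv/= ffunE ler_pdivrMr// ltr_pdivlMr//.
      exact: floor_itv.
    move=> h; apply/ffunP => k; rewrite ffunE; have := h k I.
    rewrite /= in_itv/= ler_pdivrMr// ltr_pdivlMr// => hk.
    exact: floor_def.
  apply: fin_bigcap_measurable; first exact: finite_finset.
  by move=> k _; rewrite -[X in measurable X]setTI; exact: mY.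
move=> z _; apply: (@cvg_comp _ _ _ (fun m => vec m (N m z)) (G ^~ z) _ (nbhs (Y z)) _); last exact: cG.
apply: cvg_cV => k.
apply: (@squeeze_cvgr _ _ _ _ (fun m => Y z k ord0 - m.+1%:R^-1) (fun=> Y z k ord0)); last exact: cvg_cst.
- apply: nearW => m; rewrite mxE ffunE; have /andP[h1 h2] := floor_itv (Y z k ord0 * m.+1%:R).
  rewrite ler_pdivrMr// h1 andbT ler_pdivlMr// mulrBl mulVf//.
  by rewrite lerBlDr ltW//; move: h2; rewrite intrD.
- rewrite -[X in _ --> X]subr0; apply: cvgB; first exact: cvg_cst.
  exact: cvg_harmonic.
Qed.

Lemma compact_ball_vnorm (n : R) : exists2 K : set 'cV[R]_d, compact K & forall x, hsnorm x <= n -> K x.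
Proof.
pose B : set 'rV[R]_d := [set v | forall i, `[- n, n]%classic (v ord0 i)].
have cB : compact B by apply: (@rV_compact R d (fun=> `[- n, n]%classic)) => i; exact: segment_compact.
exists (trmx @` B).
  apply: continuous_compact cB; apply: continuous_subspaceT => v.
  apply: cvg_cV; [exact: nbhs_filter|move=> k]; rewrite mxE; under eq_fun do rewrite mxE; exact: coord_continuous.
  move=> x xn; exists (x^T); last exact: trmxK.
move=> i /=; rewrite mxE in_itv/= -ler_norml (le_trans _ xn)// hsnorm_vnorm.
exact: (le_coord_vnorm (fun k => x k ord0)).
Qed.

Lemma continuous_bounded (g : 'cV[R]_d -> R) (n : R) : continuous g ->
  exists M : R, forall x, hsnorm x <= n -> `|g x| <= M.
Proof.
move=> cg; have [K cK hK] := compact_ball_vnorm n.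
have : compact (g @` K) by apply: continuous_compact cK; exact: continuous_subspaceT.
move=> /compact_bounded[M [_ hM]]; exists (M + 1) => x xn.
have MM : M < M + 1 by rewrite ltrDl.
by apply: (hM _ MM); exists x => //; exact: hK.
Qed.

End vectors.

(** * Coefficients along one solution *)

Lemma integral_countable_mod (R : realType) (D C : set R) (f f' : R -> R) :
  measurable (D : set (measurableTypeR R)) -> countable C ->
  (forall s, D s -> ~ C s -> f s = f' s) ->
  measurable_fun (D : set (measurableTypeR R)) f' ->
  (measurable_fun (D : set (measurableTypeR R)) f) /\
  (\int[@lebesgue_measure R]_(s in D) (f s)%:E = \int[@lebesgue_measure R]_(s in D) (f' s)%:E)%E.
Proof.
move=> mD cC ff' mf'.
have mf : measurable_fun (D : set (measurableTypeR R)) f.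
  exact: (@measurable_countable_mod _ (measurableTypeR R) R D C f f' (fun z => measurable_set1 z) mD cC ff' mf').
split => //; apply: ae_eq_integral => //.
- exact/measurable_EFinP.
- exact/measurable_EFinP.
- exists C; split.
  + by apply: (@countable_measurable _ (measurableTypeR R)) => // z; exact: measurable_set1.
  + exact: countable_lebesgue_measure0.
  + move=> s /= h; apply: contrapT => Cs; apply: h => Ds; congr EFin; exact: ff'.
Qed.

Lemma continuous_entry (R : realType) (T : topologicalType) m q (f : T -> 'M[R]_(m, q)) i j :
  continuous f -> continuous (fun x => f x i j).
Proof.
move=> cf x; apply: (@continuous_comp _ _ _ f (fun A : 'M[R]_(m, q) => A i j)); first exact: cf.
exact: coord_continuous.
Qed.

Section one_solution.
Context {dO : measure_display} {O : measurableType dO} {R : realType}.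
Variables (P : probability O R) (F : R -> set (set O)) (d : nat).
Context {dU : measure_display} {U : measurableType dU}.
Variables (nu : {sigma_finite_measure set U -> \bar R}) (p : O -> R -> option U).
Variables (b : 'cV[R]_d -> 'cV[R]_d) (sigma : 'cV[R]_d -> 'M[R]_d) (c : 'cV[R]_d -> U -> 'cV[R]_d).
Variables (W : R -> O -> 'cV[R]_d) (X : R -> O -> 'cV[R]_d).
Hypothesis uh : usual_hypotheses P F.
Hypothesis sa : standing_assumptions nu b sigma c.
Hypothesis sol : solution P F nu b sigma c W p X.
Variable n : nat.
Local Notation leb := (@lebesgue_measure R).
Local Notation OR := (O * measurableTypeR R)%type.
Local Notation tau := (exit_time X n).
Local Notation Y := (left_lim X).

Lemma sol_right w t : 0 <= t -> X s w @[s --> t^'+] --> X t w.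
Proof. by move=> t0; have [h _] := sol_cadlag sol w; exact: h. Qed.

Lemma sol_left w t : 0 < t -> X s w @[s --> t^'-] --> Y t w.
Proof. by move=> t0; have [_ h] := sol_cadlag sol w; have [l hl] := h t t0; exact: (cvgP l hl). Qed.

Lemma cvg_coord (F' : set_system R) (f : R -> 'cV[R]_d) (l : 'cV[R]_d) k : Filter F' ->
  f s @[s --> F'] --> l -> f s k ord0 @[s --> F'] --> l k ord0.
Proof. by move=> FF h; apply: (@cvg_comp _ _ _ f (fun A : 'cV[R]_d => A k ord0) _ _ _ h); exact: coord_continuous. Qed.

Lemma cvg_hsnorm (F' : set_system R) (f : R -> 'cV[R]_d) (l : 'cV[R]_d) : Filter F' ->
  f s @[s --> F'] --> l -> hsnorm (f s) @[s --> F'] --> hsnorm l.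
Proof.
move=> FF h; rewrite hsnorm_vnorm; under eq_fun do rewrite hsnorm_vnorm.
by apply: cvg_vnorm => k; exact: cvg_coord.
Qed.

Lemma measurable_sol t k : 0 <= t -> measurable_fun setT (fun w => X t w k ord0).
Proof. by move=> t0; exact: (Fmeas uh t0 (sol_adapted sol k t0)). Qed.

(** Set to 0 at nonpositive times, where the paths are unconstrained, so that measurability holds on
    the whole line. *)
Definition Yplus (z : OR) : 'cV[R]_d := if 0 < z.2 then Y z.2 z.1 else 0.

Lemma measurable_Yplus k : measurable_fun setT (fun z => Yplus z k ord0).
Proof.
have mpos : measurable_fun setT (fun z : OR => \1_(`]0, +oo[%classic) z.2 : R).
  have m1 : measurable_fun setT (\1_(`]0, +oo[%classic) : measurableTypeR R -> R) by exact: measurable_indic.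
  exact: (measurableT_comp m1 measurable_snd).
apply: (@measurable_fun_cvg _ OR R setT (fun m (z : OR) => \1_(`]0, +oo[%classic) z.2 * X (qgrid (1 / m.+1%:R) z.2) z.1 k ord0)).
  move=> m; apply: measurable_funM => //.
  pose G (i : int) (z : OR) := X (Num.max ((i%:~R - 1) * (1 / m.+1%:R)) 0) z.1 k ord0.
  apply: (@measurable_countable_sel _ _ _ _ (fun z : OR => Num.ceil (z.2 / (1 / m.+1%:R))) G).
    move=> i; have -> : [set z : OR | Num.ceil (z.2 / (1 / m.+1%:R)) = i] =
       setT `*` `](i - 1)%:~R / m.+1%:R, i%:~R / m.+1%:R].
      apply/seteqP; split => -[w s] /=.
        move=> <-; split => //; rewrite in_itv/= ltr_pdivrMr// ler_pdivlMr// div1r invrK.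
        exact: ceil_itv.
      move=> [_]; rewrite in_itv/= ltr_pdivrMr// ler_pdivlMr// div1r invrK => h.
      exact: ceil_def.
    by apply: measurableX.
  move=> i; rewrite /G; have t0 : 0 <= Num.max ((i%:~R - 1) * (1 / m.+1%:R)) 0 :> R by rewrite le_max lexx orbT.
  exact: (measurableT_comp (measurable_sol k t0) measurable_fst).
move=> [w s] _ /=; rewrite /Yplus /=; case: ifPn => s0.
  have H : X (qgrid (1 / m.+1%:R) s) w k ord0 @[m --> \oo] --> Y s w k ord0.
    apply: (@cvg_left_qgrid _ (fun t => X t w k ord0)) => //.
    by apply: cvg_coord; exact: sol_left.
  apply: cvg_trans H; apply: near_eq_cvg; apply: nearW => m.
  by rewrite indicE mem_set ?mul1r//= in_itv/= s0.
rewrite mxE; apply: cvg_near_cst; apply: nearW => m.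
by rewrite indicE memNset ?mul0r//= in_itv/= (negPf s0).
Qed.

Lemma uptoP w s : (upto tau s w = 1 /\ forall t, 0 <= t -> t < s -> hsnorm (X t w) <= n%:R) \/
  (upto tau s w = 0 /\ exists t, [/\ 0 <= t, t < s & n%:R < hsnorm (X t w)]).
Proof.
rewrite /upto; case: ifPn => h; [left|right]; split => //.
  move=> t t0 ts; rewrite leNgt; apply/negP => nt.
  have : (tau w <= t%:E)%E by apply: ereal_inf_lbound; exists t.
  by move=> /(le_trans h); rewrite lee_fin leNgt ts.
apply: contrapT => h'; move/negP: h; apply.
apply: le_ereal_inf_tmp => _ [t [t0 nt] <-]; rewrite lee_fin leNgt; apply/negP => ts.
by apply: h'; exists t.
Qed.

(** Being outside the closed ball is an open condition and the paths are right continuous, so an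
    exit strictly before s is already witnessed at a rational time before s. *)
Lemma measurable_upto : measurable_fun setT (fun z : OR => upto tau z.2 z.1).
Proof.
pose B : set OR := \bigcup_(q : rat) (if 0 <= (ratr q : R) then [set w | n%:R < hsnorm (X (ratr q) w)] `*` `]ratr q, +oo[ else set0).
have mB : measurable B.
  apply: bigcupT_measurable_rat => q; case: ifPn => // q0; apply: measurableX => //.
  have mh : measurable_fun setT (fun w => hsnorm (X (ratr q) w)).
    under eq_fun do rewrite hsnorm_vnorm.
    apply: (@measurableT_comp _ _ _ _ _ _ (@Num.sqrt R)).
      by apply: continuous_measurable_fun; exact: sqrt_continuous.
    by apply: measurable_sum => k; apply: measurable_funX; exact: measurable_sol.
  have := mh measurableT _ (measurable_itv `]n%:R, +oo[).
  rewrite setTI; congr (measurable _); apply/seteqP; split => w /=; by rewrite in_itv/= andbT.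
have -> : (fun z : OR => upto tau z.2 z.1) = \1_(~` B).
  apply/funext => -[w s] /=; rewrite indicE; have [[-> h]|[-> [t [t0 ts nt]]]] := uptoP w s.
    rewrite mem_set// => -[q _]; case: ifPn => // q0 [/= nq]; rewrite in_itv/= andbT => qs.
    by have := h _ q0 qs; rewrite leNgt nq.
  suff Bws : B (w, s) by rewrite memNset//= => /(_ Bws).
  have cv : hsnorm (X u w) @[u --> t^'+] --> hsnorm (X t w) by apply: cvg_hsnorm; exact: sol_right.
  have e0 : 0 < (hsnorm (X t w) - n%:R) / 2 by rewrite divr_gt0// subr_gt0.
  have [eta eta0 he] := near_right_ex (near_dist_le _ cv e0).
  have : t < Num.min s (t + eta) by rewrite lt_min ts ltrDl.
  move=> /rat_in_itvoo[q]; rewrite in_itv/= lt_min => /and3P[q1 q2 q3].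
  exists q => //; rewrite (le_trans t0 (ltW q1)); split => /=; last by rewrite in_itv/= q2.
  have := he _ q1 q3; rewrite ler_norml => /andP[_]; lra.
by apply: measurable_indic; exact: measurableC.
Qed.

Lemma left_bounded w s (M : R) : 0 < s -> (forall t, 0 <= t -> t < s -> hsnorm (X t w) <= M) -> hsnorm (Y s w) <= M.
Proof.
move=> s0 h.
have cv : hsnorm (X u w) @[u --> s^'-] --> hsnorm (Y s w) by apply: cvg_hsnorm; exact: sol_left.
apply: (cvgr_to_le cv); near=> t; apply: h.
  by apply: ltW; near: t; exact: nbhs_left_gt.
by near: t; exact: nbhs_left_lt.
Unshelve. all: by end_near. Qed.

Definition cut_ind (z : OR) : R := \1_(`]0, +oo[%classic) z.2 * upto tau z.2 z.1.

Lemma cut_indP z : (cut_ind z = 0) \/ [/\ cut_ind z = 1, 0 < z.2, upto tau z.2 z.1 = 1 & hsnorm (Yplus z) <= n%:R].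
Proof.
case: z => w s; rewrite /cut_ind /=; have [s0|s0] := boolP (0 < s); last first.
  by left; rewrite indicE memNset ?mul0r//= in_itv/= (negPf s0).
rewrite indicE mem_set/= ?in_itv/= ?s0// mul1r.
have [[e h]|[e _]] := uptoP w s; [right|by left].
by split => //; rewrite /Yplus /= s0; exact: left_bounded.
Qed.

Lemma measurable_cut_ind : measurable_fun setT cut_ind.
Proof.
apply: measurable_funM; last exact: measurable_upto.
have m1 : measurable_fun setT (\1_(`]0, +oo[%classic) : measurableTypeR R -> R) by exact: measurable_indic.
exact: (measurableT_comp m1 measurable_snd).
Qed.

(** Evaluation at the left limit keeps the coefficient bounded: at the exit time itself the
    indicator is still 1 and X may have jumped out of the ball, but its left limit is in the
    ball. *)
Definition cut (g : 'cV[R]_d -> R) (z : OR) : R := cut_ind z * g (Yplus z).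

Lemma measurable_cut g : continuous g -> measurable_fun setT (cut g).
Proof.
move=> cg; apply: measurable_funM; first exact: measurable_cut_ind.
apply: (@measurable_caratheodory _ _ _ _ (fun x _ => g x) Yplus) => //.
exact: measurable_Yplus.
Qed.

Lemma cut_bounded g M : (forall x, hsnorm x <= n%:R -> `|g x| <= M) -> 0 <= M -> forall z, `|cut g z| <= M.
Proof.
move=> gM M0 z; rewrite /cut; have [->|[-> _ _ h]] := cut_indP z.
  by rewrite mul0r normr0.
by rewrite mul1r gM.
Qed.

Definition cutc k (y : OR * U) : R := cut_ind y.1 * c (Yplus y.1) y.2 k ord0.

Lemma measurable_c v k : measurable_fun setT (fun u => c v u k ord0).
Proof.
have mc := sa_c_meas sa.
have m1 : measurable_fun setT (fun u : U => ((v, u) : borel 'cV[R]_d * U)) by exact: pair1_measurable.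
have m2 : measurable_fun setT (fun u : U => (c v u : borel 'cV[R]_d)) := measurableT_comp mc m1.
have m3 : measurable_fun setT (fun x : borel 'cV[R]_d => (x : 'cV[R]_d) k ord0).
  apply: (measurability _ (RGenOpens.measurableE R)) => // _ [_ [a [b0 ->] <-]].
  rewrite setTI; apply: sub_sigma_algebra.
  by apply: open_comp => [x _|]; [exact: coord_continuous|exact: interval_open].
exact: (measurableT_comp m3 m2).
Qed.

Lemma continuous_c u k : continuous (fun x => c x u k ord0).
Proof. by apply: (@continuous_entry _ _ _ _ (c ^~ u) k ord0); have [_ _ _ _ _ h _ _] := sa; exact: h. Qed.

Lemma measurable_cutc k : measurable_fun setT (cutc k).
Proof.
apply: measurable_funM; first exact: (measurableT_comp measurable_cut_ind measurable_fst).
apply: (@measurable_caratheodory _ _ _ _ (fun x (y : OR * U) => c x y.2 k ord0) (fun y => Yplus y.1)).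
- by move=> j; exact: (measurableT_comp (measurable_Yplus j) measurable_fst).
- by move=> y; exact: continuous_c.
- by move=> v; exact: (measurableT_comp (measurable_c v k) measurable_snd).
Qed.

(** Time 0 is included because the cut coefficients vanish there by convention. The set is
    countable, hence invisible to integrals in time. *)
Definition jumps w : set R := [set s | s = 0] `|` \bigcup_(k in [set: 'I_d]) [set s | 0 < s /\ X s w k ord0 <> Y s w k ord0].

Lemma countable_sol_jumps w : countable (jumps w).
Proof.
have -> : jumps w = \bigcup_(i in [set: bool]) (if i then [set 0] else \bigcup_(k in [set: 'I_d]) [set s | 0 < s /\ X s w k ord0 <> Y s w k ord0]).
  apply/seteqP; split => s; first by move=> [h|h]; [exists true|exists false].
  by move=> [[] _ h]; [left|right].
apply: bigcup_countable; first exact: countableP.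
move=> [] _; first exact: countable1.
apply: bigcup_countable; first exact: countableP.
move=> k _; apply: (@countable_jumps _ (fun s => X s w k ord0) (fun s => Y s w k ord0)) => t t0.
by apply: cvg_coord; exact: sol_left.
Qed.

Lemma cut_off_jumps g w s : 0 < s -> ~ jumps w s -> cut g (w, s) = upto tau s w * g (X s w).
Proof.
move=> s0 nj; rewrite /cut /cut_ind /Yplus /= s0 indicE mem_set/= ?in_itv/= ?s0// mul1r.
congr (_ * g _); apply/matrixP => k j; rewrite ord1.
by apply: contrapT => h; apply: nj; right; exists k => //; split => // /esym.
Qed.

Lemma stoppedP w t s : 0 <= t -> s <= stopped_time tau t w <-> s <= t /\ upto tau s w = 1.
Proof.
move=> t0; rewrite /stopped_time.
have tau0 : (0 <= tau w)%E by apply: le_ereal_inf_tmp => _ [r [r0 _] <-]; rewrite lee_fin.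
have fm : Order.min t%:E (tau w) \is a fin_num.
  rewrite ge0_fin_numE; first by rewrite (le_lt_trans _ (ltry t))// ge_min lexx.
  by rewrite le_min lee_fin t0.
rewrite -lee_fin fineK// le_min lee_fin /upto.
split; first by move=> /andP[-> ->].
by move=> [->]; case: ifPn => // _ /esym/eqP; rewrite oner_eq0.
Qed.

Lemma stopped_full w t : 0 <= t -> (forall r, 0 <= r -> r < t -> hsnorm (X r w) <= n%:R) -> stopped_time tau t w = t.
Proof.
move=> t0 h; apply/eqP; rewrite eq_le; apply/andP; split.
  by have [/(_ (lexx _))[]] := @stoppedP w t (stopped_time tau t w) t0.
apply/(stoppedP _ _ t0); split => //; have [[]//|[_ [r [r0 rt]]]] := uptoP w t.
by rewrite ltNge h.
Qed.

(** The processes M and L of [solution] serve unchanged. The bounded integrands differ from the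
    given ones only at countably many times, so every approximation condition and the drift integral
    keep their values. *)
Lemma solution_cut : exists (M : 'I_d -> 'I_d -> R -> O -> R) (L : 'I_d -> R -> O -> R),
  [/\ forall i j, is_ito_integral P F (fun t w => W t w j ord0)
        (fun s w => cut (fun x => sigma x i j) (w, s)) (M i j),
      forall i, is_poisson_integral P F nu p (fun s u w => cutc i ((w, s), u)) (L i) &
      {ae P, forall w, forall t, 0 <= t -> forall i,
        X (stopped_time tau t w) w i ord0 = X 0 w i ord0
          + (\int[leb]_(s in `]0%R, t]) cut (fun x => b x i ord0) (w, s))
          + \sum_(j < d) M i j t w + L i t w}].
Proof.
have [M [L [hM hL hX]]] := sol_eq sol n; exists M, L; split.
- move=> i j; have [aM cM [H HM]] := hM i j; split => //; exists H => T T0.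
  have [h1 h2] := HM T T0; split; last exact: h2.
  apply: cvg_trans h1; apply: near_eq_cvg; apply: nearW => k.
  apply: eq_integral => w _.
  have cs : continuous (fun x => sigma x i j).
    by apply: (@continuous_entry _ _ _ _ sigma i j); have [_ _ _ _ h _ _ _] := sa.
  have mh : measurable_fun (`]0, T]%classic : set (measurableTypeR R)) (fun s => (sp_eval (H k) s w - cut (fun x => sigma x i j) (w, s)) ^+ 2).
    apply: measurable_funTS; apply: measurable_funX; apply: measurable_funB.
      exact: (measurableT_comp (measurable_sp_fun uh (H k)) (pair1_measurable w)).
    exact: (measurableT_comp (measurable_cut cs) (pair1_measurable w)).
  have [|_ E] := @integral_countable_mod R `]0, T]%classic (jumps w)
     (fun s => (sp_eval (H k) s w - upto tau s w * sigma (X s w) i j) ^+ 2) _ (measurable_itv _) (countable_sol_jumps w) _ mh; last by rewrite E.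
  by move=> s /=; rewrite in_itv/= => /andP[s0 _] nj; rewrite cut_off_jumps.
- move=> i; have [aL cL [H HL]] := hL i; split => //; exists H => T T0.
  have [h1 h2] := HL T T0; split; last exact: h2.
  apply: cvg_trans h1; apply: near_eq_cvg; apply: nearW => k.
  apply: eq_integral => w _; apply: eq_integral => s; rewrite inE/= in_itv/= => /andP[s0 _].
  apply: eq_integral => u _; rewrite /cutc /cut_ind /Yplus /= s0 indicE mem_set/= ?in_itv/= ?s0// mul1r.
  by [].
- apply: filterS hX => w hX t t0 i; rewrite hX//; congr (_ + _ + _ + _).
  have cb : continuous (fun x => b x i ord0).
    by apply: (@continuous_entry _ _ _ _ b i ord0); have [_ _ _ h _ _ _ _] := sa.
  rewrite Rintegral_mkcond [RHS]Rintegral_mkcond /Rintegral; congr fine.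
  have mh : measurable_fun (setT : set (measurableTypeR R)) ((fun s => cut (fun x => b x i ord0) (w, s)) \_ `]0, t]).
    have mc : measurable_fun setT (fun s : measurableTypeR R => cut (fun x => b x i ord0) (w, s)).
      exact: (measurableT_comp (measurable_cut cb) (pair1_measurable w)).
    by apply/(measurable_restrictT (fun s : measurableTypeR R => cut (fun x => b x i ord0) (w, s))) => //; exact: measurable_funTS.
  have [|_ E] := @integral_countable_mod R setT (jumps w)
     ((fun s => b (X s w) i ord0) \_ `[0, stopped_time tau t w]) _ measurableT (countable_sol_jumps w) _ mh; last by rewrite E.
  move=> s _ nj; rewrite !patchE !mem_setE !in_itv/=.
  have [s0|s0|s0] := ltgtP 0 s; last by exfalso; apply: nj; left; rewrite -s0.
    have [ss|ss] := boolP (s <= stopped_time tau t w).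
      have [st e] := (stoppedP w s t0).1 ss; rewrite st cut_off_jumps// e mul1r//.
    case: ifPn => // st; rewrite cut_off_jumps//.
    have [[e _]|[-> _]] := uptoP w s; last by rewrite mul0r.
    by move/negP: ss; case; apply/(stoppedP _ _ t0).
  by [].
Qed.

End one_solution.

(** * Comparison before the exit *)

Lemma measurable_inv_sqrt (R : realType) (e : R) :
  measurable_fun setT (fun r : R => (Num.sqrt (r + e ^+ 2))^-1).
Proof.
have -> : (fun r : R => (Num.sqrt (r + e ^+ 2))^-1) = (@powR R ^~ (-1)) \o (fun r => Num.sqrt (r + e ^+ 2)).
  by apply/funext => r; rewrite /= powR_inv1// sqrtr_ge0.
apply: measurableT_comp; first exact: measurable_powR.
apply: (@measurableT_comp _ _ _ _ _ _ (@Num.sqrt R)).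
  by apply: continuous_measurable_fun; exact: sqrt_continuous.
exact: measurable_funD.
Qed.

Lemma measurable_qgrid d (O : measurableType d) (R : realType) (x : R -> O -> R) (h : R) :
  0 < h -> (forall t, 0 <= t -> measurable_fun setT (x t)) ->
  measurable_fun setT (fun z : O * measurableTypeR R => x (qgrid h z.2) z.1).
Proof.
move=> h0 mx.
pose G (i : int) (z : O * measurableTypeR R) := x (Num.max ((i%:~R - 1) * h) 0) z.1.
apply: (@measurable_countable_sel _ _ _ _ (fun z : O * measurableTypeR R => Num.ceil (z.2 / h)) G).
  move=> i; have -> : [set z : O * measurableTypeR R | Num.ceil (z.2 / h) = i] = setT `*` `](i - 1)%:~R * h, i%:~R * h].
    apply/seteqP; split => -[w s] /=.
      by move=> <-; split => //; rewrite in_itv/= -ltr_pdivlMr// -ler_pdivrMr// ceil_itv.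
    move=> [_]; rewrite in_itv/= -ltr_pdivlMr// -ler_pdivrMr// => hh.
    exact: ceil_def.
  by apply: measurableX.
move=> i; rewrite /G; have t0 : 0 <= Num.max ((i%:~R - 1) * h) 0 by rewrite le_max lexx orbT.
exact: (measurableT_comp (mx _ t0) measurable_fst).
Qed.

Lemma ler_add3 (R : numDomainType) (s x3 x4 x5 y3 y4 y5 : R) :
  x3 <= y3 -> x4 <= y4 -> x5 <= y5 -> s + x3 + x4 + x5 <= s + y3 + y5 + y4.
Proof. by move=> h3 h4 h5; rewrite [leRHS]addrAC !lerD. Qed.

(** The predicate holds on an initial segment, so the weighted sum telescopes up to the first index
    where it fails, or to N. The step during which it starts to fail is still counted. *)
Lemma telescope_stop (R : realType) (p : nat -> bool) (N : nat) :
  (forall i j, (i <= j)%N -> p j -> p i) ->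
  exists k, [/\ (k <= N)%N, forall i, (i < k)%N -> p i, (k < N)%N -> ~~ p k &
    forall g : nat -> R, g 0%N + \sum_(i < N) (p i)%:R * (g i.+1 - g i) = g k].
Proof.
move=> pm; elim: N => [|N [k [kN pk npk gk]]].
  by exists 0%N; split => // g; rewrite big_ord0 addr0.
have [pN|pN] := boolP (p N).
  have kE : k = N.
    apply/eqP; rewrite eqn_leq kN leqNgt; apply/negP => kN'.
    by have := npk kN'; rewrite (pm _ _ kN pN).
  exists N.+1; split; [exact: leqnn| |by rewrite ltnn|].
    by move=> i; rewrite ltnS => iN; exact: pm pN.
  by move=> g; rewrite big_ord_recr/= pN addrA gk kE mul1r; ring.
exists k; split; [exact: leqW|exact: pk| |].
  by move=> _; move: kN; rewrite leq_eqVlt => /orP[/eqP ->//|/npk].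
by move=> g; rewrite big_ord_recr/= (negPf pN) mul0r addr0 gk.
Qed.

Lemma ge0_strip_fubini2 d (O : measurableType d) (R : realType) (P : probability O R) (s t : R)
    (f : O * measurableTypeR R -> \bar R) :
  measurable_fun (strip s t) f -> (forall y, (0 <= f y)%E) ->
  (\int[(P \x @lebesgue_measure R)%E]_(y in strip s t) f y =
   \int[@lebesgue_measure R]_(r in `]s, t]) \int[P]_w f (w, r))%E /\
  measurable_fun `]s, t]%classic (fun r : measurableTypeR R => (\int[P]_w f (w, r))%E).
Proof.
move=> mf f0.
have mfr : measurable_fun setT (f \_ (strip s t)).
  by apply/(measurable_restrictT f) => //; exact: measurable_strip.
have fr0 y : (0 <= (f \_ (strip s t)) y)%E by apply: erestrict_ge0 => *; exact: f0.
split.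
  rewrite integral_mkcond (fubini_tonelli2 _ mfr fr0) [RHS]integral_mkcond.
  apply: eq_integral => r _; rewrite /fubini_G [RHS]patchE mem_setE in_itv/=.
  case: ifPn => h; first by apply: eq_integral => w _; rewrite patchE in_strip h.
  by rewrite integral0_eq// => w _; rewrite patchE in_strip (negPf h).
have mG := measurable_fun_fubini_tonelli_G (m1 := P) (f \_ (strip s t)) mfr fr0.
apply: (eq_measurable_fun (fubini_G P (f \_ (strip s t)))); last exact: measurable_funTS.
move=> r; rewrite mem_setE in_itv/= => h; apply: eq_integral => w _.
by rewrite patchE in_strip h.
Qed.

Lemma strip_split d (O : measurableType d) (R : realType) (P : probability O R) (s r t : R)
    (f : O * measurableTypeR R -> R) : s <= r -> r <= t ->
  L1 (P \x @lebesgue_measure R)%E (strip s t) f ->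
  \int[(P \x @lebesgue_measure R)%E]_(y in strip s t) f y =
  \int[(P \x @lebesgue_measure R)%E]_(y in strip s r) f y + \int[(P \x @lebesgue_measure R)%E]_(y in strip r t) f y.
Proof.
move=> sr rt fi.
have e : strip s t = strip s r `|` strip r t :> set (O * measurableTypeR R).
  apply/seteqP; split => -[w x].
    move=> [_ /=]; rewrite in_itv/= => /andP[h1 h2]; have [xr|rx] := leP x r; [left|right];
    by split => //=; rewrite in_itv/= ?h1 ?h2 ?xr ?rx.
  by move=> [] [_ /=]; rewrite in_itv/= => /andP[h1 h2]; split => //=;
    rewrite in_itv/= ?h1 ?h2 ?(le_trans h2) ?(le_lt_trans sr h1).
rewrite e Rintegral_setU//; try exact: measurable_strip.
- by rewrite -e.
- rewrite disj_set2E; apply/eqP; rewrite -subset0 => -[w x] [[_ /= +] [_ /= +]].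
  by rewrite !in_itv/= => /andP[_ h1] /andP[h2 _]; have := le_lt_trans h1 h2; rewrite ltxx.
Qed.

Lemma vnorm_le_sum (R : realType) d (x : 'I_d -> R) : vnorm x <= \sum_k `|x k|.
Proof.
apply/ler_addgt0Pr => e e0; rewrite addrC.
have := @fnorm_lip R d e (fun=> 0) x e0; rewrite fnorm0//.
have -> : (fun k => 0 + x k) = x by apply/funext => k; rewrite add0r.
by apply: le_trans; exact: vnorm_le_fnorm.
Qed.

Section comparison.
Context {dO : measure_display} {O : measurableType dO} {R : realType}.
Variables (P : probability O R) (F : R -> set (set O)) (d : nat).
Hypothesis uh : usual_hypotheses P F.
Local Notation leb := (@lebesgue_measure R).
Local Notation Q := (P \x leb)%E.
Local Notation OR := (O * measurableTypeR R)%type.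

(** The abstract setting: the exit happens when z becomes positive; [Dl] stands for the true
    difference of the solutions and [Dm] for its left limits; [a], [H2] and [G] stand for the gaps
    of the drift, of the diffusion (squared) and of the jumps (in L^1), all bounded by K; [M] and
    [L] stand for the differences of the stochastic integrals. *)
Variable z : R -> O -> R.
Hypothesis mz : forall t, 0 <= t -> measurable_wrt (F t) (z t).
Hypothesis rz : forall w t, 0 <= t -> z s w @[s --> t^'+] --> z t w.
Variables (Dl Dm : 'I_d -> R -> O -> R).
Hypothesis mDl : forall k t, 0 <= t -> measurable_wrt (F t) (Dl k t).
Hypothesis rDl : forall k w t, 0 <= t -> Dl k s w @[s --> t^'+] --> Dl k t w.
Hypothesis lDl : forall k w s, 0 < s -> Dl k u w @[u --> s^'-] --> Dm k s w.
Variables (a : 'I_d -> OR -> R) (H2 G : OR -> R) (K : R).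
Hypothesis ma : forall k, measurable_fun setT (a k).
Hypothesis aK : forall k y, `|a k y| <= K.
Hypothesis mH2 : measurable_fun setT H2.
Hypothesis H2K : forall y, 0 <= H2 y <= K.
Hypothesis mG : measurable_fun setT G.
Hypothesis GK : forall y, 0 <= G y <= K.
Variables (M L : 'I_d -> R -> O -> R).
Hypothesis lM : forall k t, 0 <= t -> L2 P setT (M k t).
Hypothesis lL : forall k t, 0 <= t -> L2 P setT (L k t).
Hypothesis M_mean : forall k s t (psi : O -> R), 0 <= s -> s <= t -> measurable_wrt (F s) psi ->
  (exists B : R, forall w, `|psi w| <= B) -> \int[P]_w (psi w * (M k t w - M k s w)) = 0.
Hypothesis M_sqr : forall s t (phi : O -> R) (B : R), 0 <= s -> s <= t -> measurable_wrt (F s) phi ->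
  (forall w, 0 <= phi w <= B) ->
  \int[P]_w (phi w * \sum_k (M k t w - M k s w) ^+ 2) <= \int[Q]_(y in strip s t) (phi y.1 * H2 y).
Hypothesis L_abs : forall s t (phi : O -> R) (B : R), 0 <= s -> s <= t -> measurable_wrt (F s) phi ->
  (forall w, 0 <= phi w <= B) ->
  \int[P]_w (phi w * \sum_k `|L k t w - L k s w|) <= 2 * \int[Q]_(y in strip s t) (phi y.1 * G y).

Let PT : (P setT < +oo)%E. Proof. by rewrite probability_setT ltry. Qed.
Let K0 : 0 <= K. Proof. by have /andP[h /(le_trans h)] := GK point. Qed.

Definition inside t : set O := [set w | forall r, 0 <= r -> r <= t -> z r w <= 0].

Lemma insideS s t w : s <= t -> inside t w -> inside s w.
Proof. by move=> st h r r0 rs; apply: h => //; exact: le_trans st. Qed.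

(** By right continuity a positive value of z before t is seen at a rational time before t; the time
    t itself is added by hand, since beyond it nothing is known to F t. *)
Lemma F_inside t : 0 <= t -> F t (inside t).
Proof.
move=> t0; have sF := Fsig uh t0.
have FE (S : set O) : F t S <-> measurable (S : set (g_sigma_algebraType (F t))).
  have e : <<s F t >> = F t by exact: sigma_algebra_id.
  by split; rewrite /measurable /= e.
apply/FE.
have mS r : 0 <= r -> r <= t -> measurable ([set w | 0 < z r w] : set (g_sigma_algebraType (F t))).
  move=> r0 rt; apply/FE; have := Fmono uh r0 rt (mz r0) (measurable_itv `]0, +oo[).
  by congr (F t _); apply/seteqP; split => w /=; rewrite in_itv/= andbT.
pose B (q : rat) : set O := if (0 <= (ratr q : R)) && ((ratr q : R) <= t) then [set w | 0 < z (ratr q) w] else set0.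
have -> : inside t = ~` ([set w | 0 < z t w] `|` \bigcup_q B q).
  apply/seteqP; split => w /=.
    move=> h [zt|[q _]]; first by have := h t t0 (lexx t); rewrite leNgt zt.
    by rewrite /B; case: ifPn => // /andP[q0 qt] /= zq; have := h _ q0 qt; rewrite leNgt zq.
  move=> h r r0; rewrite le_eqVlt => /orP[/eqP ->|rt].
    by rewrite leNgt; apply/negP => zt; apply: h; left.
  rewrite leNgt; apply/negP => zr; apply: h; right.
  have e0 : 0 < z r w / 2 by rewrite divr_gt0.
  have [eta eta0 he] := near_right_ex (near_dist_le _ (@rz w r r0) e0).
  have : r < Num.min t (r + eta) by rewrite lt_min rt ltrDl.
  move=> /rat_in_itvoo[q]; rewrite in_itv/= lt_min => /and3P[q1 q2 q3].
  exists q => //; rewrite /B (le_trans r0 (ltW q1)) (ltW q2) /=.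
  have := he _ q1 q3; rewrite ler_norml => /andP[_]; lra.
apply: measurableC; apply: measurableU; first exact: mS.
apply: bigcupT_measurable_rat => q; rewrite /B; case: ifPn => [/andP[q0 qt]|_]; first exact: mS.
exact: measurable0.
Qed.

Local Notation phi t := (\1_(inside t) : O -> R).

Let mphi t : 0 <= t -> measurable_wrt (F t) (phi t).
Proof. by move=> t0; apply: (wrt_indic (Fsig uh t0)); exact: F_inside. Qed.

Let phi01 t w : 0 <= phi t w <= 1.
Proof. by rewrite indicE; case: (_ \in _); rewrite /= ?lexx ?ler01. Qed.

Definition drift k t w : R := \int[leb]_(s in `]0%R, t]) a k (w, s).
(** The integral representation, defined at all times; it is identified with [Dl] only before the
    exit, and afterwards runs on with the cut coefficients. *)
Definition D k t w : R := drift k t w + M k t w + L k t w.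

Let mas k w : measurable_fun setT (fun s : measurableTypeR R => a k (w, s)).
Proof. exact: (measurableT_comp (ma k) (pair1_measurable w)). Qed.

Let lebfin (s t : R) : (leb `]s, t]%classic < +oo)%E.
Proof. by rewrite lebesgue_measure_itv/=; case: ifP => _ //; rewrite -EFinB ltry. Qed.

Let ias k w (s t : R) : L1 leb `]s, t] (fun s => a k (w, s)).
Proof.
apply: (@L1_bnd _ (measurableTypeR R) _ _ _ _ K) => //; first exact: lebfin.
by apply: measurable_funTS; exact: mas.
Qed.

Lemma drift_incr k (s t : R) w : 0 <= s -> s <= t ->
  drift k t w - drift k s w = \int[leb]_(r in `]s, t]) a k (w, r).
Proof.
move=> s0 st; rewrite /drift.
have e : `]0, t]%classic = `]0, s]%classic `|` `]s, t]%classic.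
  by rewrite (@itv_bndbnd_setU _ _ (BRight 0) (BRight s)).
rewrite e Rintegral_setU//=.
- by rewrite addrAC subrr add0r.
- by rewrite -e; exact: (ias k w 0 t).
- rewrite disj_set2E; apply/eqP; rewrite -subset0 => r [/=]; rewrite !in_itv/= => /andP[_ h1] /andP[h2 _].
  by have := lt_le_trans h2 h1; rewrite ltxx.
Qed.

Lemma drift_incr_le k (s t : R) w : 0 <= s -> s <= t -> `|drift k t w - drift k s w| <= K * (t - s).
Proof.
move=> s0 st; rewrite drift_incr//.
apply: (@le_trans _ _ (\int[leb]_(r in `]s, t]) K)).
  apply: (@le_norm_Rint _ (measurableTypeR R)); [by []|exact: ias| |by move=> r _; exact: aK].
  by apply: (@L1_bnd _ (measurableTypeR R) _ _ _ _ `|K|) => //; exact: lebfin.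
rewrite Rintegral_cst//= lebesgue_measure_itv/= lte_fin; case: ifPn => [_|]; first by rewrite -EFinB.
by rewrite -leNgt => ts; rewrite /= mulr0 mulr_ge0// subr_ge0.
Qed.

Lemma strip_drift k (s t : R) (psi : O -> R) : 0 <= s -> s <= t -> measurable_fun setT psi ->
  (exists B : R, forall w, `|psi w| <= B) ->
  measurable_fun setT (fun w => drift k t w - drift k s w) /\
  \int[P]_w (psi w * (drift k t w - drift k s w)) = \int[Q]_(y in strip s t) (psi y.1 * a k y).
Proof.
move=> s0 st mpsi bpsi.
have i1 : L1 Q (strip s t) (fun y => 1 * a k y).
  by apply: (@L1_strip _ _ _ P s t (fun=> 1)) => //; [exists 1 => w; rewrite normr1|exists K].
split; last first.
  rewrite strip_fubini; last by apply: L1_strip => //; exists K.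
  apply: eq_Rintegral => w _; rewrite drift_incr//= RintegralZl//; exact: ias.
have i1' := i1; move: i1' => /integrable_mkcond => /(_ (measurable_strip _ _)) fi.
apply: (eq_measurable_fun (fun w => fine (fubini_F leb ((EFin \o (fun y => 1 * a k y)) \_ (strip s t)) w))).
  move=> w _; rewrite drift_incr// /fubini_F /Rintegral; congr fine; rewrite [RHS]integral_mkcond.
  apply: eq_integral => r _; rewrite !patchE in_strip /= mul1r.
  by rewrite (_ : (r \in _) = (s < r <= t))// mem_setE in_itv.
by apply: measurableT_comp; [exact: fine_measurable|exact: (measurable_fubini_F fi)].
Qed.

Section step.
Variables (e th : R).
Hypotheses (e0 : 0 < e) (th0 : 0 < th).

Local Notation fD t w := (fnorm e (fun k => Dl k t w)).
(** [psi] is the gradient of the smoothed norm at [Dl], and [chi] the weight of its quadratic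
    remainder, both switched off once the exit has occurred. *)
Definition psi k t w : R := phi t w * (Dl k t w / fD t w).
Definition chi t w : R := phi t w / fD t w.
(** The rate at which the expected smoothed norm can grow when the weights are frozen at time t. The
    1/2 comes from the tangent plane estimate, the 2 from the total variation bound on the jumps. *)
Definition grate t (y : OR) : R := \sum_k psi k t y.1 * a k y + (1 + th) / 2 * (chi t y.1 * H2 y) + 2 * (phi t y.1 * G y).
(* Bounds the increment over [s, t] of the smoothed norm of D, stopped at the exit. *)
Definition rem s t w : R :=
  \sum_k psi k s w * (drift k t w - drift k s w) + \sum_k psi k s w * (M k t w - M k s w)
  + (1 + th) / 2 * (chi s w * \sum_k (M k t w - M k s w) ^+ 2)
  + (1 + th^-1) / 2 * (chi s w * \sum_k (drift k t w - drift k s w) ^+ 2)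
  + phi s w * \sum_k `|L k t w - L k s w|.

Let mfinv t : 0 <= t -> measurable_wrt (F t) (fun w => (fD t w)^-1).
Proof.
move=> t0; have Ft := Fsig uh t0.
apply: (wrt_comp Ft (g := fun r => (Num.sqrt (r + e ^+ 2))^-1)); first exact: measurable_inv_sqrt.
apply: (wrt_sum Ft) => k; rewrite (_ : (fun w => _) = (fun w => Dl k t w * Dl k t w)); last first.
  by apply/funext => w; rewrite expr2.
by apply: (wrtM Ft); exact: mDl.
Qed.

Lemma wrt_psi k t : 0 <= t -> measurable_wrt (F t) (psi k t).
Proof.
move=> t0; have Ft := Fsig uh t0; apply: (wrtM Ft); first exact: mphi.
by apply: (wrtM Ft); [exact: mDl|exact: mfinv].
Qed.

Lemma wrt_chi t : 0 <= t -> measurable_wrt (F t) (chi t).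
Proof. by move=> t0; apply: (wrtM (Fsig uh t0)); [exact: mphi|exact: mfinv]. Qed.

Lemma psi_le1 k t w : `|psi k t w| <= 1.
Proof.
have f0 := fnorm_gt0 (fun k => Dl k t w) e0.
have /andP[p0 p1] := phi01 t w.
rewrite /psi normrM (ger0_norm p0) -[1]mulr1 ler_pM//.
rewrite normrM normfV (ger0_norm (ltW f0)) ler_pdivrMr// mul1r.
exact: (le_coord_fnorm e (fun k => Dl k t w)).
Qed.

Lemma chi_bnd t w : 0 <= chi t w <= e^-1.
Proof.
have f0 := fnorm_gt0 (fun k => Dl k t w) e0; have /andP[p0 p1] := phi01 t w.
rewrite divr_ge0 ?(ltW f0)//= ler_pdivrMr//.
have ee : e^-1 * e = 1 by rewrite mulVf// gt_eqF.
by apply: (le_trans p1); rewrite -ee ler_wpM2l ?invr_ge0 ?(ltW e0)// fnorm_ge.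
Qed.

Lemma grate_bounded t y : `|grate t y| <= d%:R * K + (1 + th) / 2 * (e^-1 * K) + 2 * K.
Proof.
have /andP[h0 h1] := H2K y; have /andP[g0 g1] := GK y.
have /andP[c0 c1] := chi_bnd t y.1; have /andP[p0 p1] := phi01 t y.1.
have th2 : 0 <= (1 + th) / 2 by rewrite divr_ge0// addr_ge0// ltW.
rewrite /grate (le_trans (ler_normD _ _))// lerD//.
  rewrite (le_trans (ler_normD _ _))// lerD//.
    rewrite (le_trans (ler_norm_sum _ _ _))//.
    have -> : d%:R * K = \sum_(k < d) K by rewrite sumr_const card_ord mulr_natl.
    by apply: ler_sum => k _; rewrite normrM -[K]mul1r ler_pM// psi_le1.
  have n0 : 0 <= (1 + th) / 2 * (chi t y.1 * H2 y) by apply: mulr_ge0 => //; exact: mulr_ge0.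
  by rewrite (ger0_norm n0); apply: ler_wpM2l => //; exact: ler_pM.
have n0 : 0 <= 2 * (phi t y.1 * G y) by apply: mulr_ge0 => //; exact: mulr_ge0.
by rewrite (ger0_norm n0); apply: ler_wpM2l => //; rewrite -[K]mul1r; exact: ler_pM.
Qed.

Lemma measurable_grate_qgrid h : 0 < h -> measurable_fun setT (fun y : OR => grate (qgrid h y.2) y).
Proof.
move=> h0.
have mq (x : R -> O -> R) : (forall t, 0 <= t -> measurable_wrt (F t) (x t)) ->
    measurable_fun setT (fun y : OR => x (qgrid h y.2) y.1).
  by move=> mx; apply: measurable_qgrid => // t t0; exact: (Fmeas uh t0 (mx t t0)).
apply: measurable_funD.
  apply: measurable_funD.
    apply: measurable_sum => k; apply: measurable_funM => //.
    by apply: (mq (psi k)) => t t0; exact: wrt_psi.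
  apply: measurable_funM => //; apply: measurable_funM => //.
  by apply: (mq chi) => t t0; exact: wrt_chi.
apply: measurable_funM => //; apply: measurable_funM => //.
by apply: (mq (fun t => phi t)) => t t0; exact: mphi.
Qed.

(** The term linear in M has mean 0, and the squares of M and the absolute values of L are bounded
    by hypothesis. The squared drift increments are of order (t - s)^2, so their sum over a grid
    vanishes with the mesh. *)
Lemma rem_bound (s t : R) : 0 <= s -> s <= t ->
  L1 P setT (rem s t) /\
  \int[P]_w rem s t w <= \int[Q]_(y in strip s t) grate s y + (1 + th^-1) / 2 * (e^-1 * (d%:R * (K * (t - s)) ^+ 2)).
Proof.
move=> s0 st; have t0 := le_trans s0 st.
have mpsi k := Fmeas uh s0 (wrt_psi k s0).
have bpsi k : exists B : R, forall w, `|psi k s w| <= B by exists 1; exact: psi_le1.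
have mchi := Fmeas uh s0 (wrt_chi s0); have mph := Fmeas uh s0 (mphi s0).
have bchi : exists B : R, forall w, `|chi s w| <= B.
  by exists e^-1 => w; have /andP[c0 c1] := chi_bnd s w; rewrite ger0_norm.
have nchi w : [set: O] w -> `|chi s w| <= e^-1.
  by move=> _; have /andP[c0 c1] := chi_bnd s w; rewrite ger0_norm.
have nphi w : [set: O] w -> `|phi s w| <= 1.
  by move=> _; have /andP[c0 c1] := phi01 s w; rewrite ger0_norm.
have [mdr _] := all_and2 (fun k => strip_drift k s0 st (mpsi k) (bpsi k)).
have ldr k : L2 P setT (fun w => drift k t w - drift k s w).
  by apply: (@L2_bnd _ _ _ _ _ _ (K * (t - s))) => // w _; exact: drift_incr_le.
have lMi k : L2 P setT (fun w => M k t w - M k s w) by apply: L2B => //; exact: lM.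
have lLi k : L2 P setT (fun w => L k t w - L k s w) by apply: L2B => //; exact: lL.
have npsi k w : [set: O] w -> `|psi k s w| <= 1 by move=> _; exact: psi_le1.
have psiL k f : L2 P setT f -> L1 P setT (fun w => psi k s w * f w).
  by move=> l; apply: (@L1Mb _ _ _ P setT (psi k s) f 1 measurableT (mpsi k) (@npsi k)); exact: L2_L1.
have chiL f : L1 P setT f -> L1 P setT (fun w => chi s w * f w).
  by move=> l; exact: (@L1Mb _ _ _ P setT (chi s) f e^-1 measurableT mchi nchi).
have phiL f : L1 P setT f -> L1 P setT (fun w => phi s w * f w).
  by move=> l; exact: (@L1Mb _ _ _ P setT (phi s) f 1 measurableT mph nphi).
have i1 k : L1 P setT (fun w => psi k s w * (drift k t w - drift k s w)) by exact: psiL.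
have i2 k : L1 P setT (fun w => psi k s w * (M k t w - M k s w)) by exact: psiL.
have i3 : L1 P setT (fun w => chi s w * \sum_k (M k t w - M k s w) ^+ 2).
  by apply: chiL; apply: L1_sum => // k; exact: (lMi k).2.
have i4 : L1 P setT (fun w => chi s w * \sum_k (drift k t w - drift k s w) ^+ 2).
  by apply: chiL; apply: L1_sum => // k; exact: (ldr k).2.
have i5 : L1 P setT (fun w => phi s w * \sum_k `|L k t w - L k s w|).
  by apply: phiL; apply: L1_sum => // k; apply: L1_norm => //; exact: L2_L1.
have i1s := L1_sum (index_enum 'I_d) measurableT i1.
have i2s := L1_sum (index_enum 'I_d) measurableT i2.
have i3z := L1Z ((1 + th) / 2) measurableT i3.
have i4z := L1Z ((1 + th^-1) / 2) measurableT i4.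
have i12 := L1D measurableT i1s i2s.
have i123 := L1D measurableT i12 i3z.
have i1234 := L1D measurableT i123 i4z.
split; first exact: L1D.
have q1 k : L1 Q (strip s t) (fun y => psi k s y.1 * a k y) by apply: L1_strip => //; exists K.
have q2 : L1 Q (strip s t) (fun y => chi s y.1 * H2 y).
  by apply: L1_strip => //; exists K => y; have /andP[h0 h1] := H2K y; rewrite ger0_norm.
have q3 : L1 Q (strip s t) (fun y => phi s y.1 * G y).
  apply: L1_strip => //; first by exists 1 => w; exact: nphi.
  by exists K => y; have /andP[h0 h1] := GK y; rewrite ger0_norm.
have ms := @measurable_strip _ O R s t.
have q1s := L1_sum (index_enum 'I_d) ms q1.
have q2z := L1Z ((1 + th) / 2) ms q2; have q3z := L1Z 2 ms q3.
have q12 := L1D ms q1s q2z.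
rewrite /grate (RintegralDr ms q12 q3z) (RintegralDr ms q1s q2z) (Rintegral_sumr _ ms q1).
rewrite (RintegralZl _ ms q2) (RintegralZl _ ms q3).
rewrite /rem (RintegralDr measurableT i1234 i5) (RintegralDr measurableT i123 i4z) (RintegralDr measurableT i12 i3z).
rewrite (RintegralDr measurableT i1s i2s) (Rintegral_sumr _ measurableT i1) (Rintegral_sumr _ measurableT i2).
rewrite (RintegralZl _ measurableT i3) (RintegralZl _ measurableT i4).
have -> : \sum_k \int[P]_w (psi k s w * (M k t w - M k s w)) = 0.
  by apply: big1 => k _; apply: M_mean => //; exact: wrt_psi.
have -> : \sum_k \int[P]_w (psi k s w * (drift k t w - drift k s w)) = \sum_k \int[Q]_(y in strip s t) (psi k s y.1 * a k y).
  by apply: eq_bigr => k _; have [_ ->] := strip_drift k s0 st (mpsi k) (bpsi k).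
have b3 := M_sqr s0 st (wrt_chi s0) (chi_bnd s).
have b5 := L_abs s0 st (mphi s0) (phi01 s).
have b4 : \int[P]_w (chi s w * \sum_k (drift k t w - drift k s w) ^+ 2) <= e^-1 * (d%:R * (K * (t - s)) ^+ 2).
  apply: (@le_trans _ _ (\int[P]_w (e^-1 * (d%:R * (K * (t - s)) ^+ 2)))); last first.
    by rewrite Rintegral_cst//= probability_setT mulr1.
  apply: ler_Rint => //; first exact: (@L1_bnd _ _ _ _ _ _ `|e^-1 * (d%:R * (K * (t - s)) ^+ 2)|).
  move=> w _; have /andP[c0 c1] := chi_bnd s w; apply: ler_pM => //.
    by apply: sumr_ge0 => k _; exact: sqr_ge0.
  have -> : d%:R * (K * (t - s)) ^+ 2 = \sum_(k < d) (K * (t - s)) ^+ 2 by rewrite sumr_const card_ord mulr_natl.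
  apply: ler_sum => k _; rewrite -[leLHS]real_normK ?num_real// lerXn2r// ?nnegrE ?mulr_ge0 ?subr_ge0//.
  exact: drift_incr_le.
have t2 : 0 <= (1 + th) / 2 by rewrite divr_ge0// addr_ge0// ltW.
have t3 : 0 <= (1 + th^-1) / 2 by rewrite divr_ge0// addr_ge0// invr_ge0 ltW.
rewrite addr0; exact: (ler_add3 _ (ler_wpM2l t2 b3) (ler_wpM2l t3 b4) b5).
Qed.

Lemma rem_path (s t : R) w : 0 <= s -> s <= t -> (inside s w -> forall k, D k s w = Dl k s w) ->
  phi s w * (fnorm e (fun k => D k t w) - fnorm e (fun k => D k s w)) <= rem s t w.
Proof.
move=> s0 st HD; rewrite /rem /psi /chi indicE.
have [ins|nin] := pselect (inside s w); last first.
  rewrite memNset// !mul0r !mulr0 !addr0 !big1 ?addr0// => k _; by rewrite !mul0r.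
rewrite mem_set// [true%:R]/(1 : R) !mul1r.
have E : (fun k => D k t w) = (fun k => Dl k s w + (drift k t w - drift k s w) + (M k t w - M k s w) + (L k t w - L k s w)).
  by apply/funext => k; rewrite -(HD ins) /D; ring.
have E' : (fun k => D k s w) = (fun k => Dl k s w) by apply/funext => k; exact: HD.
rewrite E E'; apply: le_trans (fnorm_step _ _ _ _ e0 th0) _.
set f := fnorm e _; have f0 : f != 0 by rewrite gt_eqF// fnorm_gt0.
have S (x : 'I_d -> R) : \sum_k 1 * (Dl k s w / f) * x k = (\sum_k Dl k s w * x k) / f.
  by rewrite mulr_suml; apply: eq_bigr => k _; rewrite mul1r mulrAC.
rewrite !S lerD2r le_eqVlt -!addrA; apply/orP; left; apply/eqP; congr (_ + (_ + _)).
have hth : th != 0 by rewrite gt_eqF.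
by field; rewrite ?f0 ?hth.
Qed.

End step.

Hypothesis DDl : {ae P, forall w, forall t, 0 <= t -> inside t w -> forall k, D k t w = Dl k t w}.
Hypothesis D_start : {ae P, forall w, forall k, D k 0 w = 0}.
Variables (rho : R -> R) (C0 B : R).
Hypothesis rho0 : forall r, 0 <= r -> 0 <= rho r.
Hypothesis rho_mono : forall r s, 0 <= r -> r <= s -> rho r <= rho s.
Hypothesis rho_concave : convex_function (`[0, +oo[%classic : set R^o) (fun r : R^o => - rho r).
Hypothesis rho_pos : forall r, 0 < r -> 0 < rho r.
Hypothesis rho_osgood : forall e : R, 0 < e ->
  (\int[lebesgue_measure]_(r in `]0%R, e[) ((rho r)^-1)%:E)%E = +oo%E.
Hypothesis C00 : 0 <= C0.
Hypothesis Dl_bnd : forall t w, 0 <= t -> inside t w -> vnorm (fun k => Dl k t w) <= B.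
Local Notation nDm s w := (vnorm (fun k => Dm k s w)).
Local Notation nDl s w := (vnorm (fun k => Dl k s w)).
Local Notation nD s w := (vnorm (fun k => D k s w)).
Hypothesis rate_bound : forall w s, 0 < s -> (forall r, 0 <= r -> r < s -> z r w <= 0) ->
  \sum_k Dm k s w * a k (w, s) + 2^-1 * H2 (w, s) <= C0 * nDm s w * rho (nDm s w) /\
  G (w, s) <= C0 * rho (nDm s w).
Hypothesis rM : forall k w t, 0 <= t -> M k s w @[s --> t^'+] --> M k t w.
Hypothesis rL : forall k w t, 0 <= t -> L k s w @[s --> t^'+] --> L k t w.

Definition inside_before s : set O := [set w | forall r, 0 <= r -> r < s -> z r w <= 0].
Local Notation phim s := (\1_(inside_before s) : O -> R).

Lemma drift0 k w : drift k 0 w = 0.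
Proof. by rewrite /drift set_itvoc0 Rintegral_set0. Qed.

Lemma L2_D k t : 0 <= t -> L2 P setT (D k t).
Proof.
move=> t0; apply: L2D => //; last exact: lL.
apply: L2D => //; last exact: lM.
have b0 : exists B : R, forall w : O, `|(0 : R)| <= B by exists 0 => w; rewrite normr0.
have [m _] := @strip_drift k 0 t (fun=> 0) (lexx 0) t0 (measurable_cst _) b0.
apply: (@L2_bnd _ _ _ _ _ _ (K * (t - 0))) => //.
  by apply: eq_measurable_fun m => w _; rewrite drift0 subr0.
by move=> w _; have := drift_incr_le k w (lexx 0) t0; rewrite drift0 (subr0 (drift k t w)).
Qed.

Lemma measurable_vnorm dT (T : measurableType dT) (A : set T) (x : 'I_d -> T -> R) :
  (forall k, measurable_fun A (x k)) -> measurable_fun A (fun w => vnorm (fun k => x k w)).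
Proof.
move=> mx; apply: (@measurableT_comp _ _ _ _ _ _ (@Num.sqrt R)).
  by apply: continuous_measurable_fun; exact: sqrt_continuous.
by apply: measurable_sum => k; apply: measurable_funX; exact: mx.
Qed.

Lemma L1_nD t : 0 <= t -> L1 P setT (fun w => nD t w).
Proof.
move=> t0; have l k := L2_D k t0.
apply: (@L1_dom _ _ _ _ _ _ (fun w => \sum_k `|D k t w|)) => //.
- by apply: measurable_vnorm => k; have [] := l k.
- by move=> w _; rewrite ger0_norm ?vnorm_ge0// vnorm_le_sum.
- by apply: L1_sum => // k; apply: L1_norm => //; exact: L2_L1.
Qed.

(** |D| at the first grid point that is not inside, or at N h if there is none, in telescoped form;
    each increment is then weighted by an event known at its left end. *)
Definition Zsum h N w : R := nD 0 w + \sum_(i < N) phi (i%:R * h) w * (nD (i.+1%:R * h) w - nD (i%:R * h) w).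

Lemma stop_index h N w : 0 <= h -> exists k, [/\ (k <= N)%N, forall i, (i < k)%N -> inside (i%:R * h) w,
  (k < N)%N -> ~ inside (k%:R * h) w &
  forall g : R -> R, g 0 + \sum_(i < N) phi (i%:R * h) w * (g (i.+1%:R * h) - g (i%:R * h)) = g (k%:R * h)].
Proof.
move=> h0; have [|k [kN pk npk gk]] := @telescope_stop R (fun i => w \in inside (i%:R * h)) N.
  move=> i j ij /set_mem hj; apply/mem_set; apply: insideS hj.
  by rewrite ler_wpM2r// ler_nat.
exists k; split => //.
- by move=> i /pk /set_mem.
- by move=> /npk /negP h' h2; apply: h'; exact/mem_set.
- move=> g; rewrite -(gk (fun i => g (i%:R * h))) mul0r; congr (_ + _).
Qed.

Lemma Zsum_ge0 h N w : 0 <= h -> 0 <= Zsum h N w.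
Proof. by move=> h0; have [k [_ _ _ H]] := stop_index N w h0; rewrite /Zsum (H (fun t => nD t w)) vnorm_ge0. Qed.

Lemma L1_Zsum h N : 0 <= h -> L1 P setT (Zsum h N).
Proof.
move=> h0; apply: L1D => //; first exact: L1_nD.
apply: L1_sum => // i; have t0 : 0 <= i%:R * h by rewrite mulr_ge0.
apply: (@L1Mb _ _ _ _ _ _ _ 1) => //; first exact: (Fmeas uh t0 (mphi t0)).
  by move=> w _; have /andP[p0 p1] := phi01 (i%:R * h) w; rewrite ger0_norm.
by apply: L1B => //; apply: L1_nD => //; rewrite mulr_ge0.
Qed.

(** [Zsum] is at most its analogue for the smoothed norm, by [stop_index] used in both directions;
    that one starts from the value e and grows by [rem] on each cell, where [qgrid] is the left
    end. *)
Lemma Zsum_le e th h N : 0 < e -> 0 < th -> 0 < h ->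
  \int[P]_w Zsum h N w <= e + \int[Q]_(y in strip 0 (N%:R * h)) grate e th (qgrid h y.2) y
     + N%:R * ((1 + th^-1) / 2 * (e^-1 * (d%:R * (K * h) ^+ 2))).
Proof.
move=> e0 th0 h0.
have ih0 i : 0 <= i%:R * h by rewrite mulr_ge0// ltW.
have ihS i : i%:R * h <= i.+1%:R * h by apply: ler_wpM2r; [exact: ltW|rewrite ler_nat].
have dih i : i.+1%:R * h - i%:R * h = h by rewrite -mulrBl -natr1 addrAC subrr add0r mul1r.
have ir i := rem_bound e0 th0 (ih0 i) (ihS i).
have icst : L1 P setT (fun=> e) by exact: (@L1_bnd _ _ _ _ _ _ `|e|).
have isum : L1 P setT (fun w => \sum_(i < N) rem e th (i%:R * h) (i.+1%:R * h) w).
  by apply: L1_sum => // i; have [] := ir i.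
apply: (@le_trans _ _ (\int[P]_w (e + \sum_(i < N) rem e th (i%:R * h) (i.+1%:R * h) w))).
  apply: ae_ler_Rint => //; [exact/L1_Zsum/ltW|exact: L1D|].
  apply: filterS2 DDl D_start => w HD HD0 _.
  have [k [kN _ _ H]] := stop_index N w (ltW h0).
  rewrite /Zsum (H (fun t => nD t w)) (le_trans (vnorm_le_fnorm e _))//.
  rewrite -(H (fun t => fnorm e (fun k => D k t w))); apply: lerD.
    have -> : (fun k => D k 0 w) = (fun=> 0) by apply/funext => j; exact: HD0.
    by rewrite fnorm0.
  by apply: ler_sum => i _; apply: rem_path => //; exact: HD.
rewrite RintegralDr// Rintegral_cst//= probability_setT mulr1 -addrA lerD2l.
rewrite (Rintegral_sumr _ measurableT (fun i : 'I_N => (ir i).1)).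
have mgr := measurable_grate_qgrid e th h0.
have igr (s t : R) : L1 Q (strip s t) (fun y => grate e th (qgrid h y.2) y).
  apply: (@L1_bnd _ _ _ _ _ _ (d%:R * K + (1 + th) / 2 * (e^-1 * K) + 2 * K)) => //.
  - exact: measurable_strip.
  - exact: strip_fin.
  - exact: measurable_funTS.
  - by move=> y _; exact: grate_bounded.
pose c := (1 + th^-1) / 2 * (e^-1 * (d%:R * (K * h) ^+ 2)); rewrite -/c.
elim: N {isum} => [|N IH].
  by rewrite big_ord0 !mul0r addr0 Rintegral_ge0// => y; rewrite /strip /= in_itv/= => -[_ /andP[h1 h2]]; have := lt_le_trans h1 h2; rewrite ltxx.
have cS : N.+1%:R * c = N%:R * c + c by rewrite -natr1 mulrDl mul1r.
rewrite big_ord_recr/= (strip_split (ih0 N) (ihS N) (igr _ _)) cS addrACA.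
apply: lerD; first exact: IH.
have [_] := ir N; rewrite dih => /le_trans; apply; rewrite lerD2r le_eqVlt; apply/orP; left; apply/eqP.
apply: eq_Rintegral => -[w r]; rewrite in_strip => /andP[h1 h2] /=.
by rewrite (qgrid_itv h0 h1 h2).
Qed.

(** The sequence is eventually constant: either every earlier time is inside, or z was positive at
    some r < s and the grid points eventually pass r. *)
Lemma cvg_phi (T s : R) w : 0 < T -> 0 < s -> phi (qgrid (T / m.+1%:R) s) w @[m --> \oo] --> phim s w.
Proof.
move=> T0 s0; apply: cvg_near_cst.
have hm (m : nat) : 0 < T / m.+1%:R by rewrite divr_gt0.
have [ib|nib] := pselect (inside_before s w).
  apply: nearW => m; rewrite !indicE !mem_set// => r r0 rq; apply: ib => //.
  by have /andP[_ h] := qgrid_lt (hm m) s0; exact: le_lt_trans h.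
have [r [r0 rs zr]] : exists r, [/\ 0 <= r, r < s & 0 < z r w].
  apply: contrapT => H; apply: nib => r r0 rs; rewrite leNgt; apply/negP => zr.
  by apply: H; exists r.
have ev : \forall m \near \oo, r <= qgrid (T / m.+1%:R) s.
  by apply: (cvgr_ge s); [exact: cvg_qgrid|exact: rs].
apply: filterS ev => m hr.
rewrite !indicE !memNset// => h; have := h r r0 hr; by rewrite leNgt zr.
Qed.

Lemma nDm_bnd w s : 0 < s -> inside_before s w -> nDm s w <= B.
Proof.
move=> s0 ib.
have c : vnorm (fun k => Dl k u w) @[u --> s^'-] --> nDm s w by apply: cvg_vnorm => k; exact: lDl.
apply: (cvgr_to_le c); near=> u; apply: Dl_bnd.
  by apply: ltW; near: u; exact: nbhs_left_gt.
move=> r r0 ru; apply: ib => //; apply: (le_lt_trans ru); near: u; exact: nbhs_left_lt.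
Unshelve. all: by end_near. Qed.

Definition rate_lim e th (y : OR) : R := phim y.2 y.1 *
  ((\sum_k Dm k y.2 y.1 * a k y) / fnorm e (fun k => Dm k y.2 y.1)
   + (1 + th) / 2 * (H2 y / fnorm e (fun k => Dm k y.2 y.1)) + 2 * G y).

Lemma cvg_fnorm e (T : Type) (A : set_system T) (FF : Filter A) (f : 'I_d -> T -> R) (l : 'I_d -> R) :
  (forall k, f k s @[s --> A] --> l k) -> fnorm e (fun k => f k s) @[s --> A] --> fnorm e l.
Proof.
move=> h; apply: (@cvg_comp _ _ _ (fun s => \sum_k f k s ^+ 2 + e ^+ 2) (@Num.sqrt R) A (nbhs (\sum_k l k ^+ 2 + e ^+ 2)) _); last exact: sqrt_continuous.
apply: cvgD; last exact: cvg_cst.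
apply: (@cvg_big R^o 'I_d +%R 0 predT add_continuous _ A _ (fun k s => f k s ^+ 2)).
by move=> k _; rewrite expr2; under eq_fun do rewrite expr2; exact: cvgM.
Qed.

Lemma cvg_grate e th (T s : R) w : 0 < e -> 0 < T -> 0 < s ->
  grate e th (qgrid (T / m.+1%:R) s) (w, s) @[m --> \oo] --> rate_lim e th (w, s).
Proof.
move=> e0 T0 s0.
have cp := @cvg_phi T s w T0 s0.
have cD k : Dl k (qgrid (T / m.+1%:R) s) w @[m --> \oo] --> Dm k s w.
  by apply: (@cvg_left_qgrid _ (fun t => Dl k t w)) => //; exact: lDl.
have cf : (fnorm e (fun k => Dl k (qgrid (T / m.+1%:R) s) w))^-1 @[m --> \oo] --> (fnorm e (fun k => Dm k s w))^-1.
  by apply: cvgV; [rewrite gt_eqF// fnorm_gt0|exact: cvg_fnorm].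
have -> : rate_lim e th (w, s) = \sum_k (phim s w * (Dm k s w / fnorm e (fun k => Dm k s w))) * a k (w, s)
  + (1 + th) / 2 * ((phim s w / fnorm e (fun k => Dm k s w)) * H2 (w, s)) + 2 * (phim s w * G (w, s)).
  rewrite /rate_lim /= !mulrDr; congr (_ + _ + _); last by rewrite mulrCA.
    rewrite mulr_suml mulr_sumr; apply: eq_bigr => k _.
    by rewrite -!mulrA; congr (_ * (_ * _)); rewrite mulrC.
  by rewrite mulrCA; congr (_ * _); rewrite -mulrA; congr (_ * _); rewrite mulrC.
rewrite /grate /psi /chi /=; apply: cvgD; last by apply: cvgMl_tmp; exact: cvgMr_tmp.
apply: cvgD; last by apply: cvgMl_tmp; apply: cvgMr_tmp; exact: cvgM.
apply: (@cvg_big R^o 'I_d +%R 0 predT add_continuous _ \oo _ (fun k m => phi (qgrid (T / m.+1%:R) s) w * (Dl k (qgrid (T / m.+1%:R) s) w / fnorm e (fun k => Dl k (qgrid (T / m.+1%:R) s) w)) * a k (w, s))).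
by move=> k _; apply: cvgMr_tmp; apply: cvgM => //; exact: cvgM.
Qed.

Let st0 (s t : R) (y : OR) : 0 <= s -> strip s t y -> 0 < y.2.
Proof. by case: y => w r s0 [_ /=]; rewrite in_itv/= => /andP[/(le_lt_trans s0)]. Qed.

Lemma measurable_phim (s t : R) : 0 <= s -> measurable_fun (strip s t) (fun y => phim y.2 y.1).
Proof.
move=> s0; apply: (@measurable_fun_cvg _ OR R (strip s t) (fun m y => phi (qgrid (1 / m.+1%:R) y.2) y.1)).
  move=> m; apply: measurable_funTS; apply: (@measurable_qgrid _ _ _ (fun u => phi u)) => // u u0.
  exact: (Fmeas uh u0 (mphi u0)).
by move=> [w r] /(st0 s0) r0; exact: cvg_phi.
Qed.

Lemma measurable_Dm k (s t : R) : 0 <= s -> measurable_fun (strip s t) (fun y => Dm k y.2 y.1).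
Proof.
move=> s0; apply: (@measurable_fun_cvg _ OR R (strip s t) (fun m y => Dl k (qgrid (1 / m.+1%:R) y.2) y.1)).
  move=> m; apply: measurable_funTS; apply: (@measurable_qgrid _ _ _ (Dl k)) => // u u0.
  exact: (Fmeas uh u0 (mDl k u0)).
move=> [w r] /(st0 s0) r0; apply: (@cvg_left_qgrid _ (fun t => Dl k t w)) => //; exact: lDl.
Qed.

Let phim01 s w : 0 <= phim s w <= 1.
Proof. by rewrite indicE; case: (_ \in _); rewrite /= ?lexx ?ler01. Qed.

Definition vrate (y : OR) : R := phim y.2 y.1 * rho (Num.max (nDm y.2 y.1) 0).
Definition xrate (y : OR) : R := phim y.2 y.1 * nDm y.2 y.1.
(** The factor 3 collects 1 for drift and diffusion together and 2 for the jumps. Unlike the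
    expectation of |D|, this majorant is nondecreasing by construction, as the Osgood argument
    requires. *)
Definition V (T : R) : R := 3 * C0 * \int[Q]_(y in strip 0 T) vrate y.

Lemma vrate_ge0 y : 0 <= vrate y.
Proof. by rewrite mulr_ge0 ?rho0 ?le_max ?lexx ?orbT//; case/andP: (phim01 y.2 y.1). Qed.

Lemma L1_vrate (s t : R) : 0 <= s -> L1 Q (strip s t) vrate.
Proof.
move=> s0; have ms := @measurable_strip _ O R s t.
apply: (@L1_bnd _ _ _ _ _ _ (rho (Num.max B 0))) => //; first exact: strip_fin.
  apply: measurable_funM; first exact: measurable_phim.
  have m1 : measurable_fun (strip s t) (fun y => nDm y.2 y.1) by apply: (measurable_vnorm (x := fun k y => Dm k y.2 y.1)) => k; exact: measurable_Dm.
  exact: (measurableT_comp (measurable_modulus rho_mono) m1).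
move=> [w r] /(st0 s0) /= r0; rewrite ger0_norm ?vrate_ge0// /vrate indicE /=.
have pB : 0 <= rho (Num.max B 0) by rewrite rho0// le_max lexx orbT.
have [ib|nib] := pselect (inside_before r w); last by rewrite memNset// mul0r.
rewrite mem_set// mul1r; apply: rho_mono; first by rewrite le_max lexx orbT.
by rewrite ge_max !le_max lexx orbT andbT nDm_bnd.
Qed.

Lemma L1_xrate (s t : R) : 0 <= s -> L1 Q (strip s t) xrate.
Proof.
move=> s0; have ms := @measurable_strip _ O R s t.
apply: (@L1_bnd _ _ _ _ _ _ (Num.max B 0)) => //; first exact: strip_fin.
  apply: measurable_funM; first exact: measurable_phim.
  by apply: (measurable_vnorm (x := fun k y => Dm k y.2 y.1)) => k; exact: measurable_Dm.
move=> [w r] /(st0 s0) /= r0; rewrite /xrate indicE /=.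
have [ib|nib] := pselect (inside_before r w); last by rewrite memNset// mul0r normr0 le_max lexx orbT.
by rewrite mem_set// mul1r ger0_norm ?vnorm_ge0// le_max nDm_bnd.
Qed.

Lemma V_ge0 T : 0 <= V T.
Proof. by rewrite mulr_ge0 ?mulr_ge0// Rintegral_ge0// => y _; exact: vrate_ge0. Qed.

Lemma V0 : V 0 = 0.
Proof.
rewrite /V (_ : strip 0 0 = set0) ?Rintegral_set0 ?mulr0// -subset0 => -[w r] [_ /=].
by rewrite in_itv/= => /andP[h1 h2]; have := lt_le_trans h1 h2; rewrite ltxx.
Qed.

(** Splitting (1 + th) / 2 into 1/2 and th / 2 isolates the combination bounded by the modulus, in
    which the factor |Dm| is absorbed by the denominator. The surplus in th is controlled only by
    the crude bounds H2 <= K and f >= e, so th has to be small compared with e. *)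
Lemma rate_lim_le e th (T : R) y : 0 < e -> 0 < th -> strip 0 T y ->
  rate_lim e th y <= 3 * C0 * vrate y + th * (K / (2 * e)).
Proof.
move=> e0 th0 /(st0 (lexx 0)); case: y => w s /= s0.
have k0 : 0 <= th * (K / (2 * e)) by rewrite mulr_ge0 ?(ltW th0)// divr_ge0// mulr_ge0// ltW.
rewrite /rate_lim /vrate /= indicE.
have [ib|nib] := pselect (inside_before s w); last by rewrite memNset// !mul0r mulr0 add0r.
rewrite mem_set// !mul1r (max_idPl (vnorm_ge0 _)).
have [h1 h2] := rate_bound s0 ib.
set f := fnorm e _; have f0 : 0 < f := fnorm_gt0 _ e0.
have fe : e <= f := fnorm_ge _ e0.
have nf : nDm s w <= f := vnorm_le_fnorm e _.
have rn : 0 <= rho (nDm s w) by rewrite rho0// vnorm_ge0.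
have /andP[H20 H21] := H2K (w, s).
have if0 : 0 <= f^-1 by rewrite invr_ge0 ltW.
have g1 := ler_wpM2r if0 h1.
have g2 : C0 * nDm s w * rho (nDm s w) * f^-1 <= C0 * rho (nDm s w).
  rewrite -mulrA -[leRHS]mulr1 -!mulrA ler_wpM2l// mulrCA ler_wpM2l// ler_pdivrMr// mul1r//.
have g3 : th / 2 * (H2 (w, s) / f) <= th * (K / (2 * e)).
  have -> : th * (K / (2 * e)) = th / 2 * (K / e) by field; rewrite gt_eqF.
  rewrite ler_wpM2l ?divr_ge0 ?(ltW th0)//; apply: ler_pM => //.
  by rewrite lef_pV2 ?posrE.
have -> : (\sum_k Dm k s w * a k (w, s)) / f + (1 + th) / 2 * (H2 (w, s) / f) + 2 * G (w, s) =
  (\sum_k Dm k s w * a k (w, s) + 2^-1 * H2 (w, s)) * f^-1 + th / 2 * (H2 (w, s) / f) + 2 * G (w, s).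
  by field; rewrite gt_eqF.
apply: (le_trans (lerD (lerD (le_trans g1 g2) g3) (ler_wpM2l (ler0n R 2) h2))).
by rewrite le_eqVlt; apply/orP; left; apply/eqP; ring.
Qed.

(** The smoothing e and the Young parameter th are fixed first, and then the grid is refined; the
    rates converge pointwise under a bound that depends on e and th but not on the grid. *)
Lemma Zsum_lim (T eta : R) : 0 < T -> 0 < eta ->
  \forall m \near \oo, \int[P]_w Zsum (T / m.+1%:R) m.+1 w <= V T + eta.
Proof.
move=> T0 eta0.
pose e := eta / 3; have e0 : 0 < e by rewrite divr_gt0.
have KT : 0 < K * T + 1 by rewrite ltr_wpDl// mulr_ge0// ltW.
(* Chosen so that the surplus th K / (2 e), accumulated over [0, T], stays below e; with the
   starting value e the total excess is then 2 e < eta. *)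
pose th := 2 * e * e / (K * T + 1).
have th0 : 0 < th by rewrite divr_gt0// !mulr_gt0.
have thT : T * (th * (K / (2 * e))) <= e.
  have -> : T * (th * (K / (2 * e))) = e * ((K * T) / (K * T + 1)) by rewrite /th; field; rewrite !gt_eqF.
  by rewrite ler_piMr ?(ltW e0)// ler_pdivrMr// mul1r lerDl.
have hm (m : nat) : 0 < T / m.+1%:R by rewrite divr_gt0.
have ms := @measurable_strip _ O R 0 T.
pose Bd := d%:R * K + (1 + th) / 2 * (e^-1 * K) + 2 * K.
have mgr m : measurable_fun (strip 0 T) (fun y => grate e th (qgrid (T / m.+1%:R) y.2) y).
  by apply: measurable_funTS; exact: measurable_grate_qgrid.
have cg (y : OR) : strip 0 T y -> grate e th (qgrid (T / m.+1%:R) y.2) y @[m --> \oo] --> rate_lim e th y.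
  by move=> /(st0 (lexx 0)); case: y => w s /= s0; exact: cvg_grate.
have mrl : measurable_fun (strip 0 T) (rate_lim e th).
  by apply: (@measurable_fun_cvg _ OR R (strip 0 T) (fun m y => grate e th (qgrid (T / m.+1%:R) y.2) y)).
have iBd : L1 Q (strip 0 T) (fun=> Bd).
  by apply: (@L1_bnd _ _ _ _ _ _ `|Bd|) => //; exact: strip_fin.
have gBd m (y : OR) : strip 0 T y -> `|grate e th (qgrid (T / m.+1%:R) y.2) y| <= Bd.
  by move=> _; exact: grate_bounded.
have c1 := Rint_dominated ms mgr iBd gBd cg mrl.
have rlB (y : OR) : strip 0 T y -> `|rate_lim e th y| <= Bd.
  move=> hy; apply: (cvgr_to_le (cvg_norm (cg y hy))); apply: nearW => m; exact: gBd.
have irl : L1 Q (strip 0 T) (rate_lim e th).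
  by apply: (@L1_bnd _ _ _ _ _ _ Bd) => //; exact: strip_fin.
(* There are m + 1 cells, each with a drift error of order (T / (m+1))^2. *)
pose C1 := (1 + th^-1) / 2 * (e^-1 * (d%:R * K ^+ 2)) * T ^+ 2.
have c2 : C1 / m.+1%:R @[m --> \oo] --> (0 : R).
  by rewrite -[X in _ --> X](mulr0 C1); apply: cvgMl_tmp; exact: cvg_harmonic.
have lim_le : e + \int[Q]_(y in strip 0 T) rate_lim e th y + 0 < V T + eta.
  have ik : L1 Q (strip 0 T) (fun=> th * (K / (2 * e))).
    by apply: (@L1_bnd _ _ _ _ _ _ `|th * (K / (2 * e))|) => //; exact: strip_fin.
  have iv := L1Z (3 * C0) ms (L1_vrate T (lexx 0)).
  have : \int[Q]_(y in strip 0 T) rate_lim e th y <= V T + e.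
    apply: (@le_trans _ _ (\int[Q]_(y in strip 0 T) (3 * C0 * vrate y + th * (K / (2 * e))))).
      apply: ler_Rint => //; [exact: L1D|move=> y hy; exact: (rate_lim_le e0 th0 hy)].
    rewrite (RintegralDr ms iv ik) (RintegralZl _ ms (L1_vrate T (lexx 0))) lerD2l.
    have b1 : exists C : R, forall w : O, `|(1 : R)| <= C by exists 1 => w; rewrite normr1.
    have H := @strip_Rint_cst _ _ _ P 0 T (th * (K / (2 * e))) (fun=> 1) (ltW T0) (measurable_cst _) b1.
    have P1 : \int[P]_w (1 : R) = 1 by rewrite Rintegral_cst//= probability_setT mulr1.
    rewrite P1 mulr1 subr0 in H.
    by under eq_Rintegral do rewrite -[th * (K / (2 * e))]mul1r; rewrite H.
  have e2 : 2 * e < eta by rewrite /e; lra.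
  move=> h; rewrite addr0; apply: (@le_lt_trans _ _ (V T + 2 * e)); last by rewrite ltrD2l.
  by rewrite addrC mulr2n mulrDl mul1r addrA lerD2r.
have c3 : e + \int[Q]_(y in strip 0 T) grate e th (qgrid (T / m.+1%:R) y.2) y + C1 / m.+1%:R @[m --> \oo]
   --> e + \int[Q]_(y in strip 0 T) rate_lim e th y + 0.
  by apply: cvgD => //; apply: cvgD => //; exact: cvg_cst.
have ev : \forall m \near \oo, e + \int[Q]_(y in strip 0 T) grate e th (qgrid (T / m.+1%:R) y.2) y + C1 / m.+1%:R < V T + eta.
  by apply: (cvgr_lt (e + \int[Q]_(y in strip 0 T) rate_lim e th y + 0)).
apply: filterS ev => m hlt; apply: (le_trans (Zsum_le m.+1 e0 th0 (hm m))).
have -> : m.+1%:R * (T / m.+1%:R) = T by rewrite mulrCA divff ?mulr1.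
apply: le_trans (ltW hlt); rewrite lerD2l le_eqVlt; apply/orP; left; apply/eqP.
rewrite /C1; have : m.+1%:R != 0 :> R by [].
move: (1 + th^-1) (e^-1) (m.+1%:R : R) => x y q q0; by field.
Qed.

(** If t is inside, so is every grid point up to t, and [Zsum] is |D| at t; otherwise the left side
    is 0 and [Zsum] is nonnegative. The time 0 is treated apart, having no grid. *)
Lemma inside_le_V t : 0 <= t -> L1 P setT (fun w => phi t w * nDl t w) /\
  \int[P]_w (phi t w * nDl t w) <= V t.
Proof.
move=> t0.
have iD : L1 P setT (fun w => phi t w * nDl t w).
  apply: (@L1_bnd _ _ _ _ _ _ (Num.max B 0)) => //.
    apply: measurable_funM; first exact: (Fmeas uh t0 (mphi t0)).
    by apply: measurable_vnorm => k; exact: (Fmeas uh t0 (mDl k t0)).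
  move=> w _; rewrite indicE.
  have [ib|nib] := pselect (inside t w); last by rewrite memNset// mul0r normr0 le_max lexx orbT.
  by rewrite mem_set// mul1r ger0_norm ?vnorm_ge0// le_max Dl_bnd.
split => //; move: t0; rewrite le_eqVlt => /orP[/eqP t0|t0].
  apply: le_trans (V_ge0 t); rewrite -t0 in iD *.
  have i0 : L1 P setT (fun=> 0 : R) by apply: (@L1_bnd _ _ _ _ _ _ 0) => // w _; rewrite normr0.
  apply: (@le_trans _ _ (\int[P]_w (0 : R))); last by rewrite /Rintegral integral0.
  apply: ae_ler_Rint => //; apply: filterS2 DDl D_start => w HD HD0 _; rewrite indicE.
  have [ib|nib] := pselect (inside 0 w); last by rewrite memNset// mul0r.
  have -> : (fun k => Dl k 0 w) = (fun=> 0) by apply/funext => k; rewrite -HD// HD0.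
  by rewrite vnorm0 mulr0.
apply/ler_addgt0Pr => eta eta0; have [m hm] := filter_ex (Zsum_lim t0 eta0).
apply: le_trans hm; have h0 : 0 < t / m.+1%:R by rewrite divr_gt0.
apply: ae_ler_Rint => //; first exact/L1_Zsum/ltW.
apply: filterS DDl => w HD _; rewrite indicE.
have [ib|nib] := pselect (inside t w); last by rewrite memNset// mul0r; exact/Zsum_ge0/ltW.
rewrite mem_set// mul1r.
have [k [kN _ npk H]] := stop_index m.+1 w (ltW h0); rewrite /Zsum (H (fun u => nD u w)).
have kE : k = m.+1.
  apply/eqP; rewrite eqn_leq kN leqNgt; apply/negP => kN'; apply: (npk kN'); apply: insideS ib.
  by rewrite mulrA ler_pdivrMr// mulrC ler_wpM2l ?(ltW t0)// ler_nat.
rewrite kE mulrCA divff// mulr1.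
by have -> : (fun k => Dl k t w) = (fun k => D k t w) by apply/funext => j; rewrite HD// ltW.
Qed.

Lemma V_split (s t : R) : 0 <= s -> s <= t -> V t = V s + 3 * C0 * \int[Q]_(y in strip s t) vrate y.
Proof. by move=> s0 st; rewrite /V (strip_split s0 st (L1_vrate t (lexx 0))) mulrDr. Qed.

Lemma V_mono (s t : R) : 0 <= s -> s <= t -> V s <= V t.
Proof.
by move=> s0 st; rewrite (V_split s0 st) lerDl mulr_ge0 ?mulr_ge0// Rintegral_ge0// => y _; exact: vrate_ge0.
Qed.

(** Dominated convergence along grid points increasing to r turns values into left limits, which is
    what the rates contain. *)
Lemma inside_before_le_V r : 0 < r -> L1 P setT (fun w => phim r w * nDm r w) /\
  \int[P]_w (phim r w * nDm r w) <= V r.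
Proof.
move=> r0.
have hm (m : nat) : 0 < r / m.+1%:R by rewrite divr_gt0.
pose q (m : nat) := qgrid (r / m.+1%:R) r.
have mj m : measurable_fun setT (fun w => phi (q m) w * nDl (q m) w).
  exact: (L1_meas (inside_le_V (qgrid_ge0 _ _)).1).
have cv w : [set: O] w -> phi (q m) w * nDl (q m) w @[m --> \oo] --> phim r w * nDm r w.
  move=> _; apply: cvgM; first exact: cvg_phi.
  by apply: cvg_vnorm => k; apply: (@cvg_left_qgrid _ (fun t => Dl k t w)) => //; exact: lDl.
have ml := @measurable_fun_cvg _ O R setT _ _ mj cv.
have bd m w : [set: O] w -> `|phi (q m) w * nDl (q m) w| <= Num.max B 0.
  move=> _; rewrite indicE.
  have [ib|nib] := pselect (inside (q m) w); last by rewrite memNset// mul0r normr0 le_max lexx orbT.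
  by rewrite mem_set// mul1r ger0_norm ?vnorm_ge0// le_max Dl_bnd// qgrid_ge0.
have iB : L1 P setT (fun=> Num.max B 0) by exact: (@L1_bnd _ _ _ _ _ _ `|Num.max B 0|).
have c := Rint_dominated measurableT mj iB bd cv ml.
split.
  apply: (@L1_bnd _ _ _ _ _ _ (Num.max B 0)) => // w _.
  by apply: (cvgr_to_le (cvg_norm (cv w I))); apply: nearW => m; exact: bd.
apply: (cvgr_to_le c); apply: nearW => m.
apply: (le_trans (inside_le_V (qgrid_ge0 _ _)).2); apply: V_mono; first exact: qgrid_ge0.
by have /andP[_ /ltW] := qgrid_lt (hm m) r0.
Qed.

(** The linear majorant of rho is taken at m = V t, which must be positive. By monotonicity of V the
    mean of the left limits over [s, t] is at most m, so the majorant integrates to at most 2 rho(m)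
    (t - s); with the 3 in V this makes 6. *)
Lemma V_incr (s t : R) : 0 <= s -> s <= t -> V s <= V t <= V s + 6 * C0 * (t - s) * rho (V t).
Proof.
move=> s0 st; rewrite V_mono//=.
have [Vt0|Vt0] := leP (V t) 0.
  apply: (le_trans Vt0); apply: addr_ge0; first exact: V_ge0.
  by rewrite mulr_ge0 ?rho0 ?V_ge0// mulr_ge0 ?subr_ge0// mulr_ge0.
set m := V t in Vt0 *; have ms := @measurable_strip _ O R s t.
have rm : 0 <= rho m by rewrite rho0// ltW.
have im0 : 0 < m^-1 by rewrite invr_gt0.
have ix := L1_xrate t s0.
have x0 y : 0 <= xrate y by rewrite mulr_ge0 ?vnorm_ge0//; case/andP: (phim01 y.2 y.1).
have leb_st : leb `]s, t]%classic = (t - s)%:E.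
  rewrite lebesgue_measure_itv/= lte_fin; case: ifPn => [_|]; first by rewrite -EFinB.
  by rewrite -leNgt => ts; rewrite (_ : t = s) ?subrr//; apply/eqP; rewrite eq_le ts.
have xle : \int[Q]_(y in strip s t) xrate y <= m * (t - s).
  rewrite -lee_fin RintegralE//.
  have mx : measurable_fun (strip s t) (fun y => (xrate y)%:E).
    by apply/measurable_EFinP; exact: (L1_meas ix).
  have [-> mr] := ge0_strip_fubini2 P mx (fun y => x0 y).
  rewrite EFinM -leb_st -integral_cst//.
  apply: ge0_le_integral => //.
  - by move=> r _; apply: integral_ge0 => w _; rewrite lee_fin x0.
  - move=> r; rewrite /= in_itv/= => /andP[sr rt].
    have r0 : 0 < r by exact: le_lt_trans sr.
    have [i1 h1] := inside_before_le_V r0.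
    rewrite -(@RintegralE _ _ _ P setT (fun w => xrate (w, r)))// lee_fin (le_trans h1)//.
    by apply: V_mono => //; exact: ltW.
have irx : L1 Q (strip s t) (fun y => rho m * (1 + m^-1 * xrate y)).
  apply: L1Z => //; apply: L1D => //; last exact: L1Z.
  by apply: (@L1_bnd _ _ _ _ _ _ 1) => //; [exact: strip_fin|move=> y _; rewrite normr1].
have i1 : L1 Q (strip s t) (fun=> 1 : R).
  by apply: (@L1_bnd _ _ _ _ _ _ 1) => //; [exact: strip_fin|move=> y _; rewrite normr1].
have one : \int[Q]_(y in strip s t) (1 : R) = t - s.
  have b1 : exists C : R, forall w : O, `|(1 : R)| <= C by exists 1 => w; rewrite normr1.
  have H := @strip_Rint_cst _ _ _ P s t 1 (fun=> 1) st (measurable_cst _) b1.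
  have P1 : \int[P]_w (1 : R) = 1 by rewrite Rintegral_cst//= probability_setT mulr1.
  by rewrite P1 !mulr1 in H; rewrite -H.
have vle : \int[Q]_(y in strip s t) vrate y <= rho m * (2 * (t - s)).
  apply: (@le_trans _ _ (\int[Q]_(y in strip s t) (rho m * (1 + m^-1 * xrate y)))).
    apply: ler_Rint => //; first exact: L1_vrate.
    move=> y _; rewrite /vrate /xrate indicE.
    have [ib|nib] := pselect (inside_before y.2 y.1); last first.
      by rewrite memNset// !mul0r mulr0 addr0 mulr1.
    rewrite mem_set// !mul1r (max_idPl (vnorm_ge0 _)) [m^-1 * _]mulrC.
    exact: (concave_le_linear rho0 rho_mono rho_concave Vt0 (vnorm_ge0 _)).
  have iz := L1Z m^-1 ms ix; have i1z := L1D ms i1 iz.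
  rewrite (RintegralZl _ ms i1z) (RintegralDr ms i1 iz) one (RintegralZl _ ms ix).
  rewrite ler_wpM2l//.
  have -> : 2 * (t - s) = (t - s) + m^-1 * (m * (t - s)) by rewrite mulKf ?gt_eqF//; ring.
  by rewrite lerD2l ler_wpM2l// ltW.
rewrite [leLHS](V_split s0 st) lerD2l.
apply: (le_trans (ler_wpM2l _ vle)); first by rewrite mulr_ge0.
by rewrite le_eqVlt; apply/orP; left; apply/eqP; ring.
Qed.

Lemma V_eq0 t : 0 <= t -> V t = 0.
Proof.
by apply: (osgood rho0 rho_mono rho_pos rho_osgood (C := 6 * C0)); [rewrite mulr_ge0|exact: V0|exact: V_incr].
Qed.

(** V = 0 settles countably many rational times outside one null set; right continuity extends this
    to t. The slack t < r leaves rational times just after t that are still inside. *)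
Lemma inside_zero : {ae P, forall w, forall t r, 0 <= t -> t < r -> inside r w -> forall k, Dl k t w = 0}.
Proof.
pose qn (i : nat) : R := ratr (odflt 0%Q (unpickle i)).
have : {ae P, forall w, forall i, 0 <= qn i -> inside (qn i) w -> forall k, Dl k (qn i) w = 0}.
  apply: ae_foralln => i; have [q0|q0] := leP 0 (qn i); last by exact: nearW.
  have [iD hD] := inside_le_V q0; rewrite V_eq0// in hD.
  have : (\int[P]_(w in setT) `|(phi (qn i) w * nDl (qn i) w)%:E| = 0)%E.
    under eq_integral do rewrite gee0_abs ?lee_fin ?mulr_ge0 ?vnorm_ge0 ?(andP (phi01 _ _)).1//.
    rewrite -(RintegralE measurableT iD); congr EFin; apply/eqP; rewrite eq_le hD.
    by apply: Rintegral_ge0 => w _; rewrite mulr_ge0 ?vnorm_ge0//; case/andP: (phi01 (qn i) w).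
  have mE : measurable_fun setT (fun w => (phi (qn i) w * nDl (qn i) w)%:E).
    by apply/measurable_EFinP; exact: (L1_meas iD).
  move=> /(ae_eq_integral_abs P measurableT mE); apply: filterS => w hw _ ib k.
  move: (hw I); rewrite indicE mem_set// mul1r => -[n0].
  by apply/eqP; rewrite -normr_le0 -n0; exact: (le_coord_vnorm (fun k => Dl k (qn i) w)).
apply: filterS => w hw t r t0 tr ir k; apply: contrapT => /eqP nz.
have e0 : 0 < `|Dl k t w| / 2 by rewrite divr_gt0// normr_gt0.
have [eta eta0 he] := near_right_ex (near_dist_le _ (@rDl k w t t0) e0).
have : t < Num.min r (t + eta) by rewrite lt_min tr ltrDl.
move=> /rat_in_itvoo[q]; rewrite in_itv/= lt_min => /and3P[q1 q2 q3].
have qE : qn (pickle q) = ratr q by rewrite /qn pickleK.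
have := hw (pickle q); rewrite qE => /(_ (le_trans t0 (ltW q1)) (insideS (ltW q2) ir) k) z0.
have := he _ q1 q3; rewrite z0 subr0; have : 0 < `|Dl k t w| by rewrite normr_gt0.
lra.
Qed.

Lemma cvg_D_right k w t : 0 <= t -> D k u w @[u --> t^'+] --> D k t w.
Proof.
move=> t0; apply: cvgD; last exact: rL.
apply: cvgD; last exact: rM.
apply/cvgrPdist_le => e e0.
have K1 : 0 < K + 1 by rewrite ltr_wpDl.
near=> u; have tu : t < u by near: u; exact: nbhs_right_gt.
have ut : u < t + e / (K + 1) by near: u; apply: nbhs_right_lt; rewrite ltrDl divr_gt0.
rewrite distrC (le_trans (drift_incr_le k w t0 (ltW tu)))//.
have h : u - t <= e / (K + 1) by rewrite lerBlDl ltW.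
apply: (le_trans (ler_wpM2l K0 h)).
by rewrite mulrCA ler_piMr ?(ltW e0)// ler_pdivrMr// mul1r lerDl.
Unshelve. all: by end_near. Qed.

(** For a path exiting at S < T, [Zsum] is |D| at a grid point between S and S plus one mesh width,
    so by right continuity it tends to |D| at S as the grid is refined. Its expectation tends to 0,
    and Fatou's lemma concludes. *)
Lemma exit_zero (T : R) : 0 < T ->
  {ae P, forall w, forall S, 0 <= S -> S < T -> (forall r, 0 <= r -> r < S -> inside r w) ->
    (forall r, S < r -> ~ inside r w) -> forall k, D k S w = 0}.
Proof.
move=> T0.
have hm (m : nat) : 0 < T / m.+1%:R by rewrite divr_gt0.
pose Z (m : nat) w := Zsum (T / m.+1%:R) m.+1 w.
have iZ m : L1 P setT (Z m) by exact/L1_Zsum/ltW.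
have Z0 m w : 0 <= Z m w by exact/Zsum_ge0/ltW.
have mZ m : measurable_fun setT (EFin \o Z m) by apply/measurable_EFinP; exact: (L1_meas (iZ m)).
have cZ : (\int[P]_w (Z m w)%:E)%E @[m --> \oo] --> 0%E.
  have -> : (fun m => \int[P]_w (Z m w)%:E)%E = (fun m => (\int[P]_w Z m w)%:E).
    by apply/funext => m; rewrite -RintegralE.
  apply: cvg_EFin; first exact: nearW.
  have cr : \int[P]_w Z m w @[m --> \oo] --> (0 : R).
    apply/cvgrPdist_le => e e0; apply: filterS (Zsum_lim T0 e0) => m; rewrite V_eq0 ?(ltW T0)// add0r => h.
    by rewrite sub0r normrN ger0_norm// Rintegral_ge0.
  exact: cr.
(* The lower limit makes sense for every w, so the random time S enters only afterwards, path by
   path. *)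
have fat := @fatou _ _ _ P setT measurableT (fun m => EFin \o Z m) mZ (fun m w _ => ltac:(by rewrite lee_fin)).
have mli : measurable_fun setT (fun w => limn_einf (fun m => (Z m w)%:E)).
  apply: (emeasurable_fun_cvg (fun m w => einfs (fun j => (Z j w)%:E) m)).
  - by move=> m; exact: measurable_fun_einfs.
  - by move=> w _; rewrite limn_einf_lim; exact: is_cvg_einfs.
have li0 w : (0 <= limn_einf (fun m => (Z m w)%:E))%E.
  rewrite limn_einf_lim; apply: lime_ge; first exact: is_cvg_einfs.
  by apply: nearW => m; apply: le_ereal_inf_tmp => _ [j _ <-]; rewrite lee_fin.
have : (\int[P]_(w in setT) `|limn_einf (fun m => (Z m w)%:E)| = 0)%E.
  under eq_integral do rewrite gee0_abs//.
  apply/eqP; rewrite eq_le integral_ge0// andbT; apply: (le_trans fat).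
  by have [-> _] := cvg_limn_einf_sup cZ.
move=> /(ae_eq_integral_abs P measurableT mli); apply: filterS => w hw S S0 ST ins nins k.
have cD : nD u w @[u --> S^'+] --> nD S w by apply: cvg_vnorm => j; exact: cvg_D_right.
have cZw : (Z m w)%:E @[m --> \oo] --> (nD S w)%:E.
  apply: cvg_EFin; first exact: nearW.
  suff cr : Z m w @[m --> \oo] --> nD S w by exact: cr.
  apply/cvgrPdist_le => e e0.
  have [eta eta0 he] := near_right_ex (near_dist_le _ cD e0).
  have ev : \forall m \near \oo, T / m.+1%:R < eta.
    have c : T / m.+1%:R @[m --> \oo] --> (0 : R).
      by rewrite -[X in _ --> X](mulr0 T); apply: cvgMl_tmp; exact: cvg_harmonic.
    by apply: (cvgr_lt (0 : R)).
  apply: filterS ev => m hme; have h0 := hm m.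
  have [j [jN pj npj H]] := stop_index m.+1 w (ltW h0).
  rewrite /Z /Zsum (H (fun u => nD u w)).
  (* The stopping index is either not inside, or the last one, whose time T exceeds S; so it is not
     before S. The preceding index is inside, so it is not after S. *)
  have jS : S <= j%:R * (T / m.+1%:R).
    move: jN; rewrite leq_eqVlt => /orP[/eqP ->|jN].
      by rewrite mulrCA divff// mulr1 ltW.
    rewrite leNgt; apply/negP => lt; apply: (npj jN); apply: ins => //.
    by rewrite mulr_ge0// ltW.
  have jS' : j%:R * (T / m.+1%:R) <= S + T / m.+1%:R.
    case: j {H npj jN jS} pj => [|j] pj; first by rewrite mul0r addr_ge0// ltW.
    rewrite -natr1 mulrDl mul1r lerD2r leNgt; apply/negP => lt.
    by apply: (nins _ lt); apply: pj.
  move: jS; rewrite le_eqVlt => /orP[/eqP <-|jS]; first by rewrite subrr normr0 ltW.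
  by apply: he => //; rewrite (le_lt_trans jS')// ltrD2l.
have := hw I; have [-> _] := cvg_limn_einf_sup cZw => -[n0].
by apply/eqP; rewrite -normr_le0 -n0; exact: (le_coord_vnorm (fun k => D k S w)).
Qed.

End comparison.

(** * Comparison of two solutions *)

Lemma vnormZ (R : realType) d (t : R) (x : 'I_d -> R) : vnorm (fun k => t * x k) = `|t| * vnorm x.
Proof.
rewrite /vnorm -sqrtr_sqr -sqrtrM ?sqr_ge0// mulr_sumr; congr Num.sqrt.
by apply: eq_bigr => k _; rewrite exprMn.
Qed.

Lemma hsnormBC (R : realType) d (x y : 'cV[R]_d) : hsnorm (x - y) = hsnorm (y - x).
Proof.
rewrite !hsnorm_vnorm /vnorm; congr Num.sqrt; apply: eq_bigr => k _.
by rewrite !mxE -sqrrN opprB.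
Qed.

Lemma le_coord_hsnorm (R : realType) d (x : 'cV[R]_d) k : `|x k ord0| <= hsnorm x.
Proof. by rewrite hsnorm_vnorm; exact: (le_coord_vnorm (fun k => x k ord0)). Qed.

Lemma measurable_hsnorm dT (T : measurableType dT) (R : realType) d (f : T -> 'cV[R]_d) :
  (forall k, measurable_fun setT (fun u => f u k ord0)) -> measurable_fun setT (fun u => hsnorm (f u)).
Proof.
move=> mf; under eq_fun do rewrite hsnorm_vnorm.
exact: (measurable_vnorm (x := fun k u => f u k ord0)).
Qed.

(** * Integrals over the mark space along a strip *)

Section slab_integral.
Context {dO : measure_display} {O : measurableType dO} {R : realType} (P : probability O R).
Context {dU : measure_display} {U : measurableType dU} (nu : {sigma_finite_measure set U -> \bar R}).
Local Notation leb := (@lebesgue_measure R).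
Local Notation Q := (P \x leb)%E.
Local Notation QN := ((P \x leb) \x nu)%E.
Local Notation OR := (O * measurableTypeR R)%type.
Variables (f : OR * U -> R) (C : R).
Hypothesis mf : measurable_fun setT f.
Hypothesis fC : forall z : OR, (\int[nu]_u `|f (z, u)|%:E <= C%:E)%E.
Local Notation I z := (\int[nu]_u `|f (z, u)|).

Lemma section_L1 z : L1 nu setT (fun u => f (z, u)).
Proof.
apply/integrableP; split.
  by apply/measurable_EFinP; exact: (measurableT_comp mf (pair1_measurable z)).
exact: (le_lt_trans (fC z) (ltry C)).
Qed.

Lemma section_int_le z : 0 <= I z <= C.
Proof.
rewrite Rintegral_ge0//=; rewrite -lee_fin RintegralE//; exact: L1_norm (section_L1 z).
Qed.

Lemma measurable_section_int : measurable_fun setT (fun z : OR => I z).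
Proof.
have mn : measurable_fun setT (fun y => `|f y|%:E).
  by apply/measurable_EFinP; apply: measurableT_comp.
have := measurable_fun_fubini_tonelli_F (m2 := nu) (fun y => `|f y|%:E) mn (fun y => ltac:(by rewrite lee_fin)).
by move=> h; apply: measurableT_comp; [exact: fine_measurable|exact: h].
Qed.

Lemma slab_section (s t : R) (phi : O -> R) (B : R) : measurable_fun setT phi -> (forall w, 0 <= phi w <= B) ->
  (\int[QN]_(y in slab s t) (phi y.1.1 * `|f y|)%:E = \int[Q]_(z in strip s t) (phi z.1 * I z)%:E)%E.
Proof.
move=> mphi phiB.
have phi0 w : 0 <= phi w by case/andP: (phiB w).
rewrite ge0_slab_fubini; last 2 first.
- apply/measurable_EFinP; apply: measurable_funM; last exact: measurableT_comp.
  by apply: measurableT_comp => //; exact: measurableT_comp.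
- by move=> y; rewrite lee_fin mulr_ge0.
rewrite ge0_strip_fubini; last 2 first.
- apply/measurable_EFinP; apply: measurable_funM; last exact: measurable_section_int.
  exact: measurableT_comp.
- by move=> y; rewrite lee_fin mulr_ge0//; case/andP: (section_int_le y).
apply: eq_integral => w _; apply: eq_integral => r _ /=.
have iN : L1 nu setT (fun u => `|f ((w, r), u)|) by apply: L1_norm => //; exact: section_L1.
rewrite EFinM RintegralE// -integralZl//.
Qed.

Lemma slab_L1 (s t : R) : L1 QN (slab s t) f.
Proof.
apply/integrableP; split; first by apply/measurable_EFinP; exact: measurable_funTS.
have b1 w : 0 <= (fun _ : O => 1 : R) w <= 1 by rewrite ler01 lexx.
have h := @slab_section s t (fun=> 1) 1 (measurable_cst _) b1.
have -> : (\int[QN]_(y in slab s t) `|(f y)%:E| = \int[Q]_(z in strip s t) (I z)%:E)%E.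
  transitivity (\int[QN]_(y in slab s t) ((fun _ : O => 1) y.1.1 * `|f y|)%:E)%E.
    by apply: eq_integral => y _; rewrite mul1r.
  by rewrite h; apply: eq_integral => y _; rewrite mul1r.
have : L1 Q (strip s t) (fun z => I z).
  apply: (@L1_bnd _ _ _ _ _ _ C).
  - exact: measurable_strip.
  - exact: strip_fin.
  - by apply: measurable_funTS; exact: measurable_section_int.
  - by move=> z _; have /andP[h0 h1] := section_int_le z; rewrite ger0_norm.
move=> /integrableP[_]; apply: le_lt_trans; rewrite le_eqVlt; apply/orP; left; apply/eqP.
by apply: eq_integral => z _ /=; rewrite ger0_norm//; case/andP: (section_int_le z).
Qed.

Lemma slab_section_R (s t : R) (phi : O -> R) (B : R) : measurable_fun setT phi -> (forall w, 0 <= phi w <= B) ->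
  \int[QN]_(y in slab s t) (phi y.1.1 * `|f y|) = \int[Q]_(z in strip s t) (phi z.1 * I z).
Proof. by move=> mphi phiB; rewrite /Rintegral (slab_section s t mphi phiB). Qed.

End slab_integral.

(** * Bounds on the jump coefficient over balls *)

Section coefficient_bounds.
Context {R : realType} {d : nat} {dU : measure_display} {U : measurableType dU}.
Variables (nu : {sigma_finite_measure set U -> \bar R}).
Variables (b : 'cV[R]_d -> 'cV[R]_d) (sigma : 'cV[R]_d -> 'M[R]_d) (c : 'cV[R]_d -> U -> 'cV[R]_d).
Hypothesis sa : standing_assumptions nu b sigma c.
Variables (delta0 : R) (rho : R -> R).
Hypothesis d0 : 0 < delta0.
Hypothesis rho0 : forall r, 0 <= r -> 0 <= rho r.
Hypothesis rho_mono : forall r s, 0 <= r -> r <= s -> rho r <= rho s.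
Variables (K kappa : R).
Hypotheses (K0 : 0 < K) (kappa0 : 0 < kappa).
Hypothesis c_mod : forall x z : 'cV[R]_d, hsnorm x <= K -> hsnorm z <= K -> hsnorm (x - z) <= delta0 ->
  (\int[nu]_u (hsnorm (c z u - c x u))%:E <= (kappa * rho (hsnorm (z - x)))%:E)%E.
Hypothesis hc0 : (\int[nu]_u (hsnorm (c 0 u))%:E < +oo)%E.

Let mc x k : measurable_fun setT (fun u => c x u k ord0). Proof. exact: (measurable_c sa). Qed.

(* The modulus only compares points within delta0, so x is reached from 0 in m short steps. *)
Lemma c_L1_bound : exists C : R, forall x k, hsnorm x <= K -> (\int[nu]_u `|c x u k ord0|%:E <= C%:E)%E.
Proof.
pose m := (Num.bound (K / delta0)).+1.
have mK : K / m%:R <= delta0.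
  rewrite ler_pdivrMr// mulrC -ler_pdivrMr//.
  have := archi_boundP (divr_ge0 (ltW K0) (ltW d0)); move=> /ltW /le_trans; apply.
  by rewrite ler_nat.
pose c0 := fine (\int[nu]_u (hsnorm (c 0 u))%:E)%E.
have pr : 0 <= kappa * rho delta0 by rewrite mulr_ge0 ?(ltW kappa0)// rho0// ltW.
have mh x x' : measurable_fun setT (fun u => (hsnorm (c x u - c x' u))%:E).
  apply/measurable_EFinP; apply: measurable_hsnorm => k; under eq_fun do rewrite !mxE.
  by apply: measurable_funB.
have hs0 m' q (A : 'M[R]_(m', q)) : 0 <= hsnorm A by exact: sqrtr_ge0.
exists (c0 + m%:R * (kappa * rho delta0)) => x k xK.
have xj j : hsnorm ((j%:R / m%:R) *: x) = j%:R / m%:R * hsnorm x.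
  have q0 : 0 <= (j%:R / m%:R : R) by rewrite divr_ge0.
  rewrite !hsnorm_vnorm -[RHS](_ : `|j%:R / m%:R| * vnorm (fun k => x k ord0) = _); last by rewrite ger0_norm.
  by rewrite -vnormZ; congr vnorm; apply/funext => i; rewrite mxE.
have xjK j : (j <= m)%N -> hsnorm ((j%:R / m%:R) *: x) <= K.
  move=> jm; rewrite xj; apply: le_trans xK; rewrite ler_piMl//.
  by rewrite ler_pdivrMr// mul1r ler_nat.
suff H j : (j <= m)%N -> (\int[nu]_u `|c ((j%:R / m%:R) *: x) u k ord0|%:E <= (c0 + j%:R * (kappa * rho delta0))%:E)%E.
  have e : m%:R / m%:R = 1 :> R by rewrite divff// pnatr_eq0.
  by have := H m (leqnn m); rewrite e scale1r.
elim: j => [_|j IH jm].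
  rewrite !mul0r scale0r addr0 /c0 fineK; last by rewrite ge0_fin_numE// integral_ge0// => u _; rewrite lee_fin.
  apply: ge0_le_integral => //.
  - by apply/measurable_EFinP; apply: measurableT_comp.
  - by apply/measurable_EFinP; exact: measurable_hsnorm.
  - by move=> u _; rewrite lee_fin le_coord_hsnorm.
have step : (\int[nu]_u (hsnorm (c ((j.+1%:R / m%:R) *: x) u - c ((j%:R / m%:R) *: x) u))%:E <= (kappa * rho delta0)%:E)%E.
  have dst : hsnorm ((j.+1%:R / m%:R) *: x - (j%:R / m%:R) *: x) <= delta0.
    rewrite -scalerBl -mulrBl -natr1 addrAC subrr add0r -[1]/(1%:R) xj mul1r.
    apply: le_trans mK; rewrite mulrC ler_pM// ?invr_ge0//.
  apply: (le_trans (c_mod (xjK _ (ltnW jm)) (xjK _ jm) _)); first by rewrite hsnormBC.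
  by rewrite lee_fin ler_wpM2l ?(ltW kappa0)//; apply: rho_mono => //; exact: hs0.
have -> : c0 + j.+1%:R * (kappa * rho delta0) = (c0 + j%:R * (kappa * rho delta0)) + kappa * rho delta0.
  by rewrite -natr1 mulrDl mul1r addrA.
rewrite EFinD; apply: le_trans (leeD (IH (ltnW jm)) step).
rewrite -ge0_integralD//; last 2 first.
- by apply/measurable_EFinP; apply: measurableT_comp.
- by move=> u _; rewrite lee_fin.
apply: ge0_le_integral => //.
- by apply/measurable_EFinP; apply: measurableT_comp.
- apply: emeasurable_funD => //; by apply/measurable_EFinP; apply: measurableT_comp.
- move=> u _; rewrite -EFinD lee_fin.
  have := le_coord_hsnorm (c ((j.+1%:R / m%:R) *: x) u - c ((j%:R / m%:R) *: x) u) k.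
  by rewrite !mxE => h; rewrite -lerBlDl (le_trans _ h)// lerB_dist.
Qed.

(** Continuity on a compact set containing the ball bounds the real-valued integral, and finiteness
    at each x turns this into a bound on the extended one. *)
Lemma c_L2_bound : exists C : R, forall x k, hsnorm x <= K -> (\int[nu]_u ((c x u k ord0) ^+ 2)%:E <= C%:E)%E.
Proof.
have cont : continuous (fun x => \int[nu]_u (hsnorm (c x u) ^+ 2)) by have [] := sa.
have [C hC] := continuous_bounded K cont; exists C => x k xK.
have fin : (\int[nu]_u (hsnorm (c x u) ^+ 2)%:E < +oo)%E by have [_ _ _ _ _ _ h _] := sa; exact: h.
apply: (@le_trans _ _ (\int[nu]_u (hsnorm (c x u) ^+ 2)%:E)%E).
  apply: ge0_le_integral => //.
  - by move=> u _; rewrite lee_fin sqr_ge0.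
  - by apply/measurable_EFinP; apply: measurable_funX.
  - by apply/measurable_EFinP; apply: measurable_funX; exact: measurable_hsnorm.
  - move=> u _; rewrite lee_fin -[leLHS]real_normK ?num_real// lerXn2r ?nnegrE ?le_coord_hsnorm//.
    exact: sqrtr_ge0.
have := hC x xK; rewrite /Rintegral => h.
rewrite -(fineK (_ : (\int[nu]_u (hsnorm (c x u) ^+ 2)%:E \is a fin_num)%E)).
  by rewrite lee_fin (le_trans (ler_norm _)).
by rewrite ge0_fin_numE// integral_ge0// => u _; rewrite lee_fin sqr_ge0.
Qed.

End coefficient_bounds.

Lemma sqr_bnd (R : realType) (x M : R) : `|x| <= M -> x ^+ 2 <= M ^+ 2.
Proof.
move=> h; rewrite -[x ^+ 2]real_normK ?num_real//.
by rewrite lerXn2r ?nnegrE// (le_trans _ h).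
Qed.

Lemma eta_OR (A B C : Type) (g : A * B -> C) : (fun z => g (z.1, z.2)) = g.
Proof. by apply/funext => -[]. Qed.

Lemma eta_ORU (A B D C : Type) (g : (A * B) * D -> C) : (fun y => g ((y.1.1, y.1.2), y.2)) = g.
Proof. by apply/funext => -[[]]. Qed.

Section one_cut.
Context {dO : measure_display} {O : measurableType dO} {R : realType}.
Variables (P : probability O R) (F : R -> set (set O)) (d : nat).
Context {dU : measure_display} {U : measurableType dU}.
Variables (nu : {sigma_finite_measure set U -> \bar R}) (p : O -> R -> option U).
Variables (b : 'cV[R]_d -> 'cV[R]_d) (sigma : 'cV[R]_d -> 'M[R]_d) (c : 'cV[R]_d -> U -> 'cV[R]_d).
Variables (W : R -> O -> 'cV[R]_d) (X : R -> O -> 'cV[R]_d).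
Hypothesis sol : solution P F nu b sigma c W p X.
Variable n : nat.

Lemma cut_ind_inside w s : 0 < s -> (forall r, 0 <= r -> r < s -> hsnorm (X r w) <= n%:R) ->
  [/\ cut_ind X n (w, s) = 1, Yplus X (w, s) = left_lim X s w & hsnorm (left_lim X s w) <= n%:R].
Proof.
move=> s0 h; split; [|by rewrite /Yplus /= s0|exact: (left_bounded sol s0 h)].
rewrite /cut_ind /= indicE mem_set/= ?in_itv/= ?s0// mul1r.
have [[]//|[_ [r [r0 rs]]]] := uptoP X n w s.
by rewrite ltNge h.
Qed.

Lemma cutc_int (q : R -> R) (C : R) k z : q 0 = 0 -> 0 <= C ->
  (forall x, hsnorm x <= n%:R -> (\int[nu]_u (q (c x u k ord0))%:E <= C%:E)%E) ->
  (\int[nu]_u (q (cutc c X n k (z, u)))%:E <= C%:E)%E.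
Proof.
move=> q0 C0 h; rewrite /cutc /=; have [->|[-> _ _ hy]] := cut_indP sol n z.
  rewrite integral0_eq ?lee_fin// => u _; by rewrite mul0r q0.
by under eq_integral do rewrite mul1r; exact: h.
Qed.

End one_cut.

Section level.
Context {dO : measure_display} {O : measurableType dO} {R : realType}.
Variables (P : probability O R) (F : R -> set (set O)) (d : nat).
Context {dU : measure_display} {U : measurableType dU}.
Variables (nu : {sigma_finite_measure set U -> \bar R}) (p : O -> R -> option U).
Variables (b : 'cV[R]_d -> 'cV[R]_d) (sigma : 'cV[R]_d -> 'M[R]_d) (c : 'cV[R]_d -> U -> 'cV[R]_d).
Variables (W : R -> O -> 'cV[R]_d) (X1 X2 : R -> O -> 'cV[R]_d).
Hypothesis uh : usual_hypotheses P F.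
Hypothesis bm : brownian_motion P F W.
Hypothesis pp : poisson_point_process P F nu p.
Hypothesis sa : standing_assumptions nu b sigma c.
Hypothesis sol1 : solution P F nu b sigma c W p X1.
Hypothesis sol2 : solution P F nu b sigma c W p X2.
Hypothesis start : {ae P, forall w, X1 0 w = X2 0 w}.
Variables (delta0 : R) (rho : R -> R).
Hypothesis d0 : 0 < delta0.
Hypothesis rho0 : forall r, 0 <= r -> 0 <= rho r.
Hypothesis rho_mono : forall r s, 0 <= r -> r <= s -> rho r <= rho s.
Hypothesis rho_concave : convex_function (`[0, +oo[%classic : set R^o) (fun r : R^o => - rho r).
Hypothesis rho_pos : forall r, 0 < r -> 0 < rho r.
Hypothesis rho_osgood : forall e : R, 0 < e ->
  (\int[lebesgue_measure]_(r in `]0%R, e[) ((rho r)^-1)%:E)%E = +oo%E.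
Variable n : nat.
Variable kappa : R.
Hypothesis kappa0 : 0 < kappa.
Hypothesis modulus : forall x z : 'cV[R]_d, hsnorm x <= n%:R -> hsnorm z <= n%:R -> hsnorm (x - z) <= delta0 ->
  2 * dotv (z - x) (b z - b x) + hsnorm (sigma z - sigma x) ^+ 2 <= kappa * hsnorm (z - x) * rho (hsnorm (z - x)) /\
  (\int[nu]_u (hsnorm (c z u - c x u))%:E <= (kappa * rho (hsnorm (z - x)))%:E)%E.
Variables Mb Ms C1 C2 : R.
Hypotheses (Mb0 : 0 <= Mb) (Ms0 : 0 <= Ms) (C10 : 0 <= C1) (C20 : 0 <= C2).
Hypothesis b_le : forall k x, hsnorm x <= n%:R -> `|b x k ord0| <= Mb.
Hypothesis sigma_le : forall i j x, hsnorm x <= n%:R -> `|sigma x i j| <= Ms.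
Hypothesis c_le1 : forall k x, hsnorm x <= n%:R -> (\int[nu]_u `|c x u k ord0|%:E <= C1%:E)%E.
Hypothesis c_le2 : forall k x, hsnorm x <= n%:R -> (\int[nu]_u (c x u k ord0 ^+ 2)%:E <= C2%:E)%E.

Local Notation leb := (@lebesgue_measure R).
Local Notation Q := (P \x leb)%E.
Local Notation QN := ((P \x leb) \x nu)%E.
Local Notation OR := (O * measurableTypeR R)%type.
Local Notation csig X i j := (cut X n (fun x => sigma x i j)).
Local Notation cb X k := (cut X n (fun x => b x k ord0)).

Variables (M1 M2 : 'I_d -> 'I_d -> R -> O -> R) (J1 J2 : 'I_d -> R -> O -> R).
Hypothesis hM1 : forall i j, is_ito_integral P F (fun t w => W t w j ord0) (fun s w => csig X1 i j (w, s)) (M1 i j).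
Hypothesis hM2 : forall i j, is_ito_integral P F (fun t w => W t w j ord0) (fun s w => csig X2 i j (w, s)) (M2 i j).
Hypothesis hJ1 : forall i, is_poisson_integral P F nu p (fun s u w => cutc c X1 n i ((w, s), u)) (J1 i).
Hypothesis hJ2 : forall i, is_poisson_integral P F nu p (fun s u w => cutc c X2 n i ((w, s), u)) (J2 i).
Hypothesis hX1 : {ae P, forall w, forall t, 0 <= t -> forall i,
  X1 (stopped_time (exit_time X1 n) t w) w i ord0 = X1 0 w i ord0
    + (\int[leb]_(s in `]0%R, t]) cb X1 i (w, s)) + \sum_(j < d) M1 i j t w + J1 i t w}.
Hypothesis hX2 : {ae P, forall w, forall t, 0 <= t -> forall i,
  X2 (stopped_time (exit_time X2 n) t w) w i ord0 = X2 0 w i ord0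
    + (\int[leb]_(s in `]0%R, t]) cb X2 i (w, s)) + \sum_(j < d) M2 i j t w + J2 i t w}.

(** Twice the positive part, in a form whose continuity and measurability are immediate. The sum of
    three such terms in [excess] is nonpositive exactly when all three constraints hold, so one real
    process describes the exit. *)
Let pos_part (x : R) := x + `|x|.
Definition excess t w : R :=
  pos_part (hsnorm (X1 t w) - n%:R) + pos_part (hsnorm (X2 t w) - n%:R) + pos_part (hsnorm (X1 t w - X2 t w) - delta0).
Definition gap k t w : R := X1 t w k ord0 - X2 t w k ord0.
Definition gap_left k t w : R := left_lim X1 t w k ord0 - left_lim X2 t w k ord0.
Definition drift_gap k (y : OR) : R := cb X1 k y - cb X2 k y.
Definition sigma_gap (y : OR) : R := \sum_k \sum_j (csig X1 k j y - csig X2 k j y) ^+ 2.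
Definition cgap k (y : OR * U) : R := cutc c X1 n k y - cutc c X2 n k y.
Definition jump_gap (y : OR) : R := \sum_k \int[nu]_u `|cgap k (y, u)|.
Definition Mgap k t w : R := \sum_j (M1 k j t w - M2 k j t w).
Definition Jgap k t w : R := J1 k t w - J2 k t w.
Let K : R := (Mb + Mb) + \sum_(k < d) \sum_(j < d) (Ms + Ms) ^+ 2 + \sum_(k < d) (C1 + C1).

Let PT : (P setT < +oo)%E. Proof. by rewrite probability_setT ltry. Qed.

Lemma excessP t w : excess t w <= 0 <->
  [/\ hsnorm (X1 t w) <= n%:R, hsnorm (X2 t w) <= n%:R & hsnorm (X1 t w - X2 t w) <= delta0].
Proof.
have pp0 x : 0 <= pos_part x by rewrite /pos_part -lerBlDl sub0r -normrN ler_norm.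
have ppN x : pos_part x <= 0 -> x <= 0 by rewrite /pos_part; have := normr_ge0 x; lra.
have ppP x : x <= 0 -> pos_part x = 0 by move=> h; rewrite /pos_part ler0_norm// subrr.
rewrite /excess -![_ <= n%:R]subr_le0 -[_ <= delta0]subr_le0; split.
  move=> h; have := pp0 (hsnorm (X1 t w) - n%:R); have := pp0 (hsnorm (X2 t w) - n%:R).
  have := pp0 (hsnorm (X1 t w - X2 t w) - delta0) => h1 h2 h3.
  by split; apply: ppN; move: h h1 h2 h3; move: (pos_part _) (pos_part _) (pos_part _) => x y z; lra.
by move=> [h1 h2 h3]; rewrite !ppP// !addr0.
Qed.

Lemma excess_wrt t : 0 <= t -> measurable_wrt (F t) (excess t).
Proof.
move=> t0; apply/(measurable_wrtP (Fsig uh t0)).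
have m1 k : measurable_fun setT (fun w : g_sigma_algebraType (F t) => X1 t w k ord0).
  by apply/(measurable_wrtP (Fsig uh t0)); exact: (sol_adapted sol1 k t0).
have m2 k : measurable_fun setT (fun w : g_sigma_algebraType (F t) => X2 t w k ord0).
  by apply/(measurable_wrtP (Fsig uh t0)); exact: (sol_adapted sol2 k t0).
have mpp (f : g_sigma_algebraType (F t) -> R) : measurable_fun setT f -> measurable_fun setT (fun w => pos_part (f w)).
  by move=> mf; apply: measurable_funD => //; exact: measurableT_comp.
apply: measurable_funD; first apply: measurable_funD.
- by apply: mpp; apply: measurable_funB => //; exact: measurable_hsnorm.
- by apply: mpp; apply: measurable_funB => //; exact: measurable_hsnorm.
- apply: mpp; apply: measurable_funB => //; apply: measurable_hsnorm => k.
  by under eq_fun do rewrite !mxE; exact: measurable_funB.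
Qed.

Lemma excess_right w t : 0 <= t -> excess s w @[s --> t^'+] --> excess t w.
Proof.
move=> t0; have r1 : X1 s w @[s --> t^'+] --> X1 t w by exact: (sol_right sol1).
have r2 : X2 s w @[s --> t^'+] --> X2 t w by exact: (sol_right sol2).
have cpp (f : R -> R) (l : R) : f s @[s --> t^'+] --> l -> pos_part (f s) @[s --> t^'+] --> pos_part l.
  by move=> h; apply: cvgD => //; exact: cvg_norm.
apply: cvgD; first apply: cvgD.
- by apply: cpp; apply: cvgB; [exact: cvg_hsnorm|exact: cvg_cst].
- by apply: cpp; apply: cvgB; [exact: cvg_hsnorm|exact: cvg_cst].
- apply: cpp; apply: cvgB; last exact: cvg_cst.
  by apply: cvg_hsnorm; exact: cvgB.
Qed.

Lemma gap_wrt k t : 0 <= t -> measurable_wrt (F t) (gap k t).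
Proof.
move=> t0; apply: (wrtB (Fsig uh t0)); [exact: (sol_adapted sol1 k t0)|exact: (sol_adapted sol2 k t0)].
Qed.

Lemma gap_right k w t : 0 <= t -> gap k s w @[s --> t^'+] --> gap k t w.
Proof. by move=> t0; apply: cvgB; apply: cvg_coord; [exact: (sol_right sol1)|exact: (sol_right sol2)]. Qed.

Lemma gap_cvg_left k w s : 0 < s -> gap k u w @[u --> s^'-] --> gap_left k s w.
Proof. by move=> s0; apply: cvgB; apply: cvg_coord; [exact: (sol_left sol1)|exact: (sol_left sol2)]. Qed.

Let mb1 k : measurable_fun setT (cb X1 k).
Proof. by apply: (measurable_cut uh sol1 n); apply: continuous_entry; have [] := sa. Qed.
Let mb2 k : measurable_fun setT (cb X2 k).
Proof. by apply: (measurable_cut uh sol2 n); apply: continuous_entry; have [] := sa. Qed.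
Let ms1 k j : measurable_fun setT (csig X1 k j).
Proof. by apply: (measurable_cut uh sol1 n); apply: continuous_entry; have [] := sa. Qed.
Let ms2 k j : measurable_fun setT (csig X2 k j).
Proof. by apply: (measurable_cut uh sol2 n); apply: continuous_entry; have [] := sa. Qed.
Let mc1 k : measurable_fun setT (cutc c X1 n k).
Proof. exact: (measurable_cutc uh sa sol1 n k). Qed.
Let mc2 k : measurable_fun setT (cutc c X2 n k).
Proof. exact: (measurable_cutc uh sa sol2 n k). Qed.

Lemma measurable_drift_gap k : measurable_fun setT (drift_gap k).
Proof. exact: measurable_funB. Qed.

Let sum1_ge0 : 0 <= \sum_(k < d) (C1 + C1). Proof. by apply: sumr_ge0 => k _; rewrite addr_ge0. Qed.
Let sum2_ge0 : 0 <= \sum_(k < d) \sum_(j < d) (Ms + Ms) ^+ 2.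
Proof. by apply: sumr_ge0 => k _; apply: sumr_ge0 => j _; exact: sqr_ge0. Qed.

Lemma drift_gap_le k y : `|drift_gap k y| <= K.
Proof.
apply: (@le_trans _ _ (Mb + Mb)); last by rewrite /K -addrA lerDl addr_ge0.
by apply: le_trans (ler_normB _ _) _; apply: lerD; [exact: (cut_bounded sol1 (b_le k))|exact: (cut_bounded sol2 (b_le k))].
Qed.

Let s1_le k j y : `|csig X1 k j y| <= Ms. Proof. exact: (cut_bounded sol1 (sigma_le k j)). Qed.
Let s2_le k j y : `|csig X2 k j y| <= Ms. Proof. exact: (cut_bounded sol2 (sigma_le k j)). Qed.
Let sd_le k j y : (csig X1 k j y - csig X2 k j y) ^+ 2 <= (Ms + Ms) ^+ 2.
Proof. by apply: sqr_bnd; apply: le_trans (ler_normB _ _) _; exact: lerD. Qed.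

Lemma measurable_sigma_gap : measurable_fun setT sigma_gap.
Proof.
by apply: measurable_sum => k; apply: measurable_sum => j; apply: measurable_funX; exact: measurable_funB.
Qed.

Lemma sigma_gap_le y : 0 <= sigma_gap y <= K.
Proof.
apply/andP; split; first by apply: sumr_ge0 => k _; apply: sumr_ge0 => j _; exact: sqr_ge0.
apply: (@le_trans _ _ (\sum_(k < d) \sum_(j < d) (Ms + Ms) ^+ 2)).
  by apply: ler_sum => k _; apply: ler_sum => j _; exact: sd_le.
by rewrite /K addrAC lerDr !addr_ge0.
Qed.

Let mcg k : measurable_fun setT (cgap k). Proof. exact: measurable_funB. Qed.

Lemma cgap_le k z : (\int[nu]_u `|cgap k (z, u)|%:E <= (C1 + C1)%:E)%E.
Proof.
have h1 : (\int[nu]_u `|cutc c X1 n k (z, u)|%:E <= C1%:E)%E.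
  by apply: (cutc_int sol1 (q := fun x => `|x|)); [exact: normr0|exact: C10|exact: c_le1].
have h2 : (\int[nu]_u `|cutc c X2 n k (z, u)|%:E <= C1%:E)%E.
  by apply: (cutc_int sol2 (q := fun x => `|x|)); [exact: normr0|exact: C10|exact: c_le1].
have m1 : measurable_fun setT (fun u => `|cutc c X1 n k (z, u)|%:E).
  by apply/measurable_EFinP; apply: measurableT_comp => //; exact: (measurableT_comp (mc1 k) (pair1_measurable z)).
have m2 : measurable_fun setT (fun u => `|cutc c X2 n k (z, u)|%:E).
  by apply/measurable_EFinP; apply: measurableT_comp => //; exact: (measurableT_comp (mc2 k) (pair1_measurable z)).
rewrite EFinD; apply: le_trans (leeD h1 h2); rewrite -ge0_integralD//.
apply: ge0_le_integral => //.
- by apply/measurable_EFinP; apply: measurableT_comp => //; exact: (measurableT_comp (mcg k) (pair1_measurable z)).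
- exact: emeasurable_funD.
- by move=> u _; rewrite -EFinD lee_fin ler_normB.
Qed.

Lemma measurable_jump_gap : measurable_fun setT jump_gap.
Proof. by apply: measurable_sum => k; exact: (measurable_section_int nu (mcg k)). Qed.

Lemma jump_gap_le y : 0 <= jump_gap y <= K.
Proof.
apply/andP; split; first by apply: sumr_ge0 => k _; have /andP[] := section_int_le (mcg k) (cgap_le k) y.
apply: (@le_trans _ _ (\sum_(k < d) (C1 + C1))); last by rewrite /K lerDr !addr_ge0.
by apply: ler_sum => k _; have /andP[] := section_int_le (mcg k) (cgap_le k) y.
Qed.

Let mh1 k j : measurable_fun [set: OR] (fun z : OR => csig X1 k j (z.1, z.2)).
Proof. by rewrite (eta_OR (csig X1 k j)). Qed.
Let mh2 k j : measurable_fun [set: OR] (fun z : OR => csig X2 k j (z.1, z.2)).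
Proof. by rewrite (eta_OR (csig X2 k j)). Qed.
Let mf1 k : measurable_fun [set: OR * U] (fun y : OR * U => cutc c X1 n k ((y.1.1, y.1.2), y.2)).
Proof. by rewrite (eta_ORU (cutc c X1 n k)). Qed.
Let mf2 k : measurable_fun [set: OR * U] (fun y : OR * U => cutc c X2 n k ((y.1.1, y.1.2), y.2)).
Proof. by rewrite (eta_ORU (cutc c X2 n k)). Qed.

Let lM1 k j t : 0 <= t -> L2 P setT (M1 k j t).
Proof. move=> t0; exact: (ito_L2 uh bm (hM1 k j) (mh1 k j) t0). Qed.
Let lM2 k j t : 0 <= t -> L2 P setT (M2 k j t).
Proof. move=> t0; exact: (ito_L2 uh bm (hM2 k j) (mh2 k j) t0). Qed.

Lemma Mgap_L2 k t : 0 <= t -> L2 P setT (Mgap k t).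
Proof. by move=> t0; apply: L2_sum => // j; apply: L2B => //; [exact: lM1|exact: lM2]. Qed.

Lemma Jgap_L2 k t : 0 <= t -> L2 P setT (Jgap k t).
Proof.
move=> t0; apply: L2B => //; [exact: (poisson_L2 uh pp (hJ1 k) (mf1 k) t0)|exact: (poisson_L2 uh pp (hJ2 k) (mf2 k) t0)].
Qed.

Lemma Mgap_mean k s t (psi : O -> R) : 0 <= s -> s <= t -> measurable_wrt (F s) psi ->
  (exists B : R, forall w, `|psi w| <= B) -> \int[P]_w (psi w * (Mgap k t w - Mgap k s w)) = 0.
Proof.
move=> s0 st mpsi bpsi; have t0 := le_trans s0 st; have [B psiB] := bpsi.
have mpsi' := Fmeas uh s0 mpsi.
rewrite (_ : (fun w => _) = (fun w => \sum_j (psi w * (M1 k j t w - M1 k j s w) - psi w * (M2 k j t w - M2 k j s w)))); last first.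
  by apply/funext => w; rewrite /Mgap -sumrB mulr_sumr; apply: eq_bigr => j _; ring.
have l1 j : L1 P setT (fun w => psi w * (M1 k j t w - M1 k j s w)).
  by apply: (@L1Mb _ _ _ _ _ _ _ B) => //; apply: L2_L1 => //; apply: L2B => //; exact: lM1.
have l2 j : L1 P setT (fun w => psi w * (M2 k j t w - M2 k j s w)).
  by apply: (@L1Mb _ _ _ _ _ _ _ B) => //; apply: L2_L1 => //; apply: L2B => //; exact: lM2.
rewrite Rintegral_sumr//; last by move=> j; exact: L1B.
apply: big1 => j _; rewrite (RintegralBr measurableT (l1 j) (l2 j)).
rewrite (ito_incr_mean uh bm (hM1 k j) (mh1 k j) s0 st mpsi bpsi).
by rewrite (ito_incr_mean uh bm (hM2 k j) (mh2 k j) s0 st mpsi bpsi) subrr.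
Qed.

Let ls1 k j s t : L2 Q (strip s t) (fun z : OR => csig X1 k j (z.1, z.2)).
Proof.
apply: (@L2_bnd _ _ _ _ _ _ Ms); [exact: measurable_strip|exact: strip_fin|exact: measurable_funTS|].
by move=> z _; exact: s1_le.
Qed.
Let ls2 k j s t : L2 Q (strip s t) (fun z : OR => csig X2 k j (z.1, z.2)).
Proof.
apply: (@L2_bnd _ _ _ _ _ _ Ms); [exact: measurable_strip|exact: strip_fin|exact: measurable_funTS|].
by move=> z _; exact: s2_le.
Qed.

Lemma Mgap_sqr s t (phi : O -> R) (B : R) : 0 <= s -> s <= t -> measurable_wrt (F s) phi ->
  (forall w, 0 <= phi w <= B) ->
  \int[P]_w (phi w * \sum_k (Mgap k t w - Mgap k s w) ^+ 2) <= \int[Q]_(y in strip s t) (phi y.1 * sigma_gap y).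
Proof.
move=> s0 st mphi phiB; have t0 := le_trans s0 st; have mphi' := Fmeas uh s0 mphi.
have phin w : `|phi w| <= B by have /andP[h1 h2] := phiB w; rewrite ger0_norm.
have B0 : 0 <= B by have /andP[h1 h2] := phiB point; exact: le_trans h2.
rewrite (_ : (fun w => _) = (fun w => \sum_k phi w * (Mgap k t w - Mgap k s w) ^+ 2)); last first.
  by apply/funext => w; rewrite mulr_sumr.
rewrite Rintegral_sumr//; last first.
  move=> k; apply: (@L1Mb _ _ _ _ _ _ _ B) => //.
  have lB : L2 P setT (fun w => Mgap k t w - Mgap k s w) by apply: L2B => //; exact: Mgap_L2.
  exact: lB.2.
rewrite [X in _ <= Rintegral _ _ X](_ : _ = (fun y : OR => \sum_k phi y.1 * \sum_j (csig X1 k j y - csig X2 k j y) ^+ 2)); last first.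
  by apply/funext => y; rewrite /sigma_gap mulr_sumr.
rewrite Rintegral_sumr; [|exact: measurable_strip|]; last first.
  move=> k; apply: (@L1_bnd _ _ _ _ _ _ (B * \sum_(j < d) (Ms + Ms) ^+ 2)); [exact: measurable_strip|exact: strip_fin| |].
    apply: measurable_funTS; apply: measurable_funM; first exact: (measurableT_comp mphi' measurable_fst).
    by apply: measurable_sum => j; apply: measurable_funX; exact: measurable_funB.
  move=> y _; rewrite normrM; apply: ler_pM => //; rewrite ger0_norm; last by apply: sumr_ge0 => j _; exact: sqr_ge0.
  by apply: ler_sum => j _; exact: sd_le.
apply: ler_sum => k _.
have := ito_incr_sqr uh bm (hM1 k) (hM2 k) (mh1 k) (mh2 k) (fun j => ls1 k j s t) (fun j => ls2 k j s t) s0 st mphi phiB.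
rewrite (_ : (fun w => phi w * _) = (fun w => phi w * (Mgap k t w - Mgap k s w) ^+ 2)); last first.
  by apply/funext => w; rewrite /Mgap -sumrB.
move=> /le_trans; apply; rewrite le_eqVlt; apply/orP; left; apply/eqP; congr Rintegral.
Qed.

Let slab_cut X (sol : solution P F nu b sigma c W p X) (mc : forall k, measurable_fun setT (cutc c X n k)) k s t :
  L1 QN (slab s t) (cutc c X n k) /\ L2 QN (slab s t) (cutc c X n k).
Proof.
split.
  apply: (slab_L1 P (mc k) (C := C1)) => z.
  by apply: (cutc_int sol (q := fun x => `|x|)); [exact: normr0|exact: C10|exact: c_le1].
split; first exact: measurable_funTS.
apply: (slab_L1 P (f := fun y => cutc c X n k y ^+ 2) (C := C2)); first exact: measurable_funX.
move=> z; under eq_integral do rewrite ger0_norm ?sqr_ge0//.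
apply: (cutc_int sol (q := fun x => x ^+ 2)); [by rewrite expr0n|exact: C20|exact: c_le2].
Qed.

Lemma Jgap_abs s t (phi : O -> R) (B : R) : 0 <= s -> s <= t -> measurable_wrt (F s) phi ->
  (forall w, 0 <= phi w <= B) ->
  \int[P]_w (phi w * \sum_k `|Jgap k t w - Jgap k s w|) <= 2 * \int[Q]_(y in strip s t) (phi y.1 * jump_gap y).
Proof.
move=> s0 st mphi phiB; have t0 := le_trans s0 st; have mphi' := Fmeas uh s0 mphi.
have phin w : `|phi w| <= B by have /andP[h1 h2] := phiB w; rewrite ger0_norm.
rewrite (_ : (fun w => _) = (fun w => \sum_k phi w * `|Jgap k t w - Jgap k s w|)); last first.
  by apply/funext => w; rewrite mulr_sumr.
rewrite Rintegral_sumr//; last first.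
  move=> k; apply: (@L1Mb _ _ _ _ _ _ _ B) => //; apply: L1_norm => //; apply: L2_L1 => //.
  by apply: L2B => //; exact: Jgap_L2.
rewrite [X in _ <= _ * Rintegral _ _ X](_ : _ = (fun y : OR => \sum_k phi y.1 * \int[nu]_u `|cgap k (y, u)|)); last first.
  by apply/funext => y; rewrite /jump_gap mulr_sumr.
rewrite Rintegral_sumr; [|exact: measurable_strip|]; last first.
  move=> k; apply: (@L1Mb _ _ _ _ _ _ _ B); [exact: measurable_strip| |by []|].
    by apply: measurable_funTS; exact: (measurableT_comp mphi' measurable_fst).
  apply: (@L1_bnd _ _ _ _ _ _ (C1 + C1)); [exact: measurable_strip|exact: strip_fin| |].
    by apply: measurable_funTS; exact: (measurable_section_int nu (mcg k)).
  by move=> y _; have /andP[h1 h2] := section_int_le (mcg k) (cgap_le k) y; rewrite ger0_norm.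
rewrite mulr_sumr; apply: ler_sum => k _.
rewrite -(slab_section_R P (mcg k) (cgap_le k) s t mphi' phiB).
have [a1 a2] := slab_cut sol1 mc1 k s t; have [b1 b2] := slab_cut sol2 mc2 k s t.
have eg : (fun y : OR * U => cutc c X1 n k ((y.1.1, y.1.2), y.2) - cutc c X2 n k ((y.1.1, y.1.2), y.2)) = cgap k.
  by apply/funext => -[[w r] u].
have g1 : L1 QN (slab s t) (fun y : OR * U => cutc c X1 n k ((y.1.1, y.1.2), y.2) - cutc c X2 n k ((y.1.1, y.1.2), y.2)).
  by rewrite eg; apply: L1B => //; exact: measurable_slab.
have g2 : L2 QN (slab s t) (fun y : OR * U => cutc c X1 n k ((y.1.1, y.1.2), y.2) - cutc c X2 n k ((y.1.1, y.1.2), y.2)).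
  by rewrite eg; apply: L2B => //; exact: measurable_slab.
have := poisson_incr_L1 uh pp (hJ1 k) (hJ2 k) (mf1 k) (mf2 k) s0 st mphi phiB g1 g2.
move=> /le_trans; apply; rewrite le_eqVlt; apply/orP; left; apply/eqP; congr (_ * Rintegral _ _ _).
Qed.

Lemma Mgap_right k w t : 0 <= t -> Mgap k s w @[s --> t^'+] --> Mgap k t w.
Proof.
have rc (f : R -> R) : {within `[0, +oo[, continuous f} -> 0 <= t -> f s @[s --> t^'+] --> f t.
  move=> /continuous_within_itvcyP[h1 h2]; rewrite le_eqVlt => /orP[/eqP <- //|t0].
  by apply: cvg_at_right_filter; apply: h1; rewrite in_itv/= t0.
move=> t0; apply: (@cvg_big R^o 'I_d +%R 0 predT add_continuous _ _ _ (fun j s => M1 k j s w - M2 k j s w)) => j _.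
by apply: cvgB; apply: rc => //; [have [_ h _] := hM1 k j|have [_ h _] := hM2 k j]; exact: h.
Qed.

Lemma Jgap_right k w t : 0 <= t -> Jgap k s w @[s --> t^'+] --> Jgap k t w.
Proof.
move=> t0; have [_ h1 _] := hJ1 k; have [_ h2 _] := hJ2 k.
by apply: cvgB; [exact: (h1 w).1|exact: (h2 w).1].
Qed.

Let lebfin (s t : R) : (leb `]s, t]%classic < +oo)%E.
Proof. by rewrite lebesgue_measure_itv/=; case: ifP => _ //; rewrite -EFinB ltry. Qed.

(** Each integral equation holds with its own exit time; subtracting them expresses D through the
    two separately stopped solutions. *)
Lemma D_stopped : {ae P, forall w, forall t, 0 <= t -> forall k, D drift_gap Mgap Jgap k t w =
  X1 (stopped_time (exit_time X1 n) t w) w k ord0 - X2 (stopped_time (exit_time X2 n) t w) w k ord0}.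
Proof.
move: hX1 hX2 start; apply: filterS3 => w e1 e2 e0 t t0 k.
have lb X (mX : measurable_fun setT (cb X k)) : (forall y, `|cb X k y| <= Mb) -> L1 leb `]0, t] (fun s => cb X k (w, s)).
  move=> h; apply: (@L1_bnd _ _ _ _ _ _ Mb) => //.
    exact: lebfin.
  by apply: measurable_funTS; exact: (measurableT_comp mX (pair1_measurable w)).
have Ed : \int[leb]_(s in `]0%R, t]) drift_gap k (w, s) =
    \int[leb]_(s in `]0%R, t]) cb X1 k (w, s) - \int[leb]_(s in `]0%R, t]) cb X2 k (w, s).
  apply: RintegralBr => //; apply: lb => //.
    exact: (cut_bounded sol1 (b_le k)).
  exact: (cut_bounded sol2 (b_le k)).
by rewrite /D /drift Ed /Mgap sumrB /Jgap e1// e2// e0; ring.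
Qed.

(** Only times strictly before t are constrained, so the identity also covers the exit time and the
    jump made there. *)
Lemma D_gap : {ae P, forall w, forall t, 0 <= t -> (forall r, 0 <= r -> r < t -> excess r w <= 0) ->
  forall k, D drift_gap Mgap Jgap k t w = gap k t w}.
Proof.
apply: filterS D_stopped => w e t t0 h k; rewrite e// !stopped_full// => r r0 rt.
  by have /excessP[] := h r r0 rt.
by have /excessP[] := h r r0 rt.
Qed.

Lemma D_gap_inside : {ae P, forall w, forall t, 0 <= t -> inside excess t w ->
  forall k, D drift_gap Mgap Jgap k t w = gap k t w}.
Proof. by apply: filterS D_gap => w e t t0 h k; apply: e => // r r0 rt; apply: h => //; exact: ltW. Qed.

Lemma D_zero : {ae P, forall w, forall k, D drift_gap Mgap Jgap k 0 w = 0}.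
Proof.
move: D_gap start; apply: filterS2 => w e e0 k; rewrite e//; first by rewrite /gap e0 subrr.
by move=> r r0 /(le_lt_trans r0); rewrite ltxx.
Qed.

Lemma vnorm_gap t w : vnorm (fun k => gap k t w) = hsnorm (X1 t w - X2 t w).
Proof. by rewrite hsnorm_vnorm; congr vnorm; apply/funext => k; rewrite !mxE. Qed.

Lemma gap_le t w : 0 <= t -> inside excess t w -> vnorm (fun k => gap k t w) <= delta0.
Proof. by move=> t0 h; rewrite vnorm_gap; have /excessP[] := h t t0 (lexx t). Qed.

(** The factor d accounts for the jump gap, which sums d coordinates each bounded by kappa rho; the
    1 covers drift and diffusion with room to spare. *)
Let C0 : R := kappa * (1 + d%:R).
Let C00 : 0 <= C0. Proof. by rewrite mulr_ge0 ?(ltW kappa0)// addr_ge0. Qed.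

(** The left limits inherit both the ball and the distance delta0 from the times before s, so the
    modulus condition applies to them, and the cut coefficients are there the true ones. *)
Lemma rate_le w s : 0 < s -> (forall r, 0 <= r -> r < s -> excess r w <= 0) ->
  \sum_k gap_left k s w * drift_gap k (w, s) + 2^-1 * sigma_gap (w, s) <=
    C0 * vnorm (fun k => gap_left k s w) * rho (vnorm (fun k => gap_left k s w)) /\
  jump_gap (w, s) <= C0 * rho (vnorm (fun k => gap_left k s w)).
Proof.
move=> s0 h.
have h1 r : 0 <= r -> r < s -> hsnorm (X1 r w) <= n%:R by move=> r0 rs; have /excessP[] := h r r0 rs.
have h2 r : 0 <= r -> r < s -> hsnorm (X2 r w) <= n%:R by move=> r0 rs; have /excessP[] := h r r0 rs.
have [e1 y1 b1] := cut_ind_inside sol1 s0 h1; have [e2 y2 b2] := cut_ind_inside sol2 s0 h2.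
pose Y1 := left_lim X1 s w; pose Y2 := left_lim X2 s w.
have bd : hsnorm (Y2 - Y1) <= delta0.
  rewrite hsnormBC.
  have cv : hsnorm (X1 u w - X2 u w) @[u --> s^'-] --> hsnorm (Y1 - Y2).
    by apply: cvg_hsnorm; apply: cvgB; [exact: (sol_left sol1)|exact: (sol_left sol2)].
  apply: (cvgr_to_le cv); near=> r.
  have r0 : 0 <= r by apply: ltW; near: r; exact: nbhs_left_gt.
  have rs : r < s by near: r; exact: nbhs_left_lt.
  by have /excessP[] := h r r0 rs.
have [m1 m2] := modulus b2 b1 bd.
have ev : vnorm (fun k => gap_left k s w) = hsnorm (Y1 - Y2).
  by rewrite hsnorm_vnorm; congr vnorm; apply/funext => k; rewrite !mxE.
rewrite ev; set v := hsnorm (Y1 - Y2) in m1 m2 *.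
have rv : 0 <= kappa * rho v by rewrite mulr_ge0 ?(ltW kappa0)// rho0// sqrtr_ge0.
split.
  have -> : \sum_k gap_left k s w * drift_gap k (w, s) = dotv (Y1 - Y2) (b Y1 - b Y2).
    by apply: eq_bigr => k _; rewrite /drift_gap /cut e1 e2 y1 y2 !mul1r !mxE.
  have -> : sigma_gap (w, s) = hsnorm (sigma Y1 - sigma Y2) ^+ 2.
    rewrite hsnorm_sqr; apply: eq_bigr => k _; apply: eq_bigr => j _.
    by rewrite /cut e1 e2 y1 y2 !mul1r !mxE.
  have q0 : 0 <= kappa * v * rho v by rewrite mulrAC mulr_ge0// sqrtr_ge0.
  have dq0 : 0 <= d%:R * (kappa * v * rho v) by rewrite mulr_ge0.
  have -> : C0 * v * rho v = kappa * v * rho v + d%:R * (kappa * v * rho v) by rewrite /C0; ring.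
  move: q0 dq0 m1; move: (kappa * v * rho v) (d%:R * _) (dotv _ _) (hsnorm _ ^+ 2) => q dq x y; lra.
have -> : C0 * rho v = kappa * rho v + \sum_(k < d) kappa * rho v.
  by rewrite sumr_const card_ord -mulr_natl /C0; ring.
apply: (@le_trans _ _ (\sum_(k < d) kappa * rho v)); last by rewrite lerDr.
apply: ler_sum => k _; rewrite -lee_fin RintegralE; [|exact: measurableT|by apply: L1_norm => //; exact: (section_L1 (mcg k) (cgap_le k))].
apply: le_trans m2; apply: ge0_le_integral => //.
- by apply/measurable_EFinP; apply: measurableT_comp => //; exact: (measurableT_comp (mcg k) (pair1_measurable _)).
- apply/measurable_EFinP; apply: measurable_hsnorm => j; under eq_fun do rewrite !mxE.
  by apply: measurable_funB; exact: (measurable_c sa).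
- move=> u _; rewrite lee_fin /cgap /cutc /= e1 e2 y1 y2 !mul1r.
  by have := le_coord_hsnorm (c Y1 u - c Y2 u) k; rewrite !mxE.
Unshelve. all: by end_near. Qed.

Lemma level_inside : {ae P, forall w, forall t r, 0 <= t -> t < r -> inside excess r w -> X1 t w = X2 t w}.
Proof.
have := inside_zero uh excess_wrt excess_right gap_wrt gap_right gap_cvg_left measurable_drift_gap drift_gap_le
  measurable_sigma_gap sigma_gap_le measurable_jump_gap jump_gap_le Mgap_L2 Jgap_L2 Mgap_mean Mgap_sqr Jgap_abs
  D_gap_inside D_zero rho0 rho_mono rho_concave rho_pos rho_osgood C00 gap_le rate_le.
apply: filterS => w h t r t0 tr ir; apply/matrixP => k j; rewrite ord1.
by have /eqP := h t r t0 tr ir k; rewrite subr_eq0 => /eqP.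
Qed.

Lemma level_exit (T : R) : 0 < T -> {ae P, forall w, forall S, 0 <= S -> S < T ->
  (forall r, 0 <= r -> r < S -> inside excess r w) -> (forall r, S < r -> ~ inside excess r w) -> X1 S w = X2 S w}.
Proof.
move=> T0.
have := exit_zero uh excess_wrt excess_right gap_wrt gap_cvg_left measurable_drift_gap drift_gap_le
  measurable_sigma_gap sigma_gap_le measurable_jump_gap jump_gap_le Mgap_L2 Jgap_L2 Mgap_mean Mgap_sqr Jgap_abs
  D_gap_inside D_zero rho0 rho_mono rho_concave rho_pos rho_osgood C00 gap_le rate_le Mgap_right Jgap_right T0.
move: D_gap => /[swap]; apply: filterS2 => w e e' S S0 ST h1 h2; apply/matrixP => k j; rewrite ord1.
have := e' S S0 _ k; rewrite e// => /(_ _)/esym/eqP; rewrite subr_eq0 => /(_ _)/eqP; apply.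
by move=> r r0 rS; exact: (h1 r r0 rS r r0 (lexx r)).
Qed.

End level.

Lemma uniform_bound (R : realType) (I : finType) (Pr : I -> R -> Prop) :
  (forall i x y, x <= y -> Pr i x -> Pr i y) -> (forall i, exists M : R, Pr i M) ->
  exists M : R, 0 <= M /\ forall i, Pr i M.
Proof.
move=> mono /fin_all_exists[f hf]; exists (\sum_i `|f i|); split; first exact: sumr_ge0.
by move=> i; apply: mono (hf i); rewrite (bigD1 i)//= (le_trans (ler_norm _))// lerDl sumr_ge0.
Qed.

Lemma hsnorm0 (R : realType) m q : hsnorm (0 : 'M[R]_(m, q)) = 0.
Proof. by rewrite /hsnorm mul0mx mxtrace0 sqrtr0. Qed.

(** * From local agreement to agreement of a whole path *)

Section agreement.
Context {dO : measure_display} {O : measurableType dO} {R : realType} {d : nat}.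
Variables (X1 X2 : R -> O -> 'cV[R]_d) (delta0 : R) (n : nat) (w : O) (T : R).
Hypothesis d0 : 0 < delta0.
Hypothesis right1 : forall t, 0 <= t -> X1 s w @[s --> t^'+] --> X1 t w.
Hypothesis right2 : forall t, 0 <= t -> X2 s w @[s --> t^'+] --> X2 t w.
Hypothesis start : X1 0 w = X2 0 w.
Hypothesis bounded : forall r, 0 <= r <= T -> hsnorm (X1 r w) <= n%:R /\ hsnorm (X2 r w) <= n%:R.
Local Notation close := (inside (excess X1 X2 delta0 n)).
Hypothesis close_eq : forall t r, 0 <= t -> t < r -> close r w -> X1 t w = X2 t w.
Hypothesis exit_eq : forall S, 0 <= S -> (forall r, 0 <= r -> r < S -> close r w) ->
  (forall r, S < r -> ~ close r w) -> X1 S w = X2 S w.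

(* If the supremum S of the times up to which the solutions stay within delta0 were
   less than T, they would agree at S and hence stay close a little longer. *)
Lemma agree_before t : 0 <= t -> t < T -> X1 t w = X2 t w.
Proof.
move=> t0 tT; have T0 : 0 <= T := le_trans t0 (ltW tT).
have closeI r : 0 <= r -> r <= T -> hsnorm (X1 r w - X2 r w) <= delta0 -> excess X1 X2 delta0 n r w <= 0.
  by move=> r0 rT h; apply/excessP; have [|h1 h2] := @bounded r; [rewrite r0|split].
have eq_close r : 0 <= r -> r <= T -> X1 r w = X2 r w -> excess X1 X2 delta0 n r w <= 0.
  by move=> r0 rT e; apply: closeI => //; rewrite e subrr hsnorm0 ltW.
pose E := [set r : R | 0 <= r <= T /\ close r w].
have E0 : E 0.
  split; first by rewrite lexx.
  move=> r r0 r0'; have -> : r = 0 by apply/eqP; rewrite eq_le r0' r0.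
  exact: eq_close.
have hE : has_sup E by split; [exists 0|exists T => r [/andP[]]].
pose S := sup E.
have S0 : 0 <= S by exact: (sup_upper_bound hE E0).
have ST : S <= T by apply: ge_sup; [exists 0|move=> r [/andP[]]].
have before r : 0 <= r -> r < S -> close r w.
  move=> r0 rS; have : 0 < S - r by rewrite subr_gt0.
  move=> /(sup_adherent)/(_ hE)[e [_ ie]]; rewrite -/S subKr => re.
  exact: (insideS (ltW re) ie).
have [/eqP eT|STn] := boolP (S == T).
  have tS : t < (t + T) / 2 < T by lra.
  by have /andP[h1 h2] := tS; apply: (close_eq t0 h1); apply: before; [lra|rewrite eT].
have {STn}ST : S < T by rewrite lt_neqAle STn.
have after r : S < r -> ~ close r w.
  move=> Sr ir; have : E (Num.min r T).
    split; last by apply: (insideS _ ir); rewrite ge_min lexx.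
    by rewrite le_min T0 (le_trans S0 (ltW Sr)) ge_min lexx orbT.
  by move=> /(sup_upper_bound hE); rewrite leNgt lt_min Sr ST.
have eS := exit_eq S0 before after.
have cv : hsnorm (X1 r w - X2 r w) @[r --> S^'+] --> (0 : R).
  have -> : 0 = hsnorm (X1 S w - X2 S w) by rewrite eS subrr hsnorm0.
  by apply: cvg_hsnorm; apply: cvgB; [exact: right1|exact: right2].
have near_S : \forall r \near S^'+, hsnorm (X1 r w - X2 r w) < delta0.
  by apply: (cvgr_lt (0 : R)).
have [eta eta0 he] := near_right_ex near_S.
pose r1 := Num.min (S + eta / 2) T.
have Sr1 : S < r1 by rewrite lt_min ST ltrDl divr_gt0.
exfalso; apply: (after r1 Sr1) => r r0 rr1.
have rT : r <= T by apply: le_trans rr1 _; rewrite ge_min lexx orbT.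
have [rS|Sr|->] := ltgtP r S; first exact: (before r r0 rS r r0 (lexx r)).
  apply: closeI => //; apply: ltW; apply: he => //; apply: (le_lt_trans rr1).
  by rewrite (@le_lt_trans _ _ (S + eta / 2))// ?ge_min ?lexx// ltrD2l; lra.
exact: (eq_close S S0 (ltW ST)).
Qed.

End agreement.

Theorem theorem2p4 (R : realType) (d : nat) (hd : (2 <= d)%N)
    (dU : measure_display) (U : measurableType dU)
    (nu : {sigma_finite_measure set U -> \bar R})
    (b : 'cV[R]_d -> 'cV[R]_d) (sigma : 'cV[R]_d -> 'M[R]_d)
    (c : 'cV[R]_d -> U -> 'cV[R]_d)
    (hstanding : standing_assumptions nu b sigma c)
    (hgrowth : exists (kappa : R) (zeta : R -> R),
      0 < kappa /\
      (forall r, 0 <= r -> 1 <= zeta r) /\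
      (forall r s, 0 <= r -> r <= s -> zeta r <= zeta s) /\
      C1_halfline zeta /\
      (\int[lebesgue_measure]_(r in `[0%R, +oo[)
         ((r * zeta r + 1)^-1)%:E)%E = +oo%E /\
      forall x : 'cV[R]_d,
        ((2 * dotv x (b x) + hsnorm (sigma x) ^+ 2)%:E
           + \int[nu]_u (hsnorm (c x u) ^+ 2)%:E
         <= (kappa * (hsnorm x ^+ 2 * zeta (hsnorm x ^+ 2) + 1))%:E)%E)
    (hmodulus : exists (delta0 : R) (rho : R -> R),
      0 < delta0 /\
      (forall r, 0 <= r -> 0 <= rho r) /\
      (forall r s, 0 <= r -> r <= s -> rho r <= rho s) /\
      convex_function (`[0, +oo[%classic : set R^o) (fun r : R^o => - rho r) /\
      (forall r, 0 < r -> 0 < rho r) /\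
      (forall e : R, 0 < e ->
         (\int[lebesgue_measure]_(r in `]0%R, e[) ((rho r)^-1)%:E)%E = +oo%E) /\
      forall K : R, 0 < K -> exists kappaK : R, 0 < kappaK /\
        forall x z : 'cV[R]_d,
          hsnorm x <= K -> hsnorm z <= K -> hsnorm (x - z) <= delta0 ->
          2 * dotv (z - x) (b z - b x) + hsnorm (sigma z - sigma x) ^+ 2
            <= kappaK * hsnorm (z - x) * rho (hsnorm (z - x)) /\
          (\int[nu]_u (hsnorm (c z u - c x u))%:E
            <= (kappaK * rho (hsnorm (z - x)))%:E)%E)
    (hc0 : (\int[nu]_u (hsnorm (c 0 u))%:E < +oo)%E) :
  pathwise_uniqueness nu b sigma c.
Proof.
move=> dO O P F W p uh bm pp _ X1 X2 sol1 sol2 start.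
have [delta0 [rho [d0 [r0 [rm [rc [rp [ro hmod]]]]]]]] := hmodulus.
(* The exceptional sets are collected over all levels n and all integer horizons m first, because
   the level and horizon used below depend on the path. *)
have lev n : {ae P, forall w, (forall t r, 0 <= t -> t < r -> inside (excess X1 X2 delta0 n) r w -> X1 t w = X2 t w) /\
    forall m : nat, forall S, 0 <= S -> S < m.+1%:R -> (forall r, 0 <= r -> r < S -> inside (excess X1 X2 delta0 n) r w) ->
    (forall r, S < r -> ~ inside (excess X1 X2 delta0 n) r w) -> X1 S w = X2 S w}.
  (* The modulus is available only at positive radii, while the level n may be 0; radius n + 1
     serves for every n. *)
  have n1 : 0 < n%:R + 1 :> R by rewrite ltr_wpDl.
  have [kappa [kappa0 md0]] := hmod _ n1.
  have wd (x : 'cV[R]_d) : hsnorm x <= n%:R -> hsnorm x <= n%:R + 1 by move=> h; rewrite (le_trans h)// lerDl.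
  have md (x z : 'cV[R]_d) (hx : hsnorm x <= n%:R) (hz : hsnorm z <= n%:R) := md0 x z (wd x hx) (wd z hz).
  have [Mb [Mb0 bM]] : exists M : R, 0 <= M /\ forall k x, hsnorm x <= n%:R -> `|b x k ord0| <= M.
    apply: uniform_bound => [k x y xy h v /h /le_trans|k]; first exact.
    by apply: continuous_bounded; apply: continuous_entry; have [] := hstanding.
  have [Ms [Ms0 sM]] : exists M : R, 0 <= M /\ forall ij : 'I_d * 'I_d, forall x, hsnorm x <= n%:R -> `|sigma x ij.1 ij.2| <= M.
    apply: uniform_bound => [k x y xy h v /h /le_trans|k]; first exact.
    by apply: continuous_bounded; apply: continuous_entry; have [] := hstanding.
  have [C1 hC1] := c_L1_bound hstanding d0 r0 rm n1 kappa0 (fun x z hx hz h => (md0 x z hx hz h).2) hc0.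
  have [C2 hC2] := c_L2_bound hstanding (n%:R + 1).
  have c1 k x : hsnorm x <= n%:R -> (\int[nu]_u `|c x u k ord0|%:E <= `|C1|%:E)%E.
    by move=> h; apply: (le_trans (hC1 x k (wd x h))); rewrite lee_fin ler_norm.
  have c2 k x : hsnorm x <= n%:R -> (\int[nu]_u (c x u k ord0 ^+ 2)%:E <= `|C2|%:E)%E.
    by move=> h; apply: (le_trans (hC2 x k (wd x h))); rewrite lee_fin ler_norm.
  have [M1 [J1 [a1 a2 a3]]] := solution_cut uh hstanding sol1 n.
  have [M2 [J2 [b1 b2 b3]]] := solution_cut uh hstanding sol2 n.
  have L1 := level_inside uh bm pp hstanding sol1 sol2 start r0 rm rc rp ro kappa0 md Mb0 Ms0 (normr_ge0 C1) (normr_ge0 C2)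
    bM (fun i j => sM (i, j)) c1 c2 a1 b1 a2 b2 a3 b3.
  have L2 m := level_exit uh bm pp hstanding sol1 sol2 start r0 rm rc rp ro kappa0 md Mb0 Ms0 (normr_ge0 C1) (normr_ge0 C2)
    bM (fun i j => sM (i, j)) c1 c2 a1 b1 a2 b2 a3 b3 (ltr0Sn R m).
  have L2' := ae_foralln L2.
  by move: L1 L2'; apply: filterS2.
have lev' := ae_foralln lev.
move: lev' start; apply: filterS2 => w hw e0 t t0.
(* A cadlag path is bounded on [0, t + 1], so some level n is never exceeded there; the horizon t +
   1 puts t strictly before it. *)
have bd X : solution P F nu b sigma c W p X -> exists M : R, forall u, 0 <= u <= t + 1 -> `|hsnorm (X u w)| <= M.
  move=> sol; apply: cadlag_bounded => u u0; first by apply: cvg_hsnorm; exact: (sol_right sol).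
  by exists (hsnorm (left_lim X u w)); apply: cvg_hsnorm; exact: (sol_left sol).
have [B1 hB1] := bd X1 sol1; have [B2 hB2] := bd X2 sol2.
pose n := Num.bound (`|B1| + `|B2|).
have nB : `|B1| + `|B2| < n%:R by apply: archi_boundP; rewrite addr_ge0.
apply: (@agree_before _ O R d X1 X2 delta0 n w (t + 1) d0) => //.
- by move=> u u0; exact: (sol_right sol1).
- by move=> u u0; exact: (sol_right sol2).
- move=> r rt; have := hB1 r rt; have := hB2 r rt; have := ler_norm B1; have := ler_norm B2.
  have := normr_ge0 B1; have := normr_ge0 B2; have := ler_norm (hsnorm (X1 r w)); have := ler_norm (hsnorm (X2 r w)).
  move: nB; move: (n%:R) `|B1| `|B2| `|hsnorm (X1 r w)| `|hsnorm (X2 r w)| => a p1 p2 p3 p4 *; split; lra.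
- exact: (hw n).1.
- move=> S S0; apply: ((hw n).2 (Num.bound S) S S0).
  by apply: (lt_trans (archi_boundP S0)); rewrite ltr_nat.
- by rewrite ltrDl.
Qed.
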